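(* Let $(M,g,\mu)$ be a smooth connected weighted Riemannian manifold without boundary, $V:M\to[0,\infty)$ smooth and $\rho:M\to(0,\infty)$ smooth. Consider the following assertions. (i) $Q_{\rho,V}$ is conservative in the generalized sense. (ii) $W^1(M,\rho+V)=W^1_0(M,\rho+V)$. Then (i) always implies (ii). If $\rho+V\in L^1(M,\mu)$, then (i) and (ii) are equivalent.
   Context: All functions are real-valued. The measure is $\mu=\Psi\,\mathrm{vol}_g$ with $\Psi$ smooth and strictly positive, $\mathrm{vol}_g$ the Riemannian measure. For a smooth $w:M\to(0,\infty)$ let $W^1(M,w)=\{f\in L^2(M,w\mu): |\nabla f|\in L^2(M,\mu)\}$ (distributional gradient) with norm $\|f\|_{W^1}=(\int_M|\nabla f|^2d\mu+\int_M f^2 w\,d\mu)^{1/2}$, and let $W^1_0(M,w)$ be the closure of $C_c^\infty(M)$ in it. The quadratic form $Q_{\rho,V}$ with domain $W_0^1(M,\rho+V)$, $Q_{\rho,V}(f,h)=\int_M\langle\nabla f,\nabla h\rangle d\mu+\int_M fhV\,d\mu$, is a Dirichlet form on $L^2(M,\rho\mu)$. Let $L_{\rho,V}$ be the associated nonpositive self-adjoint operator on $L^2(M,\rho\mu)$ and $T^{\rho,V}_t=e^{tL_{\rho,V}}$, $t>0$, the associated positivity preserving Markovian semigroup. $L^+(M)$ denotes the cone of $[0,\infty]$-valued, $\mu$-a.e. defined measurable functions. Any positivity preserving linear operator $T$ on $L^2(M,\rho\mu)$ is extended to $L^+(M)$ by $Tf=\lim_{n\to\infty}Tf_n$, where $(f_n)$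 is any increasing sequence of nonnegative functions in $L^2(M,\rho\mu)$ with $f_n\to f$ $\mu$-a.e. (this is well defined). $Q_{\rho,V}$ is called conservative in the generalized sense if $$T_t^{\rho,V}1+\int_0^tT_s^{\rho,V}(V/\rho)\,ds=1\quad\text{for all }t>0,$$ where the integral denotes the $L^+(M)$-extension of the positivity preserving operator $f\mapsto\int_0^tT_s^{\rho,V}f\,ds$ on $L^2(M,\rho\mu)$, applied to $V/\rho$. *)

(* Defs.v *)
From HB Require Import structures.
From mathcomp Require Import all_boot all_order all_algebra.
From mathcomp Require Import all_classical all_reals all_analysis.

Set Implicit Arguments.
Unset Strict Implicit.
Unset Printing Implicit Defensive.

Import Order.TTheory GRing.Theory Num.Theory.
Import numFieldNormedType.Exports.

Local Open Scope classical_set_scope.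
Local Open Scope ring_scope.

Definition borel (M : ptopologicalType) : measurableType _ :=
  g_sigma_algebraType (@open M).

Section euclidean.
Context {R : realType}.

Definition partial_derivative {n} (i : 'I_n) (f : 'rV[R]_n -> R) :
    'rV[R]_n -> R :=
  'D_(delta_mx 0 i) f.

(* C^k on the set U, meant for open U: all iterated partial derivatives of
   order at most k exist and are continuous at every point of U. *)
Fixpoint Ck {n} (k : nat) (U : set 'rV[R]_n) (f : 'rV[R]_n -> R) : Prop :=
  (forall y, U y -> {for y, continuous f}) /\
  match k with
  | 0%N => True
  | k'.+1 => forall i : 'I_n,
      (forall y, U y -> derivable f y (delta_mx 0 i)) /\
      Ck k' U (partial_derivative i f)
  end.

Definition Cinfty {n} (U : set 'rV[R]_n) (f : 'rV[R]_n -> R) : Prop :=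
  forall k, Ck k U f.

(* Iterated one-dimensional Lebesgue integral; by Tonelli's theorem it is the
   Lebesgue integral on R^n for every Borel function with values in
   [0, +oo], the only functions it is applied to. *)
Fixpoint lebesgue_integral_Rn {n} : ('rV[R]_n -> \bar R) -> \bar R :=
  match n with
  | 0%N => fun f => f 0
  | m.+1 => fun f => (\int[lebesgue_measure]_(t in [set: R])
      lebesgue_integral_Rn (fun v : 'rV[R]_m => f (row_mx t%:M v)))%E
  end.

End euclidean.

(* [bwd] is a total function, but only its values on [fwd @` dom] matter. *)
Record chart (R : realType) (n : nat) (M : ptopologicalType) := Chart {
  dom : set M;
  fwd : M -> 'rV[R]_n;
  bwd : 'rV[R]_n -> M;
  open_dom : open dom;
  open_codom : open (fwd @` dom);
  fwdK : forall x, dom x -> bwd (fwd x) = x;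
  fwd_continuous : forall x, dom x -> {for x, continuous fwd};
  bwd_continuous : forall y, (fwd @` dom) y -> {for y, continuous bwd} }.

(* [chart_at x] is a preferred chart around x. It plays no role in the
   smooth structure itself; it identifies the tangent space at x with R^n,
   see [in_chart] below. *)
Record smooth_manifold (R : realType) (n : nat) (M : ptopologicalType) :=
  SmoothManifold {
  atlas : set (chart R n M);
  chart_at : M -> chart R n M;
  chart_at_atlas : forall x, atlas (chart_at x);
  chart_at_dom : forall x, dom (chart_at x) x;
  atlas_compatible : forall c d, atlas c -> atlas d -> forall k,
    Cinfty (fwd c @` (dom c `&` dom d)) (fun y => fwd d (bwd c y) 0 k);
  manifold_hausdorff : hausdorff_space M;
  manifold_second_countable : @second_countable M }.

Section manifold.
Context {R : realType} {n : nat} {M : ptopologicalType}.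
Variable S : smooth_manifold R n M.

Definition smooth (f : M -> R) : Prop :=
  forall c, atlas S c -> Cinfty (fwd c @` dom c) (fun y => f (bwd c y)).

Definition compactly_supported {V : nmodType} (f : M -> V) : Prop :=
  exists2 K : set M, compact K & forall x, ~ K x -> f x = 0.

(* Jacobian at x of the coordinate change from c to d, for row vectors:
   a tangent vector with components v in c has components v *m J in d. *)
Definition transition_jacobian (c d : chart R n M) (x : M) : 'M[R]_n :=
  \matrix_(i, k) partial_derivative i (fun y => fwd d (bwd c y) 0 k) (fwd c x).

(* A vector field X is given by the components X x of its value at x in the
   chart [chart_at S x]; [in_chart c X x] are the components in the chart c. *)
Definition in_chart (c : chart R n M) (X : M -> 'rV[R]_n) (x : M) : 'rV[R]_n :=
  X x *m transition_jacobian (chart_at S x) c x.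

Definition smooth_field (X : M -> 'rV[R]_n) : Prop :=
  forall c, atlas S c -> forall k,
    Cinfty (fwd c @` dom c) (fun y => in_chart c X (bwd c y) 0 k).

Definition measurable_field (X : M -> 'rV[R]_n) : Prop :=
  forall c, atlas S c -> forall k,
    measurable_fun (dom c : set (borel M)) (fun x => in_chart c X x 0 k).

(* Gram matrix, in the coordinate frame of c, of the bilinear form whose
   matrix in the coordinate frame of [chart_at S x] is G x. *)
Definition gram_in_chart (G : M -> 'M[R]_n) (c : chart R n M) (x : M) :
    'M[R]_n :=
  let J := transition_jacobian c (chart_at S x) x in J *m G x *m J^T.

Record riemannian_metric := RiemannianMetric {
  gram :> M -> 'M[R]_n;
  gram_sym : forall x, (gram x)^T = gram x;
  gram_posdef : forall x (v : 'rV[R]_n), v != 0 ->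
    0 < (v *m gram x *m v^T) 0 0;
  gram_smooth : forall c, atlas S c -> forall i j,
    Cinfty (fwd c @` dom c) (fun y => gram_in_chart gram c (bwd c y) i j) }.

Variable g : riemannian_metric.

Definition scal (X Y : M -> 'rV[R]_n) (x : M) : R :=
  (X x *m g x *m (Y x)^T) 0 0.

Definition sqrt_det (c : chart R n M) (x : M) : R :=
  Num.sqrt (\det (gram_in_chart g c x)).

(* The condition determines vol: by second countability, countably many
   charts cover M. *)
Definition is_riemannian_measure (vol : {measure set (borel M) -> \bar R}) :
    Prop :=
  forall c, atlas S c ->
  forall A : set (borel M), measurable A -> A `<=` dom c ->
    vol A = lebesgue_integral_Rn
      (fun y => (\1_(fwd c @` A) y * sqrt_det c (bwd c y))%:E).

Definition is_weighted_measure (vol : {measure set (borel M) -> \bar R})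
    (Psi : M -> R) (mu : {measure set (borel M) -> \bar R}) : Prop :=
  forall A : set (borel M), measurable A ->
    mu A = (\int[vol]_(x in A) (Psi x)%:E)%E.

(* div_mu Y = (Psi sqrt(det g))^-1 \sum_i d_i (Psi sqrt(det g) Y^i) in local
   coordinates, where mu = Psi vol. *)
Definition weighted_div (Psi : M -> R) (Y : M -> 'rV[R]_n) (x : M) : R :=
  let c := chart_at S x in
  let density z := Psi z * sqrt_det c z in
  (\sum_i partial_derivative i
     (fun y => density (bwd c y) * in_chart c Y (bwd c y) 0 i) (fwd c x))
  / density x.

Variables (Psi : M -> R) (mu : {measure set (borel M) -> \bar R}).

Definition locally_L1 (f : M -> R) : Prop :=
  measurable_fun [set: borel M] f /\
  forall K : set M, compact K -> mu.-integrable (K : set (borel M)) (EFin \o f).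

(* X is the distributional gradient of f: both are locally integrable and
   (X, Y) = - (f, div_mu Y) for all smooth compactly supported fields Y. *)
Definition is_distributional_gradient (f : M -> R) (X : M -> 'rV[R]_n) : Prop :=
  [/\ locally_L1 f, measurable_field X,
      locally_L1 (fun x => Num.sqrt (scal X X x)) &
      forall Y : M -> 'rV[R]_n, smooth_field Y -> compactly_supported Y ->
        \int[mu]_x scal X Y x = - \int[mu]_x (f x * weighted_div Psi Y x)].

(* Meaningful, and unique up to null sets, as soon as the distributional
   gradient of f is a locally integrable vector field. *)
Definition grad (f : M -> R) : M -> 'rV[R]_n :=
  xget (fun=> 0) [set X : M -> 'rV[R]_n | is_distributional_gradient f X].

(* L^2(M, w mu); here and below functions stand for their mu-a.e. classes. *)
Definition L2 (w : M -> R) : set (M -> R) :=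
  [set f : M -> R | measurable_fun [set: borel M] f /\
           (\int[mu]_x (f x ^+ 2 * w x)%:E < +oo)%E].

Definition L2_scal (w : M -> R) (f h : M -> R) : R :=
  \int[mu]_x (f x * h x * w x).

Definition L2_norm (w : M -> R) (f : M -> R) : R := Num.sqrt (L2_scal w f f).

Definition W1 (w : M -> R) : set (M -> R) :=
  [set f : M -> R | L2 w f /\
     exists2 X, is_distributional_gradient f X &
                (\int[mu]_x (scal X X x)%:E < +oo)%E].

Definition W1_norm (w : M -> R) (f : M -> R) : R :=
  Num.sqrt (\int[mu]_x scal (grad f) (grad f) x + \int[mu]_x (f x ^+ 2 * w x)).

Definition Cc_infty : set (M -> R) :=
  [set f : M -> R | smooth f /\ compactly_supported f].

Definition W10 (w : M -> R) : set (M -> R) :=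
  [set f : M -> R | W1 w f /\
     forall e : R, 0 < e -> exists2 h, Cc_infty h & W1_norm w (f \- h) < e].

Variables rho V : M -> R.

Definition form_domain : set (M -> R) := W10 (rho \+ V).

Definition form (f h : M -> R) : R :=
  \int[mu]_x scal (grad f) (grad h) x + \int[mu]_x (f x * h x * V x).

(* f belongs to the domain of the operator L associated with the form, and
   L f = u. *)
Definition operator_graph (f u : M -> R) : Prop :=
  [/\ form_domain f, L2 rho u &
      forall h, form_domain h -> form f h = - L2_scal rho u h].

(* (T t)_{t > 0} = (exp(t L))_{t > 0}: the strongly continuous contraction
   semigroup on L^2(M, rho mu) whose generator is L. The values of T t outside
   L^2(M, rho mu) are irrelevant. *)
Definition is_semigroup_of_form (T : R -> (M -> R) -> (M -> R)) : Prop :=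
  [/\ forall (t : R) f, 0 < t -> L2 rho f ->
        L2 rho (T t f) /\ L2_norm rho (T t f) <= L2_norm rho f,
      forall (t a : R) f h, 0 < t -> L2 rho f -> L2 rho h ->
        {ae mu, forall x, T t (fun z => a * f z + h z) x = a * T t f x + T t h x},
      forall (s t : R) f, 0 < s -> 0 < t -> L2 rho f ->
        {ae mu, forall x, T (s + t) f x = T s (T t f) x},
      forall f, L2 rho f -> L2_norm rho (T t f \- f) @[t --> 0^'+] --> (0 : R) &
      forall f u, L2 rho f -> L2 rho u ->
        (L2_norm rho (fun x => t^-1 * (T t f x - f x) - u x) @[t --> 0^'+]
           --> (0 : R)) <-> operator_graph f u].

(* The L^2(M, rho mu)-valued integral of s |-> T s f over (0, t), defined by
   duality. *)
Definition time_integral (T : R -> (M -> R) -> (M -> R)) (t : R) (f : M -> R) :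
    M -> R :=
  xget (fun=> 0) [set u : M -> R | L2 rho u /\ forall h, L2 rho h ->
    L2_scal rho u h =
      \int[lebesgue_measure]_(s in `]0%R, t[) L2_scal rho (T s f) h].

Definition approximations (f : M -> \bar R) : set (nat -> M -> R) :=
  [set fn : nat -> M -> R | [/\ forall k, L2 rho (fn k),
                forall k, {ae mu, forall x, 0 <= fn k x},
                forall k, {ae mu, forall x, fn k x <= fn k.+1 x} &
                {ae mu, forall x, (fn k x)%:E @[k --> \oo] --> f x}]].

(* Extension to L^+(M) of a positivity preserving operator A on
   L^2(M, rho mu); up to null sets it does not depend on the approximating
   sequence, so one is chosen. *)
Definition Lplus_extension (A : (M -> R) -> (M -> R)) (f : M -> \bar R) (x : M) :
    \bar R :=
  let fn := xget (fun _ _ => 0) (approximations f) in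
  limn (fun k => (A (fn k) x)%:E).

Definition conservative_generalized (T : R -> (M -> R) -> (M -> R)) : Prop :=
  forall t : R, 0 < t ->
    {ae mu, forall x,
      (Lplus_extension (T t) (fun=> 1) x +
       Lplus_extension (time_integral T t) (fun z => (V z / rho z)%:E) x = 1)%E}.

End manifold.

(* Main.v *)
(* Write w = rho + V, let e_n, h_n increase to 1 and V/rho, and let u_n be the
   resolvent at 1 of e_n + h_n. The semigroup law gives
     int_0^t e^-s (T_s e_n + int_0^s T_r h_n dr) ds
       = u_n - e^-t (T_t u_n + int_0^t T_r h_n dr),
   so that u_n increases to 1 under (i). If f in W^1 is orthogonal to W^1_0 and
   f <= C, the maximum principle gives f + C u_n <= C, whence f <= 0. Projecting
   onto W^1_0, every bounded element of W^1 lies in W^1_0, and truncation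
   gives (ii). Conversely, if w is integrable and (ii) holds, then 1 lies in
   W^1_0, the squared form norm of 1 - u_n is at most
   int (w - rho (e_n + h_n)) dmu, which tends to 0, and (i) follows.
   Elements of W^1 are approximated in charts by polynomial (Landau) kernels. *)
Require Import Defs.
From HB Require Import structures.
From mathcomp Require Import all_boot all_order all_algebra.
From mathcomp Require Import all_classical all_reals all_analysis measurable_realfun.
From mathcomp Require Import ring lra.
From mathcomp.real_closed Require polyrcf.
Set Implicit Arguments.
Unset Strict Implicit.
Unset Printing Implicit Defensive.
Import Order.TTheory GRing.Theory Num.Theory.
Import numFieldNormedType.Exports.
Local Open Scope classical_set_scope.
Local Open Scope ring_scope.
Local Notation mEFinP := measurable_EFinP.
Local Notation mfM := measurable_funM.
Local Notation mfX := measurable_funX.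
Local Notation mfTS := measurable_funTS.
Local Notation mfB := measurable_funB.
Local Notation mfT_comp := measurableT_comp.
Local Notation measf := measurable_fun.
Local Notation isD := is_derive.
Local Notation mTR := measurableTypeR.
Local Notation mindic := measurable_indic.
Local Notation pder := partial_derivative.
Local Notation lebm := lebesgue_measure.
Local Notation onbhs := open_nbhs_nbhs.
Local Notation eqRint := eq_Rintegral.
Local Notation chatP := chart_at_atlas.
Local Notation mfld := measurable_field.
Local Notation tjac := transition_jacobian.
Local Notation csubT := continuous_subspaceT.
Local Notation eqint := eq_integral.

(** * Differential calculus on open sets of R^n: chain rule and classes C^k *)

Section calculus.
Context {R : realType}.
Implicit Types (n m k : nat).

(** The W^1 product with weight rho + V is the form plus the inner product of L^2(rho mu), so the
    resolvent at 1 is the Riesz representation in W^1_0, and the constant 1 formally solves its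
    equation with source 1 + V/rho; hence the source e_n + h_n. The maximum principle needs (C u_n +
    f - C)^+ in W^1_0 although f is not there: C u_n is approximated by test functions phi, and (phi
    + f - C)^+ vanishes almost everywhere off the support of phi because f <= C. It remains to see
    that compactly supported elements of W^1 lie in W^1_0. By orthogonal projection it is enough to
    pair their averages with one vector orthogonal to W^1_0, so weak convergence suffices, and a
    polynomial kernel is a finite sum of products, which avoids differentiation under the integral.
    The semigroup is given only through its generator; its positivity is derived from the decay of
    negative parts on the domain. Elements of W^1 are handled as pairs of a function and a gradient,
    the gradient being determined only up to null sets. *)

Definition urow {n} (i : 'I_n) : 'rV[R]_n := delta_mx 0 i.

Lemma crd_le_norm n (v : 'rV[R]_n) i : `|v 0 i| <= `|v|.
rewrite [leRHS]/Num.Def.normr/= mx_normrE.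
exact: (le_bigmax _ (fun ij : 'I_1 * 'I_n => `|v ij.1 ij.2|) (0, i)).
Qed.

Lemma norm_row_le n (v : 'rV[R]_n) (r : R) : 0 <= r ->
 (forall i, `|v 0 i| <= r) -> `|v| <= r.
move=> r0 h; rewrite [leLHS]/Num.Def.normr/= mx_normrE.
by apply: bigmax_le => // -[i j] _ /=; rewrite ord1.
Qed.

Lemma cont_crd n (i : 'I_n) : continuous (fun v : 'rV[R]_n => v 0 i).
by move=> v; exact: coord_continuous. Qed.

Lemma cont_row (T : topologicalType) n (f : T -> 'rV[R]_n) x :
 (forall i, {for x, continuous (fun t => f t 0 i)}) -> {for x, continuous f}.
move=> h; apply/cvgrPdist_le => /= e e0.
near=> y; apply: norm_row_le; first exact: ltW.
move=> i; rewrite !mxE; move: i; near: y; apply: filter_forall => i.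
exact: (cvgrPdist_le _ _).1 (h i) _ e0.
Unshelve. all: by end_near. Qed.

Lemma is_der_line n (f : 'rV[R]_n -> R) (x v : 'rV[R]_n) (t : R) :
 derivable f (t *: v + x) v ->
 isD t (1 : R) (fun s : R => f (s *: v + x)) ('D_v f (t *: v + x)).
move=> fv.
have E (h : R) : ((fun s : R => f (s *: v + x)) \o shift t) (h *: (1 : R)) =
 (f \o shift (t *: v + x)) (h *: v).
 by rewrite /= [h *: 1]mulr1 scalerDl addrA.
apply: DeriveDef.
- rewrite /derivable. rewrite [X in X @ _](_ : _ = fun h =>
 h^-1 *: ((f \o shift (t *: v + x)) (h *: v) - f (t *: v + x))) //.
 by apply/funext => h; rewrite E.
- rewrite /derive. rewrite [X in lim (X @ _)](_ : _ = fun h =>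
 h^-1 *: ((f \o shift (t *: v + x)) (h *: v) - f (t *: v + x))) //.
 by apply/funext => h; rewrite E.
Qed.

Lemma is_der_along n (f : 'rV[R]_n -> R) (x v : 'rV[R]_n) (d : R) :
 isD (0 : R) (1 : R) (fun s : R => f (s *: v + x)) d ->
 isD x v f d.
move=> [h1 h2]; have fv : derivable f x v by apply/derivable1P.
split=> //; rewrite -h2.
have := @is_der_line n f x v 0; rewrite scale0r add0r => /(_ fv) [_ <-].
by [].
Qed.

Lemma is_der_mulr (c s : R) : isD s (1 : R) (fun t => t * c) c.
apply: is_derive_eq.
by rewrite /= scaler0 add0r [_ *: _]mulr1.
Qed.

Lemma is_der_mul (f h : R -> R) (s df dh : R) :
 isD s 1 f df -> isD s 1 h dh ->
 isD s 1 (fun t => f t * h t) (df * h s + f s * dh).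
move=> hf hh; have hfh := @is_deriveM R R f h s 1 df dh hf hh.
by apply: is_derive_eq hfh _; rewrite /GRing.scale /= addrC [h s * _]mulrC.
Qed.

Lemma is_der_comp1 n (G : R -> R) (f : 'rV[R]_n -> R) x v (a b : R) :
 isD (f x) 1 G a -> isD x v f b ->
 isD x v (fun y => G (f y)) (a * b).
move=> Ga [fv <-]; apply: is_der_along.
have := @is_der_line n f x v 0; rewrite scale0r add0r => /(_ fv) h.
have E : f (0 *: v + x) = f x by rewrite scale0r add0r.
by apply: (@is_derive1_comp _ G (fun s => f (s *: v + x))); rewrite ?E.
Qed.

Lemma contDr (T : topologicalType) (f h : T -> R) x :
 {for x, continuous f} -> {for x, continuous h} ->
 {for x, continuous (fun y => f y + h y)}.
by move=> cf ch; exact: (@continuousD R R T f h x cf ch). Qed.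

Lemma contMr (T : topologicalType) (f h : T -> R) x :
 {for x, continuous f} -> {for x, continuous h} ->
 {for x, continuous (fun y => f y * h y)}.
by move=> cf ch; exact: (@continuousM R T f h x cf ch). Qed.

Lemma cont_cstr (T : topologicalType) (c : R) (x : T) :
 {for x, continuous (fun=> c)}.
exact: (@cst_continuous T R c x). Qed.

Lemma cont_sumr (T : topologicalType) n (f : 'I_n -> T -> R) x :
 (forall i, {for x, continuous (f i)}) ->
 {for x, continuous (fun y => \sum_i f i y)}.
move=> h; apply: (@cvg_big R 'I_n +%R 0 xpredT _ _ (nbhs x)) => //.
- exact: add_continuous.
- by move=> i _; exact: h.
Qed.

(** Vertices of the path from 0 to [v] that switches on the coordinates one at a time. *)
Definition prefix {n} (k : nat) (v : 'rV[R]_n) : 'rV[R]_n :=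
 \row_i (if (i < k)%N then v 0 i else 0).

Lemma prefixS n (v : 'rV[R]_n) (i : 'I_n) :
 prefix i.+1 v = v 0 i *: urow i + prefix i v.
apply/rowP => j; rewrite !mxE ltnS leq_eqVlt eqxx /=.
have [->|ji] := eqVneq j i; first by rewrite eqxx ltnn mulr1 addr0.
by rewrite (inj_eq val_inj) (negbTE ji) mulr0 add0r.
Qed.

Lemma row_sum n (v : 'rV[R]_n) : v = \sum_i v 0 i *: urow i.
exact: row_sum_delta. Qed.

Lemma diff_of_linear (U W : normedModType R) (f : U -> W)
 (L : {linear U -> W}) a : continuous L ->
 (forall e : R, 0 < e -> \forall v \near (0 : U),
 `|f (v + a) - (f a + L v)| <= e * `|v|) -> differentiable f a.
move=> Lc h; have LE : f \o shift a = cst (f a) + L +o_ 0 id.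
 by apply/eqaddoP => e e0; exact: h.
by apply/diff_locallyP; rewrite (diff_unique Lc LE); split.
Qed.

Lemma crd_mvt n (f : 'rV[R]_n -> R) (x : 'rV[R]_n) i (c : R) :
 (forall s : R, s \in `[0, 1] ->
 derivable f ((s * c) *: urow i + x) (urow i)) ->
 exists2 s : R, s \in `[0, 1] &
 f (c *: urow i + x) - f x =
 'D_(urow i) f ((s * c) *: urow i + x) * c.
move=> df; pose h (s : R) : R := f ((s * c) *: urow i + x).
pose dh (s : R) : R := 'D_(urow i) f ((s * c) *: urow i + x) * c.
have hd (s : R) : s \in `[0, 1] -> isD s 1 h (dh s).
 move=> /df /is_der_line hh. apply: (@is_derive1_comp _ (fun t => f (t *: urow i + x))
 (fun s => s * c)) => //.
 exact: is_der_mulr.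
have h1 (s : R) : s \in `]0, 1[ -> isD s 1 h (dh s).
 by move=> s01; apply: hd; move: s01; rewrite !in_itv /= => /andP[? ?]; rewrite !ltW.
have h2 : {within `[0, 1], continuous h}.
 by apply: derivable_within_continuous => s /hd [].
have [c' c01] := @MVT_segment R h dh 0 1 ler01 h1 h2.
by rewrite subr0 mulr1 /h mul1r mul0r scale0r add0r => hE; exists c'.
Qed.

(* Change one coordinate at a time and apply the mean value theorem. *)
Lemma cont_partials_diff n (f : 'rV[R]_n -> R) (a : 'rV[R]_n) :
 (\forall y \near a, forall i, derivable f y (urow i)) ->
 (forall i, {for a, continuous ('D_(urow i) f)}) ->
 differentiable f a.
move=> df cf.
pose L (v : 'rV[R]_n) := \sum_i v 0 i * 'D_(urow i) f a.
have Llin : linear (L : 'rV[R]_n -> R^o).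
 move=> c u v; rewrite /L scaler_sumr -big_split /=; apply: eq_bigr => i _.
 by rewrite !mxE mulrDl [in RHS]/GRing.scale /= mulrA.
pose LM := GRing.isLinear.Build _ _ _ _ _ Llin.
pose L' : {linear 'rV[R]_n -> R^o} := HB.pack L LM.
have Lc : continuous L'.
 move=> v; rewrite /L' /=. have := @cont_sumr 'rV[R]_n n (fun i u => u 0 i * 'D_(urow i) f a) v.
 apply => i; apply: contMr; last exact: cont_cstr. exact: (@cont_crd n i v).
apply: (@diff_of_linear _ R^o f L' a) => // e e0.
(* Each of the [n] coordinate steps contributes at most this fraction of the norm of [v]; [n.+1]
   keeps the quotient meaningful in dimension 0. *)
have en0 : 0 < e / n.+1%:R by rewrite divr_gt0.
have : \forall y \near a, forall i, derivable f y (urow i) /\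
 `|'D_(urow i) f a - 'D_(urow i) f y| <= e / n.+1%:R.
 near=> y => i; split; first by move: i; near: y. move: i; near: y; apply: filter_forall => i.
 exact: (cvgrPdist_le _ _).1 (cf i) _ en0.
move=> /nbhs_ballP [d /= d0 dP].
apply/nbhs_ballP; exists d => // v.
rewrite -ball_normE /ball_ /= sub0r normrN => vd.
have dQ w : `|w| <= `|v| -> forall i, derivable f (w + a) (urow i) /\
 `|'D_(urow i) f a - 'D_(urow i) f (w + a)| <= e / n.+1%:R.
 move=> wv; apply: dP; rewrite -ball_normE /ball_ /= opprD addrC. by rewrite addrNK normrN; exact: le_lt_trans vd.
have step (i : 'I_n) : `|f (prefix i.+1 v + a) - f (prefix i v + a) -
 v 0 i * 'D_(urow i) f a| <= e / n.+1%:R * `|v|.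
 pose w := prefix i v. have wsv (s : R) : 0 <= s <= `|v 0 i| -> True by [].
 have nrm (s : R) : s \in `[0, 1] -> `|(s * v 0 i) *: urow i + w| <= `|v|.
 rewrite in_itv /= => /andP[s0 s1]; apply: norm_row_le => // j. rewrite !mxE eqxx /=; have [->|ji] := eqVneq j i.
 rewrite ltnn mulr1 addr0 normrM ger0_norm //. by apply: le_trans (crd_le_norm v i); rewrite ler_piMl.
 rewrite mulr0 add0r; case: ifP => _; first exact: crd_le_norm. by rewrite normr0.
 have [|c c01 hE] := @crd_mvt n f (w + a) i (v 0 i).
 by move=> s /nrm /dQ /(_ i) [+ _]; rewrite addrA.
 have [_ cd] := dQ _ (nrm _ c01) i. have -> : prefix i.+1 v + a = v 0 i *: urow i + (w + a).
 by rewrite prefixS addrA.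
 rewrite hE; rewrite -addrA in cd. rewrite mulrC -mulrBr normrM mulrC distrC.
 apply: ler_pM => //; exact: crd_le_norm.
have E : f (v + a) - (f a + L' v) = \sum_(i < n)
 (f (prefix i.+1 v + a) - f (prefix i v + a) - v 0 i * 'D_(urow i) f a).
 rewrite sumrB. rewrite -(big_mkord xpredT (fun i => f (prefix i.+1 v + a) - f (prefix i v + a))).
 rewrite (telescope_sumr (fun i => f (prefix i v + a))) // opprD addrA; congr (f _ - f _ - _).
 by congr (_ + _); apply/rowP => j; rewrite !mxE ltn_ord.
 by rewrite -[LHS]add0r; congr (_ + _); apply/rowP => j; rewrite !mxE ltn0.
rewrite E; apply: le_trans (ler_norm_sum _ _ _) _.
apply: le_trans (ler_sum _ (fun i _ => step i)) _.
have : 0 <= (`|v| : R) by []; move: (`|v| : R) => r r0.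
rewrite sumr_const card_ord -[leLHS]mulr_natl mulrA ler_wpM2r //.
rewrite mulrCA ler_piMr ?(ltW e0) // ler_pdivrMr // mul1r ler_nat.
exact: leqnSn.
Unshelve. all: by end_near. Qed.

(** Restricted to the line through [y] in direction [v], [p] is a curve in one real variable, where
    derivable and differentiable coincide; so derivability of the coordinates of [p] along [v] is
    enough. *)
Lemma der_chain n m (G : 'rV[R]_m -> R) (p : 'rV[R]_n -> 'rV[R]_m)
 (y v : 'rV[R]_n) :
 differentiable G (p y) ->
 (forall k : 'I_m, derivable (fun z => p z 0 k) y v) ->
 isD y v (fun z => G (p z))
 (\sum_(k < m) 'D_v (fun z => p z 0 k) y * 'D_(urow k) G (p y)).
move=> dG dp.
have dpv : derivable p y v by apply/derivable_mxP => i j; rewrite ord1.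
pose q (t : R) := p (t *: v + y).
have q0 : q 0 = p y by rewrite /q scale0r add0r.
have dq : differentiable q 0.
 by apply/derivable1_diffP; exact: (derivable1P p y v).1 dpv.
have dGq : differentiable (G \o q) 0 by apply: differentiable_comp; rewrite ?q0.
apply: is_der_along.
apply: (@DeriveDef _ _ _ _ _ (G \o q)); first exact/derivable1_diffP.
rewrite deriveE // diff_comp // ?q0 //=.
have -> : 'd q 0 1 = 'D_v p y.
 rewrite -deriveE // /derive. rewrite [X in lim (X @ _)](_ : _ = fun h =>
 h^-1 *: ((p \o shift y) (h *: v) - p y)) //.
 by apply/funext => h /=; rewrite q0 /q addr0 [_ *: 1]mulr1.
rewrite derive_mx // {1}(row_sum (\matrix_(_, _) _)) linear_sum.
by apply: eq_bigr => k _; rewrite linearZ /= mxE -deriveE.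
Qed.

(** Smoothness in one variable is witnessed by an explicit sequence of iterated derivatives, so that
    an induction on the order can treat all of them at once. *)
Definition smooth1 (I : set R) (G : R -> R) : Prop :=
 exists2 D : nat -> R -> R, D 0%N = G &
 forall k s, I s -> isD s 1 (D k) (D k.+1 s).

Section Ck_lemmas.
Context {n : nat}.
Implicit Types (U : set 'rV[R]_n) (f h : 'rV[R]_n -> R).
Lemma Ck_cont k U f y : Ck k U f -> U y -> {for y, continuous f}.
by case: k => [|k] [h _] Uy; exact: h. Qed.

Lemma CkW k U f : Ck k.+1 U f -> Ck k U f.
elim: k U f => [|k IH] U f; first by move=> [cf _]; split.
move=> [cf df]; split=> // i; have [h1 h2] := df i.
by split=> //; apply: IH.
Qed.

Lemma Ck_sub k U U' f : U' `<=` U -> Ck k U f -> Ck k U' f.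
elim: k U U' f => [|k IH] U U' f UU' [cf df]; split => //.
- by move=> y /UU'; exact: cf.
- by move=> y /UU'; exact: cf.
move=> i; have [h1 h2] := df i.
by split; [move=> y /UU'; exact: h1|apply: IH h2].
Qed.

Lemma near_pder f h (y v : 'rV[R]_n) : (\forall z \near y, f z = h z) ->
 derivable f y v -> isD y v h ('D_v f y).
move=> fh df; have fv := derivableP df.
exact: (near_eq_is_derive fh fv).
Qed.

Lemma Ck_ext k U f h : open U -> {in U, f =1 h} -> Ck k U f -> Ck k U h.
move=> oU; elim: k f h => [|k IH] f h fh [cf df].
 split=> // y Uy. have fhy : \forall z \near y, f z = h z.
 have : nbhs y U by exact: onbhs. by apply: filterS => z Uz; apply: fh; rewrite inE.
 rewrite /prop_for /continuous_at -(fh y) ?inE //. apply: cvg_trans (cf _ Uy); exact: near_eq_cvg fhy.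
have near_fh y : U y -> \forall z \near y, f z = h z.
 move=> Uy; have : nbhs y U by exact: onbhs. by apply: filterS => z Uz; apply: fh; rewrite inE.
split=> [y Uy|i].
 rewrite /prop_for /continuous_at -(fh y) ?inE //. apply: cvg_trans (cf _ Uy); exact: near_eq_cvg (near_fh _ Uy).
have [h1 h2] := df i.
have hd y : U y -> isD y (delta_mx 0 i) h ('D_(delta_mx 0 i) f y).
 by move=> Uy; apply: near_pder; [exact: near_fh|exact: h1].
split=> [y /hd []//|].
apply: IH h2 => y /[!inE] Uy; have [_ E] := hd _ Uy.
by rewrite /partial_derivative E.
Qed.

Lemma Ck_local k U f :
 (forall y, U y -> exists2 U', U' y & Ck k U' f) -> Ck k U f.
elim: k U f => [|k IH] U f hU; split => //.
- by move=> y /hU [U' U'y [cf _]]; exact: cf.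
- by move=> y /hU [U' U'y [cf _]]; exact: cf.
move=> i; split=> [y /hU [U' U'y [_ df]]|]; first by have [h1 _] := df i; exact: h1.
apply: IH => y /hU [U' U'y [_ df]]; exists U' => //.
by have [] := df i.
Qed.

Lemma Ck_cst k U (c : R) : Ck k U (fun=> c).
have cc : forall c' y, U y -> {for y, continuous (fun _ : 'rV[R]_n => c' : R)}.
 by move=> c' y _; exact: cont_cstr.
elim: k c => [|k IH] c; split; [exact: cc|by []|exact: cc|].
move=> i; split=> [y _|]; first exact: derivable_cst.
rewrite /partial_derivative.
by have -> : 'D_(delta_mx 0 i) (fun=> c) = (fun=> 0) :> ('rV[R]_n -> R)
 by apply/funext => y; rewrite derive_cst.
Qed.

Lemma CkD k U f h : open U -> Ck k U f -> Ck k U h -> Ck k U (fun y => f y + h y).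
move=> oU; elim: k f h => [|k IH] f h [cf df] [ch dh]; split => //.
- by move=> y Uy; apply: contDr; [exact: cf|exact: ch].
- by move=> y Uy; apply: contDr; [exact: cf|exact: ch].
move=> i; have [f1 f2] := df i; have [h1 h2] := dh i.
split=> [y Uy|]; first by apply: derivableD; [exact: f1|exact: h1].
apply: Ck_ext (IH _ _ f2 h2) => // y /[!inE] Uy.
by rewrite /partial_derivative deriveD //; [exact: f1|exact: h1].
Qed.

Lemma CkM k U f h : open U -> Ck k U f -> Ck k U h -> Ck k U (fun y => f y * h y).
move=> oU; elim: k f h => [|k IH] f h cf ch.
 have [cf0 _] := cf; have [ch0 _] := ch. by split=> // y Uy; apply: contMr; [exact: cf0|exact: ch0].
have [cf0 df] := cf; have [ch0 dh] := ch; split.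
 by move=> y Uy; apply: contMr; [exact: cf0|exact: ch0].
move=> i; have [f1 f2] := df i; have [h1 h2] := dh i.
split=> [y Uy|]; first by apply: derivableM; [exact: f1|exact: h1].
have := CkD oU (IH _ _ (CkW cf) h2) (IH _ _ (CkW ch) f2).
apply: Ck_ext => // y /[!inE] Uy.
by rewrite /partial_derivative deriveM //; [exact: f1|exact: h1].
Qed.

Lemma Ck_sum k U m (F : 'I_m -> 'rV[R]_n -> R) : open U ->
 (forall i, Ck k U (F i)) -> Ck k U (fun y => \sum_i F i y).
move=> oU; elim: m F => [|m IH] F hF.
 apply: Ck_ext (Ck_cst k U 0) => // y _; by rewrite big_ord0.
apply: Ck_ext (CkD oU (IH _ (fun i => hF (widen_ord (leqnSn m) i))) (hF ord_max)) => //.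
by move=> y _; rewrite big_ord_recr.
Qed.

Lemma Ck_prod k U m (F : 'I_m -> 'rV[R]_n -> R) : open U ->
 (forall i, Ck k U (F i)) -> Ck k U (fun y => \prod_i F i y).
move=> oU; elim: m F => [|m IH] F hF.
 apply: Ck_ext (Ck_cst k U 1) => // y _; by rewrite big_ord0.
apply: Ck_ext (CkM oU (IH _ (fun i => hF (widen_ord (leqnSn m) i))) (hF ord_max)) => //.
by move=> y _; rewrite big_ord_recr.
Qed.

Lemma is_der_crd (y v : 'rV[R]_n) j :
 isD y v (fun z : 'rV[R]_n => z 0 j) (v 0 j).
apply: is_der_along.
have -> : (fun s : R => (s *: v + y) 0 j) = (fun s => s * v 0 j + y 0 j).
 by apply/funext => s; rewrite !mxE.
apply: is_derive_eq.
by rewrite /= scaler0 add0r addr0 [_ *: _]mulr1.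
Qed.

Lemma Ck_crd k U j : open U -> Ck k U (fun y => y 0 j).
move=> oU; case: k => [|k]; split => //;
 try by move=> y _; exact: cont_crd.
move=> i; split=> [y _|]; first by have [] := is_der_crd y (delta_mx 0 i) j.
apply: Ck_ext (Ck_cst k U ((delta_mx 0 i : 'rV[R]_n) 0 j)) => // y _.
by have [_ <-] := is_der_crd y (delta_mx 0 i) j.
Qed.

Lemma Ck_comp1 k U (I : set R) (G : R -> R) f : open U ->
 (forall y, U y -> I (f y)) -> smooth1 I G -> Ck k U f ->
 Ck k U (fun y => G (f y)).
(* Differentiating [D j] after [f] produces [D j.+1] after [f], hence the claim for all [j] before
   the induction on [k]. *)
move=> oU fI [D <- DS] cf; suff : forall j, Ck k U (fun y => D j (f y)) by apply.
move: cf; move=> cf j; move: cf.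
have cD y j' : U y -> {for f y, continuous (D j')}.
 move=> Uy; apply/differentiable_continuous/derivable1_diffP. by have [] := DS j' _ (fI _ Uy).
elim: k j => [|k IH] j cf; have cf0 y (Uy : U y) := Ck_cont cf Uy; split => //.
- by move=> y Uy; apply: continuous_comp; [exact: cf0|exact: cD].
- by move=> y Uy; apply: continuous_comp; [exact: cf0|exact: cD].
move=> i; have [_ df] := cf; have [f1 f2] := df i.
have hd y : U y -> isD y (delta_mx 0 i) (fun y => D j (f y))
 (D j.+1 (f y) * pder i f y).
 move=> Uy; apply: is_der_comp1; first by apply: DS; exact: fI. by apply: derivableP; exact: f1.
split=> [y /hd []//|].
apply: Ck_ext (CkM oU (IH j.+1 (CkW cf)) f2) => // y /[!inE] Uy.
by rewrite /partial_derivative; have [_ ->] := hd _ Uy.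
Qed.

Lemma Ck1_diff k U f y : open U -> U y -> Ck k.+1 U f ->
 differentiable f y.
move=> oU Uy [cf df]; apply: cont_partials_diff.
 have : nbhs y U by exact: onbhs. by apply: filterS => z Uz i; have [h1 _] := df i; exact: h1.
by move=> i; have [_ h2] := df i; exact: (Ck_cont h2).
Qed.
End Ck_lemmas.

Lemma Ck_comp n m k (U : set 'rV[R]_n) (U' : set 'rV[R]_m)
 (G : 'rV[R]_m -> R) (p : 'rV[R]_n -> 'rV[R]_m) :
 open U -> open U' -> (forall y, U y -> U' (p y)) -> Ck k U' G ->
 (forall j, Ck k U (fun y => p y 0 j)) -> Ck k U (fun y => G (p y)).
move=> oU oU' pU; elim: k G => [|k IH] G cG cp.
 have [cG0 _] := cG. split=> // y Uy; apply: continuous_comp; last by apply: cG0; exact: pU.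
 by apply: cont_row => i; exact: Ck_cont (cp i) Uy.
have [cG0 dG] := cG; split.
 move=> y Uy; apply: continuous_comp; last by apply: cG0; exact: pU.
 by apply: cont_row => i; exact: Ck_cont (cp i) Uy.
move=> i.
have hd y : U y -> isD y (delta_mx 0 i) (fun z => G (p z))
 (\sum_j 'D_(delta_mx 0 i) (fun z => p z 0 j) y * 'D_(urow j) G (p y)).
 move=> Uy; apply: der_chain.
 exact: (Ck1_diff oU' (pU _ Uy) cG).
 by move=> j; have [_ dp] := cp j; have [h1 _] := dp i; exact: h1.
split=> [y /hd []//|].
have hC := Ck_sum oU (fun j : 'I_m => CkM oU ((cp j).2 i).2
 (IH _ (dG j).2 (fun j => CkW (cp j)))).
apply: Ck_ext hC => // y /[!inE] Uy.
by rewrite /partial_derivative; have [_ ->] := hd _ Uy.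
Qed.
End calculus.

(** * Functions p(1/s) exp(-1/s), flat at 0: bumps and smooth positive parts *)

Section flat_functions.
Context {R : realType}.
Implicit Types (p : {poly R}) (s x : R).
(** From exp(y) >= 1 + y at y = x/(m+1), raised to the power m+1. The summand 1 of the constant
    covers x <= 1. *)
Lemma exp_dominates_pow m : exists2 C : R, 0 <= C &
 forall x, 0 < x -> x ^+ m * expR (- x) <= C.
exists (m.+1%:R ^+ m.+1 + 1); first by rewrite addr_ge0 // exprn_ge0.
move=> x x0; rewrite expRN ler_pdivrMr ?expR_gt0 //.
have h : (x / m.+1%:R) ^+ m.+1 <= expR x.
 have {2}-> : x = m.+1%:R * (x / m.+1%:R) by rewrite mulrC divfK. rewrite expRM_natl.
 apply: lerXn2r; rewrite ?nnegrE ?divr_ge0 ?expR_ge0 ?ltW //. by apply: lt_le_trans (expR_ge1Dx _); rewrite ltrDr.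
rewrite mulrDl mul1r.
have [x1|x1] := lerP x 1.
 apply: (@le_trans _ _ 1); first by rewrite exprn_ile1 // ltW.
 rewrite -[leLHS]add0r lerD // ?mulr_ge0 ?exprn_ge0 ?expR_ge0 //. by rewrite -expR0 ler_expR ltW.
apply: (@le_trans _ _ (x ^+ m.+1)).
 by rewrite exprS ler_peMl ?exprn_ge0 // ltW.
rewrite -[leLHS]addr0 lerD ?expR_ge0 //.
apply: le_trans (ler_wpM2l _ h); last by rewrite exprn_ge0.
by rewrite expr_div_n mulrC divfK // expf_neq0.
Qed.

Lemma exp_dominates_poly_aux p : exists2 C : R, 0 <= C &
 forall x, 0 < x -> `|p.[x]| * x * expR (- x) <= C.
pose K : R := \sum_(i < size p) `|p`_i|.
have {K} [C hC] : exists C : nat -> R, forall i, 0 <= C i /\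
 forall x, 0 < x -> x ^+ i * expR (- x) <= C i.
 have h i : exists c, 0 <= c /\ forall x, 0 < x -> x ^+ i * expR (- x) <= c.
 by have [c c0 hc] := exp_dominates_pow i; exists c.
 by have [C hC] := choice h; exists C.
exists (\sum_(i < size p) `|p`_i| * C i.+1).
 by apply: sumr_ge0 => i _; rewrite mulr_ge0 //; have [] := hC i.+1.
move=> x x0; rewrite horner_coef.
apply: (@le_trans _ _ ((\sum_(i < size p) `|p`_i * x ^+ i|) * x * expR (- x))).
 by rewrite !ler_wpM2r ?expR_ge0 ?(ltW x0) // ler_norm_sum.
rewrite !big_distrl /=; apply: ler_sum => i _.
rewrite normrM (ger0_norm (exprn_ge0 _ (ltW x0))) -!mulrA ler_wpM2l //.
by rewrite mulrA -exprSr; have [_] := hC i.+1; apply.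
Qed.

Lemma exp_dominates_poly p : exists2 C : R, 0 <= C &
 forall x, 0 < x -> `|p.[x]| * expR (- x) <= C.
elim/poly_ind: p => [|p c [C C0 IH]].
 by exists 0 => // x _; rewrite horner0 normr0 mul0r.
have [D D0 hD] := exp_dominates_poly_aux p.
have [E E0 hE] := exp_dominates_pow 0.
exists (D + `|c| * E); first by rewrite addr_ge0 // mulr_ge0.
move=> x x0; rewrite hornerMXaddC.
apply: le_trans (ler_wpM2r (expR_ge0 _) (ler_normD _ _)) _.
rewrite mulrDl lerD //.
 by rewrite normrM (gtr0_norm x0) hD.
by rewrite ler_wpM2l // -[expR _]mul1r -(expr0 x) hE.
Qed.

Definition flat p s : R := if 0 < s then p.[s^-1] * expR (- s^-1) else 0.

(** The derivative of p(1/s) exp(-1/s) is q(1/s) exp(-1/s) with q = X^2 (p - p'), so this class of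
    functions is stable under differentiation. *)
Definition flat_deriv p : {poly R} := 'X^2 * (p - p^`()).

Lemma flat_le0 p s : s <= 0 -> flat p s = 0.
by rewrite /flat ltNge => ->. Qed.

Lemma flat_bdd p : exists2 C : R, 0 <= C & forall s, `|flat p s| <= C.
have [C C0 h] := exp_dominates_poly p; exists C => // s; rewrite /flat.
case: ifPn => [s0|_]; last by rewrite normr0.
by rewrite normrM (gtr0_norm (expR_gt0 _)) h // invr_gt0.
Qed.

Lemma is_der_flat p s : isD s 1 (flat p) (flat (flat_deriv p) s).
have [s0|s0|->] := ltgtP s 0.
- rewrite (flat_le0 _ (ltW s0)). apply: (@near_eq_is_derive _ _ _ (cst 0)).
 by near=> t; rewrite flat_le0 // ltW //; near: t; exact: lt_nbhsl.
- have E : isD s 1 (fun t => p.[t^-1] * expR (- t^-1))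
 (flat (flat_deriv p) s).
 have i1 : isD s 1 (fun t : R => t^-1) (- s ^- 2).
 have := @is_deriveV R id s 1 1 (lt0r_neq0 s0) (is_derive_id _ _).
 by move=> h; apply: is_derive_eq h _; rewrite /GRing.scale /= mulr1.
 have i2 : isD s 1 (fun t : R => p.[t^-1]) (p^`().[s^-1] * (- s ^- 2)).
 exact: (@is_derive1_comp _ (horner p) (fun t : R => t^-1)).
 have i3 : isD s 1 (fun t : R => expR (- t^-1))
 (expR (- s^-1) * (s ^- 2)).
 apply: (@is_derive1_comp _ expR (fun t : R => - t^-1)). by apply: is_derive_eq; rewrite opprK.
 apply: is_derive_eq. rewrite /flat s0 /flat_deriv !hornerE /= /GRing.scale /=. by rewrite exprVn; ring.
 apply: near_eq_is_derive E. by near=> t; rewrite /flat ifT //; near: t; exact: lt_nbhsr.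
(* At 0: boundedness for the polynomial ['X^2 * p] says that [flat p t] is at most C t^2, so the
   difference quotient tends to 0. *)
- rewrite (flat_le0 _ (lexx 0)). have [C C0 h] := flat_bdd ('X^2 * p). have hC t : `|flat p t| <= C * t ^+ 2.
 have [t0|t0] := lerP t 0; first by rewrite flat_le0 // normr0 mulr_ge0 // sqr_ge0.
 have := h t; rewrite /flat t0 hornerM hornerXn -mulrA normrM. rewrite exprVn normfV (ger0_norm (sqr_ge0 t)).
 by rewrite mulrC ler_pdivrMr // exprn_gt0.
 have cv : (fun h : R => h^-1 *: ((flat p \o shift 0) (h *: (1 : R)) - flat p 0))
 @ 0^' --> (0 : R).
 have C1 : 0 < C + 1 by lra. apply/cvgrPdist_le => /= e e0; have eC : 0 < e / (C + 1) by rewrite divr_gt0.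
 near=> t; have t0 : t != 0 by near: t; exact: nbhs_dnbhs_neq.
 rewrite sub0r normrN addr0 [_ *: 1]mulr1 (flat_le0 _ (lexx 0)) subr0.
 rewrite /GRing.scale /= normrM normfV mulrC ler_pdivrMr ?normr_gt0 //. apply: le_trans (hC t) _.
 rewrite -[t ^+ 2]ger0_norm ?sqr_ge0 // expr2 normrM mulrA ler_wpM2r //. have te : `|t| <= e / (C + 1).
 by near: t; exact: dnbhs0_le.
 apply: le_trans (ler_wpM2l C0 te) _. by rewrite mulrCA ler_piMr ?(ltW e0) // ler_pdivrMr //; lra.
 by split; [apply/cvg_ex; exists 0|exact/cvg_lim].
Unshelve. all: by end_near. Qed.

Lemma smooth1_flat p : smooth1 setT (flat p).
exists (fun k => flat (iter k flat_deriv p)) => // k s _.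
exact: is_der_flat.
Qed.

(** Applied with the exponents -1 and 1/2, for reciprocals and square roots of positive smooth
    functions. *)
Lemma smooth1_powR (q : R) : smooth1 [set s | 0 < s] (fun s => s `^ q).
pose C k : R := \prod_(i < k) (q - i%:R).
exists (fun k s => C k * s `^ (q - k%:R)).
 by apply/funext => s; rewrite /C big_ord0 mul1r subr0.
move=> k s /= s0.
have := is_derive1_powR (q - k%:R) s0 => h.
have H := @is_der_mul R (fun=> C k) (fun s => s `^ (q - k%:R)) s 0 _
 (is_derive_cst (C k) s 1) h.
apply: is_derive_eq H _.
rewrite /C big_ord_recr /= mul0r add0r mulrA; congr (_ * _ `^ _).
by rewrite -natr1; ring.
Qed.

(** The profile exp(-1/s) for s > 0, and 0 otherwise; its dilations tend to the indicator of s >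
    0. *)
Definition bp1 (s : R) : R := flat 1 s.

Lemma bp1E s : 0 < s -> bp1 s = expR (- s^-1).
by rewrite /bp1 /flat => ->; rewrite hornerC mul1r. Qed.

Lemma bp1_gt0 s : 0 < s -> 0 < bp1 s.
by move=> s0; rewrite bp1E // expR_gt0. Qed.

Lemma bp1_eq0 s : s <= 0 -> bp1 s = 0. Proof. exact: flat_le0. Qed.

Lemma bp1_ge0 s : 0 <= bp1 s.
have [/bp1_eq0->//|/bp1_gt0/ltW//] := lerP s 0.
Qed.

Lemma bp1_le1 s : bp1 s <= 1.
have [/bp1_eq0->//|s0] := lerP s 0.
by rewrite bp1E // -expR0 ler_expR oppr_le0 invr_ge0 ltW.
Qed.

(* [s * bp1 s] is the profile of a smooth approximation of the positive part;
 its derivative (1 + 1/s) exp(-1/s) lies in [0, 1]. *)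
Definition dramp (s : R) : R := flat (1 + 'X) s.

Lemma is_der_ramp s : isD s 1 (fun t => t * bp1 t) (dramp s).
have h := is_der_flat 1 s.
have H := @is_der_mul R id bp1 s 1 _ (is_derive_id s 1) h.
apply: is_derive_eq H _.
rewrite /dramp /bp1 /flat_deriv /flat; case: ifPn => s0; last by rewrite !mulr0 add0r.
rewrite !hornerE derivC !hornerE /=.
by field; rewrite gt_eqF.
Qed.

Lemma drampE s : 0 < s -> dramp s = (1 + s^-1) * expR (- s^-1).
by rewrite /dramp /flat => ->; rewrite !hornerE. Qed.

Lemma dramp_ge0 s : 0 <= dramp s.
have [s0|s0] := lerP s 0; first by rewrite /dramp flat_le0.
by rewrite drampE // mulr_ge0 ?expR_ge0 // addr_ge0 // invr_ge0 ltW.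
Qed.

Lemma dramp_le1 s : dramp s <= 1.
have [s0|s0] := lerP s 0; first by rewrite /dramp flat_le0.
by rewrite drampE // expRN ler_pdivrMr ?expR_gt0 // mul1r expR_ge1Dx.
Qed.

(** The chain rule in W^1 passes to L^2 limits inside the derivative of the outer function, which
    therefore has to be Lipschitz. *)
Lemma dramp_lip : exists2 C : R, 0 <= C &
 forall s t, `|dramp s - dramp t| <= C * `|s - t|.
have [C C0 h] := flat_bdd (flat_deriv (1 + 'X)); exists C => // s t.
wlog ts : s t / t <= s.
 move=> hw; case/orP: (le_total t s) => [/hw//|/hw]. by rewrite (distrC (dramp t)) (distrC t).
have dd x : isD x 1 dramp (flat (flat_deriv (1 + 'X)) x).
 exact: is_der_flat.
have cd : {within `[t, s], continuous dramp}.
 by apply: derivable_within_continuous => x _; have [] := dd x.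
have [x _ ->] := MVT_segment ts (fun x _ => dd x) cd.
by rewrite normrM ler_wpM2r.
Qed.

Lemma bp1_cvg s : 0 < s -> (bp1 (k.+1%:R * s)) @[k --> \oo] --> (1 : R).
move=> s0.
have I : - (k.+1%:R * s)^-1 @[k --> \oo] --> (0 : R).
 rewrite [X in X @ _](_ : _ = fun k => (k.+1%:R)^-1 * - s^-1); last first.
 by apply/funext => k; rewrite invfM mulrN.
 by rewrite -(mul0r (- s^-1)); apply: cvgMl; exact: cvg_harmonic.
have P : expR (- (k.+1%:R * s)^-1) @[k --> \oo] --> (expR 0 : R).
 by apply: continuous_cvg => //; exact: continuous_expR.
rewrite expR0 in P; apply: cvg_trans P; apply: near_eq_cvg.
by near=> k; rewrite bp1E // mulr_gt0.
Unshelve. all: by end_near. Qed.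

Lemma dramp_cvg s : 0 < s -> (dramp (k.+1%:R * s)) @[k --> \oo] --> (1 : R).
move=> s0.
have C := bp1_cvg s0.
have I : (k.+1%:R * s)^-1 @[k --> \oo] --> (0 : R).
 rewrite [X in X @ _](_ : _ = fun k => (k.+1%:R)^-1 * s^-1); last first.
 by apply/funext => k; rewrite invfM.
 by rewrite -(mul0r s^-1); apply: cvgMl; exact: cvg_harmonic.
have P : ((1 + (k.+1%:R * s)^-1) * bp1 (k.+1%:R * s)) @[k --> \oo] --> ((1 + 0) * 1 : R).
 apply: cvgM => //; apply: cvgD => //; exact: cvg_cst.
rewrite addr0 mul1r in P; apply: cvg_trans P; apply: near_eq_cvg.
by near=> k; rewrite drampE ?bp1E // mulr_gt0.
Unshelve. all: by end_near. Qed.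
End flat_functions.

(** * Borel sets and Lebesgue measure on R^n; integration of partial derivatives *)

Section borel_rows.
Context {R : realType}.
Lemma open_from_nbhs (M : topologicalType) (A : set M) :
 (forall x, A x -> nbhs x A) -> open A.
by rewrite openE. Qed.

Lemma om_borel (M : ptopologicalType) (A : set M) :
 open A -> measurable (A : set (borel M)).
by move=> oA; exact: sub_sigma_algebra. Qed.

Lemma clsd_meas_borel (M : ptopologicalType) (A : set M) :
 closed A -> measurable (A : set (borel M)).
move=> cA; rewrite -(setCK A); apply: measurableC.
by apply: om_borel; exact: closed_openC.
Qed.

Lemma borel_meas_fun d (T : measurableType d) (M : ptopologicalType)
 (D : set T) (f : T -> M) : measurable D ->
 (forall A : set M, open A -> measurable (D `&` f @^-1` A)) ->
 measf D (f : T -> borel M).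
move=> mD h; apply: (@measurability _ _ T (borel M) D f (@open M)) => //.
by move=> _ [A oA <-]; exact: h.
Qed.

Lemma cont_on_meas (M : ptopologicalType) (D : set M) (f : M -> R) :
 open D -> (forall x, D x -> {for x, continuous f}) ->
 measf (D : set (borel M)) f.
move=> oD cf; apply: (measurability _ (RGenOpens.measurableE R)) => // B [A [a [b ->]] <-].
apply: om_borel.
apply: open_from_nbhs => x [Dx fx].
apply: filterI; first exact: onbhs.
apply: (cf _ Dx); apply: onbhs; split => //.
Qed.

(** Rational cubes are indexed by a countable type, which reduces Borel measurability of a map into
    R^n to that of its coordinates. *)
Lemma rat_balls n (A : set 'rV[R]_n) : open A ->
 exists P : set ('rV[rat]_n * nat), A = \bigcup_(q in P)
 [set v | forall i, `|v 0 i - ratr (q.1 0 i)| <= q.2.+1%:R^-1].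
move=> oA; pose B (q : 'rV[rat]_n * nat) : set 'rV[R]_n :=
 [set v | forall i, `|v 0 i - ratr (q.1 0 i)| <= q.2.+1%:R^-1].
exists [set q | B q `<=` A]; rewrite eqEsubset; split; last first.
 by move=> v [q /= qA]; exact: qA.
move=> v Av.
have /nbhs_ballP [e /= e0 eA] : nbhs v A by exact: onbhs.
have [k ke] : exists k : nat, k.+1%:R^-1 < e / 2.
 have e2 : 0 < e / 2 by rewrite divr_gt0. exists (Num.truncn (e / 2)^-1).
 rewrite -[ltRHS]invrK ltf_pV2 ?posrE ?invr_gt0 //. exact: truncnS_gt.
have hq i : exists q : rat, `|v 0 i - ratr q| < k.+1%:R^-1.
 have k0 : 0 < k.+1%:R^-1 :> R by rewrite invr_gt0.
 have [q /itvP qv] := @rat_in_itvoo R (v 0 i) (v 0 i + k.+1%:R^-1) ltac:(by rewrite ltrDl).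
 exists q; rewrite distrC ger0_norm; last by rewrite subr_ge0 ltW // qv. by rewrite ltrBlDl qv.
have [q qv] := choice hq.
exists (\row_i q i, k) => /=; last by move=> i; rewrite mxE ltW.
move=> w /= wq; apply: eA; rewrite -ball_normE /ball_ /=.
apply: (@le_lt_trans _ _ (k.+1%:R^-1 + k.+1%:R^-1)); last first.
 by rewrite [ltRHS]splitr ltrD.
apply: norm_row_le; first by rewrite addr_ge0.
move=> i; rewrite !mxE; have := wq i; rewrite mxE => h.
rewrite -(subrKA (ratr (q i))); apply: le_trans (ler_normD _ _) _.
by apply: lerD; [exact: ltW (qv i)|rewrite distrC].
Qed.

Lemma ms_row d (T : measurableType d) n (D : set T)
 (f : T -> 'rV[R]_n) : measurable D ->
 (forall i, measf D (fun t => f t 0 i)) ->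
 measf D (f : T -> borel 'rV[R]_n).
move=> mD mf; apply: borel_meas_fun => // A /rat_balls [P ->].
rewrite preimage_bigcup setI_bigcupr.
pose F (q : 'rV[rat]_n * nat) := D `&` f @^-1`
 [set v | forall i, `|v 0 i - ratr (q.1 0 i)| <= q.2.+1%:R^-1].
have -> : \bigcup_(q in P) (F q) = \bigcup_q (if `[< P q >] then F q else set0).
 rewrite eqEsubset; split => x [q Pq Fx].
 by exists q => //; case: asboolP.
 by move: Fx; case: asboolP => // Pq' Fx; exists q.
apply: countable_bigcupT_measurable => [|q].
 exact: countableP.
case: asboolP => // _; rewrite /F.
have -> : D `&` f @^-1` [set v | forall i, `|v 0 i - ratr (q.1 0 i)| <= q.2.+1%:R^-1]
 = D `&` \bigcap_(i in [set: 'I_n]) (D `&` (fun t => `|f t 0 i - ratr (q.1 0 i)|) @^-1` `]-oo, q.2.+1%:R^-1]).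
 rewrite eqEsubset; split => x [Dx /= h]; split => // i.
 by move=> _; split => //=; rewrite in_itv /=.
 by have [_ /=] := h i I; rewrite in_itv.
apply: measurableI => //; apply: fin_bigcap_measurable => // i _.
have m1 : measf D (fun t => `|f t 0 i - ratr (q.1 0 i)|).
 apply: mfT_comp => //; apply: mfB => //.
by apply: m1.
Qed.

Lemma ms_crd n (i : 'I_n) :
 measf [set: borel 'rV[R]_n] (fun v : 'rV[R]_n => v 0 i).
apply: (@cont_on_meas 'rV[R]_n setT) => [|x _]; first exact: openT.
exact: cont_crd.
Qed.

Definition crow m (p : R * 'rV[R]_m) : 'rV[R]_m.+1 := row_mx p.1%:M p.2.

Definition uncrow m (v : 'rV[R]_m.+1) : R * 'rV[R]_m :=
 (v 0 ord0, \row_j v 0 (lift ord0 j)).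

Lemma crow0 m (p : R * 'rV[R]_m) : crow p 0 ord0 = p.1.
rewrite /crow; have -> : ord0 = lshift m (ord0 : 'I_1) by apply/val_inj.
have := row_mxEl p.1%:M p.2 0 (ord0 : 'I_1); rewrite [X in _ = X]mxE eqxx mulr1n.
by [].
Qed.

Lemma crowS m (p : R * 'rV[R]_m) j : crow p 0 (lift ord0 j) = p.2 0 j.
rewrite /crow; have -> : lift ord0 j = rshift 1 j by apply/val_inj.
exact: (row_mxEr p.1%:M p.2 0 j).
Qed.

Lemma crowK m : cancel (@crow m) (@uncrow m).
move=> [t v]; rewrite /uncrow crow0; congr pair.
by apply/rowP => j; rewrite mxE crowS.
Qed.

Lemma ms_crow m : measf
 [set: mTR R * borel 'rV[R]_m] (@crow m : _ -> borel 'rV[R]_m.+1).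
apply: ms_row => // i; case: (unliftP ord0 i) => [j ->|->].
 under eq_fun do rewrite crowS. exact: (mfT_comp (ms_crd j) measurable_snd).
under eq_fun do rewrite crow0.
exact: measurable_fst.
Qed.

Lemma ms_uncrow m : measf [set: borel 'rV[R]_m.+1]
 (@uncrow m : _ -> mTR R * borel 'rV[R]_m).
apply: measurable_fun_pair; first exact: ms_crd.
apply: ms_row => // j; under eq_fun do rewrite mxE.
exact: ms_crd.
Qed.

Section lebesgue_step.
Context {m : nat} (mu : {sigma_finite_measure set (borel 'rV[R]_m) -> \bar R}).
Definition prod_leb : {measure set (mTR R * borel 'rV[R]_m)%type -> \bar R} :=
 (@lebesgue_measure R \x mu)%E.

Definition leb_step : set (borel 'rV[R]_m.+1) -> \bar R :=
 pushforward prod_leb (@crow m : _ -> borel 'rV[R]_m.+1).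

HB.instance Definition _ := Measure.copy leb_step
 (measure_function_pushforward__canonical__measure_function_Measure prod_leb
 (@ms_crow m)).

Lemma leb_step_sigma_finite : sigma_finite setT leb_step.
have /sigma_finiteP[F [TF ndF Foo]] := @sigma_finiteT _ _ _ (@lebesgue_measure R).
have /sigma_finiteP[G [TG ndG Goo]] := sigma_finiteT mu.
exists (fun k => (@uncrow m) @^-1` (F k `*` G k)).
 rewrite -preimage_bigcup -(preimage_setT (@uncrow m)); congr (_ @^-1` _).
 rewrite -setXTT TF TG predeqE => -[x y]; split.
 move=> [/= [k _ Fkx] [l _ Gly]]; exists (maxn k l) => //; split.
 - by move: x Fkx; exact/subsetPset/ndF/leq_maxl.
 - by move: y Gly; exact/subsetPset/ndG/leq_maxr.
 by move=> [k _ []/= ? ?]; split; exists k.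
move=> k; have [mF F1] := Foo k; have [mG G1] := Goo k.
have mFG : measurable (F k `*` G k : set (mTR R * borel 'rV[R]_m)).
 exact: measurableX.
split; first by rewrite -[X in measurable X]setTI; exact: ms_uncrow.
rewrite /leb_step /pushforward -comp_preimage.
rewrite (_ : _ \o _ = id) ?preimage_id; last by apply/funext => p; exact: crowK.
by rewrite /prod_leb /= product_measure1E// lte_mul_pinfty// ge0_fin_numE.
Qed.

HB.instance Definition _ := Measure_isSigmaFinite.Build _ _ _ leb_step
 leb_step_sigma_finite.

Lemma int_leb_step (f : 'rV[R]_m.+1 -> \bar R) :
 measf [set: borel 'rV[R]_m.+1] f -> (forall x, 0 <= f x)%E ->
 (\int[leb_step]_x f x =
 \int[lebm]_t \int[mu]_v f (crow (t, v)))%E.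
move=> mf f0.
rewrite (@ge0_integral_pushforward _ _ _ _ _ _ (@ms_crow m)) //.
rewrite preimage_setT (@fubini_tonelli1 _ _ _ _ _ lebm mu) //; last first.
 by move=> p; exact: f0.
exact: mfT_comp mf (@ms_crow m).
Qed.
End lebesgue_step.

(** [lebesgue_integral_Rn] is only an iterated integral. A genuine sigma-finite measure with the
    same integrals of nonnegative Borel functions gives access to Fubini's theorem and to L^2. *)
Fixpoint leb n : {sigma_finite_measure set (borel 'rV[R]_n) -> \bar R} :=
 match n with
 | 0%N => [the {sigma_finite_measure set _ -> \bar R} of \d_(0 : borel 'rV[R]_0)]
 | m.+1 => [the {sigma_finite_measure set _ -> \bar R} of leb_step (leb m)]
 end.

Lemma leb_int n (f : 'rV[R]_n -> \bar R) :
 measf [set: borel 'rV[R]_n] f -> (forall x, 0 <= f x)%E ->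
 (\int[leb n]_x f x = lebesgue_integral_Rn f)%E.
elim: n f => [|n IH] f mf f0 /=.
 by rewrite integral_dirac // diracT mul1e.
rewrite int_leb_step //; apply: eqint => t _.
apply: IH => //.
apply: (mfT_comp mf).
exact: (mfT_comp (@ms_crow n) (pair1_measurable t)).
Qed.

(** Source of the volumes of cubes, of the nullity of hyperplanes and of the action of product
    kernels on boxes. *)
Lemma int_leb_prod n (q : 'I_n -> R -> \bar R) :
 (forall i, measf [set: mTR R] (q i)) ->
 (forall i t, 0 <= q i t)%E ->
 (\int[leb n]_v (\prod_i q i (v 0%R i)) = \prod_i \int[lebm]_t q i t)%E.
elim: n q => [|n IH] q mq q0 /=.
 rewrite big_ord0; under eqint do rewrite big_ord0. by rewrite integral_dirac // diracT mul1e.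
have mprod k (r : 'I_k -> R -> \bar R) :
 (forall i, measf [set: mTR R] (r i)) ->
 measf [set: borel 'rV[R]_k] (fun v => \prod_i r i (v 0%R i))%E.
 move=> mr; elim: k r mr => [|k IHk] r mr.
 by under eq_fun do rewrite big_ord0; exact: measurable_cst.
 under eq_fun do rewrite big_ord_recl. apply: emeasurable_funM; first exact: mfT_comp (mr _) (ms_crd _).
 have mt : measf [set: borel 'rV[R]_k.+1]
 ((fun v => \row_j v 0%R (lift ord0 j)) : _ -> borel 'rV[R]_k).
 by apply: ms_row => // j; under eq_fun do rewrite mxE; exact: ms_crd.
 have := mfT_comp (IHk (fun i => r (lift ord0 i)) (fun i => mr _)) mt.
 by apply: eq_measurable_fun => v _ /=; apply: eq_bigr => i _; rewrite mxE.
have prod_ge0 k (r : 'I_k -> R -> \bar R) (v : 'rV[R]_k) : (forall i t, 0 <= r i t)%E ->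
 (0 <= \prod_i r i (v 0%R i))%E.
 by move=> r0; elim/big_ind: _ => // x y x0 y0; exact: mule_ge0.
rewrite int_leb_step; [|exact: (mprod n.+1 q)|by move=> v; exact: (prod_ge0 n.+1 q)].
rewrite big_ord_recl -IH //.
transitivity (\int[lebm]_t (q ord0 t *
 \int[leb n]_v \prod_i q (lift ord0 i) (v 0%R i)))%E.
 apply: eqint => t _. transitivity (\int[leb n]_v (q ord0 t * \prod_i q (lift ord0 i) (v 0%R i)))%E.
 apply: eqint => v _; rewrite big_ord_recl crow0 /=.
 by congr (_ * _)%E; apply: eq_bigr => k _; rewrite crowS.
 apply: ge0_integralZl => //.
 by apply: (mprod n (fun i => q (lift ord0 i))) => i.
 by move=> v _; exact: (prod_ge0 n (fun i => q (lift ord0 i))).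
rewrite ge0_integralZr //.
by apply: integral_ge0 => v _; exact: (prod_ge0 n (fun i => q (lift ord0 i))).
Qed.

Definition cube n (a : 'rV[R]_n) (r : R) : set 'rV[R]_n :=
 [set v | forall i, `|v 0 i - a 0 i| <= r].

Lemma ms_cube n (a : 'rV[R]_n) r : measurable (cube a r : set (borel 'rV[R]_n)).
have -> : cube a r = \bigcap_(i in [set: 'I_n])
 (setT `&` (fun v : 'rV[R]_n => `|v 0 i - a 0 i|) @^-1` `]-oo, r]).
 rewrite eqEsubset; split => v /= h i; first by split => //=; rewrite in_itv /=.
 by have [_ /=] := h i I; rewrite in_itv.
apply: fin_bigcap_measurable => // i _.
have m1 : measf [set: borel 'rV[R]_n] (fun v : 'rV[R]_n => `|v 0 i - a 0 i|).
 by apply: mfT_comp => //; apply: mfB => //; exact: ms_crd.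
by apply: m1.
Qed.

Lemma leb_cube_fin n (a : 'rV[R]_n) r : (leb n (cube a r) < +oo)%E.
have mI i : measurable (`[a 0 i - r, a 0 i + r] : set (mTR R)) by [].
rewrite -[X in leb n X]setIT -integral_indic //; last exact: ms_cube.
pose q (i : 'I_n) (t : R) : \bar R := (\1_(`[a 0 i - r, a 0 i + r]%classic : set R) t)%:E.
have qE v : (\1_(cube a r) v)%:E = (\prod_i q i (v 0%R i))%E.
 rewrite /q prodEFin; congr EFin; rewrite /indic. case: (boolP (v \in cube a r)); rewrite ?inE => h.
 rewrite big1 // => i _; rewrite mem_set //= in_itv /=. by have := h i; rewrite ler_distl.
 have [i hi] : exists i, ~ `|v 0 i - a 0 i| <= r.
 by apply/existsNP => h'; move/negP: h; apply; rewrite inE.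
 rewrite (bigD1 i) //= memNset ?mul0r //= in_itv /=. by apply/negP; rewrite -ler_distl; apply/negP.
under eqint do rewrite qE.
rewrite int_leb_prod; last 2 first.
- by move=> i; apply/mEFinP; exact: mindic.
- by move=> i t; rewrite lee_fin.
suff h : (\prod_i \int[lebm]_t q i t)%E \is a fin_num by rewrite ltey_eq h.
elim/big_ind: _ => [//|x y|i _]; first exact: fin_numM.
rewrite /q integral_indic // setIT.
suff : lebm (`[a 0 i - r, a 0 i + r]%classic : set R) \is a fin_num by [].
by rewrite lebesgue_measure_itv /=; case: ifP.
Qed.

Lemma int_der (f g : R -> R) (a b : R) : a < b ->
 (forall t : R, isD t 1 f (g t)) -> continuous g ->
 (\int[lebm]_(t in `[a, b]) (g t)%:E = (f b - f a)%:E)%E.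
move=> ab df cg.
have cf t : {for t, continuous f}.
 by apply/differentiable_continuous/derivable1_diffP; have [] := df t.
rewrite EFinB; apply: continuous_FTC2 => //.
- exact: csubT.
- split; first by move=> t _; have [] := df t.
 exact: cvg_at_right_filter (cf a).
 exact: cvg_at_left_filter (cf b).
- by move=> t _; rewrite derive1E; have [_ ->] := df t.
Qed.

Lemma int_der_cpt (f g : R -> R) (B : R) :
 (forall t : R, isD t 1 f (g t)) -> continuous g ->
 (forall t, B < `|t| -> f t = 0) -> (forall t, B < `|t| -> g t = 0) ->
 (\int[lebm]_t (g t)%:E = 0)%E.
(* [f] vanishes at both ends of [-b, b], whatever the sign of [B]. *)
move=> df cg f0 g0; pose b : R := `|B| + 1.
have b0 : 0 < b by rewrite ltr_wpDl.
have Bb : B < b by rewrite (le_lt_trans (ler_norm B)) // ltrDl.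
transitivity (\int[lebm]_(t in `[(- b)%R, b]) (g t)%:E)%E.
 rewrite [RHS]integral_mkcond; apply: eqint => t _; rewrite patchE.
 case: ifPn => //; rewrite notin_setE /= in_itv /= -ler_norml => /negP.
 by rewrite -ltNge => tb; rewrite g0 // (lt_trans Bb).
rewrite (int_der _ df cg); last by rewrite gtrN.
by rewrite !f0 ?subrr // ?normrN gtr0_norm.
Qed.

(** Both orders of integration are recorded, because the coordinate to be integrated first may be
    the head or lie in the tail. *)
Lemma fubini_leb_step m (mu : {sigma_finite_measure set (borel 'rV[R]_m) -> \bar R})
 (f : 'rV[R]_m.+1 -> \bar R) :
 (leb_step mu).-integrable setT f ->
 (\int[leb_step mu]_x f x =
 \int[lebm]_t \int[mu]_v f (crow (t, v)))%E /\
 (\int[leb_step mu]_x f x =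
 \int[mu]_v \int[lebm]_t f (crow (t, v)))%E.
move=> /integrableP [mf fi].
have mfc : measf [set: (mTR R * borel 'rV[R]_m)%type] (f \o @crow m).
 exact: (mfT_comp mf (@ms_crow m)).
have fi2 : (prod_leb mu).-integrable setT (f \o @crow m).
 apply/integrableP; split => //. rewrite -[X in (X < _)%E](@ge0_integral_pushforward _ _ _ _ _ _ (@ms_crow m)
 (prod_leb mu) setT (fun y => `|f y|%E)) //.
 exact: mfT_comp.
have E : (\int[leb_step mu]_x f x =
 \int[(lebm \x mu)%E]_z (f \o @crow m) z)%E.
 rewrite (@integral_pushforward _ _ _ _ _ _ (@ms_crow m)) //.
rewrite !E; split.
 by rewrite -(@integral12_prod_meas1 _ _ _ _ _ lebm mu _ fi2).
by rewrite -(@integral21_prod_meas1 _ _ _ _ _ lebm mu _ fi2).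
Qed.

Lemma rowDE n (u v : 'rV[R]_n) i : (u + v) 0 i = u 0 i + v 0 i.
by rewrite mxE. Qed.

Lemma rowZE n c (v : 'rV[R]_n) i : (c *: v) 0 i = c * v 0 i.
by rewrite mxE. Qed.

Lemma urowE n (i j : 'I_n) : (urow i : 'rV[R]_n) 0 j = (j == i)%:R.
by rewrite mxE eqxx. Qed.

Lemma intble_cube n (G : 'rV[R]_n -> R) (B C : R) :
 continuous G -> (forall y, `|G y| <= C) -> (forall y, ~ cube 0 B y -> G y = 0) ->
 (leb n).-integrable setT (EFin \o G).
move=> cG CG G0.
have mG : measf [set: borel 'rV[R]_n] G.
 apply: (@cont_on_meas 'rV[R]_n setT) => [|x _]; first exact: openT. exact: cG.
have iG : (leb n).-integrable setT (EFin \o G).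
 apply: (@le_integrable _ _ _ (leb n) setT _ _ (EFin \o (fun y => `|C| * \1_(cube 0 B) y))) => //.
 - exact/mEFinP.
 - move=> y _ /=; rewrite lee_fin normrM normr_id /indic. case: (boolP (y \in cube 0 B)); rewrite ?inE => h.
 by rewrite normr1 mulr1 (le_trans (CG y)) // ler_norm.
 by rewrite G0 ?normr0 ?mulr0 // => h'; move/negP: h; apply; rewrite inE.
 - apply/integrableP; split.
 apply/mEFinP; apply: mfM => //. by apply: mindic; exact: ms_cube.
 have mI : measf [set: borel 'rV[R]_n] (EFin \o (\1_(cube 0 B) : 'rV[R]_n -> R)).
 by apply/mEFinP; apply: mindic; exact: ms_cube.
 under eqint => y _.
 rewrite /= ger0_norm ?mulr_ge0 // EFinM. over.
 rewrite (@ge0_integralZl _ _ _ (leb n) setT measurableT _ mI) //; last first.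
 by move=> y _ /=; rewrite lee_fin.
 rewrite integral_indic //; last exact: ms_cube.
 by rewrite setIT lte_mul_pinfty // ?lee_fin //; exact: leb_cube_fin.
exact: iG.
Qed.

Lemma cont_crow1 n (v : 'rV[R]_n) : continuous (fun t : R => crow (t, v)).
move=> t; apply: cont_row => j; case: (unliftP ord0 j) => [k ->|->].
 have -> : (fun s : R => crow (s, v) 0 (lift ord0 k)) = fun=> v 0 k.
 by apply/funext => s; rewrite crowS.
 exact: cont_cstr.
have -> : (fun s : R => crow (s, v) 0 ord0) = id.
 by apply/funext => s; rewrite crow0.
exact: cvg_id.
Qed.

Lemma cont_crow2 n (t : R) :
 continuous (fun v : 'rV[R]_n => crow (t, v)).
move=> v; apply: cont_row => j; case: (unliftP ord0 j) => [k ->|->].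
 have -> : (fun u : 'rV[R]_n => crow (t, u) 0 (lift ord0 k)) = fun u => u 0 k.
 by apply/funext => s; rewrite crowS.
 exact: (@cont_crd R n k v).
have -> : (fun u : 'rV[R]_n => crow (t, u) 0 ord0) = fun=> t.
 by apply/funext => s; rewrite crow0.
exact: cont_cstr.
Qed.

(* Fubini's theorem moves the differentiated coordinate to the innermost place. *)
Lemma int_partial n (i : 'I_n) (F G : 'rV[R]_n -> R) (B C : R) :
 (forall y, isD y (urow i) F (G y)) ->
 continuous G -> (forall y, `|G y| <= C) ->
 (forall y, ~ cube 0 B y -> F y = 0) -> (forall y, ~ cube 0 B y -> G y = 0) ->
 (\int[leb n]_y (G y)%:E = 0)%E.
elim: n i F G => [i|n IH i] F G dF cG CG F0 G0 /=; first by case: (i).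
have iG := intble_cube cG CG G0.
have consE (t : R) v : crow (t, v) = t *: urow ord0 + crow (0, v).
 apply/rowP => j; case: (unliftP ord0 j) => [k ->|->].
 by rewrite rowDE rowZE urowE !crowS /= mulr0 add0r.
 by rewrite rowDE rowZE urowE !crow0 /= ?eqxx mulr1 addr0.
have far0 (t : R) v : B < `|t| -> ~ cube 0 B (crow (t, v)).
 by move=> Bt /(_ ord0); rewrite crow0 mxE subr0 leNgt Bt.
have farS (t : R) v : ~ cube 0 B v -> ~ cube 0 B (crow (t, v)).
 move=> h h'; apply: h => j; have := h' (lift ord0 j). by rewrite crowS !mxE.
have [E1 E2] := fubini_leb_step iG.
case: (unliftP ord0 i) dF => [j ->|->] dF.
 rewrite E1; apply: integral0_eq => t _. apply: (IH j (fun v => F (crow (t, v))) (fun v => G (crow (t, v)))).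
 - move=> v; apply: is_der_along. have [h1 h2] := dF (crow (t, v)).
 have h3 := @is_der_line R n.+1 F (crow (t, v)) (urow (lift ord0 j)) 0.
 rewrite scale0r add0r h2 in h3; have := h3 h1. congr (isD _ _ _ _); apply/funext => s; congr F.
 apply/rowP => k; case: (unliftP ord0 k) => [l ->|->].
 by rewrite rowDE rowZE urowE !crowS /= rowDE rowZE urowE (inj_eq lift_inj).
 by rewrite rowDE rowZE urowE !crow0 /= ?(negbTE (neq_lift _ _)) mulr0 add0r.
 - by move=> v; apply: continuous_comp; [exact: cont_crow2|exact: cG].
 - by [].
 - by move=> v /(farS _ t); exact: F0.
 - by move=> v /(farS _ t); exact: G0.
rewrite E2; apply: integral0_eq => v _.
apply: (@int_der_cpt (fun t => F (crow (t, v)))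
 (fun t => G (crow (t, v))) B).
- move=> t; have [h1 h2] := dF (crow (t, v)). rewrite consE in h1 h2. have h3 := is_der_line h1.
 rewrite h2 -consE in h3. have -> : (fun t0 : R => F (crow (t0, v))) =
 (fun s : R => F (s *: urow ord0 + crow (0, v))). by apply/funext => s; rewrite consE.
 exact: h3.
- by move=> t; apply: continuous_comp; [exact: cont_crow1|exact: cG].
- by move=> t /far0 h; exact: F0.
- by move=> t /far0 h; exact: G0.
Qed.
End borel_rows.

(** * Prehilbert forms on raw types: minimisation, Riesz representation, projection *)

Section prehilbert.
Context {R : realType} {E : Type}.
Variables (lin : R -> E -> E -> E) (D : set E) (b : E -> E -> R).
(** [lin a x y] plays the role of a x + y on the domain [D]. The form is semidefinite and [E] is a
    bare type, because its elements will be functions and fields that stand for their classes modulo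
    null sets. *)
Record prehilbert : Prop := Prehilbert {
 ph_lin : forall a x y, D x -> D y -> D (lin a x y);
 ph_linl : forall a x y z, D x -> D y -> D z ->
 b (lin a x y) z = a * b x z + b y z;
 ph_sym : forall x y, D x -> D y -> b x y = b y x;
 ph_ge0 : forall x, D x -> 0 <= b x x }.

Definition dif (x y : E) : E := lin (-1) y x.

Definition dist2 (x y : E) : R := b (dif x y) (dif x y).

Definition cauchy2 (u : nat -> E) : Prop := forall e : R, 0 < e ->
 exists N, forall i j, (N <= i)%N -> (N <= j)%N -> dist2 (u i) (u j) < e.

Definition conv2 (u : nat -> E) (x : E) : Prop := forall e : R, 0 < e ->
 exists N, forall i, (N <= i)%N -> dist2 (u i) x < e.

Definition compl2 : Prop := forall u : nat -> E, (forall i, D (u i)) ->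
 cauchy2 u -> exists2 x, D x & conv2 u x.

Definition clsd2 (C : set E) : Prop := forall x, D x ->
 (forall e : R, 0 < e -> exists2 c, C c & dist2 c x < e) -> C x.

Definition bdd_linear (l : E -> R) : Prop :=
 (forall a x y, D x -> D y -> l (lin a x y) = a * l x + l y) /\
 exists K : R, forall x, D x -> (l x) ^+ 2 <= K * b x x.

Definition mid (x y : E) : E := lin (2^-1) x (lin (- 2^-1) y y).

Hypothesis H : prehilbert.

Lemma ph_linr a x y z : D x -> D y -> D z ->
 b z (lin a x y) = a * b z x + b z y.
move=> Dx Dy Dz; rewrite (ph_sym H) ?(ph_linl H) //; last exact: (ph_lin H).
by rewrite (ph_sym H Dx Dz) (ph_sym H Dy Dz).
Qed.

Lemma ph_dif x y : D x -> D y -> D (dif x y).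
by move=> Dx Dy; apply: ph_lin. Qed.

Lemma ph_exp a x y : D x -> D y ->
 b (lin a x y) (lin a x y) = a ^+ 2 * b x x + 2 * a * b x y + b y y.
move=> Dx Dy; have Dl := ph_lin H a Dx Dy.
by rewrite ph_linl // !ph_linr // (ph_sym H Dy Dx); ring.
Qed.

Lemma ph_CS x y : D x -> D y -> b x y ^+ 2 <= b x x * b y y.
move=> Dx Dy; have y0 := ph_ge0 H Dy; have x0 := ph_ge0 H Dx.
have P t : 0 <= t ^+ 2 * b x x + 2 * t * b x y + b y y.
 by rewrite -ph_exp //; apply: (ph_ge0 H); exact: (ph_lin H).
have [x1|x1] := eqVneq (b x x) 0.
 (* When b x x = 0 the quadratic polynomial is affine, and this argument makes it equal to -1. *)
 have [->|c0] := eqVneq (b x y) 0; first by rewrite expr0n mulr_ge0. have := P (- (b y y + 1) / (2 * b x y)).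
 rewrite x1 mulr0 add0r. have -> : 2 * (- (b y y + 1) / (2 * b x y)) * b x y = - (b y y + 1) by field. lra.
have x2 : 0 < b x x by rewrite lt_neqAle eq_sym x1.
have := P (- b x y / b x x).
have -> : (- b x y / b x x) ^+ 2 * b x x + 2 * (- b x y / b x x) * b x y + b y y
 = (b x x * b y y - b x y ^+ 2) / b x x by field.
by rewrite pmulr_lge0 ?invr_gt0 // subr_ge0.
Qed.

(** Weighted Cauchy-Schwarz inequality, linear in the two squared norms, so that linear arithmetic
    can close an estimate. *)
Lemma ph_amgm (t : R) x y : 0 < t -> D x -> D y ->
 2 * `|b x y| <= t * b x x + t^-1 * b y y.
move=> t0 Dx Dy.
have Dl s := ph_ge0 H (ph_lin H s Dx Dy).
have := Dl t; have := Dl (- t); rewrite !ph_exp // => h1 h2.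
have e1 : t * (t * b x x + t^-1 * b y y) = t ^+ 2 * b x x + b y y.
 by field; lra.
rewrite sqrrN in h1; rewrite -(ler_pM2l t0) e1.
by case: (ger0P (b x y)) => _; lra.
Qed.

Lemma ph_bdd_amgm l (t : R) (K : R) x : 0 < t -> 0 <= K ->
 (l x) ^+ 2 <= K * b x x -> D x ->
 2 * `|l x| <= t * K + t^-1 * b x x.
move=> t0 K0 lx Dx; have x0 := ph_ge0 H Dx.
rewrite -(@ler_pXn2r _ 2) // ?nnegrE; last 2 first.
- by rewrite mulr_ge0.
- by rewrite addr_ge0 // mulr_ge0 // ?ltW // invr_gt0.
rewrite exprMn real_normK ?num_real //.
have -> : (t * K + t^-1 * b x x) ^+ 2 =
 (t * K - t^-1 * b x x) ^+ 2 + 4 * (K * b x x) by field; lra.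
by have := sqr_ge0 (t * K - t^-1 * b x x); lra.
Qed.

Lemma midE x y : D x -> D y -> D (mid x y).
by move=> Dx Dy; do 2 apply: (ph_lin H) => //. Qed.

Lemma mid_exp x y : D x -> D y ->
 b (mid x y) (mid x y) = 2^-1 * (b x x + b y y) - 4^-1 * dist2 x y.
move=> Dx Dy; rewrite /mid ph_exp //; last exact: (ph_lin H).
rewrite ph_linr // !ph_exp // /dist2 /dif ph_exp // (ph_sym H Dy Dx).
by field.
Qed.

Variable complete_D : compl2.
(* Minimising sequences are Cauchy by the parallelogram identity. *)
Theorem convex_min (C : set E) (l : E -> R) :
 C `<=` D -> C !=set0 -> (forall x y, C x -> C y -> C (mid x y)) ->
 clsd2 C -> bdd_linear l ->
 exists2 m, C m & forall c, C c -> b m m - 2 * l m <= b c c - 2 * l c.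
move=> CD [c0 Cc0] Cmid Cclosed [llin [K0 lK0]].
pose K := `|K0|.
have K_ge0 : 0 <= K by rewrite normr_ge0.
have lK x : D x -> (l x) ^+ 2 <= K * b x x.
 move=> Dx; apply: (le_trans (lK0 _ Dx)). by rewrite ler_wpM2r ?ler_norm // (ph_ge0 H).
pose J x := b x x - 2 * l x.
pose A := [set J c | c in C].
have JK x : D x -> - K <= J x.
 move=> Dx; have := ph_bdd_amgm (t := 1) ltr01 K_ge0 (lK _ Dx) Dx.
 rewrite invr1 !mul1r /J; have := ler_norm (l x); lra.
have Alb : has_inf A.
 split; first by exists (J c0), c0. by exists (- K) => _ [c Cc <-]; apply: JK; apply: CD.
have IA c : C c -> inf A <= J c.
 by move=> Cc; apply: ge_inf; [case: Alb|exists c].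
have mk k : exists c, C c /\ J c < inf A + k.+1%:R^-1.
 have i0 : 0 < k.+1%:R^-1 :> R by rewrite invr_gt0. have [_ [c Cc <-] h] := inf_adherent i0 Alb. by exists c.
have [u uP] := choice mk.
have uC i : C (u i) by case: (uP i).
have uD i : D (u i) by apply: CD.
have Jmid x y : C x -> C y -> dist2 x y <= 2 * (J x + J y) - 4 * inf A.
 move=> Cx Cy; have := IA _ (Cmid _ _ Cx Cy). have Dx := CD _ Cx; have Dy := CD _ Cy.
 rewrite /J mid_exp // /mid !llin //; last exact: (ph_lin H). by rewrite !mulrDr; lra.
have smallE (e : R) : 0 < e -> exists N, forall i, (N <= i)%N ->
 J (u i) < inf A + e.
 move=> e0; exists (Num.truncn e^-1) => i Ni. have [_ h] := uP i; apply: (lt_trans h); rewrite ltrD2l.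
 rewrite -[e]invrK ltf_pV2 ?posrE ?invr_gt0 //. have := truncnS_gt e^-1; move/lt_le_trans; apply. by rewrite ler_nat.
have cu : cauchy2 u.
 move=> e e0; have e4 : 0 < e / 4 by lra. have [N NP] := smallE _ e4.
 exists N => i j Ni Nj; apply: (le_lt_trans (Jmid _ _ (uC i) (uC j))). by have := NP _ Ni; have := NP _ Nj; lra.
have [m Dm um] := complete_D uD cu.
have Cm : C m.
 apply: Cclosed => // e e0; have [N NP] := um e e0. by exists (u N) => //; apply: NP.
exists m => // c Cc; apply: (le_trans _ (IA _ Cc)); rewrite -/(J m).
apply/ler_addgt0Pr => e e0.
(* Passing from [u i] to the limit [m] costs 2 b(m, u_i - m) and 2 l(u_i - m); the weighted
   inequalities with this [t] bound both by fractions of [e]. *)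
have [t [t0 ht]] : exists t : R, 0 < t /\ t * (b m m + K) <= e / 4.
 have p : 0 < b m m + K + 1 by have := ph_ge0 H Dm; lra.
 exists (e / 4 / (b m m + K + 1)); split; first by rewrite divr_gt0 //; lra.
 by rewrite mulrAC ler_pdivrMr // ler_wpM2l //; lra.
have e4 : 0 < e / 4 by lra.
have te8 : 0 < t * e / 8 by rewrite !mulr_gt0.
have [N1 h1] := smallE _ e4.
have [N2 h2] := um _ te8.
pose i := maxn N1 N2.
have a1 := h1 i (leq_maxl _ _).
have a2 := h2 i (leq_maxr _ _).
have Dd := ph_dif (uD i) Dm.
have e1 : b (dif (u i) m) (dif (u i) m) = b (u i) (u i) + b m m - 2 * b (u i) m.
 by rewrite /dif ph_exp // (ph_sym H Dm) //; ring.
have e2 : b m (dif (u i) m) = b (u i) m - b m m.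
 by rewrite /dif ph_linr // (ph_sym H Dm) //; ring.
have e3 : l (dif (u i) m) = l (u i) - l m by rewrite /dif llin //; ring.
have b1 := ph_amgm t0 Dm Dd.
have b2 := ph_bdd_amgm t0 K_ge0 (lK _ Dd) Dd.
have b3 : t^-1 * dist2 (u i) m < e / 8.
 rewrite mulrC ltr_pdivrMr //; lra.
have b4 := ler_norm (- b m (dif (u i) m)); rewrite normrN in b4.
have b5 := ler_norm (l (dif (u i) m)).
have b6 := ph_ge0 H Dd.
rewrite /dist2 in b3 a2.
rewrite /J in a1 *.
lra.
Qed.

(** The minimiser of b z z - 2 l z on [N]; its first variation in every direction of [N]
    vanishes. *)
Theorem riesz (N : set E) (l : E -> R) :
 N `<=` D -> N !=set0 -> (forall a x y, N x -> N y -> N (lin a x y)) ->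
 clsd2 N -> bdd_linear l ->
 exists2 u, N u & forall z, N z -> b u z = l z.
move=> ND N0 Nlin Ncl lb.
have [|u Nu umin] := convex_min ND N0 _ Ncl lb.
 by move=> x y Nx Ny; do 2 apply: (Nlin) => //.
exists u => // z Nz; have [llin _] := lb.
have Du := ND _ Nu; have Dz := ND _ Nz.
have P t : 0 <= t ^+ 2 * b z z + 2 * t * (b u z - l z).
 have := umin _ (Nlin t _ _ Nz Nu). rewrite ph_exp // llin // (ph_sym H Dz) //; lra.
apply/eqP; rewrite -subr_eq0; apply/eqP; set c := b u z - l z in P *.
have z0 := ph_ge0 H Dz.
(* The summand 1 keeps the denominator positive when b z z = 0. *)
have := P (- c / (b z z + 1)).
have -> : (- c / (b z z + 1)) ^+ 2 * b z z + 2 * (- c / (b z z + 1)) * c =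
 - (c ^+ 2 * ((b z z + 2) / (b z z + 1) ^+ 2)).
 by field; lra.
rewrite oppr_ge0 pmulr_lle0; last by rewrite divr_gt0 ?exprn_gt0 //; lra.
by move=> h; apply/eqP; rewrite -sqrf_eq0 eq_le h sqr_ge0.
Qed.

Theorem orth_proj (N : set E) (x : E) :
 N `<=` D -> N !=set0 -> (forall a x y, N x -> N y -> N (lin a x y)) ->
 clsd2 N -> D x -> exists2 p, N p & forall z, N z -> b (dif x p) z = 0.
move=> ND N0 Nlin Ncl Dx.
have [|p Np pP] := riesz (l := b x) ND N0 Nlin Ncl.
 split=> [a y z Dy Dz|]; first by rewrite ph_linr. by exists (b x x) => y Dy; apply: ph_CS.
by exists p => // z Nz; rewrite /dif ph_linl ?pP //; [ring|exact: ND..].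
Qed.

(* The elements of minimal norm of the sets [C k] form a Cauchy sequence. *)
Theorem nest_cvx (C : nat -> set E) (B : R) :
 (forall k, C k `<=` D) ->
 (forall k, C k.+1 `<=` C k) ->
 (forall k x y, C k x -> C k y -> C k (mid x y)) ->
 (forall k, clsd2 (C k)) ->
 (forall k, exists2 c, C k c & b c c <= B) ->
 exists m, forall k, C k m.
move=> CD Cdec Cmid Ccl CB.
have Cle i j : (i <= j)%N -> C j `<=` C i.
 move=> /subnK <-; elim: (j - i)%N => [|k IH]; first by rewrite add0n. by apply: subset_trans IH; exact: Cdec.
have mk k : exists m, C k m /\ forall c, C k c -> b m m <= b c c.
 have [c Cc _] := CB k. have [| |m Cm mm] := @convex_min (C k) (fun=> 0) (CD k) _ (Cmid k) (Ccl k) _.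
 - by exists c.
 - by split=> [*|]; [ring|exists 0 => x _; rewrite expr0n mul0r].
 - by exists m; split=> // d /mm; rewrite !mulr0 !subr0.
have [m mP] := choice mk.
have mC k : C k (m k) by case: (mP k).
have mD k : D (m k) by apply: (CD k).
have mmono i j : (i <= j)%N -> b (m i) (m i) <= b (m j) (m j).
 by move=> ij; have [_ h] := mP i; apply: h; apply: (Cle _ _ ij).
have mB k : b (m k) (m k) <= B.
 by have [c Cc cB] := CB k; have [_ h] := mP k; apply: le_trans cB; apply: h.
pose A := [set b (m k) (m k) | k in setT].
have supA : has_sup A.
 by split; [exists (b (m 0%N) (m 0%N)), 0%N|exists B => _ [k _ <-]].
have distm i j : (i <= j)%N ->
 dist2 (m i) (m j) <= 2 * (b (m j) (m j) - b (m i) (m i)).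
 move=> ij; have Cj : C i (m j) by apply: (Cle _ _ ij). have [_ h] := mP i.
 by have := h _ (Cmid _ _ _ (mC i) Cj); rewrite mid_exp //; lra.
have dsym x y : D x -> D y -> dist2 x y = dist2 y x.
 by move=> Dx Dy; rewrite /dist2 /dif !ph_exp // (ph_sym H Dx Dy); ring.
have [e e0|x Dx mx] := complete_D mD.
 have e2 : 0 < e / 2 by lra. have [_ [N _ <-] hN] := sup_adherent e2 supA. exists N => i j Ni Nj.
 wlog ij : i j Ni Nj / (i <= j)%N.
 move=> hw; case/orP: (leq_total i j) => ij; first exact: hw. by rewrite dsym //; apply: hw.
 apply: (le_lt_trans (distm _ _ ij)). have := mmono _ _ Ni.
 have : b (m j) (m j) <= sup A by apply: ub_le_sup; [case: supA|exists j]. by lra.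
exists x => k; apply: Ccl => // e e0; have [N hN] := mx e e0.
exists (m (maxn k N)); first exact: (Cle k _ (leq_maxl _ _)).
exact: hN (leq_maxr _ _).
Qed.
End prehilbert.

(** * Square integrable functions and real integrals on a measure space *)

Section square_integrable.
Context {d} {T : measurableType d} {R : realType}.
Variable m : {measure set T -> \bar R}.
Implicit Types f h : T -> R.
Definition sqi f : Prop :=
 measf setT f /\ (\int[m]_x (f x ^+ 2)%:E < +oo)%E.

Lemma intble_lin (a : R) f h : m.-integrable setT (EFin \o f) ->
 m.-integrable setT (EFin \o h) ->
 m.-integrable setT (EFin \o (fun x => a * f x + h x)).
move=> fi hi; have := integrableD measurableT (integrableZl measurableT a fi) hi.
by apply: eq_integrable => // x _ /=.
Qed.

Lemma RiL (a : R) f h : m.-integrable setT (EFin \o f) ->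
 m.-integrable setT (EFin \o h) ->
 \int[m]_x (a * f x + h x) = a * (\int[m]_x f x) + \int[m]_x h x.
move=> fi hi; rewrite RintegralD //; last first.
 have := integrableZl measurableT a fi. by apply: eq_integrable => // x _ /=.
by rewrite RintegralZl.
Qed.

Lemma ae_le_intble f h : measf setT f ->
 (forall x, `|f x| <= h x) -> m.-integrable setT (EFin \o h) ->
 m.-integrable setT (EFin \o f).
move=> mf fh hi; apply: le_integrable hi => //.
 exact/mEFinP.
by move=> x _ /=; rewrite lee_fin; apply: le_trans (fh x) (ler_norm _).
Qed.

Lemma sqi_sqr f : sqi f -> m.-integrable setT (EFin \o (fun x => f x ^+ 2)).
move=> [mf fi]; apply/integrableP; split.
 by apply/mEFinP; exact: mfX.
rewrite (eqint (fun x => (f x ^+ 2)%:E)) // => x _ /=.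
by rewrite ger0_norm // sqr_ge0.
Qed.

Lemma intble_sqint f : measf setT f ->
 m.-integrable setT (EFin \o (fun x => f x ^+ 2)) -> sqi f.
move=> mf /integrableP[_ fi]; split=> //; apply: le_lt_trans fi.
apply: ge0_le_integral => //.
- by move=> x _; rewrite lee_fin sqr_ge0.
- by apply/mEFinP; exact: mfX.
- by apply: mfT_comp => //; apply/mEFinP; exact: mfX.
- by move=> x _ /=; rewrite lee_fin ler_norm.
Qed.

Lemma sqiM f h : sqi f -> sqi h ->
 m.-integrable setT (EFin \o (fun x => f x * h x)).
move=> sf sh; have [mf _] := sf; have [mh _] := sh.
apply: (@ae_le_intble _ (fun x => 1 * f x ^+ 2 + h x ^+ 2)).
- exact: mfM.
- move=> x; rewrite normrM -(real_normK (num_real (f x))) -(real_normK (num_real (h x))).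
 have := sqr_ge0 (`|f x| - `|h x|); have := normr_ge0 (f x); have := normr_ge0 (h x). nra.
- by apply: intble_lin; exact: sqi_sqr.
Qed.

Lemma sqi_lin (a : R) f h : sqi f -> sqi h -> sqi (fun x => a * f x + h x).
move=> sf sh; have [mf _] := sf; have [mh _] := sh.
have mlin : measf setT (fun x => a * f x + h x).
 by apply: measurable_funD => //; exact: mfM.
apply: intble_sqint => //.
apply: (@ae_le_intble _ (fun x => (2 * a ^+ 2) * f x ^+ 2 + (1 * h x ^+ 2 + h x ^+ 2))).
- exact: mfX.
- move=> x; rewrite ger0_norm ?sqr_ge0 //. have := sqr_ge0 (a * f x - h x); nra.
- apply: intble_lin; first exact: sqi_sqr. by apply: intble_lin; exact: sqi_sqr.
Qed.

Lemma sqi_dom (C : R) f h : measf setT f -> sqi h ->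
 (forall x, `|f x| <= C * `|h x|) -> sqi f.
move=> mf sh fh; apply: intble_sqint => //.
apply: (@ae_le_intble _ (fun x => (C ^+ 2) * h x ^+ 2 + 0)).
- exact: mfX.
- move=> x; rewrite addr0 -[h x ^+ 2](real_normK (num_real (h x))) normrX -exprMn.
 by apply: lerXn2r => //; rewrite nnegrE //; apply: le_trans (fh x).
- apply: intble_lin; first exact: sqi_sqr. exact: integrable0.
Qed.

Lemma sqi_ext f h : f =1 h -> sqi f -> sqi h.
by move=> /funext ->. Qed.

Lemma sqi_norm f : sqi f -> sqi (fun x => `|f x|).
move=> sf; have [mf _] := sf; apply: (@sqi_dom 1 _ f) => //.
 exact: mfT_comp.
by move=> x; rewrite normr_id mul1r.
Qed.

Lemma Rint_sqr_eq0 f : sqi f -> \int[m]_x (f x ^+ 2) = 0 ->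
 {ae m, forall x, f x = 0}.
move=> sf f0; have [mf _] := sf; have fi := sqi_sqr sf.
have E : (\int[m]_x `|(f x ^+ 2)%:E| = 0)%E.
 transitivity (\int[m]_x (f x ^+ 2)%:E)%E.
 by apply: eqint => x _ /=; rewrite ger0_norm // sqr_ge0.
 by rewrite -(fineK (integrable_fin_num measurableT fi)) -[fine _]/(\int[m]_x (f x ^+ 2)) f0.
have /ae_eq_integral_abs := E.
have mf2 : measf setT (fun x => (f x ^+ 2)%:E).
 by apply/mEFinP; exact: mfX.
move=> /(_ measurableT mf2) h.
apply: filterS h => x /(_ I) [] /eqP; rewrite sqrf_eq0 => /eqP.
by [].
Qed.

Lemma ae_eq_Rint f h : measf setT f -> measf setT h ->
 {ae m, forall x, f x = h x} -> \int[m]_x f x = \int[m]_x h x.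
move=> mf mh fh; congr fine; apply: ae_eq_integral => //.
- exact/mEFinP.
- exact/mEFinP.
- by apply: filterS fh => x /= ->.
Qed.

Lemma ae_Rint_ge0 f : measf setT f -> {ae m, forall x, 0 <= f x} ->
 0 <= \int[m]_x f x.
move=> mf f0; rewrite (@ae_eq_Rint _ (fun x => `|f x|)) //.
- by apply: Rintegral_ge0 => x _.
- exact: mfT_comp.
- by apply: filterS f0 => x fx; rewrite ger0_norm.
Qed.

Lemma ae_Rint_le f h : m.-integrable setT (EFin \o f) ->
 m.-integrable setT (EFin \o h) -> {ae m, forall x, f x <= h x} ->
 \int[m]_x f x <= \int[m]_x h x.
move=> fi hi fh; rewrite -subr_ge0.
have -> : \int[m]_x h x - \int[m]_x f x = \int[m]_x ((-1) * f x + h x).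
 by rewrite RiL //; ring.
apply: ae_Rint_ge0.
 by have /integrableP [] := intble_lin (-1) fi hi => /mEFinP.
by apply: filterS fh => x; lra.
Qed.

Lemma le_Rint_fin f (B : R) : measf setT f -> (forall x, 0 <= f x) ->
 (\int[m]_x (f x)%:E <= B%:E)%E ->
 m.-integrable setT (EFin \o f) /\ \int[m]_x f x <= B.
move=> mf f0 fB; have fi : m.-integrable setT (EFin \o f).
 apply/integrableP; split; first exact/mEFinP.
 rewrite (eqint (fun x => (f x)%:E)); first exact: le_lt_trans fB (ltry _).
 by move=> x _ /=; rewrite ger0_norm.
split=> //; rewrite -lee_fin; apply: le_trans fB.
by rewrite fineK //; exact: integrable_fin_num.
Qed.

Lemma int_Rint f : m.-integrable setT (EFin \o f) ->
 (\int[m]_x (f x)%:E = (\int[m]_x f x)%:E)%E.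
by move=> fi; rewrite fineK //; exact: integrable_fin_num. Qed.

Lemma ae1 (P Q : T -> Prop) : (forall x, P x -> Q x) ->
 {ae m, forall x, P x} -> {ae m, forall x, Q x}.
by move=> PQ; apply: filterS. Qed.

Lemma ae2 (P P' Q : T -> Prop) : (forall x, P x -> P' x -> Q x) ->
 {ae m, forall x, P x} -> {ae m, forall x, P' x} -> {ae m, forall x, Q x}.
by move=> PQ; apply: filterS2. Qed.

Lemma ae_imp3 (P P' P'' Q : T -> Prop) : (forall x, P x -> P' x -> P'' x -> Q x) ->
 {ae m, forall x, P x} -> {ae m, forall x, P' x} -> {ae m, forall x, P'' x} ->
 {ae m, forall x, Q x}.
by move=> PQ; apply: filterS3. Qed.

Lemma aeT (P : T -> Prop) : (forall x, P x) -> {ae m, forall x, P x}.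
by move=> Px; apply: nearW. Qed.

Lemma ae_all_nat (P : nat -> T -> Prop) : (forall k, {ae m, forall x, P k x}) ->
 {ae m, forall x, forall k, P k x}.
move=> h; have h' k : m.-negligible (~` [set x | P k x]) by exact: h.
apply: negligibleS (negligible_bigcup h') => x /= /existsNP[k Pk].
by exists k.
Qed.
End square_integrable.

Lemma cvg_of_geomet_step (R : realType) (u : nat -> R) (C : R) :
 (forall j, `|u j.+1 - u j| <= C * 2^-1 ^+ j) -> cvgn u.
move=> hu; rewrite (_ : u = (fun k => u 0%N + series (telescope u) k)); last first.
 by apply/funext => k; rewrite -eq_sum_telescope.
apply: is_cvgD; first exact: is_cvg_cst.
apply: normed_cvg; apply: (@series_le_cvg _ _ (geometric C 2^-1)).
- by move=> j; exact: normr_ge0.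
- move=> j; rewrite /geometric /=; apply: mulr_ge0.
 by have := le_trans (normr_ge0 _) (hu 0%N); rewrite expr0 mulr1.
 by apply: exprn_ge0; rewrite invr_ge0.
- by move=> j; exact: hu.
- apply: is_cvg_geometric_series; rewrite ger0_norm ?invr_ge0 //; lra.
Qed.

Section dens_measure.
Context {d} {T : measurableType d} {R : realType}.
Variables (m : {measure set T -> \bar R}) (f : T -> \bar R).
Hypotheses (mf : measf setT f) (f0 : forall x, (0 <= f x)%E).

(** The proofs are arguments so that a measure structure can be attached to the term; uniqueness of
    measures will be applied to two such measures. *)
Definition dens_measure of measf setT f & (forall x, (0 <= f x)%E) :=
 fun A : set T => (\int[m]_(x in A) f x)%E.

Let dens := dens_measure mf f0.

Let dens0 : dens set0 = 0%E. Proof. exact: integral_set0. Qed.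

Let dens_ge0 A : (0 <= dens A)%E. Proof. exact: integral_ge0. Qed.

Let dens_sigma : semi_sigma_additive dens.
exact: semi_sigma_additive_nng_induced. Qed.

HB.instance Definition _ := isMeasure.Build d T R dens dens0 dens_ge0 dens_sigma.
End dens_measure.

(** * Completeness of L^2, closed subspaces, vanishing almost everywhere *)

Section riesz_fischer.
Context {d} {T : measurableType d} {R : realType}.
Variable m : {measure set T -> \bar R}.
Implicit Types f h : T -> R.
(** The sum of 4^j F_j^2 has a finite integral, hence is finite off a null set, where it dominates
    every (2^j F_j)^2. *)
Lemma fast_decay (F : nat -> T -> R) :
 (forall j, measf setT (F j)) ->
 (forall j, \int[m]_x (F j x ^+ 2)%:E <= ((8^-1) ^+ j)%:E)%E ->
 exists E : set T, [/\ measurable E, m (~` E) = 0%E &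
 forall x, E x -> exists C : R, forall j, `|F j x| <= C * 2^-1 ^+ j].
move=> mF hF.
pose G j x : \bar R := (4 ^+ j * F j x ^+ 2)%:E.
have G0 j x : (0 <= G j x)%E by rewrite lee_fin mulr_ge0 ?sqr_ge0 // exprn_ge0.
have mG j : measf setT (G j).
 by apply/mEFinP; apply: mfM => //; exact: mfX.
pose S x : \bar R := (\sum_(0 <= j <oo) G j x)%E.
have mS : measf setT S by apply: ge0_emeasurable_sum.
have S0 x : (0 <= S x)%E by apply: nneseries_ge0.
have iS : (\int[m]_x S x < +oo)%E.
 rewrite integral_nneseries //.
 apply: (@le_lt_trans _ _ (\sum_(0 <= j <oo) ((2 : R) / (2 ^ (j + 0).+1)%:R)%:E)%E); last first.
 have := @epsilon_trick R (fun=> 0%E) 2 xpredT (fun=> lexx _) (ler0n _ 2). under eq_eseriesr do rewrite add0e.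
 rewrite [X in (_ <= X + _)%E]eseries0 // add0e. under [X in _ -> (X < _)%E]eq_eseriesr do rewrite addn0.
 by move=> h; exact: le_lt_trans h (ltry _).
 apply: lee_nneseries => [j _ _|j _]; first by apply: integral_ge0 => x _; exact: G0.
 rewrite /G; under eqint do rewrite EFinM. rewrite ge0_integralZl_EFin //; first last.
 - by apply/mEFinP; exact: mfX.
 - by move=> x _; rewrite lee_fin sqr_ge0.
 apply: (@le_trans _ _ ((4 ^+ j)%:E * (8^-1 ^+ j)%:E)%E).
 by apply: lee_wpmul2l => //; rewrite lee_fin exprn_ge0.
 rewrite -EFinM lee_fin -exprMn addn0 expnS natrM invfM mulrA divff // mul1r.
 by rewrite natrX -exprVn; have -> : 4 * 8^-1 = 2^-1 :> R by lra.
pose E := setT `&` [set x | (S x < +oo)%E].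
have mE : measurable E by apply: measurable_lte.
exists E; split=> //.
- have iS' : m.-integrable setT S.
 apply/integrableP; split => //. by rewrite (eqint S) // => x _; rewrite gee0_abs.
 have [N [mN N0 EN]] := integrable_ae measurableT iS'.
 apply/eqP; rewrite eq_le measure_ge0 andbT -N0; apply: le_measure.
 + by rewrite inE; exact: measurableC.
 + by rewrite inE.
 apply: subset_trans EN => x Ex /= h; apply: Ex; split=> //=. by rewrite -ge0_fin_numE // h.
(* The inequality s <= (1 + s)^2 stands in for a square root of the sum. *)
- move=> x [_ /= Sx]; have Sf : S x \is a fin_num by rewrite ge0_fin_numE. exists (1 + fine (S x)) => j.
 have h : (G j x <= S x)%E.
 apply: le_trans (@nneseries_lim_ge _ (G^~ x) xpredT 0 j.+1 _) => //.
 by rewrite big_nat_recr //= leeDr // sume_ge0.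
 rewrite -[S x]fineK // lee_fin in h. have s0 : 0 <= fine (S x) by exact: fine_ge0.
 have h2 : `|2 ^+ j * F j x| ^+ 2 <= (1 + fine (S x)) ^+ 2.
 rewrite real_normK ?num_real // exprMn -exprM mulnC exprM. have -> : 2 ^+ 2 = 4 :> R by lra.
 by apply: le_trans h _; nra.
 rewrite ler_pXn2r // in h2; last by rewrite nnegrE addr_ge0. rewrite normrM ger0_norm ?exprn_ge0 // in h2.
 by rewrite exprVn ler_pdivlMr ?exprn_gt0 // mulrC.
Qed.

(** The bound holds only eventually, so Fatou's lemma is applied to a shifted sequence. *)
Lemma fatou_bd (g : nat -> T -> R) (g' : T -> R) (E : set T) (B : R) :
 (forall j, measf setT (g j)) -> measf setT g' ->
 (forall j x, 0 <= g j x) -> (forall x, 0 <= g' x) ->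
 measurable E -> m (~` E) = 0%E ->
 (forall x, E x -> g j x @[j --> \oo] --> g' x) ->
 (exists J, forall j, (J <= j)%N -> (\int[m]_x (g j x)%:E <= B%:E)%E) ->
 (\int[m]_x (g' x)%:E <= B%:E)%E.
move=> mg mg' g0 g'0 mE E0 gg' [J gB].
have mg2 j : measf setT (fun x => (g (J + j)%N x)%:E) by exact/mEFinP.
have g02 j x : setT x -> (0 <= (g (J + j)%N x)%:E)%E by rewrite lee_fin.
have := fatou m measurableT mg2 g02.
have -> : (\int[m]_x limn_einf (fun j => (g (J + j)%N x)%:E) = \int[m]_x (g' x)%:E)%E.
 apply: ae_eq_integral => //.
 - rewrite /limn_einf; apply: mfT_comp => //.
 apply: measurable_fun_limn_esup => j; apply: mfT_comp => //; exact: mg2.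
 - exact/mEFinP.
 - exists (~` E); split; [exact: measurableC|exact: E0|] => x h Ex; apply: h => _.
 suff gl : (g (J + j)%N x)%:E @[j --> \oo] --> (g' x)%:E.
 by have [-> _] := cvg_limn_einf_sup gl.
 apply: cvg_EFin; first by apply: nearW. have := gg' x Ex; rewrite -(@cvg_shiftn J) => h'.
 by apply: cvg_trans h'; apply: near_eq_cvg; apply: nearW => k /=; rewrite addnC.
move=> h; apply: le_trans h _.
rewrite limn_einf_lim; apply: lime_le => //.
 exact: is_cvg_einfs.
apply: nearW => k; apply: (@le_trans _ _ (\int[m]_x (g (J + k)%N x)%:E)%E).
 by apply: ereal_inf_lbound; exists k => /=.
by apply: gB; exact: leq_addr.
Qed.

Lemma fast_subseq (E : Type) (lin : R -> E -> E -> E) (b : E -> E -> R)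
 (u : nat -> E) : cauchy2 lin b u ->
 exists2 k : nat -> nat, forall j, (j <= k j)%N &
 forall j, dist2 lin b (u (k j.+1)) (u (k j)) <= 8^-1 ^+ j.
move=> cu.
have e0 j : 0 < (8^-1 : R) ^+ j by rewrite exprn_gt0 // invr_gt0.
have /choice[N hN] : forall j, exists N, forall i k, (N <= i)%N -> (N <= k)%N ->
 dist2 lin b (u i) (u k) < 8^-1 ^+ j by move=> j; exact: (cu _ (e0 j)).
pose k := fix k j := if j is i.+1 then maxn (k i).+1 (N i.+1) else N 0%N.
have kN j : (N j <= k j)%N by case: j => //= j; rewrite leq_maxr.
have kS j : (k j < k j.+1)%N by rewrite /= leq_maxl.
exists k => [j|j]; last first.
 by apply/ltW/hN => //; exact: leq_trans (kN j) (ltnW (kS j)).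
by elim: j => [//|j IH]; exact: leq_ltn_trans IH (kS j).
Qed.

Definition linf_ (a : R) (f h : T -> R) : T -> R := fun x => a * f x + h x.

Definition sqi_scal (f h : T -> R) : R := \int[m]_x (f x * h x).

Lemma sqi_prehilbert : prehilbert linf_ (sqi m) sqi_scal.
split=> [a f h sf sh|a f h z sf sh sz|f h sf sh|f sf].
- exact: sqi_lin.
- rewrite /sqi_scal -RiL; [|exact: sqiM..]. by apply: eqRint => x _; rewrite /linf_; ring.
- by apply: eqRint => x _; exact: mulrC.
- by apply: Rintegral_ge0 => x _; exact: sqr_ge0.
Qed.

Lemma sqi_dist2 f h : dist2 linf_ sqi_scal f h = \int[m]_x ((f x - h x) ^+ 2).
by apply: eqRint => x _; rewrite /dif /linf_ mulN1r addrC expr2.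
Qed.

Lemma sqi_dif f h : sqi m f -> sqi m h -> sqi m (fun x => f x - h x).
move=> sf sh; apply: sqi_ext (sqi_lin (-1) sh sf) => x; ring.
Qed.

(** Riesz-Fischer: a subsequence with geometrically small increments converges off a null set, and
    Fatou's lemma bounds the distance of the whole sequence to the limit. The limit is set to 0 on
    the null set, which keeps it measurable. *)
Lemma sqi_compl : compl2 linf_ (sqi m) sqi_scal.
move=> u su cu; have [k kj hk] := fast_subseq cu.
have mu j : measf setT (u j) by have [] := su j.
have sd i j : sqi m (fun x => u i x - u j x) by exact: sqi_dif.
have dE i j : (\int[m]_x ((u i x - u j x) ^+ 2)%:E = (dist2 linf_ sqi_scal (u i) (u j))%:E)%E.
 by rewrite sqi_dist2 int_Rint //; exact: (sqi_sqr (sd i j)).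
have [||E [mE E0 hE]] := @fast_decay (fun j x => u (k j.+1) x - u (k j) x).
- by move=> j; exact: mfB.
- by move=> j; rewrite dE lee_fin.
pose v x := \1_E x * limn (fun j => \1_E x * u (k j) x).
have vE x : E x -> u (k j) x @[j --> \oo] --> v x.
 move=> Ex; have [C hC] := hE x Ex. rewrite /v !indicE mem_set // mul1r.
 have -> : (fun j => true%:R * u (k j) x) = (fun j => u (k j) x).
 by apply/funext => j; rewrite mul1r.
 exact: cvg_of_geomet_step hC.
have m1 : measf setT (\1_E : T -> R) by exact: mindic.
have mv : measf setT v.
 apply: mfM => //. apply: (@measurable_fun_cvg _ _ _ setT (fun j x => \1_E x * u (k j) x)).
 by move=> j; exact: mfM.
 move=> x _; case: (asboolP (E x)) => Ex.
 have := vE x Ex; rewrite /v !indicE mem_set // mul1r.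
 have -> : (fun j => true%:R * u (k j) x) = (fun j => u (k j) x).
 by apply/funext => j; rewrite mul1r.
 by [].
 rewrite indicE memNset //; under eq_fun do rewrite mul0r. by rewrite lim_cst //; exact: cvg_cst.
have bound (e : R) : 0 < e -> exists N, forall i, (N <= i)%N ->
 (\int[m]_x ((v x - u i x) ^+ 2)%:E <= e%:E)%E.
 move=> e0; have [N hN] := cu e e0; exists N => i Ni.
 apply: (@fatou_bd (fun j x => (u (k j) x - u i x) ^+ 2) _ E) => //.
 - by move=> j; apply: mfX; exact: mfB.
 - by apply: mfX; exact: mfB.
 - by move=> j x; exact: sqr_ge0.
 - by move=> x; exact: sqr_ge0.
 - move=> x Ex; rewrite expr2; under eq_fun do rewrite expr2.
 by apply: cvgM; (apply: cvgB; [exact: vE|exact: cvg_cst]).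
 - exists N => j Nj; rewrite dE lee_fin; apply/ltW/hN => //. exact: leq_trans (kj j).
have sv : sqi m v.
 have [N hN] := bound 1 ltr01. have h : sqi m (fun x => v x - u N x).
 split; first exact: mfB. exact: le_lt_trans (hN N (leqnn N)) (ltry _).
 apply: sqi_ext (sqi_lin 1 h (su N)) => x; ring.
exists v => // e e0; have e2 : 0 < e / 2 by lra.
have [N hN] := bound _ e2; exists N => i Ni.
have := hN i Ni; rewrite int_Rint; last exact: (sqi_sqr (sqi_dif sv (su i))).
rewrite lee_fin sqi_dist2 => h; apply: le_lt_trans (_ : e / 2 < e); last by lra.
by apply: le_trans h; rewrite le_eqVlt; apply/orP; left; apply/eqP; apply: eqRint => x _; ring.
Qed.

(* A closed subspace of L^2 without a nonzero orthogonal vector is everything. *)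
Lemma sqi_dens (N : set (T -> R)) :
 N `<=` sqi m -> N (fun=> 0) ->
 (forall a f h, N f -> N h -> N (fun x => a * f x + h x)) ->
 (forall f, sqi m f -> (forall e : R, 0 < e -> exists2 h, N h &
 \int[m]_x ((h x - f x) ^+ 2) < e) -> N f) ->
 (forall h, sqi m h -> (forall z, N z -> \int[m]_x (h x * z x) = 0) ->
 {ae m, forall x, h x = 0}) ->
 forall f, sqi m f -> N f.
move=> Ns N0 Nlin Ncl Nperp f sf.
have [||||p Np hp] := @orth_proj _ _ _ _ _ sqi_prehilbert sqi_compl N f Ns.
- by exists (fun=> 0).
- exact: Nlin.
- move=> x sx h; apply: Ncl => // e e0; have [c Nc hc] := h e e0. by exists c => //; rewrite -sqi_dist2.
- exact: sf.
have sp := Ns _ Np.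
have h0 := Nperp _ (ph_dif sqi_prehilbert sf sp) hp.
apply: Ncl => // e e0; exists p => //.
rewrite (@ae_eq_Rint _ _ _ m _ (fun=> 0)); first by rewrite /Rintegral integral0.
- by apply: mfX; apply: mfB; [have [] := sp|have [] := sf].
- exact: measurable_cst.
- apply: filterS h0 => x; rewrite /dif /linf_ => hx. have -> : p x - f x = - (-1 * p x + f x) by ring.
 by rewrite hx oppr0 expr0n.
Qed.

(* The positive and negative parts of h have the same integrals over a pi-system
 that generates the measurable sets, hence over {h > 0} and {h < 0}. *)
Lemma ae_zero_pi (G : set (set T)) (F : nat -> set T) h :
 measurable = <<s G >> -> setI_closed G -> (forall k, G (F k)) ->
 \bigcup_k F k = setT -> measf setT h ->
 (forall A, G A -> m.-integrable A (EFin \o h)) ->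
 (forall A, G A -> (\int[m]_(x in A) (h x)%:E = 0)%E) ->
 {ae m, forall x, h x = 0}.
move=> mG GI GF FT mh hi h0.
have GM A : G A -> measurable A by rewrite mG => GA; exact: sub_sigma_algebra.
pose hp x : \bar R := (Num.max (h x) 0)%:E; pose hn x : \bar R := (Num.max (- h x) 0)%:E.
have mhp : measf setT hp.
 by apply/mEFinP; exact: measurable_funrpos.
have mhn : measf setT hn.
 by apply/mEFinP; exact: measurable_funrneg.
have hp0 x : (0 <= hp x)%E by rewrite lee_fin le_max lexx orbT.
have hn0 x : (0 <= hn x)%E by rewrite lee_fin le_max lexx orbT.
have hpn : (EFin \o h)^\+%E = hp.
 by apply/funext => x; rewrite funeposE /= /hp -EFin_max.
have hnn : (EFin \o h)^\-%E = hn.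
 by apply/funext => x; rewrite funenegE /= /hn -EFin_max.
have eqG A : G A -> (\int[m]_(x in A) hp x = \int[m]_(x in A) hn x)%E.
 move=> GA; have := h0 A GA; rewrite integralE.
 have iA := hi A GA; have h1 := integral_fune_fin_num (GM _ GA) (integrable_funepos (GM _ GA) iA).
 have h2 := integral_fune_fin_num (GM _ GA) (integrable_funeneg (GM _ GA) iA).
 rewrite hpn in h1 *; rewrite hnn in h2 *.
 by move=> /(f_equal fine); rewrite -(fineK h1) -(fineK h2) /= => /eqP; rewrite subr_eq0 => /eqP ->.
have eqM := @measure_unique _ _ _ G F mG GI GF FT (dens_measure m mhp hp0)
 (dens_measure m mhn hn0) eqG _.
have {}eqM A : measurable A -> (\int[m]_(x in A) hp x = \int[m]_(x in A) hn x)%E.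
 apply: eqM => k; rewrite ltey_eq; apply/orP; left. have GFk := GF k; have := integral_fune_fin_num (GM _ GFk)
 (integrable_funepos (GM _ GFk) (hi _ GFk)).
 by rewrite hpn.
have zero (u v : T -> \bar R) : measf setT u -> measf setT v ->
 (forall x, 0 <= u x)%E -> (forall x, 0 < u x -> v x = 0)%E ->
 (forall A, measurable A -> (\int[m]_(x in A) u x = \int[m]_(x in A) v x)%E) ->
 {ae m, forall x, u x = 0}%E.
 move=> mu mv u0 uv e. have mA : measurable (setT `&` [set x | (0 < u x)%E]).
 by apply: measurable_lte => //; exact: measurable_cst.
 have : (\int[m]_x `|u x| = 0)%E.
 transitivity (\int[m]_(x in setT `&` [set x | (0 < u x)%E]) u x)%E.
 rewrite [RHS]integral_mkcond; apply: eqint => x _; rewrite patchE gee0_abs //.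
 case: ifPn => //; rewrite notin_setE /= => nx; apply/eqP; rewrite eq_le u0 andbT.
 by rewrite leNgt; apply/negP => ux; apply: nx.
 by rewrite e //; apply: integral0_eq => x [_ /= ux]; exact: uv.
 move/(ae_eq_integral_abs m measurableT mu); by apply: filterS => x /(_ I).
have hp_ae := zero hp hn mhp mhn hp0 _ eqM.
have hn_ae := zero hn hp mhn mhp hn0 _ (fun A mA => esym (eqM A mA)).
apply: filterS2 (hp_ae _) (hn_ae _) => [x|x|x].
- move=> /(f_equal fine) /= p0 /(f_equal fine) /= n0. have : h x <= 0 by rewrite -p0 le_max lexx.
 have : - h x <= 0 by rewrite -n0 le_max lexx. lra.
- rewrite /hp /hn lte_fin lt_max ltxx orbF => h0x; congr EFin. by apply: max_r; lra.
- rewrite /hp /hn lte_fin lt_max ltxx orbF => h0x; congr EFin. by apply: max_r; lra.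
Qed.
End riesz_fischer.

(** * Monotone real sequences and dominated convergence *)

Section real_sequences.
Variable R : realType.
Implicit Types (a b : nat -> R).
Lemma nondecreasing_le a (l : R) : (forall k, a k <= a k.+1) -> a k @[k --> \oo] --> l -> forall k, a k <= l.
move=> ha ca k; have nd : nondecreasing_seq a by apply/nondecreasing_seqP.
rewrite -(cvg_lim _ ca) //; apply: nondecreasing_cvgn_le => //.
by apply/cvg_ex; exists l.
Qed.

(** Translates the conservation identity between extended limits into convergence of real sums. The
    limits exist by monotonicity and neither is -oo, so the sum of the limits is the limit of the
    sums. *)
Lemma monotone_sum_limit a b : (forall k, a k <= a k.+1) -> (forall k, b k <= b k.+1) ->
 ((limn (fun k => (a k)%:E) + limn (fun k => (b k)%:E))%E = 1%:E) <-> (a k + b k @[k --> \oo] --> (1 : R)).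
move=> ha hb.
have mono (c : nat -> R) : (forall k, c k <= c k.+1) ->
 (c k)%:E @[k --> \oo] --> limn (fun k => (c k)%:E) /\ forall k, ((c k)%:E <= limn (fun k => (c k)%:E))%E.
 move=> hc; have nd : nondecreasing_seq (fun k => (c k)%:E) by apply/nondecreasing_seqP => k; rewrite lee_fin.
 have cv := ereal_nondecreasing_is_cvgn nd. split=> // k; rewrite (cvg_lim _ (ereal_nondecreasing_cvgn nd)) //.
 by apply: ereal_sup_ubound; exists k.
have [ca la] := mono a ha; have [cb lb] := mono b hb.
have an : limn (fun k => (a k)%:E) != -oo%E.
 by apply: contraTneq (la 0) => ->; rewrite leeNy_eq.
have bn : limn (fun k => (b k)%:E) != -oo%E.
 by apply: contraTneq (lb 0) => ->; rewrite leeNy_eq.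
have adef : (limn (fun k => (a k)%:E) +? limn (fun k => (b k)%:E))%E.
 by rewrite /adde_def !negb_and an bn !orbT.
have cs : (a k + b k)%:E @[k --> \oo] --> (limn (fun k => (a k)%:E) + limn (fun k => (b k)%:E))%E.
 have -> : (fun k => (a k + b k)%:E) = (fun k => ((a k)%:E + (b k)%:E)%E) by apply/funext => k; rewrite EFinD.
 exact: cvgeD.
split=> [e|h]; first by rewrite e in cs; exact: (fine_cvg cs).
apply: (cvg_unique _ cs) => //; apply: cvg_EFin; last exact: h.
by apply: nearW.
Qed.

(** Convergence in L^2 gives pointwise convergence only along a subsequence; monotonicity recovers
    the whole sequence. *)
Lemma nondecreasing_subseq_cvg a (phi : nat -> nat) (l : R) : (forall k, a k <= a k.+1) ->
 (forall k, (k <= phi k)%N) -> a (phi k) @[k --> \oo] --> l -> a k @[k --> \oo] --> l.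
move=> ha hphi ca; have nd : nondecreasing_seq a by apply/nondecreasing_seqP.
have le_l k : a k <= l.
 apply: (cvgr_to_ge ca); exists k => // i /= ki; apply: nd; exact: leq_trans ki (hphi i).
apply/cvgrPdist_lt => e e0; move/cvgrPdist_lt : ca => /(_ e e0)[N _ hN].
exists (phi N) => // k /= Nk; have := hN N (leqnn N); rewrite /= !ger0_norm ?subr_ge0 //.
by apply: le_lt_trans; rewrite lerB // nd.
Qed.

Lemma geomet_decay_cvg a (r C l : R) : 0 < r -> (forall k, `|(a k - l) * r| <= C * 2^-1 ^+ k) ->
 a k @[k --> \oo] --> l.
move=> r0 h; have c0 : C / r * 2^-1 ^+ k @[k --> \oo] --> (0 : R).
 have h2 : (2^-1 : R) ^+ k @[k --> \oo] --> (0 : R).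
 by apply: cvg_expr; rewrite ger0_norm ?invr_ge0 // invf_lt1 ?ltr1n.
 have h3 := cvgM (@cvg_cst _ (C / r) _ \oo _) h2; rewrite mulr0 in h3; exact: h3.
apply/cvgrPdist_lt => e e0; move/cvgrPdist_lt : c0 => /(_ e e0); apply: filterS => k.
rewrite sub0r normrN distrC => hk; apply: le_lt_trans hk; apply: le_trans (ler_norm _).
by have := h k; rewrite normrM (gtr0_norm r0) -ler_pdivlMr // mulrAC.
Qed.
End real_sequences.

Lemma Rint_dom_ae d (X : measurableType d) (R : realType) (m : {measure set X -> \bar R}) (D : set X)
 (F : nat -> X -> R) (f h : X -> R) : measurable D -> (forall k, measf D (F k)) ->
 measf D f -> m.-integrable D (EFin \o h) ->
 {ae m, forall x, D x -> F k x @[k --> \oo] --> f x} ->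
 {ae m, forall x, D x -> forall k, `|F k x| <= h x} ->
 \int[m]_(x in D) F k x @[k --> \oo] --> \int[m]_(x in D) f x.
move=> mD mF mf ih cF hF.
have m1 k : measf D (EFin \o F k) by exact/mEFinP.
have m2 : measf D (EFin \o f) by exact/mEFinP.
have [||i1 _ cv] := dominated_convergence mD m1 m2 _ ih _.
- by apply: ae1 cF => x h1 Dx; apply: cvg_EFin; [exact: nearW|exact: h1].
- by apply: ae1 hF => x h1 Dx k; rewrite /= lee_fin; exact: h1.
rewrite -(fineK (integrable_fin_num mD i1)) in cv.
exact: (fine_cvg cv).
Qed.

(** * Landau kernels in one variable *)

Section ld1.
Context {R : realType}.
Implicit Types (p : {poly R}) (j : nat) (a y s t : R).
(** A polynomial antiderivative turns integrals of the kernel into differences of values, to which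
    the mean value theorem applies. *)
Definition antid p : {poly R} := \poly_(i < (size p).+1) (p`_i.-1 / i%:R).

Lemma antidK p : (antid p)^`() = p.
apply/polyP => i; rewrite coef_deriv coef_poly ltnS /=.
case: ltnP => h; last by rewrite mul0rn nth_default.
by rewrite -(mulr_natr (_ / _)) divfK // pnatr_eq0.
Qed.

Definition ld_poly j : {poly R} := (1 - 'X^2) ^+ j.

Lemma ld_polyE j t : (ld_poly j).[t] = (1 - t ^+ 2) ^+ j.
by rewrite /ld_poly horner_exp !hornerE. Qed.

Local Notation A j := (antid (ld_poly j)).
Lemma ld_mvt j s t : s <= t -> exists2 c, s <= c <= t &
 (A j).[t] - (A j).[s] = (1 - c ^+ 2) ^+ j * (t - s).
move=> st.
have dA x : isD x (1 : R) (horner (A j)) (ld_poly j).[x].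
 by have := is_derive_poly (A j) x; rewrite antidK.
have cA : {within `[s, t], continuous (horner (A j))}.
 by apply: derivable_within_continuous => x _; have [] := dA x.
have [c cI ->] := MVT_segment st (fun x _ => dA x) cA.
by exists c => //; rewrite ld_polyE.
Qed.

Lemma sqr_le1 t : -1 <= t <= 1 -> 0 <= 1 - t ^+ 2.
by move=> /andP[t1 t2]; nra. Qed.

Lemma ld_poly01 j t : -1 <= t <= 1 -> 0 <= (1 - t ^+ 2) ^+ j <= 1.
move=> t1; have h := sqr_le1 t1; rewrite exprn_ge0 //=.
by apply: exprn_ile1 => //; have := sqr_ge0 t; lra.
Qed.

(** The integral of (1 - t^2)^j over [-1, 1]. *)
Definition ld_mass j : R := (A j).[1] - (A j).[-1].

(** The parts over [-1, -e] and [e, 1] are nonnegative, and the integrand is at least (1 - e^2)^j on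
    [-e, e]. *)
Lemma ld_mass_ge j (e : R) : 0 < e <= 1 ->
 2 * e * (1 - e ^+ 2) ^+ j <= ld_mass j.
move=> /andP[e0 e1].
have [c1 /andP[c1a c1b] h1] := @ld_mvt j (-1) (- e) ltac:(lra).
have [c2 /andP[c2a c2b] h2] := @ld_mvt j (- e) e ltac:(lra).
have [c3 /andP[c3a c3b] h3] := @ld_mvt j e 1 ltac:(lra).
have /andP[p1 _] := @ld_poly01 j c1 ltac:(lra).
have /andP[p3 _] := @ld_poly01 j c3 ltac:(lra).
have p2 : (1 - e ^+ 2) ^+ j <= (1 - c2 ^+ 2) ^+ j.
 by apply: lerXn2r; rewrite ?nnegrE; nra.
rewrite /ld_mass.
have -> : (A j).[1] - (A j).[-1] = ((A j).[1] - (A j).[e]) +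
 ((A j).[e] - (A j).[- e]) + ((A j).[- e] - (A j).[-1]) by ring.
rewrite h1 h2 h3.
have : 0 <= (1 - c1 ^+ 2) ^+ j * (- e - -1) by apply: mulr_ge0 => //; lra.
have : 0 <= (1 - c3 ^+ 2) ^+ j * (1 - e) by apply: mulr_ge0 => //; lra.
have : (1 - e ^+ 2) ^+ j * (e - - e) <= (1 - c2 ^+ 2) ^+ j * (e - - e).
 by apply: ler_wpM2r => //; lra.
by nra.
Qed.

Lemma ld_mass_gt0 j : 0 < ld_mass j.
apply: lt_le_trans (@ld_mass_ge j (2^-1) _); last by apply/andP; split; lra.
by apply: mulr_gt0; [lra|apply: exprn_gt0; lra].
Qed.

Definition landau j t : R := (ld_poly j).[t] / ld_mass j.

(** Distribution function of the normalised kernel on [-1, 1]. *)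
Definition ld_cdf j t : R := ((A j).[t] - (A j).[-1]) / ld_mass j.

Lemma ld_ge0 j t : -1 <= t <= 1 -> 0 <= landau j t.
move=> t1; rewrite /landau ld_polyE; apply: divr_ge0.
 by have /andP[] := ld_poly01 j t1.
exact: ltW (ld_mass_gt0 j).
Qed.

Lemma ld_le j t : -1 <= t <= 1 -> landau j t <= (ld_mass j)^-1.
move=> t1; rewrite /landau ld_polyE; apply: ler_piMl.
 by rewrite invr_ge0; exact: ltW (ld_mass_gt0 j).
by have /andP[] := ld_poly01 j t1.
Qed.

Lemma ld_even j t : landau j (- t) = landau j t.
by rewrite /landau !ld_polyE sqrrN. Qed.

Lemma is_der_landau_cdf j t : isD t (1 : R) (ld_cdf j) (landau j t).
have dA : isD t (1 : R) (horner (A j)) (ld_poly j).[t].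
 by have := is_derive_poly (A j) t; rewrite antidK.
have dB : isD t (1 : R) (fun x => (A j).[x] - (A j).[-1]) (ld_poly j).[t].
 have := @is_deriveB R _ _ (horner (A j)) (cst (A j).[-1]) t 1 _ _ dA (is_derive_cst _ _ _). by rewrite subr0.
have := is_der_mul dB (is_derive_cst (ld_mass j)^-1 t 1).
by rewrite mulr0 addr0.
Qed.

Lemma ld_cdf_mono j s t : -1 <= s -> s <= t -> t <= 1 ->
 ld_cdf j s <= ld_cdf j t.
move=> s1 st t1; rewrite /ld_cdf ler_pM2r ?invr_gt0 ?ld_mass_gt0 //.
rewrite lerD2r -subr_ge0; have [c /andP[sc ct] ->] := ld_mvt j st.
apply: mulr_ge0; last by rewrite subr_ge0.
by have /andP[] := @ld_poly01 j c ltac:(lra).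
Qed.

Lemma ld_cdfN1 j : ld_cdf j (-1) = 0.
by rewrite /ld_cdf subrr mul0r. Qed.

Lemma ld_cdf1 j : ld_cdf j 1 = 1.
by rewrite /ld_cdf divff // gt_eqF // ld_mass_gt0. Qed.

Lemma ld_cdf01 j t : -1 <= t <= 1 -> 0 <= ld_cdf j t <= 1.
move=> /andP[t1 t2]; apply/andP; split.
 by rewrite -(ld_cdfN1 j); apply: ld_cdf_mono; lra.
by rewrite -(ld_cdf1 j); apply: ld_cdf_mono; lra.
Qed.

(** The unnormalised tail is at most (1 - d^2)^j, while the mass is at least d (1 - (d/2)^2)^j by
    [ld_mass_ge] at d/2; the quotient of the bases is less than 1, so the bound decays
    geometrically. *)
Lemma ld_tail (d : R) j : 0 < d <= 1 ->
 1 - ld_cdf j d <= d^-1 * ((1 - d ^+ 2) / (1 - (d / 2) ^+ 2)) ^+ j /\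
 ld_cdf j (- d) <= d^-1 * ((1 - d ^+ 2) / (1 - (d / 2) ^+ 2)) ^+ j.
move=> /andP[d0 d1].
have m0 := ld_mass_gt0 j.
have mg := @ld_mass_ge j (d / 2) ltac:(lra).
have hh : 0 < 1 - (d / 2) ^+ 2 by nra.
have key (x : R) : x <= (1 - d ^+ 2) ^+ j ->
 x / ld_mass j <= d^-1 * ((1 - d ^+ 2) / (1 - (d / 2) ^+ 2)) ^+ j.
 move=> xj; rewrite expr_div_n ler_pdivrMr //; apply: (le_trans xj).
 have e1 : 0 <= (1 - d ^+ 2) ^+ j by apply: exprn_ge0; nra.
 have -> : d^-1 * ((1 - d ^+ 2) ^+ j / (1 - (d / 2) ^+ 2) ^+ j) * ld_mass j =
 (1 - d ^+ 2) ^+ j * (ld_mass j / (d * (1 - (d / 2) ^+ 2) ^+ j)). by field; rewrite !gt_eqF // exprn_gt0.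
 rewrite ler_peMr // ler_pdivlMr ?mul1r; last by rewrite mulr_gt0 // exprn_gt0.
 apply: le_trans mg; rewrite le_eqVlt; apply/orP; left; apply/eqP. by field.
have [c1 /andP[c1a c1b] h1] := @ld_mvt j (-1) (- d) ltac:(lra).
have [c3 /andP[c3a c3b] h3] := @ld_mvt j d 1 ltac:(lra).
have pw (c : R) : d <= c <= 1 -> (1 - c ^+ 2) ^+ j * (1 - d) <= (1 - d ^+ 2) ^+ j.
 move=> /andP[dc cc1]; have /andP[p1 p2] := @ld_poly01 j c ltac:(lra).
 apply: (@le_trans _ _ ((1 - c ^+ 2) ^+ j)); first by rewrite ler_piMr //; lra.
 by apply: lerXn2r; rewrite ?nnegrE; nra.
split.
 have -> : 1 - ld_cdf j d = ((A j).[1] - (A j).[d]) / ld_mass j.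
 rewrite /ld_cdf -{1}(divff (lt0r_neq0 m0)) -mulrBl; congr (_ * _). by rewrite /ld_mass; ring.
 by apply: key; rewrite h3; apply: pw; lra.
apply: key; rewrite h1.
have -> : - d - -1 = 1 - d by ring.
by rewrite -sqrrN; apply: pw; lra.
Qed.

Lemma ld_tail_small (d e : R) : 0 < d <= 1 -> 0 < e ->
 exists N, forall j, (N <= j)%N -> 1 - ld_cdf j d <= e /\ ld_cdf j (- d) <= e.
move=> d01 e0; have /andP[d0 d1] := d01.
pose r := (1 - d ^+ 2) / (1 - (d / 2) ^+ 2).
have hh : 0 < 1 - (d / 2) ^+ 2 by nra.
have r1 : `|r| < 1.
 by rewrite ger0_norm ?divr_ge0 //; [rewrite ltr_pdivrMr //; nra|nra|lra].
have cv : (fun j => d^-1 * r ^+ j) @ \oo --> d^-1 * 0.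
 by apply: cvgMr; exact: cvg_expr.
rewrite mulr0 in cv.
have /cvgrPdist_le /(_ e e0) [N _ NP] := cv.
exists N => j Nj; have := NP j Nj; rewrite sub0r normrN => h.
have [t1 t2] := ld_tail j d01.
have h' := le_trans (ler_norm _) h.
by split; [apply: le_trans t1 h'|apply: le_trans t2 h'].
Qed.

Lemma cont_landau j : continuous (landau j).
move=> t; apply: contMr; last exact: cont_cstr.
exact: continuous_horner.
Qed.

(** Unit length: two points of the interval differ by at most 1, the range in which the kernel is
    nonnegative. *)
Definition Itv a : set R := `[a - 2^-1, a + 2^-1].

Lemma in_Itv a t : Itv a t = (a - 2^-1 <= t <= a + 2^-1) :> Prop.
by rewrite /Itv /= in_itv. Qed.

(** Cutting off both variables yields a kernel that is nonnegative, symmetric and of mass at most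
    1. *)
Definition kap a j y s : R := \1_(Itv a) y * \1_(Itv a) s * landau j (y - s).

Lemma indic01 (T : Type) (B : set T) x : (\1_B x = 1 :> R /\ B x) \/ (\1_B x = 0 :> R /\ ~ B x).
rewrite /indic; case: (boolP (x \in B)); rewrite ?inE => h; first by left.
by right; split=> // /mem_set h'; rewrite h' in h.
Qed.

Lemma indicT (T : Type) (B : set T) x : B x -> \1_B x = 1 :> R.
by move=> Bx; rewrite /indic mem_set. Qed.

Lemma indicF (T : Type) (B : set T) x : ~ B x -> \1_B x = 0 :> R.
by move=> Bx; rewrite /indic memNset. Qed.

Lemma kap_bds a j y s : 0 <= kap a j y s <= (ld_mass j)^-1 * \1_(Itv a) s.
rewrite /kap.
case: (indic01 (Itv a) y) => -[-> Iy]; case: (indic01 (Itv a) s) => -[-> Is];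
 rewrite ?(mul1r, mul0r, mulr0, mulr1) ?lexx //=; last first. by rewrite invr_ge0; exact: ltW (ld_mass_gt0 j).
rewrite in_Itv in Iy; rewrite in_Itv in Is.
by apply/andP; split; [apply: ld_ge0; lra|apply: ld_le; lra].
Qed.

Lemma kap_sym a j y s : kap a j y s = kap a j s y.
by rewrite /kap -ld_even opprB [X in X * _]mulrC. Qed.

Lemma ms_Itv a : measurable (Itv a : set (mTR R)).
exact: measurable_itv. Qed.

Lemma ms_landau j : measf [set: mTR R] (landau j).
by apply: continuous_measurable_fun; exact: cont_landau. Qed.

Lemma ms_kap a j : measf [set: (mTR R * mTR R)%type]
 (fun p : R * R => kap a j p.1 p.2).
apply: mfM; first apply: mfM.
- apply: (mfT_comp _ measurable_fst). by apply: mindic; exact: ms_Itv.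
- apply: (mfT_comp _ measurable_snd). by apply: mindic; exact: ms_Itv.
- apply: (mfT_comp (ms_landau j)). exact: mfB.
Qed.

Lemma ms_kap2 a j y : measf [set: mTR R] (kap a j y).
exact: (mfT_comp (ms_kap a j) (pair1_measurable (y : mTR R))).
Qed.

Lemma int_landau_itv j y (l u : R) : l <= u ->
 (\int[lebm]_(s in `[l, u]) (landau j (y - s))%:E =
 (ld_cdf j (y - l) - ld_cdf j (y - u))%:E)%E.
rewrite le_eqVlt => /predU1P[->|lu].
 by rewrite set_itv1 integral_set1 subrr.
have df (t : R) : isD t (1 : R) (fun s => - ld_cdf j (y - s)) (landau j (y - t)).
 have h1 : isD t (1 : R) (fun s => y - s) (- 1).
 have := @is_deriveB R _ _ (cst y) id t 1 _ _ (is_derive_cst _ _ _) (is_derive_id _ _). by rewrite sub0r.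
 have h2 := @is_derive1_comp _ (ld_cdf j) (fun s => y - s) t _ _
 (is_der_landau_cdf j (y - t)) h1.
 have := is_deriveN h2; rewrite mulrN1 opprK; exact.
rewrite (int_der lu df); first by rewrite opprK addrC.
move=> t; apply: (@continuous_comp _ _ _ (fun s => y - s) (landau j)).
 by apply: continuousB; [exact: cvg_cst|exact: cvg_id].
exact: cont_landau.
Qed.

Definition kap_itv a j (l u : R) y : \bar R :=
 (\int[lebm]_s (kap a j y s * \1_(`[l, u]%classic : set R) s)%:E)%E.

Lemma kap_itvE a j l u y (l' := Num.max l (a - 2^-1)) (u' := Num.min u (a + 2^-1)) :
 kap_itv a j l u y =
 if (l' <= u') && `[< Itv a y >] then
 (ld_cdf j (y - l') - ld_cdf j (y - u'))%:E else 0%E.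
rewrite /kap_itv; case: asboolP => Iy; last first.
 rewrite andbF; apply: integral0_eq => s _. by rewrite /kap (indicF Iy) !mul0r.
rewrite andbT.
transitivity (\int[lebm]_(s in `[l', u']) (landau j (y - s))%:E)%E.
 rewrite [RHS]integral_mkcond; apply: eqint => s _; rewrite patchE. rewrite /kap (indicT Iy) mul1r.
 case: ifPn; rewrite ?inE ?notin_setE /= in_itv /= /l' /u' ge_max le_min => h.
 have [[h1 h2] [h3 h4]] : (l <= s /\ a - 2^-1 <= s) /\ (s <= u /\ s <= a + 2^-1).
 by move: h => /andP[/andP[? ?] /andP[? ?]].
 by rewrite !indicT ?mul1r ?mulr1 //= ?in_itv ?in_Itv /= ?h1 ?h2 ?h3 ?h4.
 case: (indic01 (Itv a) s) => -[-> Is]; last by rewrite !mul0r.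
 rewrite indicF ?mulr0 //= in_itv /=; move: h; rewrite in_Itv in Is. by move: Is => /andP[-> ->]; rewrite !andbT.
case: ifPn => [lu|]; first exact: int_landau_itv.
by rewrite -ltNge => ul; rewrite set_itv_ge ?integral_set0 // bnd_simp -ltNge.
Qed.

Lemma kap_itv01 a j l u y : (0 <= kap_itv a j l u y <= 1)%E.
rewrite kap_itvE; case: ifPn => [/andP[lu /asboolP]|_]; last by rewrite lexx lee01.
rewrite in_Itv => /andP[y1 y2].
set l' := Num.max _ _ in lu *; set u' := Num.min _ _ in lu *.
have hl : a - 2^-1 <= l' by rewrite le_max lexx orbT.
have hu : u' <= a + 2^-1 by rewrite ge_min lexx orbT.
have /andP[p1 p2] := @ld_cdf01 j (y - l') ltac:(lra).
have /andP[p3 p4] := @ld_cdf01 j (y - u') ltac:(lra).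
have p5 := @ld_cdf_mono j (y - u') (y - l') ltac:(lra) ltac:(lra) ltac:(lra).
by rewrite !lee_fin; lra.
Qed.

(** End points are excluded because the limit there can be 1/2. Elsewhere [ld_tail_small] applies to
    the distances from [y] to the end points. *)
Lemma kap_itv_cvg a l u y (e : R) : 0 < e ->
 y \notin [:: l; u; a - 2^-1; a + 2^-1] ->
 exists N, forall j, (N <= j)%N ->
 `|fine (kap_itv a j l u y) - \1_(Itv a) y * \1_(`[l, u]%classic : set R) y| <= e.
move=> e0; rewrite !inE !negb_or => /and4P[yl yu ya1 ya2].
have [Iy|Iy] := pselect (Itv a y); last first.
 exists 0%N => j _; rewrite kap_itvE; case: asboolP => //= _; rewrite andbF.
 by rewrite indicF // mul0r subrr normr0 ltW.
rewrite (indicT Iy) mul1r.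
set l' := Num.max l (a - 2^-1); set u' := Num.min u (a + 2^-1).
have Iy' := Iy; rewrite in_Itv in Iy'; have /andP[y1 y2] := Iy'.
have hl : a - 2^-1 <= l' by rewrite le_max lexx orbT.
have hu : u' <= a + 2^-1 by rewrite ge_min lexx orbT.
have yl' : y != l' by rewrite /l' maxEle; case: ifP.
have yu' : y != u' by rewrite /u' minEle; case: ifP.
have inE' : (`[l, u]%classic y) = (l' <= y <= u') :> Prop.
 by rewrite /= in_itv /= /l' /u' ge_max le_min y1 y2 !andbT.
case: (leP l' u') => [lu|ul]; last first.
 exists 0%N => j _; rewrite kap_itvE -/l' -/u' (leNgt l') ul /= sub0r normrN.
 rewrite indicF ?normr0 ?ltW // inE' => /andP[h1 h2]. by have := le_trans h1 h2; rewrite leNgt ul.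
have ee : forall j, fine (kap_itv a j l u y) = ld_cdf j (y - l') - ld_cdf j (y - u').
 by move=> j; rewrite kap_itvE -/l' -/u' lu; case: asboolP.
have [lty|] := ltP l' y; last rewrite le_eqVlt (negbTE yl') /= => ylt.
 have [yltu|] := ltP y u'; last rewrite le_eqVlt eq_sym (negbTE yu') /= => ult.
 have e2 : 0 < e / 2 by lra. have [N1 h1] := @ld_tail_small (y - l') (e / 2) ltac:(lra) e2.
 have [N2 h2] := @ld_tail_small (u' - y) (e / 2) ltac:(lra) e2.
 exists (maxn N1 N2) => j; rewrite geq_max => /andP[j1 j2]. rewrite ee indicT; last by rewrite inE'; lra.
 have [a1 _] := h1 j j1; have [_ a2] := h2 j j2; rewrite opprB in a2.
 have /andP[p1 p2] := @ld_cdf01 j (y - l') ltac:(lra).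
 have /andP[p3 p4] := @ld_cdf01 j (y - u') ltac:(lra). by rewrite ler_norml; lra.
 have [N1 h1] := @ld_tail_small (y - u') e ltac:(lra) e0.
 exists N1 => j j1; rewrite ee indicF; last by rewrite inE'; lra. have [a1 _] := h1 j j1.
 have /andP[p1 p2] := @ld_cdf01 j (y - l') ltac:(lra).
 have p5 := @ld_cdf_mono j (y - u') (y - l') ltac:(lra) ltac:(lra) ltac:(lra). by rewrite ler_norml; lra.
have [N1 h1] := @ld_tail_small (l' - y) e ltac:(lra) e0.
exists N1 => j j1; rewrite ee indicF; last by rewrite inE'; lra.
have [_ a1] := h1 j j1; rewrite opprB in a1.
have /andP[p1 p2] := @ld_cdf01 j (y - u') ltac:(lra).
have p5 := @ld_cdf_mono j (y - u') (y - l') ltac:(lra) ltac:(lra) ltac:(lra).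
by rewrite ler_norml; lra.
Qed.
End ld1.

(** * Averaging over a cube with the product kernel *)

Section ld_n.
Context {R : realType} {n : nat}.
Variable a : 'rV[R]_n.
Implicit Types (j : nat) (y s : 'rV[R]_n) (f g : 'rV[R]_n -> R).
Local Notation mu := (@leb R n).
Local Notation Q := (cube a (2^-1)).
Definition lker j y s : R := \prod_i kap (a 0 i) j (y 0 i) (s 0 i).

Lemma lker_ge0 j y s : 0 <= lker j y s.
by apply: prodr_ge0 => i _; have /andP[] := kap_bds (a 0 i) j (y 0 i) (s 0 i). Qed.

Lemma lker_sym j y s : lker j y s = lker j s y.
by apply: eq_bigr => i _; exact: kap_sym. Qed.

Lemma indic_cubeE y : \1_Q y = \prod_i (\1_(Itv (a 0 i)) (y 0 i) : R).
have [Qy|Qy] := pselect (Q y).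
 rewrite indicT // big1 // => i _; rewrite indicT // in_Itv. by have := Qy i; rewrite ler_distl.
rewrite indicF //.
have [i hi] : exists i, ~ `|y 0 i - a 0 i| <= 2^-1 by apply/existsNP.
by rewrite (bigD1 i) //= indicF ?mul0r // in_Itv -ler_distl.
Qed.

Lemma lker_le j y s : lker j y s <= (ld_mass j)^-1 ^+ n * \1_Q s.
rewrite indic_cubeE; have -> : (ld_mass j)^-1 ^+ n = \prod_(i < n) (ld_mass (R := R) j)^-1.
 by rewrite prodr_const card_ord.
rewrite -big_split /=; apply: ler_prod => i _; exact: kap_bds.
Qed.

Lemma lker_eq0 j y s : ~ Q s -> lker j y s = 0.
move=> Qs; apply/eqP; rewrite eq_le lker_ge0 andbT.
by apply: le_trans (lker_le j y s) _; rewrite indicF ?mulr0.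
Qed.

Lemma lkerE j y s : Q y -> Q s -> lker j y s = \prod_i landau j (y 0 i - s 0 i).
move=> Qy Qs; apply: eq_bigr => i _; rewrite /kap !indicT ?mul1r // in_Itv.
 by have := Qs i; rewrite ler_distl.
by have := Qy i; rewrite ler_distl.
Qed.

Lemma ms_lker j : measf
 [set: (borel 'rV[R]_n * borel 'rV[R]_n)%type] (fun p => lker j p.1 p.2).
apply: measurable_prod => i _.
have mp : measf [set: (borel 'rV[R]_n * borel 'rV[R]_n)%type]
 ((fun p : 'rV[R]_n * 'rV[R]_n => (p.1 0 i, p.2 0 i)) :
 _ -> mTR R * mTR R).
 apply: measurable_fun_pair.
 exact: (mfT_comp (ms_crd i) measurable_fst).
 exact: (mfT_comp (ms_crd i) measurable_snd).
exact: (mfT_comp (ms_kap (a 0 i) j) mp).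
Qed.

Lemma ms_lker2 j y : measf [set: borel 'rV[R]_n] (lker j y).
exact: (mfT_comp (ms_lker j) (pair1_measurable (y : borel 'rV[R]_n))).
Qed.

Definition box (l u : 'rV[R]_n) : set 'rV[R]_n :=
 [set v | forall i, l 0 i <= v 0 i <= u 0 i].

Lemma indic_boxE l u y :
 \1_(box l u) y = \prod_i (\1_(`[l 0 i, u 0 i]%classic : set R) (y 0 i) : R).
have [Qy|Qy] := pselect (box l u y).
 rewrite indicT // big1 // => i _; rewrite indicT //= in_itv /=. exact: Qy.
rewrite indicF //.
have [i hi] : exists i, ~ (l 0 i <= y 0 i <= u 0 i) by apply/existsNP.
by rewrite (bigD1 i) //= indicF ?mul0r //= in_itv.
Qed.

Lemma ms_box l u : measurable (box l u : set (borel 'rV[R]_n)).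
have -> : box l u = \bigcap_(i in [set: 'I_n])
 (setT `&` (fun v : 'rV[R]_n => v 0 i) @^-1` `[l 0 i, u 0 i]).
 rewrite eqEsubset; split => v /= h i; first by split => //=; rewrite in_itv /=.
 by have [_ /=] := h i I; rewrite in_itv.
by apply: fin_bigcap_measurable => // i _; apply: ms_crd.
Qed.

Lemma lker_box j l u y :
 (\int[mu]_s (lker j y s * \1_(box l u) s)%:E =
 \prod_i kap_itv (a 0%R i) j (l 0%R i) (u 0%R i) (y 0%R i))%E.
pose q (i : 'I_n) (t : R) : \bar R :=
 (kap (a 0 i) j (y 0 i) t * \1_(`[l 0 i, u 0 i]%classic : set R) t)%:E.
rewrite (eqint (fun s : borel 'rV[R]_n => \prod_i q i ((s : 'rV[R]_n) 0%R i))%E); last first.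
 by move=> s _; rewrite /q prodEFin indic_boxE -big_split.
rewrite int_leb_prod // => [i|i t].
 apply/mEFinP; apply: mfM; first exact: ms_kap2.
 by apply: mindic; exact: measurable_itv.
rewrite lee_fin mulr_ge0 //.
by have /andP[] := kap_bds (a 0 i) j (y 0 i) t.
Qed.

Lemma prod01 (x : 'I_n -> \bar R) : (forall i, 0 <= x i <= 1)%E ->
 (0 <= \prod_i x i <= 1)%E.
move=> x1; elim/big_ind: _ => [|u v /andP[u0 u1] /andP[v0 v1]|i _]; last exact: x1.
 by rewrite lee01 lexx.
by rewrite mule_ge0 //= -(mule1 1%E) lee_pmul.
Qed.

Lemma fine_prod (x : 'I_n -> \bar R) : (forall i, 0 <= x i <= 1)%E ->
 fine (\prod_i x i)%E = \prod_i fine (x i).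
move=> x1; have -> : (\prod_i x i = \prod_i (fine (x i))%:E)%E.
 apply: eq_bigr => i _; rewrite fineK // ge0_fin_numE; last by have /andP[] := x1 i.
 by have /andP[_ h] := x1 i; exact: le_lt_trans h (ltry _).
by rewrite prodEFin.
Qed.

Lemma lker_mass j y : (\int[mu]_s (lker j y s)%:E <= 1)%E.
have E : (\int[mu]_s (lker j y s)%:E =
 \int[mu]_s (lker j y s * \1_(box (a - const_mx 1) (a + const_mx 1)) s)%:E)%E.
 apply: eqint => s _; have [Qs|Qs] := pselect (Q s); last by rewrite lker_eq0 ?mul0r.
 rewrite indicT ?mulr1 // => i; have := Qs i; rewrite !mxE ler_distl; lra.
rewrite E lker_box.
by have /andP[] := @prod01 _ (fun i => kap_itv01 (a 0 i) j
 ((a - const_mx 1) 0 i) ((a + const_mx 1) 0 i) (y 0 i)).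
Qed.

Definition lavg j f y : R := \int[mu]_s (f s * lker j y s).

Lemma sqi_indic_cube : sqi mu (\1_Q).
split; first by apply: mindic; exact: ms_cube.
rewrite (eqint (fun x : borel 'rV[R]_n => (\1_Q (x : 'rV[R]_n))%:E)).
 rewrite integral_indic //; last exact: ms_cube. by rewrite setIT; exact: leb_cube_fin.
by move=> y _; case: (@indic01 R _ Q y) => -[-> _]; rewrite ?expr1n ?expr0n.
Qed.

Lemma lavg_intble j f y : sqi mu f ->
 mu.-integrable setT (EFin \o (fun s => f s * lker j y s)).
move=> sf; have [mf _] := sf.
apply: (@ae_le_intble _ _ _ mu _
 (fun s => (ld_mass j)^-1 ^+ n * (`|f s| * \1_Q s) + 0)).
- by apply: mfM => //; exact: ms_lker2.
- move=> s; rewrite addr0 normrM (ger0_norm (lker_ge0 _ _ _)) mulrCA. by rewrite ler_wpM2l //; exact: lker_le.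
- apply: intble_lin; last exact: integrable0. by apply: sqiM; [exact: sqi_norm|exact: sqi_indic_cube].
Qed.

Lemma lavg_lin j (c : R) f g y : sqi mu f -> sqi mu g ->
 lavg j (fun s => c * f s + g s) y = c * lavg j f y + lavg j g y.
move=> sf sg; rewrite /lavg -RiL //; try exact: lavg_intble.
by congr (fine _); apply: eqint => s _; rewrite mulrDl mulrA.
Qed.

Lemma ms_lavg j f : sqi mu f ->
 measf [set: borel 'rV[R]_n] (lavg j f).
move=> sf; have [mf _] := sf.
have mF : measf [set: (borel 'rV[R]_n * borel 'rV[R]_n)%type]
 (fun p : 'rV[R]_n * 'rV[R]_n => (f p.2 * lker j p.1 p.2)%:E).
 apply/mEFinP; apply: mfM; last exact: ms_lker. exact: (mfT_comp mf measurable_snd).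
pose F (p : (borel 'rV[R]_n * borel 'rV[R]_n)%type) : \bar R := (f p.2 * lker j p.1 p.2)%:E.
have hp : measf [set: borel 'rV[R]_n] (fubini_F mu (F^\+)%E).
 apply: measurable_fun_fubini_tonelli_F => //. exact: measurable_funepos.
have hn : measf [set: borel 'rV[R]_n] (fubini_F mu (F^\-)%E).
 apply: measurable_fun_fubini_tonelli_F => //. exact: measurable_funeneg.
have -> : lavg j f = fine \o (fun y => fubini_F mu (F^\+)%E y - fubini_F mu (F^\-)%E y)%E.
 apply/funext => y; rewrite /lavg /Rintegral integralE /= /fubini_F.
 by congr (fine (_ - _)); apply: eqint => s _; rewrite ?funeposE ?funenegE.
apply: mfT_comp => //.
exact: (emeasurable_funB hp hn).
Qed.

(** Tonelli's theorem, symmetry of the kernel and its mass at most 1. *)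
Lemma lker_double j f : measf [set: borel 'rV[R]_n] f ->
 (\int[mu]_y \int[mu]_s (f s ^+ 2 * lker j y s)%:E <= \int[mu]_s (f s ^+ 2)%:E)%E.
move=> mf.
have mF : measf [set: (borel 'rV[R]_n * borel 'rV[R]_n)%type]
 (fun p : 'rV[R]_n * 'rV[R]_n => (f p.2 ^+ 2 * lker j p.1 p.2)%:E).
 apply/mEFinP; apply: mfM; last exact: ms_lker.
 apply: mfX; exact: (mfT_comp mf measurable_snd).
have F0 (p : 'rV[R]_n * 'rV[R]_n) : (0 <= (f p.2 ^+ 2 * lker j p.1 p.2)%:E)%E.
 by rewrite lee_fin mulr_ge0 ?sqr_ge0 ?lker_ge0.
rewrite (@fubini_tonelli _ _ _ _ _ mu mu (fun p => (f p.2 ^+ 2 * lker j p.1 p.2)%:E)) //.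
have m2 : measf [set: borel 'rV[R]_n] (fun s => (f s ^+ 2)%:E).
 by apply/mEFinP; exact: mfX.
apply: ge0_le_integral => //.
- by move=> s _; apply: integral_ge0 => y _; exact: (F0 (y, s)).
- exact: (@measurable_fun_fubini_tonelli_G _ _ _ _ _ mu _ mF F0).
move=> s _ /=.
rewrite (eqint (fun y : borel 'rV[R]_n => ((f s ^+ 2)%:E * (lker j s y)%:E)%E)); last first.
 by move=> y _; rewrite -EFinM lker_sym.
rewrite ge0_integralZl //; last 3 first.
- by apply/mEFinP; exact: ms_lker2.
- by move=> y _; rewrite lee_fin lker_ge0.
- by rewrite lee_fin sqr_ge0.
rewrite -[leRHS]mule1; apply: lee_pmul => //; last exact: lker_mass.
- by rewrite lee_fin sqr_ge0.
- by apply: integral_ge0 => y _; rewrite lee_fin lker_ge0.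
Qed.

(** Averaging is a contraction of L^2: Jensen's inequality for a kernel of mass at most 1, followed
    by [lker_double]. *)
Lemma lavg_bd j f : sqi mu f ->
 sqi mu (lavg j f) /\
 (\int[mu]_y (lavg j f y ^+ 2)%:E <= \int[mu]_s (f s ^+ 2)%:E)%E.
move=> sf; have [mf fi] := sf; have ml := ms_lavg j sf.
have pt y : ((lavg j f y ^+ 2)%:E <= \int[mu]_s (f s ^+ 2 * lker j y s)%:E)%E.
 have mk : measf [set: borel 'rV[R]_n] (fun s => f s ^+ 2 * lker j y s).
 by apply: mfM; [exact: mfX|exact: ms_lker2].
 have mk2 : measf [set: borel 'rV[R]_n] (fun s => (f s ^+ 2 * lker j y s)%:E).
 exact/mEFinP.
 have k0 s : 0 <= f s ^+ 2 * lker j y s by rewrite mulr_ge0 ?sqr_ge0 ?lker_ge0.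
 have i2 : mu.-integrable setT (EFin \o (fun s => f s ^+ 2 * lker j y s)).
 apply: (@ae_le_intble _ _ _ mu _
 (fun s => (ld_mass j)^-1 ^+ n * (f s ^+ 2) + 0)) => //.
 move=> s; rewrite addr0 ger0_norm // mulrC ler_wpM2r ?sqr_ge0 //.
 apply: le_trans (lker_le j y s) _; apply: ler_piMr.
 by apply: exprn_ge0; rewrite invr_ge0; exact: ltW (ld_mass_gt0 j).
 by case: (@indic01 R _ Q s) => -[-> _].
 apply: intble_lin; last exact: integrable0. exact: sqi_sqr.
 have [i1 k1] := @le_Rint_fin _ _ _ mu (lker j y) 1 (ms_lker2 j y)
 (lker_ge0 j y) (lker_mass j y).
 rewrite (int_Rint i2) lee_fin. have [c0|c0] := eqVneq (lavg j f y) 0.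
 by rewrite c0 expr0n; apply: Rintegral_ge0 => s _; exact: k0.
 (* Integrating (f - c)^2 >= 0 against the kernel, with [c] the average of f, gives c^2 at most the
    average of f^2. *)
 set c := lavg j f y in c0 *. have key : 0 <= \int[mu]_s (1 * ((f s ^+ 2) * lker j y s) +
 ((- 2 * c) * (f s * lker j y s) + (c ^+ 2 * lker j y s + 0))).
 apply: Rintegral_ge0 => s _; have := lker_ge0 j y s. have := sqr_ge0 (f s - c); nra.
 have i3 := lavg_intble j y sf. have i4 := intble_lin (c ^+ 2) i1 (integrable0 mu setT).
 have i5 := intble_lin (- 2 * c) i3 i4. rewrite RiL // RiL // RiL // in key; last exact: integrable0.
 rewrite -/(lavg j f y) -/c in key. have z0 : \int[mu]_x (0 : R) = 0 by rewrite /Rintegral integral0.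
 rewrite z0 in key. have : c ^+ 2 * (\int[mu]_s lker j y s) <= c ^+ 2 by rewrite ler_piMr // sqr_ge0. nra.
have bd : (\int[mu]_y (lavg j f y ^+ 2)%:E <= \int[mu]_s (f s ^+ 2)%:E)%E.
 apply: le_trans (lker_double j mf); apply: ge0_le_integral => //.
 - by move=> y _; rewrite lee_fin sqr_ge0.
 - by apply/mEFinP; exact: mfX.
 - apply: (@measurable_fun_fubini_tonelli_F _ _ _ _ _ mu
 (fun p : (borel 'rV[R]_n * borel 'rV[R]_n)%type => (f p.2 ^+ 2 * lker j p.1 p.2)%:E)).
 apply/mEFinP; apply: mfM; last exact: ms_lker.
 apply: mfX; exact: (mfT_comp mf measurable_snd).
 by move=> p; rewrite lee_fin mulr_ge0 ?sqr_ge0 ?lker_ge0.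
by split=> //; split=> //; exact: le_lt_trans bd fi.
Qed.
End ld_n.

(** * Weak convergence of the averages *)

Section ld_weak.
Context {R : realType} {n : nat}.
Variable a : 'rV[R]_n.
Implicit Types (j : nat) (y s : 'rV[R]_n) (f g : 'rV[R]_n -> R).
Local Notation mu := (@leb R n).
Local Notation Q := (cube a (2^-1)).
(** Makes the end points excluded in [kap_itv_cvg] negligible. *)
Lemma leb_hyperplane (i : 'I_n) (c : R) :
 mu [set v | v 0 i = c] = 0%E.
have mH : measurable ([set v | v 0 i = c] : set (borel 'rV[R]_n)).
 have := @ms_crd R n i measurableT [set c] (measurable_set1 c). by rewrite setTI.
rewrite -[X in mu X]setIT -integral_indic //.
pose q (k : 'I_n) (t : R) : \bar R := if k == i then (\1_[set c] t)%:E else 1%E.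
rewrite (eqint (fun v : borel 'rV[R]_n => \prod_k q k ((v : 'rV[R]_n) 0%R k))%E); last first.
 move=> v _; rewrite (bigD1 i) //= /q eqxx big1; last by move=> k /negbTE ->.
 by rewrite mule1 /indic; congr ((nat_of_bool _)%:R%:E); apply/idP/idP; rewrite !inE.
rewrite int_leb_prod.
- rewrite (bigD1 i) //= /q eqxx (_ : \int[lebm]_t _ = 0)%E ?mul0e //.
 by rewrite integral_indic ?setIT //; exact: lebesgue_measure_set1.
- move=> k; rewrite /q; case: (k == i); last exact: measurable_cst.
 by apply/mEFinP; apply: mindic.
- by move=> k t; rewrite /q; case: (k == i) => //; rewrite lee_fin.
Qed.

Lemma ae_crd_notin (i : 'I_n) (l : seq R) :
 {ae mu, forall v : borel 'rV[R]_n, (v : 'rV[R]_n) 0 i \notin l}.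
elim: l => [|c l IH]; first by apply: nearW.
have h : {ae mu, forall v : borel 'rV[R]_n, (v : 'rV[R]_n) 0 i != c}.
 exists [set v : 'rV[R]_n | v 0 i = c]; split; last by move=> v /= /negP/negbNE/eqP.
 - have := @ms_crd R n i measurableT [set c] (measurable_set1 c). by rewrite setTI.
 - exact: leb_hyperplane.
by apply: filterS2 h IH => v v1 v2; rewrite inE negb_or v1.
Qed.

Lemma ae_forall_ord (P : 'I_n -> borel 'rV[R]_n -> Prop) :
 (forall i, {ae mu, forall v, P i v}) -> {ae mu, forall v, forall i, P i v}.
move=> h; suff : forall (l : seq 'I_n), {ae mu, forall v : borel 'rV[R]_n, forall i : 'I_n, i \in l -> P i v}.
 by move=> /(_ (enum 'I_n)); apply: filterS => v hv i; apply: hv; rewrite mem_enum.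
elim=> [|k l IH]; first by apply: nearW.
apply: filterS2 (h k) IH => v v1 v2 i; rewrite inE => /predU1P[->//|]; exact: v2.
Qed.

Lemma cvg_prod_ord (u : nat -> 'I_n -> R) (l : 'I_n -> R) :
 (forall i, u j i @[j --> \oo] --> l i) -> \prod_i u j i @[j --> \oo] --> \prod_i l i.
move=> h; apply: cvg_big => //; exact: mul_continuous.
Qed.

Lemma lavg_boxE j l u y :
 lavg a j (\1_(box l u)) y = \prod_i fine (kap_itv (a 0 i) j (l 0 i) (u 0 i) (y 0 i)).
rewrite -fine_prod -?lker_box //; last by move=> i; exact: kap_itv01.
by congr fine; apply: eqint => s _; rewrite mulrC.
Qed.

Lemma lavg_box_cvg l u : {ae mu, forall y : borel 'rV[R]_n,
 lavg a j (\1_(box l u)) y @[j --> \oo] --> (\1_Q y * \1_(box l u) y : R)}.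
have h i := ae_crd_notin i [:: l 0 i; u 0 i; a 0 i - 2^-1; a 0 i + 2^-1].
apply: filterS (ae_forall_ord h) => y hy.
under eq_fun do rewrite lavg_boxE.
rewrite indic_cubeE indic_boxE -big_split /=; apply: cvg_prod_ord => i.
apply/cvgrPdist_le => e e0; have [N hN] := kap_itv_cvg e0 (hy i).
by exists N => // j /= Nj; rewrite distrC; exact: hN.
Qed.

Lemma lavg_box01 j l u y : 0 <= lavg a j (\1_(box l u)) y <= \1_Q y.
rewrite lavg_boxE; apply/andP; split.
 by apply: prodr_ge0 => i _; apply: fine_ge0; have /andP[] := kap_itv01 (a 0 i) j (l 0 i) (u 0 i) (y 0 i).
rewrite indic_cubeE; apply: ler_prod => i _.
have /andP[h0 h1] := kap_itv01 (a 0 i) j (l 0 i) (u 0 i) (y 0 i).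
rewrite fine_ge0 //=; case: (@indic01 R _ (Itv (a 0 i)) (y 0 i)) => -[-> Iy].
 rewrite -lee_fin fineK //; rewrite ge0_fin_numE //; exact: le_lt_trans h1 (ltry _).
by rewrite kap_itvE; case: asboolP => // _; rewrite andbF.
Qed.

(** Weak convergence to the restriction to the cube, stated as a property of [f] that linear
    combinations and L^2 limits preserve. *)
Definition lweak f := forall g, sqi mu g ->
 \int[mu]_y (g y * lavg a j f y) @[j --> \oo] --> \int[mu]_y (g y * (\1_Q y * f y)).

Lemma sqi_box l u : (mu (box l u) < +oo)%E -> sqi mu (\1_(box l u)).
move=> hf; split; first by apply: mindic; exact: ms_box.
rewrite (eqint (fun x : borel 'rV[R]_n => (\1_(box l u) (x : 'rV[R]_n))%:E)).
 by rewrite integral_indic ?setIT //; exact: ms_box.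
by move=> y _; case: (@indic01 R _ (box l u) y) => -[-> _]; rewrite ?expr1n ?expr0n.
Qed.

Lemma box_cube (l u : 'rV[R]_n) : exists r, box l u `<=` cube 0 r.
exists (\sum_i (`|l 0 i| + `|u 0 i|)) => v bv i; rewrite mxE subr0.
apply: (@le_trans _ _ (`|l 0 i| + `|u 0 i|)).
 have /andP[h1 h2] := bv i; have := ler_norm (u 0 i); have := ler_norm (- l 0 i).
 rewrite normrN => h3 h4; have := normr_ge0 (l 0 i); have := normr_ge0 (u 0 i). by rewrite ler_norml; lra.
by rewrite (bigD1 i) //= lerDl; apply: sumr_ge0 => k _; rewrite addr_ge0.
Qed.

Lemma leb_box_fin l u : (mu (box l u) < +oo)%E.
have [r hr] := box_cube l u; apply: le_lt_trans (leb_cube_fin 0 r).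
by apply: le_measure; rewrite ?inE //; [exact: ms_box|exact: ms_cube].
Qed.

Lemma lweak_box l u : lweak (\1_(box l u)).
move=> g sg; have [mg _] := sg.
have sb := sqi_box (leb_box_fin l u); have [mb _] := sb.
have mQ : measf [set: borel 'rV[R]_n] (\1_Q : 'rV[R]_n -> R).
 by apply: mindic; exact: ms_cube.
have gi : mu.-integrable setT (EFin \o (fun y => `|g y| * \1_Q y)).
 apply: sqiM; [exact: sqi_norm|exact: sqi_indic_cube].
have mF j : measf [set: borel 'rV[R]_n]
 (fun y => (g y * lavg a j (\1_(box l u)) y)%:E).
 apply/mEFinP; apply: mfM => //; exact: ms_lavg.
have mF' : measf [set: borel 'rV[R]_n]
 (fun y => (g y * (\1_Q y * \1_(box l u) y))%:E).
 by apply/mEFinP; apply: mfM => //; exact: mfM.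
have [||h1 _ h2] := dominated_convergence measurableT mF mF' _ gi _.
- apply: filterS (lavg_box_cvg l u) => y hy _; apply: cvg_EFin; first exact: nearW.
 by apply: cvgM => //; exact: cvg_cst.
- apply: nearW => y j _; rewrite abse_EFin lee_fin normrM.
 by have /andP[h0 h1] := lavg_box01 j l u y; rewrite ler_wpM2l // ger0_norm.
apply: (fine_cvg (f := fun j => \int[mu]_y (g y * lavg a j \1_(box l u) y)%:E)%E).
rewrite fineK; first exact: h2.
exact: integrable_fin_num.
Qed.

Lemma lavg_pair_bd (t : R) j f g : 0 < t -> sqi mu f -> sqi mu g ->
 2 * `|\int[mu]_y (g y * lavg a j f y)| <=
 t * (\int[mu]_y (g y ^+ 2)) + t^-1 * (\int[mu]_y (f y ^+ 2)).
move=> t0 sf sg; have [sl bl] := lavg_bd a j sf.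
have := ph_amgm (sqi_prehilbert mu) t0 sg sl; rewrite /sqi_scal => h.
apply: le_trans h _; apply: lerD; first by rewrite le_eqVlt; apply/orP; left; apply/eqP; congr (_ * _); apply: eqRint => x _; rewrite -expr2.
apply: ler_wpM2l; first by rewrite invr_ge0 ltW.
rewrite !(int_Rint (sqi_sqr _)) // lee_fin in bl.
Qed.

Lemma sqi_cut f : sqi mu f -> sqi mu (fun y => \1_Q y * f y).
move=> sf; have [mf _] := sf; apply: (@sqi_dom _ _ _ mu 1 _ f) => //.
 by apply: mfM => //; apply: mindic; exact: ms_cube.
by move=> y; case: (@indic01 R _ Q y) => -[-> _]; rewrite ?mul1r ?mul0r ?normr0.
Qed.

Lemma lweak_lin (c : R) f h : sqi mu f -> sqi mu h -> lweak f -> lweak h ->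
 lweak (fun y => c * f y + h y).
move=> sf sh wf wh g sg.
have E1 : (fun j => \int[mu]_y (g y * lavg a j (fun s => c * f s + h s) y)) =
 (fun j => c * (\int[mu]_y (g y * lavg a j f y)) + \int[mu]_y (g y * lavg a j h y)).
 apply/funext => j; rewrite -RiL; last 2 first.
 - by apply: sqiM => //; have [] := lavg_bd a j sf.
 - by apply: sqiM => //; have [] := lavg_bd a j sh.
 by apply: eqRint => y _; rewrite lavg_lin //; ring.
rewrite E1.
have -> : \int[mu]_y (g y * (\1_Q y * (c * f y + h y))) =
 c * (\int[mu]_y (g y * (\1_Q y * f y))) + \int[mu]_y (g y * (\1_Q y * h y)).
 rewrite -RiL; [|by apply: sqiM => //; exact: sqi_cut..]. by apply: eqRint => y _; ring.
by apply: cvgD; [apply: cvgM; [exact: cvg_cst|exact: wf]|exact: wh].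
Qed.

Lemma lweak_clsd f : sqi mu f -> (forall e : R, 0 < e ->
 exists2 h, sqi mu h /\ lweak h & \int[mu]_y ((h y - f y) ^+ 2) < e) -> lweak f.
move=> sf hf g sg; apply/cvgrPdist_le => e e0.
have fin (P Q' D E' X Y : R) : D <= Q' + P -> 2 * P <= X + Y -> 2 * Q' <= X + Y ->
 E' <= e / 4 -> X <= e / 2 -> Y <= e / 4 -> D + E' <= e by lra.
(* This [t] bounds t |g|^2 by e/2; then [h] is taken so close to [f] that |h - f|^2 / t is at most
   e/4. *)
pose t : R := e / (2 * (\int[mu]_y (g y ^+ 2) + 1)).
have g0 : 0 <= \int[mu]_y (g y ^+ 2) by apply: Rintegral_ge0 => y _; exact: sqr_ge0.
have t0 : 0 < t by rewrite divr_gt0 // mulr_gt0 //; lra.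
have [h [sh wh] hd] := hf (t * (e / 4)) ltac:(by apply: mulr_gt0 => //; lra).
have sd : sqi mu (fun y => -1 * h y + f y) by exact: sqi_lin.
have dE : \int[mu]_y ((-1 * h y + f y) ^+ 2) <= t * (e / 4).
 apply: le_trans (ltW hd); rewrite le_eqVlt; apply/orP; left; apply/eqP. by apply: eqRint => y _; ring.
have tg : t * (\int[mu]_y (g y ^+ 2)) <= e / 2.
 rewrite /t mulrAC ler_pdivrMr; [nra|lra].
have te : t^-1 * (\int[mu]_y ((-1 * h y + f y) ^+ 2)) <= e / 4.
 by rewrite mulrC ler_pdivrMr // mulrC.
have e4 : 0 < e / 4 by lra.
have /cvgrPdist_le/(_ _ e4)[N _ hN] := wh g sg.
exists N => // j /hN; set L := \int[mu]_y (g y * (\1_Q y * h y)); set Lj := \int[mu]_y (g y * lavg a j h y).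
move=> hL.
have d1 : \int[mu]_y (g y * lavg a j f y) = \int[mu]_y (g y * lavg a j (fun s => -1 * h s + f s) y) + Lj.
 have sl := (lavg_bd a j sd).1; have slh := (lavg_bd a j sh).1.
 rewrite -[X in X + _]mul1r -RiL; [|exact: sqiM..]. by apply: eqRint => y _; rewrite lavg_lin //; ring.
have d2 : \int[mu]_y (g y * (\1_Q y * f y)) =
 \int[mu]_y (g y * (\1_Q y * (-1 * h y + f y))) + L.
 rewrite -[X in X + _]mul1r -RiL; [|by apply: sqiM => //; exact: sqi_cut..].
 by apply: eqRint => y _; ring.
have b1 := lavg_pair_bd j t0 sd sg.
have b2 : 2 * `|\int[mu]_y (g y * (\1_Q y * (-1 * h y + f y)))| <= t * (\int[mu]_y (g y ^+ 2)) + t^-1 * (\int[mu]_y ((-1 * h y + f y) ^+ 2)).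
 have := ph_amgm (sqi_prehilbert mu) t0 sg (sqi_cut sd); rewrite /sqi_scal => hh.
 have eg : \int[mu]_x (g x * g x) = \int[mu]_x (g x ^+ 2) by apply: eqRint => x _; rewrite expr2.
 rewrite eg in hh; apply: le_trans hh _; rewrite lerD2l; apply: ler_wpM2l; first by rewrite invr_ge0 ltW.
 apply: le_Rintegral => //.
 - have := sqi_sqr (sqi_cut sd); apply: eq_integrable => // y _ /=; by rewrite expr2.
 - exact: sqi_sqr.
 - by move=> y _; case: (@indic01 R _ Q y) => -[-> _]; rewrite ?mul1r ?mul0r ?mulr0 ?expr2 // -expr2 sqr_ge0.
rewrite d1 d2.
move: b1 b2 hL; set p := \int[mu]_y _; set q := \int[mu]_y (g y * (\1_Q y * _)) => b1 b2 hL.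
have -> : q + L - (p + Lj) = q - p + (L - Lj) by ring.
apply: le_trans (ler_normD _ _) _.
have h2 : `|q - p| <= `|q| + `|p| by exact: ler_normB.
exact: fin h2 b1 b2 hL tg te.
Qed.

(** The functions with this property form a closed subspace of L^2. A function orthogonal to it has
    zero integral over every box, and boxes form a pi-system that generates the Borel sets, so it
    vanishes almost everywhere. *)
Theorem lavg_weak f : sqi mu f -> lweak f.
have s0 : sqi mu (fun=> 0).
 split; first exact: measurable_cst. by rewrite integral0_eq ?ltry // => x _; rewrite expr0n.
suff h : forall f, sqi mu f -> (sqi mu `&` lweak) f by move=> /h [].
move=> f0 sf0; apply: (@sqi_dens _ _ _ mu (sqi mu `&` lweak)) sf0 => [z []//||c u v [su wu] [sv wv]|u su hu|h sh hp].
- split=> // g sg; have -> : (fun j => \int[mu]_y (g y * lavg a j (fun=> 0) y)) = fun=> 0.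
 apply/funext => j; rewrite (_ : (fun y => _) = fun=> 0).
 by rewrite /Rintegral integral0.
 apply/funext => y; rewrite /lavg (_ : (fun s => _) = fun=> 0).
 by rewrite /Rintegral integral0 mulr0.
 by apply/funext => s; rewrite mul0r.
 have -> : \int[mu]_y (g y * (\1_Q y * 0)) = 0.
 rewrite (_ : (fun y => _) = fun=> 0); first by rewrite /Rintegral integral0. by apply/funext => y; rewrite !mulr0.
 exact: cvg_cst.
- by split; [exact: sqi_lin|exact: lweak_lin].
- split=> //; exact: lweak_clsd.
have [mh _] := sh.
pose G : set (set 'rV[R]_n) := [set A | exists l u, A = box l u].
pose F k : set 'rV[R]_n := box (const_mx (- k%:R)) (const_mx k%:R).
apply: (@ae_zero_pi _ _ _ mu G F) => //.
- rewrite eqEsubset; split; last first.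
 apply: smallest_sub; first exact: sigma_algebra_measurable. by move=> _ [l [u ->]]; exact: ms_box.
 apply: smallest_sub; first exact: smallest_sigma_algebra. move=> A oA; have [P PE] := rat_balls oA.
 pose B (q : 'rV[rat]_n * nat) := box (\row_i (ratr (q.1 0 i) - q.2.+1%:R^-1))
 (\row_i (ratr (q.1 0 i) + q.2.+1%:R^-1)) : set 'rV[R]_n.
 have -> : A = \bigcup_q (if `[< P q >] then B q else set0).
 rewrite PE eqEsubset; split => v [q].
 move=> Pq hv; exists q => //; case: asboolP => // _ i; rewrite !mxE. by have := hv i; rewrite ler_distl.
 move=> _; case: asboolP => // Pq hv; exists q => // i. by have := hv i; rewrite !mxE ler_distl.
 apply: (@countable_bigcupT_measurable _ (g_sigma_algebraType G)).
 exact: countableP.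
 move=> q; case: asboolP => _; last exact: measurable0. by apply: sub_sigma_algebra; eexists; eexists.
- move=> _ _ [l [u ->]] [l' [u' ->]]. exists (\row_i Num.max (l 0 i) (l' 0 i)), (\row_i Num.min (u 0 i) (u' 0 i)).
 rewrite eqEsubset; split=> v /= hv.
 move=> i; rewrite !mxE ge_max le_min; have [h1 h2] := hv. by have /andP[-> ->] := h1 i; have /andP[-> ->] := h2 i.
 split=> i; have := hv i; rewrite !mxE ge_max le_min => /andP[/andP[h1 h2] /andP[h3 h4]];
 by rewrite ?h1 ?h2 ?h3 ?h4.
- by move=> k; eexists; eexists.
- rewrite eqEsubset; split=> // v _. have [k hk] : exists k : nat, forall i, `|v 0 i| <= k%:R.
 exists (Num.bound (\sum_i `|v 0 i|)) => i; apply: ltW.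
 apply: le_lt_trans (archi_boundP _); last by apply: sumr_ge0. by rewrite (bigD1 i) //= lerDl; apply: sumr_ge0.
 by exists k => // i; rewrite !mxE -ler_norml.
- move=> _ [l [u ->]]; apply/(integrable_mkcond _ (ms_box l u)).
 have := sqiM sh (sqi_box (leb_box_fin l u)); apply: eq_integrable => // y _.
 rewrite patchE /=; case: ifPn; rewrite ?inE ?notin_setE => yb.
 by rewrite indicT ?mulr1.
 by rewrite indicF ?mulr0.
- move=> _ [l [u ->]]. have := hp _ (conj (sqi_box (leb_box_fin l u)) (lweak_box (l := l) (u := u))). move=> h0.
 have -> : (\int[mu]_(x in box l u) (h x)%:E = \int[mu]_x (h x * \1_(box l u) x)%:E)%E.
 rewrite integral_mkcond; apply: eqint => y _; rewrite patchE /=; case: ifPn; rewrite ?inE ?notin_setE => yb.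
 by rewrite indicT ?mulr1.
 by rewrite indicF ?mulr0.
 by rewrite int_Rint ?h0 //; apply: sqiM => //; exact: sqi_box (leb_box_fin l u).
Qed.
End ld_weak.

(** * The uncut polynomial kernel: smooth averages and transfer of weak derivatives *)

Section ld_convolution.
Context {R : realType} {n : nat}.
Implicit Types (j : nat) (y s : 'rV[R]_n) (f h hi : 'rV[R]_n -> R) (p : {poly R}).
Local Notation mu := (@leb R n).
Lemma smooth1_horner p : smooth1 setT (horner p).
exists (fun k => horner (p^`(k))) => // k s _.
by have := is_derive_poly (p^`(k)) s; rewrite -derivnS.
Qed.

Lemma Cinfty_horner p (b c : R) i : Cinfty setT (fun y : 'rV[R]_n => p.[c * y 0 i + b]).
move=> k; have oT : open [set: 'rV[R]_n] := openT.
apply: (@Ck_comp1 _ _ _ _ setT (horner p) (fun y => c * y 0 i + b)) => //.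
 exact: smooth1_horner.
apply: CkD => //; last exact: Ck_cst.
by apply: CkM => //; [exact: Ck_cst|exact: Ck_crd].
Qed.

Definition lconv j y s : R := \prod_i landau j (y 0 i - s 0 i).

(* The kernel is a polynomial in [y] with polynomial coefficients in [s]. *)
Lemma lconv_separated j : exists m, exists A B : 'I_m -> 'rV[R]_n -> R,
 [/\ forall l, Cinfty setT (A l), forall l, Cinfty setT (B l) &
 forall y s, lconv j y s = \sum_l A l y * B l s].
have oT : open [set: 'rV[R]_n] := openT.
pose p : {poly R} := ld_poly j; pose N := size p.
(* Multi-indices: each factor is expanded by Taylor's formula at -s_i, and the product of the [n]
   sums is distributed over them. *)
pose I := {ffun 'I_n -> 'I_N}.
pose A (phi : I) y : R := \prod_i ('X^(phi i)).[y 0 i].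
pose B (phi : I) s : R := \prod_i ((p^`N(phi i)).[- s 0 i] / ld_mass j).
have sA phi : Cinfty setT (A phi).
 move=> k; apply: (@Ck_prod R n k setT n (fun i y => ('X^(phi i)).[y 0 i])) => // i.
 have := @Cinfty_horner 'X^(phi i) 0 1 i k. by under eq_fun do rewrite mul1r addr0.
have sB phi : Cinfty setT (B phi).
 move=> k; apply: (@Ck_prod R n k setT n (fun i s => (p^`N(phi i)).[- s 0 i] / ld_mass j)) => // i.
 apply: CkM => //; last exact: Ck_cst. have := @Cinfty_horner p^`N(phi i) 0 (-1) i k.
 by under eq_fun do rewrite mulN1r addr0.
exists #|I|, (fun l => A (enum_val l)), (fun l => B (enum_val l)); split=> // y s.
rewrite -(@big_enum_val R 0 +%R I I (fun phi => A phi y * B phi s)) /=.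
under eq_bigr => phi _ do rewrite /A /B -big_split /=.
rewrite -(bigA_distr_bigA (fun i (m : 'I_N) => ('X^m).[y 0 i] * ((p^`N(m)).[- s 0 i] / ld_mass j))).
apply: eq_bigr => i _; rewrite /landau addrC nderiv_taylor; last exact: mulrC.
rewrite mulr_suml; apply: eq_bigr => m _; rewrite hornerXn; ring.
Qed.

Lemma is_der_crdB y v s i : isD y v (fun z : 'rV[R]_n => (z - s) 0 i) (v 0 i).
have -> : (fun z : 'rV[R]_n => (z - s) 0 i) = (fun z => z 0 i + - s 0 i).
 by apply/funext => z; rewrite !mxE.
have := is_deriveD (is_der_crd y v i) (is_derive_cst (- s 0 i) y v).
by rewrite addr0.
Qed.

Lemma is_der_crdN y v s i : isD s v (fun z : 'rV[R]_n => (y - z) 0 i) (- v 0 i).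
have -> : (fun z : 'rV[R]_n => (y - z) 0 i) = (fun z => y 0 i + - z 0 i).
 by apply/funext => z; rewrite !mxE.
have := is_deriveB (is_derive_cst (y 0 i) s v) (is_der_crd s v i).
by rewrite sub0r.
Qed.

Lemma sum_urow (i : 'I_n) (F : 'I_n -> R) : \sum_k (urow i : 'rV[R]_n) 0 k * F k = F i.
rewrite (bigD1 i) //= urowE eqxx mul1r big1 ?addr0 // => k ki.
by rewrite urowE (negbTE ki) mul0r.
Qed.

(** The kernel depends on y - s only, so its derivatives in the two variables are opposite. *)
Lemma lconv_antisym j i y s : exists d : R,
 isD y (urow i) (fun z => lconv j z s) d /\
 isD s (urow i) (lconv j y) (- d).
have oT : open [set: 'rV[R]_n] := openT.
pose G (v : 'rV[R]_n) : R := \prod_k landau j (v 0 k).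
have sG : Cinfty setT G.
 move=> k; apply: (@Ck_prod R n k setT n (fun k (v : 'rV[R]_n) => landau j (v 0 k))) => // l.
 apply: CkM => //; last exact: Ck_cst. have := @Cinfty_horner (ld_poly j) 0 1 l k.
 by under eq_fun do rewrite mul1r addr0.
have dG : differentiable G (y - s) by apply: (@Ck1_diff _ _ 0%N setT).
exists ('D_(urow i) G (y - s)); split.
 have := @der_chain R n n G (fun z => z - s) y (urow i) dG
 (fun k => @ex_derive _ _ _ _ _ _ _ (is_der_crdB y (urow i) s k)).
 under eq_bigr => k _ do rewrite (@derive_val _ _ _ _ _ _ _ (is_der_crdB y (urow i) s k)). rewrite sum_urow.
 have -> // : (fun z => G (z - s)) = (fun z => lconv j z s).
 by apply/funext => z; apply: eq_bigr => k _; rewrite !mxE.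
have := @der_chain R n n G (fun z => y - z) s (urow i) dG
 (fun k => @ex_derive _ _ _ _ _ _ _ (is_der_crdN y (urow i) s k)).
under eq_bigr => k _ do rewrite (@derive_val _ _ _ _ _ _ _ (is_der_crdN y (urow i) s k)) mulNr.
rewrite sumrN sum_urow.
have -> // : (fun z => G (y - z)) = lconv j y.
by apply/funext => z; apply: eq_bigr => k _; rewrite !mxE.
Qed.

Lemma is_der_sum_scaled m (A : 'I_m -> 'rV[R]_n -> R) (c : 'I_m -> R) i y :
 (forall l, Cinfty setT (A l)) ->
 isD y (urow i) (fun z => \sum_l A l z * c l)
 (\sum_l pder i (A l) y * c l).
move=> sA.
have h (l : 'I_m) : isD y (urow i) (fun z => A l z * c l) (pder i (A l) y * c l).
 have [_ /(_ i)[/(_ y I) dA _]] := sA l 1%N.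
 have dA' : isD y (urow i) (A l) (pder i (A l) y) by exact: derivableP.
 have -> : (fun z => A l z * c l) = c l \*: A l by apply/funext => z; rewrite /= mulrC.
 apply: is_derive_eq; exact: mulrC.
have := is_derive_sum h; congr isD.
by apply/funext => z; rewrite fct_sumE.
Qed.

Lemma Cinfty_sum_scaled m (A : 'I_m -> 'rV[R]_n -> R) (c : 'I_m -> R) :
 (forall l, Cinfty setT (A l)) -> Cinfty setT (fun z => \sum_l A l z * c l).
have oT : open [set: 'rV[R]_n] := openT.
move=> sA k; apply: (@Ck_sum R n k setT m (fun l z => A l z * c l)) => // l.
by apply: CkM => //; [exact: sA|exact: Ck_cst].
Qed.

Lemma intble_lin_sum m (F : 'I_m -> 'rV[R]_n -> R) (c : 'I_m -> R) :
 (forall l, mu.-integrable setT (EFin \o F l)) ->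
 mu.-integrable setT (EFin \o (fun s => \sum_l c l * F l s)) /\
 \int[mu]_s (\sum_l c l * F l s) = \sum_l c l * \int[mu]_s F l s.
move=> iF; elim: m F c iF => [|m IH] F c iF.
 have E : (fun s : 'rV[R]_n => \sum_l c l * F l s) = (fun=> 0).
 by apply/funext => s; rewrite big_ord0.
 by rewrite E big_ord0 /Rintegral integral0; split=> //; exact: integrable0.
have [i1 e1] := IH (fun l => F (lift ord0 l)) (fun l => c (lift ord0 l)) (fun l => iF _).
have E : (fun s => \sum_l c l * F l s) =
 (fun s => c ord0 * F ord0 s + \sum_l c (lift ord0 l) * F (lift ord0 l) s).
 by apply/funext => s; rewrite big_ord_recl.
by rewrite E RiL // big_ord_recl e1; split=> //; exact: intble_lin.
Qed.

Section averages.
Variables (h : 'rV[R]_n -> R) (ih : forall q, Cinfty setT q -> mu.-integrable setT (EFin \o (fun s => h s * q s))).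
Lemma lconv_avg_rep m (A B : 'I_m -> 'rV[R]_n -> R) :
 (forall l, Cinfty setT (B l)) ->
 forall y, \int[mu]_s (h s * \sum_l A l y * B l s) = \sum_l A l y * \int[mu]_s (h s * B l s).
move=> sB y; have [_ <-] := intble_lin_sum (fun l => A l y) (fun l => ih (sB l)).
by apply: eqRint => s _; rewrite mulr_sumr; apply: eq_bigr => l _; ring.
Qed.

Lemma lconv_smooth j : Cinfty setT (fun y => \int[mu]_s (h s * lconv j y s)).
have [m [A [B [sA sB E]]]] := lconv_separated j.
have -> : (fun y => \int[mu]_s (h s * lconv j y s)) =
 (fun y => \sum_l A l y * \int[mu]_s (h s * B l s)).
 by apply/funext => y; rewrite -lconv_avg_rep //; apply: eqRint => s _; rewrite E.
exact: Cinfty_sum_scaled.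
Qed.

(** Only finitely many smooth functions of [y] are differentiated. The derivative of the kernel then
    moves to [s] with a change of sign, where [hi], the weak derivative of [h], takes it up. *)
Lemma lconv_partial j i hi : (forall q, Cinfty setT q ->
 \int[mu]_s (h s * pder i q s) = - \int[mu]_s (hi s * q s)) ->
 forall y, isD y (urow i) (fun y => \int[mu]_s (h s * lconv j y s))
 (\int[mu]_s (hi s * lconv j y s)).
move=> hhi y; have [m [A [B [sA sB E]]]] := lconv_separated j.
have -> : (fun y => \int[mu]_s (h s * lconv j y s)) =
 (fun y => \sum_l A l y * \int[mu]_s (h s * B l s)).
 by apply/funext => z; rewrite -lconv_avg_rep //; apply: eqRint => s _; rewrite E.
have := @is_der_sum_scaled m A (fun l => \int[mu]_s (h s * B l s)) i y sA.
congr isD.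
rewrite -(lconv_avg_rep (fun l => pder i (A l))) //.
have sK : Cinfty setT (lconv j y).
 have -> : lconv j y = (fun s => \sum_l B l s * A l y).
 by apply/funext => s; rewrite E; apply: eq_bigr => l _; rewrite mulrC.
 exact: Cinfty_sum_scaled.
rewrite -[RHS]opprK -hhi //.
rewrite -mulN1r -RintegralZl //; last first.
 by apply: ih => k; have [_ /(_ i)[_]] := sK k.+1.
apply: eqRint => s _; have [d [d1 d2]] := lconv_antisym j i y s.
have -> : pder i (lconv j y) s = - d by exact: (@derive_val _ _ _ _ _ _ _ d2).
have d3 : isD y (urow i) (fun z => lconv j z s) (\sum_l pder i (A l) y * B l s).
 have -> : (fun z => lconv j z s) = (fun z => \sum_l A l z * B l s) by apply/funext => z; rewrite E.
 exact: is_der_sum_scaled.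
rewrite -(@derive_val _ _ _ _ _ _ _ d3) (@derive_val _ _ _ _ _ _ _ d1); ring.
Qed.
End averages.

(** On the cube the cut kernel is the polynomial one, so the same averages have the L^2 bounds of
    the first and the smoothness of the second. *)
Lemma lavg_lconv (a : 'rV[R]_n) j f y : cube a (2^-1) y ->
 (forall s, ~ cube a (2^-1) s -> f s = 0) ->
 lavg a j f y = \int[mu]_s (f s * lconv j y s).
move=> Qy f0; apply: eqRint => s _; have [Qs|Qs] := pselect (cube a (2^-1) s).
 by rewrite lkerE.
by rewrite f0 // !mul0r.
Qed.
End ld_convolution.

(** * Smooth functions, differentials and changes of charts *)

Section charts.
Context {R : realType} {n : nat} {M : ptopologicalType}.
Variable S : smooth_manifold R n M.
Implicit Types (c d : chart R n M) (x : M) (F H : M -> R).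
Local Notation Om c := (fwd c @` dom c).
Lemma ch_bwd c y : Om c y -> dom c (bwd c y) /\ fwd c (bwd c y) = y.
by move=> [x dx <-]; rewrite fwdK. Qed.

Lemma fwd_in c x : dom c x -> Om c (fwd c x).
by move=> dx; exists x. Qed.

Lemma nbhs_dom c x : dom c x -> nbhs x (dom c).
by move=> dx; apply: onbhs; split=> //; exact: open_dom. Qed.

Lemma open_chart_pre c (U : set 'rV[R]_n) : open U -> open (dom c `&` fwd c @^-1` U).
move=> oU; apply: open_from_nbhs => x [dx Ux]; apply: filterI; first exact: nbhs_dom.
by apply: (fwd_continuous dx); apply: onbhs.
Qed.

Lemma open_chart_im c (W : set M) : open W -> open (Om c `&` bwd c @^-1` W).
move=> oW; apply: open_from_nbhs => y [dy Wy]; apply: filterI.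
 by apply: onbhs; split=> //; exact: open_codom.
by apply: (bwd_continuous dy); apply: onbhs.
Qed.

(** Smoothness near the point [x], read in one chart; by compatibility of the atlas every chart
    around [x] then serves. The pointwise form lets a function be given by different formulas in
    different places. *)
Definition sma F x : Prop := exists c, exists U : set 'rV[R]_n,
 [/\ atlas S c, dom c x, open U, U (fwd c x) /\ U `<=` Om c & Cinfty U (F \o bwd c)].

Lemma sma_chart F x d : atlas S d -> dom d x -> sma F x ->
 exists U : set 'rV[R]_n,
 [/\ open U, U (fwd d x), U `<=` Om d & Cinfty U (F \o bwd d)].
move=> ad dx [c [U [ac cx oU [Ux UO] FU]]].
pose W := dom c `&` fwd c @^-1` U.
have oW : open W by exact: open_chart_pre.
exists (Om d `&` bwd d @^-1` W); split.
- exact: open_chart_im.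
- by split; [exact: fwd_in|rewrite /= fwdK].
- by move=> y [].
move=> k; have oV := open_chart_im (c:=d) oW.
apply: (@Ck_ext _ _ _ _ (fun y => (F \o bwd c) (fwd c (bwd d y)))) => //.
 move=> y; rewrite inE => -[_ [cy _]]; by rewrite /= fwdK.
apply: (Ck_comp oV oU) => // [y [_ [_ //]]|j].
apply: Ck_sub (atlas_compatible ad ac j k) => y [dy [cy _]].
by exists (bwd d y); [split=> //; exact: (ch_bwd dy).1|exact: (ch_bwd dy).2].
Qed.

Lemma smoothP F : smooth S F <-> forall x, sma F x.
split=> [sF x|sF c ac k].
 exists (chart_at S x), (Om (chart_at S x)); split.
 - exact: chatP.
 - exact: chart_at_dom.
 - exact: open_codom.
 - by split=> //; apply: fwd_in; exact: chart_at_dom.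
 - by apply: sF; exact: chatP.
apply: Ck_local => y [x dx <-].
have [U [oU Ux UO FU]] := sma_chart ac dx (sF x).
by exists U.
Qed.

Lemma sma_cont F x : sma F x -> {for x, continuous F}.
move=> [c [U [ac cx oU [Ux UO] FU]]].
have h := Ck_cont (FU 0%N) Ux.
have h2 : {for x, continuous ((F \o bwd c) \o fwd c)}.
 by apply: continuous_comp; [exact: fwd_continuous|].
rewrite /prop_for /continuous_at -[F x]/(F x) in h2 *.
rewrite /= fwdK // in h2.
apply: cvg_trans h2; apply: near_eq_cvg.
by apply: filterS (nbhs_dom cx) => z dz; rewrite /= fwdK.
Qed.

Lemma sma_eq F H x : (\forall z \near x, F z = H z) -> sma F x -> sma H x.
rewrite /prop_near1 nbhsE => -[W [oW Wx] FH] sF.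
have ac := chatP S x; have dx := chart_at_dom S x.
have [U [oU Ux UO FU]] := sma_chart ac dx sF.
pose c := chart_at S x.
exists c, (U `&` (Om c `&` bwd c @^-1` W)).
have oV : open (U `&` (Om c `&` bwd c @^-1` W)).
 by apply: openI => //; exact: open_chart_im.
split=> //.
 split; last by move=> y [/UO]. by split=> //; split; [exact: fwd_in|rewrite /= fwdK].
move=> k; apply: (@Ck_ext _ _ _ _ (F \o bwd c)) => //.
 by move=> y; rewrite inE => -[_ [_ /FH]].
by apply: Ck_sub (FU k) => y [].
Qed.

Lemma sma_near F x : sma F x -> \forall z \near x, sma F z.
move=> [c [U [ac cx oU [Ux UO] FU]]].
have oW : open (dom c `&` fwd c @^-1` U) by exact: open_chart_pre.
apply: filterS (onbhs (conj oW _)) => // z [dz Uz].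
by exists c, U.
Qed.

Lemma sma_cst (a : R) x : sma (fun=> a) x.
have ac := chatP S x; have dx := chart_at_dom S x.
exists (chart_at S x), (Om (chart_at S x)); split=> //.
- exact: open_codom.
- by split=> //; exact: fwd_in.
- by move=> k; exact: Ck_cst.
Qed.

Lemma sma2 (op : R -> R -> R) F H x :
 (forall k (U : set 'rV[R]_n) (f h : 'rV[R]_n -> R), open U -> Ck k U f -> Ck k U h ->
 Ck k U (fun y => op (f y) (h y))) ->
 sma F x -> sma H x -> sma (fun z => op (F z) (H z)) x.
move=> hop [c [U [ac cx oU [Ux UO] FU]]] /(sma_chart ac cx)[U' [oU' Ux' UO' HU]].
have oI : open (U `&` U') by exact: openI.
exists c, (U `&` U'); split=> //; first by split=> // y [/UO].
move=> k; apply: (hop k _ (F \o bwd c) (H \o bwd c)) => //.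
 by apply: Ck_sub (FU k) => y [].
by apply: Ck_sub (HU k) => y [].
Qed.

Lemma smaD F H x : sma F x -> sma H x -> sma (fun z => F z + H z) x.
by apply: sma2 => k U f h; exact: CkD. Qed.

Lemma smaM F H x : sma F x -> sma H x -> sma (fun z => F z * H z) x.
by apply: sma2 => k U f h; exact: CkM. Qed.

Lemma sma_big (I : Type) (r : seq I) (f : I -> M -> R) x :
 (forall i, sma (f i) x) -> sma (fun z => \sum_(i <- r) f i z) x.
move=> sf; elim: r => [|i r IH].
 by under eq_fun do rewrite big_nil; exact: sma_cst.
by under eq_fun do rewrite big_cons; exact: smaD.
Qed.

Lemma sma_sum m (f : 'I_m -> M -> R) x :
 (forall i, sma (f i) x) -> sma (fun z => \sum_i f i z) x.
exact: sma_big. Qed.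

Lemma sma_prod m (f : 'I_m -> M -> R) x :
 (forall i, sma (f i) x) -> sma (fun z => \prod_i f i z) x.
move=> sf; elim: (index_enum _) => [|i r IH].
 by under eq_fun do rewrite big_nil; exact: sma_cst.
by under eq_fun do rewrite big_cons; exact: smaM.
Qed.

Lemma sma_comp1 (I : set R) (G : R -> R) F x : open I -> I (F x) ->
 smooth1 I G -> sma F x -> sma (fun z => G (F z)) x.
move=> oI IF sG sF; have cF := sma_cont sF.
have [W [oW Wx WI]] : exists W, [/\ open W, W x & W `<=` F @^-1` I].
 have : nbhs x (F @^-1` I) by apply: cF; apply: onbhs. by rewrite nbhsE => -[W [oW Wx] WI]; exists W.
move: sF => [c [U [ac cx oU [Ux UO] FU]]].
exists c, (U `&` (Om c `&` bwd c @^-1` W)).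
have oV : open (U `&` (Om c `&` bwd c @^-1` W)).
 by apply: openI => //; exact: open_chart_im.
split=> //.
 split; last by move=> y [/UO]. by split=> //; split; [exact: fwd_in|rewrite /= fwdK].
move=> k; apply: (@Ck_comp1 _ _ _ _ I G (F \o bwd c)) => //.
 by move=> y [_ [_ /WI]].
by apply: Ck_sub (FU k) => y [].
Qed.

Lemma sma_crd c j x : atlas S c -> dom c x -> sma (fun z => fwd c z 0 j) x.
move=> ac cx; exists c, (Om c); split=> //; first exact: open_codom.
 by split=> //; exact: fwd_in.
move=> k; apply: (@Ck_ext _ _ _ _ (fun y => y 0 j)); first exact: open_codom.
 by move=> y; rewrite inE => /ch_bwd [_ /= ->].
by apply: Ck_crd; exact: open_codom.
Qed.

Lemma sma_fwd c (G : 'rV[R]_n -> R) x (U : set 'rV[R]_n) : atlas S c -> dom c x ->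
 open U -> U (fwd c x) -> Cinfty U G -> sma (fun z => G (fwd c z)) x.
move=> ac cx oU Ux GU; exists c, (U `&` Om c).
have oV : open (U `&` Om c) by apply: openI => //; exact: open_codom.
have V1 : (U `&` Om c) (fwd c x) by split=> //; exact: fwd_in.
split=> // k; apply: (@Ck_ext _ _ _ _ G) => //.
 by move=> y; rewrite inE => -[_ /ch_bwd [_ /= ->]].
by apply: Ck_sub (GU k) => y [].
Qed.

(** Components of the differential of [F] in the chart [c]. *)
Definition dform F c x : 'rV[R]_n :=
 \row_i pder i (F \o bwd c) (fwd c x).

Lemma sma_dform F c i x : atlas S c -> dom c x -> sma F x ->
 sma (fun z => dform F c z 0 i) x.
move=> ac cx /(sma_chart ac cx)[U [oU Ux UO FU]].
under eq_fun do rewrite mxE.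
apply: (@sma_fwd c _ _ U) => // k.
by have [_ /(_ i) []] := FU k.+1.
Qed.

Lemma sma_dvble F c x v : atlas S c -> dom c x -> sma F x ->
 derivable (F \o bwd c) (fwd c x) v /\ differentiable (F \o bwd c) (fwd c x).
move=> ac cx /(sma_chart ac cx)[U [oU Ux UO FU]].
have df := Ck1_diff oU Ux (FU 1%N).
by split=> //; exact: diff_derivable.
Qed.

Lemma dform_near F H c x : dom c x -> atlas S c -> sma F x ->
 (\forall z \near x, F z = H z) -> dform H c x = dform F c x.
move=> cx ac sF; rewrite /prop_near1 nbhsE => -[W [oW Wx] FH]; apply/rowP => i; rewrite !mxE.
have [dF _] := sma_dvble (delta_mx 0 i) ac cx sF.
have h : isD (fwd c x) (delta_mx 0 i) (H \o bwd c) ('D_(delta_mx 0 i) (F \o bwd c) (fwd c x)).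
 apply: near_pder dF. have oV := open_chart_im (c:=c) oW. apply: filterS (onbhs (conj oV _)).
 by move=> y [_ /FH].
 by split; [exact: fwd_in|rewrite /= fwdK].
by have [_ h'] := h; exact: h'.
Qed.

Lemma dform_cst (a : R) c x : dform (fun=> a) c x = 0.
by apply/rowP => i; rewrite !mxE /partial_derivative derive_cst. Qed.

Lemma dformD F H c x : atlas S c -> dom c x -> sma F x -> sma H x ->
 dform (fun z => F z + H z) c x = dform F c x + dform H c x.
move=> ac cx sF sH; apply/rowP => i; rewrite !mxE.
have [dF _] := sma_dvble (delta_mx 0 i) ac cx sF.
have [dH _] := sma_dvble (delta_mx 0 i) ac cx sH.
exact: (deriveD dF dH).
Qed.

Lemma dformM F H c x : atlas S c -> dom c x -> sma F x -> sma H x ->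
 dform (fun z => F z * H z) c x = F x *: dform H c x + H x *: dform F c x.
move=> ac cx sF sH; apply/rowP => i; rewrite !mxE.
have [dF _] := sma_dvble (delta_mx 0 i) ac cx sF.
have [dH _] := sma_dvble (delta_mx 0 i) ac cx sH.
by have := deriveM dF dH; rewrite /= fwdK // => h; exact: h.
Qed.

Lemma dform_comp1 (G : R -> R) (a : R) F c x : atlas S c -> dom c x -> sma F x ->
 isD (F x) 1 G a -> dform (fun z => G (F z)) c x = a *: dform F c x.
move=> ac cx sF dG; apply/rowP => i; rewrite !mxE.
have [dF _] := sma_dvble (delta_mx 0 i) ac cx sF.
have dG' : isD ((F \o bwd c) (fwd c x)) 1 G a by rewrite /= fwdK.
by have [_ h] := is_der_comp1 dG' (derivableP dF); exact: h.
Qed.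

Lemma jac_dform c d x i k :
 tjac c d x i k = dform (fun z => fwd d z 0 k) c x 0 i.
by rewrite !mxE. Qed.

Lemma sma_jac c d i k x : atlas S c -> atlas S d -> dom c x -> dom d x ->
 sma (fun z => tjac c d z i k) x.
move=> ac ad cx dx; under eq_fun do rewrite jac_dform.
by apply: sma_dform => //; exact: sma_crd.
Qed.

(** Chain rule for the change of coordinates: covectors transform by the transposed Jacobian. *)
Lemma dform_chart F c d x : atlas S c -> atlas S d -> dom c x -> dom d x ->
 sma F x -> dform F c x = dform F d x *m (tjac c d x)^T.
move=> ac ad cx dx sF; apply/rowP => i; rewrite !mxE.
have [_ dF] := sma_dvble (delta_mx 0 i) ad dx sF.
have e : F \o bwd c \o fwd c = F \o bwd c \o fwd c by [].
have dp k : derivable (fun z => fwd d (bwd c z) 0 k) (fwd c x) (delta_mx 0 i).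
 by have [] := sma_dvble (delta_mx 0 i) ac cx (sma_crd k ad dx).
have dF' : differentiable (F \o bwd d) (fwd d (bwd c (fwd c x))) by rewrite fwdK.
have h := der_chain dF' dp.
have h2 : isD (fwd c x) (delta_mx 0 i) (F \o bwd c)
 (\sum_(k < n) 'D_(delta_mx 0 i) (fun z => fwd d (bwd c z) 0 k) (fwd c x)
 * 'D_(urow k) (F \o bwd d) (fwd d (bwd c (fwd c x)))).
 have [h1 h3] := h. rewrite -h3; apply: near_pder h1. have oV := open_chart_im (c:=c) (open_dom d).
 apply: filterS (onbhs (conj oV _)).
 by move=> y [_ dy] /=; rewrite fwdK.
 by split; [exact: fwd_in|rewrite /= fwdK].
have [_ h3] := h2; rewrite /partial_derivative h3 fwdK //.
by apply: eq_bigr => k _; rewrite !mxE mulrC.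
Qed.

Lemma jac_comp c d e x : atlas S c -> atlas S d -> atlas S e ->
 dom c x -> dom d x -> dom e x ->
 tjac c e x = tjac c d x *m tjac d e x.
move=> ac ad ae cx dx ex; apply/matrixP => i k; rewrite jac_dform.
rewrite (@dform_chart _ c d) //; last exact: sma_crd.
rewrite !mxE; apply: eq_bigr => l _; rewrite mulrC !mxE.
by [].
Qed.

Lemma jac_id c x : dom c x -> tjac c c x = 1%:M.
move=> cx; apply/matrixP => i k; rewrite !mxE /partial_derivative.
have h : isD (fwd c x) (delta_mx 0 i) (fun y => fwd c (bwd c y) 0 k)
 ('D_(delta_mx 0 i) (fun y : 'rV[R]_n => y 0 k) (fwd c x)).
 have [h1 _] := is_der_crd (fwd c x) (delta_mx 0 i) k. apply: near_pder h1.
 have h := onbhs (conj (@open_codom _ _ _ c) (fwd_in cx)). by apply: filterS h => y /ch_bwd [_ ->].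
have [_ ->] := h; have [_ ->] := is_der_crd (fwd c x) (delta_mx 0 i) k.
by rewrite mxE eqxx eq_sym.
Qed.

Lemma jacK c d x : atlas S c -> atlas S d -> dom c x -> dom d x ->
 tjac c d x *m tjac d c x = 1%:M.
by move=> ac ad cx dx; rewrite -jac_comp // jac_id. Qed.
End charts.

(** * Positive definite matrices *)

Section posdef.
Context {R : realType} {n : nat}.
Variables (G : 'M[R]_n) (Gsym : G^T = G) (Gpos : forall v : 'rV[R]_n, v != 0 -> 0 < (v *m G *m v^T) 0 0).
Implicit Types u v : 'rV[R]_n.
Definition qf u v : R := (u *m G *m v^T) 0 0.

Lemma qf_ge0 v : 0 <= qf v v.
have [->|v0] := eqVneq v 0; first by rewrite /qf mul0mx mul0mx mxE.
exact/ltW/Gpos.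
Qed.

Lemma qf_sym u v : qf u v = qf v u.
rewrite /qf -[in LHS](trmxK (u *m G *m v^T)) mxE.
by rewrite !trmx_mul trmxK Gsym mulmxA.
Qed.

Lemma qf_prehilbert : prehilbert (fun a u v => a *: u + v) [set: 'rV[R]_n] qf.
split=> // [a u v w _ _ _|u v _ _|v _]; [|exact: qf_sym|exact: qf_ge0].
by rewrite /qf !mulmxDl -!scalemxAl !mxE.
Qed.

Lemma posdef_unit : G \in unitmx.
rewrite -row_free_unit -kermx_eq0; apply/rowV0P => v /sub_kermxP vG.
by apply/eqP; apply: contraT => /Gpos; rewrite vG mul0mx mxE ltxx.
Qed.

(** The characteristic polynomial of -G has the value det G at 0 and is positive for large
    arguments. Were det G negative, there would be a root t >= 0, and an eigenvector v would satisfy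
    v G v^T = - t v v^T <= 0. *)
Lemma posdef_det_gt0 : 0 < \det G.
have d0 : \det G != 0 by have := posdef_unit; rewrite unitmxE unitfE.
rewrite lt_neqAle eq_sym d0 /= leNgt; apply/negP => dneg.
pose p := char_poly (- G).
have p0 : p.[0] = \det G.
 by rewrite horner_coef0 char_poly_det -detZ scaleN1r opprK.
have lp : lead_coef p = 1 by apply/monicP; exact: char_poly_monic.
have [] := @polyrcf.poly_pinfty_gt_lc R p; first by rewrite lp.
move=> b hb; have b0 : 0 <= Num.max b 0 by rewrite le_max lexx orbT.
have [] := @poly_ivt R p 0 (Num.max b 0) b0.
 rewrite p0 (ltW dneg) /=; apply: le_trans (hb _ _); first by rewrite lp. by rewrite le_max lexx.
move=> t /andP[t0 _]; rewrite -eigenvalue_root_char => /eigenvalueP[v vG v0].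
have := Gpos v0; rewrite -[G]opprK mulmxN vG mulNmx -scalemxAl mxE oppr_gt0 mxE.
apply/negP; rewrite -leNgt mulr_ge0 // mxE; apply: sumr_ge0 => i _.
by rewrite mxE -expr2 sqr_ge0.
Qed.

Lemma qf_cauchy u v : qf u v ^+ 2 <= qf u u * qf v v.
exact: (ph_CS qf_prehilbert). Qed.

(** Cauchy-Schwarz for [v] and e_i G^-1, the vector that represents the i-th coordinate. *)
Lemma qf_crd v i : (v 0 i) ^+ 2 <= qf v v * (invmx G) i i.
have := qf_cauchy v (delta_mx 0 i *m invmx G).
have -> : qf v (delta_mx 0 i *m invmx G) = v 0 i.
 rewrite qf_sym /qf -(mulmxA (delta_mx 0 i)) mulVmx ?posdef_unit // mulmx1 -rowE. by rewrite !mxE.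
have -> // : qf (delta_mx 0 i *m invmx G) (delta_mx 0 i *m invmx G) = (invmx G) i i.
rewrite /qf -(mulmxA (delta_mx 0 i)) mulVmx ?posdef_unit // mulmx1.
by rewrite trmx_mul trmx_inv Gsym mulmxA -rowE trmx_delta -colE !mxE.
Qed.

Lemma qf_cocrd v i : ((v *m G) 0 i) ^+ 2 <= qf v v * G i i.
have := qf_cauchy v (delta_mx 0 i).
have -> : qf v (delta_mx 0 i) = (v *m G) 0 i by rewrite /qf trmx_delta -colE mxE.
by have -> : qf (delta_mx 0 i) (delta_mx 0 i) = G i i
 by rewrite /qf -rowE trmx_delta -colE !mxE.
Qed.
End posdef.

(** * Smooth dependence of determinants, adjugates and reciprocals *)

Section smooth_matrices.
Context {R : realType} {n : nat} {M : ptopologicalType}.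
Variable S : smooth_manifold R n M.
Lemma sma_det m (A : M -> 'M[R]_m) x :
 (forall i j, sma S (fun z => A z i j) x) -> sma S (fun z => \det (A z)) x.
move=> sA; rewrite /determinant; apply: sma_big => s.
by apply: smaM; [exact: sma_cst|apply: sma_prod].
Qed.

Lemma sma_adj m (A : M -> 'M[R]_m) x i j :
 (forall i j, sma S (fun z => A z i j) x) -> sma S (fun z => (\adj (A z)) i j) x.
move=> sA; under eq_fun do rewrite mxE /cofactor.
apply: smaM; first exact: sma_cst.
by apply: sma_det => k l; under eq_fun do rewrite !mxE; exact: sA.
Qed.

Lemma sma_mulmx m p q (A : M -> 'M[R]_(m, p)) (B : M -> 'M[R]_(p, q)) x i j :
 (forall i j, sma S (fun z => A z i j) x) ->
 (forall i j, sma S (fun z => B z i j) x) ->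
 sma S (fun z => (A z *m B z) i j) x.
move=> sA sB; under eq_fun do rewrite mxE.
by apply: sma_sum => k; exact: smaM.
Qed.

Lemma sma_inv F x : 0 < F x -> sma S F x -> sma S (fun z => (F z)^-1) x.
move=> Fx sF; have cF := sma_cont sF.
apply: (@sma_eq _ _ _ S (fun z => F z `^ (-1))).
 have : \forall z \near x, 0 < F z.
 by apply: (cF [set s | 0 < s]); apply: onbhs; split => //; exact: open_gt.
 by apply: filterS => z Fz; rewrite powR_inv1 // ltW.
apply: (@sma_comp1 _ _ _ S [set s | 0 < s] (fun s => s `^ (-1))) => //.
exact: smooth1_powR.
Qed.

Lemma sma_sqrt F x : 0 < F x -> sma S F x -> sma S (fun z => Num.sqrt (F z)) x.
move=> Fx sF; have cF := sma_cont sF.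
apply: (@sma_eq _ _ _ S (fun z => F z `^ 2^-1)).
 have : \forall z \near x, 0 < F z.
 by apply: (cF [set s | 0 < s]); apply: onbhs; split => //; exact: open_gt.
 by apply: filterS => z Fz; rewrite powR12_sqrt // ltW.
apply: (@sma_comp1 _ _ _ S [set s | 0 < s] (fun s => s `^ 2^-1)) => //.
exact: smooth1_powR.
Qed.
End smooth_matrices.

(** * Classical gradient and weighted divergence in charts *)

Section metric.
Context {R : realType} {n : nat} {M : ptopologicalType}.
Variables (S : smooth_manifold R n M) (g : riemannian_metric S) (Psi : M -> R) (Psi_smooth : smooth S Psi) (Psi_gt0 : forall x, 0 < Psi x).
Implicit Types (c d : chart R n M) (x : M) (F H : M -> R) (X Y : M -> 'rV[R]_n).
Local Notation at_ x := (chart_at S x).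
Local Notation gramc := (gram_in_chart S g).
Lemma at_atlas x : atlas S (at_ x). Proof. exact: chatP. Qed.
Lemma at_dom x : dom (at_ x) x. Proof. exact: chart_at_dom. Qed.
Hint Resolve at_atlas at_dom : core.

Lemma jac_inj c d x (v : 'rV[R]_n) : atlas S c -> atlas S d -> dom c x -> dom d x ->
 v != 0 -> v *m tjac c d x != 0.
move=> ac ad cx dx; apply: contra_neq => h.
by rewrite -[v]mulmx1 -(@jacK _ _ _ S c d x ac ad cx dx) mulmxA h mul0mx.
Qed.

Lemma gramc_sym c x : (gramc c x)^T = gramc c x.
by rewrite /gram_in_chart !trmx_mul trmxK gram_sym mulmxA. Qed.

Lemma gramc_pos c x : atlas S c -> dom c x ->
 forall v : 'rV[R]_n, v != 0 -> 0 < (v *m gramc c x *m v^T) 0 0.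
move=> ac cx v v0; rewrite /gram_in_chart !mulmxA -(mulmxA _ _ v^T) -trmx_mul.
by apply: gram_posdef; exact: jac_inj.
Qed.

Lemma in_chartK c X x : atlas S c -> dom c x ->
 in_chart S c X x *m tjac c (at_ x) x = X x.
by move=> ac cx; rewrite /in_chart -mulmxA (@jacK _ _ _ S) // mulmx1. Qed.

Lemma scal_chart c X Y x : atlas S c -> dom c x ->
 scal g X Y x = qf (gramc c x) (in_chart S c X x) (in_chart S c Y x).
move=> ac cx; rewrite /scal -[X x in LHS](in_chartK X ac cx) -[Y x in LHS](in_chartK Y ac cx).
by rewrite /qf /gram_in_chart trmx_mul !mulmxA.
Qed.

Lemma scal_sym X Y x : scal g X Y x = scal g Y X x.
exact: (qf_sym (gram_sym g x)). Qed.

Lemma scal_ge0 X x : 0 <= scal g X X x.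
exact: (qf_ge0 (gram_posdef g x)). Qed.

Lemma scal_linl (a : R) X Y Z x :
 scal g (fun z => a *: X z + Y z) Z x = a * scal g X Z x + scal g Y Z x.
by rewrite /scal !mulmxDl -!scalemxAl !mxE. Qed.

Lemma in_chart_lin c (a : R) X Y x :
 in_chart S c (fun z => a *: X z + Y z) x = a *: in_chart S c X x + in_chart S c Y x.
by rewrite /in_chart mulmxDl -scalemxAl. Qed.

Lemma in_chartZ c F X x :
 in_chart S c (fun z => F z *: X z) x = F x *: in_chart S c X x.
by rewrite /in_chart -scalemxAl. Qed.

Lemma sma_gramc c i j x : atlas S c -> dom c x -> sma S (fun z => gramc c z i j) x.
move=> ac cx; exists c, (fwd c @` dom c); split=> //.
- exact: open_codom.
- by split=> //; exact: fwd_in.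
- exact: gram_smooth.
Qed.

Lemma det_gramc_gt0 c x : atlas S c -> dom c x -> 0 < \det (gramc c x).
by move=> ac cx; apply: posdef_det_gt0; exact: gramc_pos. Qed.

Definition dens c x : R := Psi x * sqrt_det g c x.

Lemma dens_gt0 c x : atlas S c -> dom c x -> 0 < dens c x.
by move=> ac cx; rewrite mulr_gt0 // sqrtr_gt0; exact: det_gramc_gt0. Qed.

Lemma sma_dens c x : atlas S c -> dom c x -> sma S (dens c) x.
move=> ac cx; apply: smaM; first exact: (smoothP S Psi).1.
apply: sma_sqrt; first exact: det_gramc_gt0.
by apply: sma_det => i j; exact: sma_gramc.
Qed.

Lemma gramc_unit c x : atlas S c -> dom c x -> gramc c x \in unitmx.
by move=> ac cx; apply: posdef_unit; exact: gramc_pos. Qed.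

Lemma sma_invgramc c i j x : atlas S c -> dom c x ->
 sma S (fun z => (invmx (gramc c z)) i j) x.
move=> ac cx.
apply: (@sma_eq _ _ _ S (fun z => (\det (gramc c z))^-1 * (\adj (gramc c z)) i j)).
 apply: filterS (nbhs_dom cx) => z cz; by rewrite /invmx gramc_unit // [in RHS]mxE.
apply: smaM.
 apply: sma_inv; first exact: det_gramc_gt0. by apply: sma_det => k l; exact: sma_gramc.
by apply: sma_adj => k l; exact: sma_gramc.
Qed.

(** The classical gradient: the differential with its index raised by the inverse metric. *)
Definition nab F x : 'rV[R]_n := dform F (at_ x) x *m invmx (g x).

Lemma scal_nab F Y c x : atlas S c -> dom c x -> sma S F x ->
 scal g (nab F) Y x = (dform F c x *m (in_chart S c Y x)^T) 0 0.
move=> ac cx sF; rewrite /scal /nab -(mulmxA (dform _ _ _)) mulVmx ?mulmx1; last first.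
 by apply: posdef_unit => v; exact: gram_posdef.
rewrite (dform_chart (S := S) (d := c)) // /in_chart trmx_mul mulmxA; congr ((_ *m _) _ _).
Qed.

Lemma in_chart_nab F c x : atlas S c -> dom c x -> sma S F x ->
 in_chart S c (nab F) x = dform F c x *m invmx (gramc c x).
move=> ac cx sF; have gu := gramc_unit ac cx.
apply: (can_inj (mulmxK gu)); rewrite mulmxKV //.
rewrite (dform_chart (S := S) (d := at_ x)) // /gram_in_chart /in_chart /nab !mulmxA.
rewrite -(mulmxA _ _ (tjac c (at_ x) x)) (@jacK _ _ _ S) // mulmx1.
by rewrite mulmxKV //; apply: posdef_unit => v; exact: gram_posdef.
Qed.

Definition sm_fld_at X x : Prop :=
 exists c, [/\ atlas S c, dom c x & forall k, sma S (fun z => in_chart S c X z 0 k) x].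

Lemma sm_fld_chart X x d : atlas S d -> dom d x -> sm_fld_at X x ->
 forall k, sma S (fun z => in_chart S d X z 0 k) x.
move=> ad dx [c [ac cx sX]] k.
apply: (@sma_eq _ _ _ S (fun z => (in_chart S c X z *m tjac c d z) 0 k)).
 apply: filterS2 (nbhs_dom cx) (nbhs_dom dx) => z cz dz. by rewrite {1}/in_chart -mulmxA -(@jac_comp _ _ _ S).
apply: sma_mulmx => [i j|i j]; first by rewrite (ord1 i).
exact: sma_jac.
Qed.

Lemma smooth_fldP X : smooth_field S X <-> forall x, sm_fld_at X x.
split=> [sX x|sX c ac k].
 exists (at_ x); split=> // k; exists (at_ x), (fwd (at_ x) @` dom (at_ x)); split=> //.
 - exact: open_codom.
 - by split=> //; exact: fwd_in.
 - exact: sX.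
move=> j; apply: Ck_local => y [x dx <-].
have [U [oU Ux UO FU]] := sma_chart ac dx (sm_fld_chart ac dx (sX x) k).
by exists U.
Qed.

Lemma sm_fld_nab F x : sma S F x -> sm_fld_at (nab F) x.
move=> sF; exists (at_ x); split=> // k.
apply: (@sma_eq _ _ _ S (fun z => (dform F (at_ x) z *m invmx (gramc (at_ x) z)) 0 k)).
 apply: filterS2 (nbhs_dom (at_dom x)) (sma_near sF) => z cz sFz. by rewrite in_chart_nab.
apply: sma_mulmx => [i j|i j]; last exact: sma_invgramc.
by rewrite (ord1 i); exact: sma_dform.
Qed.

Lemma sm_fldZ F X x : sma S F x -> sm_fld_at X x ->
 sm_fld_at (fun z => F z *: X z) x.
move=> sF sX; exists (at_ x); split=> // k.
under eq_fun do rewrite in_chartZ mxE.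
by apply: smaM => //; exact: sm_fld_chart.
Qed.

Lemma sma_scal X Y x : sm_fld_at X x -> sm_fld_at Y x -> sma S (scal g X Y) x.
move=> sX sY; have sX' := sm_fld_chart (at_atlas x) (at_dom x) sX.
have sY' := sm_fld_chart (at_atlas x) (at_dom x) sY.
apply: (@sma_eq _ _ _ S (fun z => qf (gramc (at_ x) z) (in_chart S (at_ x) X z)
 (in_chart S (at_ x) Y z))).
 by apply: filterS (nbhs_dom (at_dom x)) => z cz; rewrite (scal_chart _ _ (at_atlas x)).
apply: sma_mulmx => [i j|i j].
 by apply: sma_mulmx => [k l|k l]; [rewrite (ord1 k)|exact: sma_gramc].
by under eq_fun do rewrite mxE; rewrite (ord1 j).
Qed.

(** [weighted_div] uses at each point the preferred chart of that point, which may jump from point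
    to point. With the chart fixed, the expression can be differentiated and integrated. *)
Definition divc c Y x : R :=
 (\sum_i dform (fun z => dens c z * in_chart S c Y z 0 i) c x 0 i) / dens c x.

Lemma wted_divE Y x : weighted_div g Psi Y x = divc (at_ x) Y x.
rewrite /weighted_div /divc /dens; congr (_ / _); apply: eq_bigr => i _.
by rewrite mxE.
Qed.

Lemma sma_divc c Y x : atlas S c -> dom c x -> sm_fld_at Y x ->
 sma S (divc c Y) x.
move=> ac cx sY; apply: smaM.
 apply: sma_sum => i; apply: sma_dform => //; apply: smaM; first exact: sma_dens. exact: sm_fld_chart.
by apply: sma_inv; [exact: dens_gt0|exact: sma_dens].
Qed.

Lemma divcZ c F Y x : atlas S c -> dom c x -> sma S F x -> sm_fld_at Y x ->
 divc c (fun z => F z *: Y z) x = F x * divc c Y x + scal g (nab F) Y x.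
move=> ac cx sF sY; have d0 := dens_gt0 ac cx.
rewrite (scal_nab _ ac cx) // /divc mxE.
have -> : \sum_i dform (fun z => dens c z * in_chart S c (fun z => F z *: Y z) z 0 i) c x 0 i =
 \sum_i (F x * dform (fun z => dens c z * in_chart S c Y z 0 i) c x 0 i +
 dens c x * (dform F c x 0 i * in_chart S c Y x 0 i)).
 apply: eq_bigr => i _. have -> : (fun z => dens c z * in_chart S c (fun z => F z *: Y z) z 0 i) =
 (fun z => F z * (dens c z * in_chart S c Y z 0 i)). by apply/funext => z; rewrite in_chartZ mxE mulrCA.
 rewrite (@dformM _ _ _ S) //; last first.
 by apply: smaM; [exact: sma_dens|exact: sm_fld_chart].
 by rewrite mxE [X in X + _]mxE [X in _ + X]mxE -mulrA; congr (_ + _); rewrite mulrCA mulrC -mulrA mulrC.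
rewrite big_split /= -!mulr_sumr mulrDl; congr (_ + _); first by rewrite mulrA.
rewrite mulrAC divff ?gt_eqF //= mul1r; apply: eq_bigr => i _; congr (_ * _); by rewrite [RHS]mxE.
Qed.

Lemma nab_near F H x : sma S F x -> (\forall z \near x, F z = H z) -> nab H x = nab F x.
by move=> sF FH; rewrite /nab (dform_near (S := S) _ _ sF FH). Qed.

Lemma nab_cst (a : R) x : nab (fun=> a) x = 0.
by rewrite /nab dform_cst mul0mx. Qed.

Lemma nabD F H x : sma S F x -> sma S H x ->
 nab (fun z => F z + H z) x = nab F x + nab H x.
by move=> sF sH; rewrite /nab (@dformD _ _ _ S) // mulmxDl. Qed.

Lemma nabM F H x : sma S F x -> sma S H x ->
 nab (fun z => F z * H z) x = F x *: nab H x + H x *: nab F x.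
by move=> sF sH; rewrite /nab (@dformM _ _ _ S) // mulmxDl -!scalemxAl. Qed.

Lemma nab_comp1 (G : R -> R) (a : R) F x : sma S F x -> isD (F x) 1 G a ->
 nab (fun z => G (F z)) x = a *: nab F x.
by move=> sF dG; rewrite /nab (dform_comp1 (S := S) _ _ sF dG) // -scalemxAl. Qed.

Lemma divc_near c Y Y' x : atlas S c -> dom c x -> sm_fld_at Y x ->
 (\forall z \near x, Y z = Y' z) -> divc c Y' x = divc c Y x.
move=> ac cx sY YY; rewrite /divc; congr (_ / _); apply: eq_bigr => i _.
rewrite (@dform_near _ _ _ S (fun z => dens c z * in_chart S c Y z 0 i)) //.
 by apply: smaM; [exact: sma_dens|exact: sm_fld_chart].
by apply: filterS YY => z; rewrite /in_chart => ->.
Qed.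
End metric.

(** * Bumps, cutoff functions and partitions *)

Section cutoffs.
Context {R : realType} {n : nat} {M : ptopologicalType}.
Variable S : smooth_manifold R n M.
Implicit Types (c d : chart R n M) (x z : M) (F H : M -> R) (X Y : M -> 'rV[R]_n).
Local Notation at_ x := (chart_at S x).
Local Notation Om c := (fwd c @` dom c).
Lemma cpt_openC (K : set M) : compact K -> open (~` K).
by move=> cK; apply: closed_openC; apply: compact_closed => //; exact: manifold_hausdorff S.
Qed.

Lemma sma_supp (K : set M) F : compact K -> (forall x, ~ K x -> F x = 0) ->
 (forall x, K x -> sma S F x) -> forall x, sma S F x.
move=> cK F0 FK x; have [Kx|Kx] := pselect (K x); first exact: FK.
have oK : open (~` K).
 exact: cpt_openC.
apply: (@sma_eq _ _ _ S (fun=> 0)); last exact: sma_cst.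
by apply: filterS (onbhs (conj oK Kx)) => z Kz; rewrite F0.
Qed.

Lemma sm_fld_supp (K : set M) X : compact K -> (forall x, ~ K x -> X x = 0) ->
 (forall x, K x -> sm_fld_at S X x) -> forall x, sm_fld_at S X x.
move=> cK F0 FK x; have [Kx|Kx] := pselect (K x); first exact: FK.
have oK : open (~` K).
 exact: cpt_openC.
exists (at_ x); split=> [||k]; [exact: chatP|exact: chart_at_dom|].
apply: (@sma_eq _ _ _ S (fun=> 0)); last exact: sma_cst.
apply: filterS (onbhs (conj oK Kx)) => z Kz.
by rewrite /in_chart F0 // mul0mx mxE.
Qed.

Lemma Cc_supp (K : set M) F : compact K -> (forall x, ~ K x -> F x = 0) ->
 (forall x, K x -> sma S F x) -> Cc_infty S F.
move=> cK F0 FK; split; last by exists K.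
by apply/smoothP; exact: sma_supp FK.
Qed.

Lemma Cc_sm F : Cc_infty S F -> forall x, sma S F x.
by move=> [/smoothP]. Qed.

Lemma Cc_mul F H : Cc_infty S F -> (forall x, sma S H x) -> Cc_infty S (fun z => F z * H z).
move=> cF sH; have sF := Cc_sm cF; have [_ [K cK FK]] := cF.
apply: (@Cc_supp K) => // [x Kx|x _]; first by rewrite FK ?mul0r.
exact: smaM.
Qed.

Lemma Cc_lin (a : R) F H : Cc_infty S F -> Cc_infty S H -> Cc_infty S (fun z => a * F z + H z).
move=> cF cH; have sF := Cc_sm cF; have [_ [K cK FK]] := cF.
have sH := Cc_sm cH; have [_ [K' cK' HK]] := cH.
apply: (@Cc_supp (K `|` K')) => [|x|x _].
- exact: compactU.
- by move=> /not_orP[k1 k2]; rewrite FK // HK // mulr0 addr0.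
- by apply: smaD => //; apply: smaM => //; exact: sma_cst.
Qed.

Lemma Cc0 : Cc_infty S (fun=> 0).
apply: (@Cc_supp set0) => //; first exact: compact0.
Qed.

Lemma Cc_sum (I : Type) (l : seq I) (f : I -> M -> R) :
 (forall i, Cc_infty S (f i)) -> Cc_infty S (fun z => \sum_(i <- l) f i z).
move=> cf; elim: l => [|i l IH].
 by under eq_fun do rewrite big_nil; exact: Cc0.
under eq_fun do rewrite big_cons -[f i _]mul1r; exact: Cc_lin.
Qed.

Definition cell c (a : 'rV[R]_n) (r : R) : set M := dom c `&` fwd c @^-1` cube a r.

Lemma clsd_cube (a : 'rV[R]_n) (r : R) : closed (cube a r).
have -> : cube a r = \bigcap_(i in [set: 'I_n]) [set v : 'rV[R]_n | `|v 0 i - a 0 i| <= r].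
 by rewrite eqEsubset; split=> v h i; [move=> _; exact: h|exact: h].
apply: closed_bigI => i _.
have cf : continuous (fun v : 'rV[R]_n => `|v 0 i - a 0 i|).
 move=> v; apply: (@continuous_comp _ _ _ (fun v : 'rV[R]_n => v 0 i - a 0 i) Num.norm).
 by apply: continuousB; [exact: cont_crd|exact: cst_continuous].
 exact: norm_continuous.
have -> : [set v : 'rV[R]_n | `|v 0 i - a 0 i| <= r] =
 (fun v : 'rV[R]_n => `|v 0 i - a 0 i|) @^-1` [set s | s <= r] by [].
by apply: preimage_closed => //; exact: closed_le.
Qed.

Lemma cpt_cube (a : 'rV[R]_n) (r : R) : compact (cube a r).
apply: bounded_closed_compact; last exact: clsd_cube.
exists (`|a| + `|r|); split; first exact: num_real.
move=> s hs v Qv /=; apply: le_trans (ltW hs).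
rewrite -[v](subrK a); apply: le_trans (ler_normD _ _) _; rewrite addrC lerD2l.
apply: norm_row_le => // i; rewrite !mxE; apply: le_trans (ler_norm _).
exact: Qv.
Qed.

Lemma cpt_cell c a r : cube a r `<=` Om c -> compact (cell c a r).
move=> QO; have -> : cell c a r = bwd c @` cube a r.
 rewrite eqEsubset; split=> x.
 by move=> [dx Qx]; exists (fwd c x) => //; rewrite fwdK.
 by move=> [y Qy <-]; have [h1 h2] := ch_bwd (QO _ Qy); split=> //=; rewrite h2.
apply: continuous_compact; last exact: cpt_cube.
apply: continuous_in_subspaceT => y; rewrite inE => Qy.
by apply: bwd_continuous; exact: QO.
Qed.

Definition push c (q : 'rV[R]_n -> R) x : R := if `[< dom c x >] then q (fwd c x) else 0.

Lemma pushE c q x : dom c x -> push c q x = q (fwd c x).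
by move=> dx; rewrite /push; case: asboolP. Qed.

Lemma push_out c (q : 'rV[R]_n -> R) a r x : (forall y, ~ cube a r y -> q y = 0) ->
 ~ cell c a r x -> push c q x = 0.
move=> q0 cx; rewrite /push; case: asboolP => // dx; apply: q0 => Qx; exact: cx.
Qed.

Lemma push_Cc c (q : 'rV[R]_n -> R) a r : atlas S c -> cube a r `<=` Om c ->
 Cinfty setT q -> (forall y, ~ cube a r y -> q y = 0) -> Cc_infty S (push c q).
move=> ac QO sq q0; apply: (Cc_supp (cpt_cell QO)) => [x cx|x [dx Qx]].
 exact: push_out q0 cx.
apply: (@sma_eq _ _ _ S (fun z => q (fwd c z))).
 by apply: filterS (nbhs_dom dx) => z dz; rewrite pushE.
by apply: (@sma_fwd _ _ _ S c q x setT) => //; exact: openT.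
Qed.

(** Vanishes off the Euclidean ball of radius [r], which lies in the cube. *)
Definition cube_bump (a : 'rV[R]_n) (r : R) (y : 'rV[R]_n) : R :=
 bp1 (r ^+ 2 - \sum_i (y 0 i - a 0 i) ^+ 2).

Lemma cube_bump_smooth a r : Cinfty setT (cube_bump a r).
move=> k; have oT : open [set: 'rV[R]_n] := openT.
apply: (@Ck_comp1 _ _ _ _ setT bp1 (fun y => r ^+ 2 - \sum_i (y 0 i - a 0 i) ^+ 2)) => //.
 exact: smooth1_flat.
have -> : (fun y : 'rV[R]_n => r ^+ 2 - \sum_i (y 0 i - a 0 i) ^+ 2) =
 (fun y => r ^+ 2 + (- 1) * \sum_i ((y 0 i + - a 0 i) * (y 0 i + - a 0 i))).
 by apply/funext => y; rewrite mulN1r; under eq_bigr do rewrite expr2.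
apply: CkD => //; first exact: Ck_cst.
apply: CkM => //; first exact: Ck_cst.
apply: Ck_sum => // i; apply: CkM => //; (apply: CkD => //; [exact: Ck_crd|exact: Ck_cst]).
Qed.

Lemma cube_bump_ge0 a r y : 0 <= cube_bump a r y. Proof. exact: bp1_ge0. Qed.

Lemma cube_bump_le1 a r y : cube_bump a r y <= 1. Proof. exact: bp1_le1. Qed.

Lemma cube_bump_out a r y : 0 < r -> ~ cube a r y -> cube_bump a r y = 0.
move=> r0 /existsNP[i /negP]; rewrite -ltNge => hi; apply: bp1_eq0; rewrite subr_le0.
rewrite (bigD1 i) //=; apply: (@le_trans _ _ ((y 0 i - a 0 i) ^+ 2)).
 rewrite -(real_normK (num_real (y 0 i - a 0 i))) ler_pXn2r ?nnegrE //; exact: ltW.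
by rewrite lerDl; apply: sumr_ge0 => k _; exact: sqr_ge0.
Qed.

Lemma cube_bump_gt0 a r : 0 < r -> 0 < cube_bump a r a.
move=> r0; apply: bp1_gt0; rewrite big1 ?subr0 ?exprn_gt0 // => i _.
by rewrite subrr expr0n.
Qed.

Lemma cell_exists x : exists r : R, [/\ 0 < r, r <= 4^-1 & cube (fwd (at_ x) x) r `<=` Om (at_ x)].
have h : nbhs (fwd (at_ x) x) (Om (at_ x)).
 apply: onbhs; split; first exact: open_codom. exact: fwd_in (chart_at_dom S x).
move: h => /nbhs_ballP[e /= e0 he].
have m0 : 0 < Num.min (e / 2) 4^-1 by rewrite lt_min; apply/andP; split; lra.
exists (Num.min (e / 2) 4^-1); split=> //; first by rewrite ge_min lexx orbT.
move=> y Qy; apply: he; rewrite -ball_normE /=.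
apply: (@le_lt_trans _ _ (e / 2)); last lra.
apply: norm_row_le; first lra.
move=> i; have := Qy i; rewrite !mxE distrC le_min => /andP[].
by [].
Qed.

(** The bound 1/4 keeps the cube inside the concentric cube of half side 1/2 on which the averaging
    kernel acts. *)
Definition radius x : R := xget 0
 [set r : R | [/\ 0 < r, r <= 4^-1 & cube (fwd (at_ x) x) r `<=` Om (at_ x)]].

Lemma radiusP x : [/\ 0 < radius x, radius x <= 4^-1 &
 cube (fwd (at_ x) x) (radius x) `<=` Om (at_ x)].
by rewrite /radius; case: xgetP => [r _ //|] h; have [r hr] := cell_exists x; case: (h r hr). Qed.

Definition cellat x : set M := cell (at_ x) (fwd (at_ x) x) (radius x).

Definition bmp x : M -> R := push (at_ x) (cube_bump (fwd (at_ x) x) (radius x)).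

Lemma cpt_cellat x : compact (cellat x).
by apply: cpt_cell; have [] := radiusP x. Qed.

Lemma bmp_Cc x : Cc_infty S (bmp x).
have [r0 r4 hr] := radiusP x.
apply: push_Cc hr _ _; [exact: chatP|exact: cube_bump_smooth|].
by move=> y; exact: cube_bump_out.
Qed.

Lemma bmp_out x z : ~ cellat x z -> bmp x z = 0.
have [r0 r4 hr] := radiusP x; apply: push_out => y; exact: cube_bump_out.
Qed.

Lemma bmp_ge0 x z : 0 <= bmp x z.
by rewrite /bmp /push; case: asboolP => // _; exact: cube_bump_ge0. Qed.

Lemma bumpat_le1 x z : bmp x z <= 1.
by rewrite /bmp /push; case: asboolP => // _; exact: cube_bump_le1. Qed.

Lemma bumpat_gt0 x : 0 < bmp x x.
have [r0 _ _] := radiusP x.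
by rewrite /bmp pushE; [exact: cube_bump_gt0|exact: chart_at_dom].
Qed.

Lemma open_sm_gt (F : M -> R) (a : R) : (forall x, sma S F x) -> open [set z | a < F z].
move=> sF; have cF : continuous F by move=> x; exact: sma_cont (sF x).
have -> : [set z | a < F z] = F @^-1` [set s | a < s] by [].
by apply: open_comp => // x _; exact: cF.
Qed.

Lemma cpt_bumps (K : set M) : compact K ->
 exists l : seq M, forall z, K z -> 0 < \sum_(x <- l) bmp x z.
rewrite compact_cover => cK.
have [||D _ KD] := cK M setT (fun x => [set z | 0 < bmp x z]).
- by move=> x _; apply: open_sm_gt => z; exact: Cc_sm (bmp_Cc x) z.
- by move=> z _; exists z => //=; exact: bumpat_gt0.
exists (finmap.enum_fset D) => z /KD[x xD zx].
rewrite (big_rem x) //=; apply: ltr_wpDr => //.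
by apply: sumr_ge0 => k _; exact: bmp_ge0.
Qed.

Lemma Cc_part chi : Cc_infty S chi -> exists l : seq M, exists2 kappa,
 Cc_infty S kappa & forall z, chi z = \sum_(x <- l) bmp x z ^+ 2 * kappa z.
move=> cc; have schi := Cc_sm cc; have [_ [K cK K0]] := cc.
have [l hl] := cpt_bumps cK.
pose N z := \sum_(x <- l) bmp x z * bmp x z.
have sN z : sma S N z.
 by apply: sma_big => x; apply: smaM; exact: Cc_sm (bmp_Cc x) z.
have N0 z : K z -> 0 < N z.
 move=> /hl h; have n0 : 0 <= N z by apply: sumr_ge0 => x _; rewrite -expr2 sqr_ge0.
 rewrite lt_neqAle n0 andbT; apply: contraTneq h => e; rewrite -leNgt big1_seq // => x /andP[_ xl].
 have := esym e; rewrite /N (big_rem x) //= => e2. have r0 : 0 <= \sum_(y <- rem x l) bmp y z * bmp y z.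
 by apply: sumr_ge0 => y _; rewrite -expr2 sqr_ge0.
 have := sqr_ge0 (bmp x z); rewrite expr2 => s0. have : bmp x z * bmp x z = 0 by lra.
 by move/eqP; rewrite mulf_eq0 orbb => /eqP.
exists l, (fun z => chi z * (N z)^-1).
 apply: (Cc_supp cK) => [x /K0 ->|x Kx]; first by rewrite mul0r.
 by apply: smaM => //; apply: sma_inv => //; exact: N0.
move=> z; rewrite -mulr_suml; have [Kz|Kz] := pselect (K z); last by rewrite K0 // mul0r mulr0.
have -> : \sum_(x <- l) bmp x z ^+ 2 = N z by apply: eq_bigr => x _; rewrite expr2.
by rewrite mulrCA divff ?mulr1 // gt_eqF // N0.
Qed.

(** With N a sum of bumps and del half its minimum over [K], the quotient b(N) / (b(N) + b(del -
    N)), where b is [bp1], equals 1 on the open set N > del, which contains [K]. *)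
Lemma cutoff (K : set M) : compact K -> exists chi, [/\ Cc_infty S chi,
 forall z, 0 <= chi z <= 1 & forall z, K z -> \forall y \near z, chi y = 1].
move=> cK; have [K0|/set0P[x0 Kx0]] := eqVneq K set0.
 by exists (fun=> 0); split=> [|z|z]; [exact: Cc0|rewrite lexx ler01|rewrite K0].
have [l hl] := cpt_bumps cK.
pose N z := \sum_(x <- l) bmp x z.
have cN : Cc_infty S N by apply: Cc_sum => x; exact: bmp_Cc.
have sN := Cc_sm cN.
have wN : {within K, continuous N}.
 by apply: csubT => x; exact: sma_cont (sN x).
have [z0 Kz0 hz0] := compact_EVT_min (ex_intro _ x0 Kx0) cK wN.
rewrite inE in Kz0; have Nz0 : 0 < N z0 := hl _ Kz0.
pose del := N z0 / 2; have del0 : 0 < del by rewrite divr_gt0.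
pose D z := bp1 (N z) + bp1 (del - N z).
have D0 z : 0 < D z.
 have [h|h] := ltP 0 (N z).
 by apply: ltr_pwDl; [exact: bp1_gt0|exact: bp1_ge0].
 by apply: ltr_wpDl; [exact: bp1_ge0|apply: bp1_gt0; lra].
have sb z : sma S (fun z => bp1 (N z)) z.
 by apply: (@sma_comp1 _ _ _ S setT bp1) => //; [exact: openT|exact: smooth1_flat].
have sb' z : sma S (fun z => bp1 (del - N z)) z.
 apply: (@sma_comp1 _ _ _ S setT bp1) => //; [exact: openT|exact: smooth1_flat|].
 have -> : (fun z => del - N z) = (fun z => del + (-1) * N z).
 by apply/funext => y; rewrite mulN1r.
 by apply: smaD; [exact: sma_cst|apply: smaM => //; exact: sma_cst].
exists (fun z => bp1 (N z) * (D z)^-1); split.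
- have [_ [K' cK' hK']] := cN; apply: (Cc_supp cK') => [x /hK' Nx|x _].
 by rewrite Nx bp1_eq0 // mul0r.
 by apply: smaM => //; apply: sma_inv => //; exact: smaD.
- move=> z; rewrite divr_ge0 ?bp1_ge0 ?(ltW (D0 z)) //= ler_pdivrMr // mul1r. by rewrite lerDl bp1_ge0.
- move=> z Kz; have oN := open_sm_gt del sN. apply: filterS (onbhs (conj oN _)).
 move=> y /= Ny; rewrite /D (@bp1_eq0 _ (del - N y)); last by lra.
 by rewrite addr0 divff // gt_eqF // bp1_gt0 //; lra.
 by have := hz0 z; rewrite inE => /(_ Kz) /=; rewrite /del; lra.
Qed.

(** Lindelof argument: for each basic open set contained in the positivity set of some bump, one
    such bump is chosen. *)
Lemma ctbl_bumps : exists p : nat -> M, forall z, exists k, 0 < bmp (p k) z.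
have [B cB [Bo Bb]] := manifold_second_countable S.
have [f Bf] : exists f : nat -> set M, B `<=` range f.
 have [B0|/set0P[b Bb0]] := eqVneq B set0; first by exists (fun=> set0); rewrite B0.
 have /countable_injP[h hinj] := cB. exists (fun k => xget b [set b' | B b' /\ h b' = k]) => b' Bb'.
 exists (h b') => //; case: xgetP => [b'' _ [Bb'' e]|/(_ b')]; last by case. by apply: hinj => //; rewrite inE.
exists (fun k => xget point [set x | f k `<=` [set z | 0 < bmp x z]]) => z.
have oz : open [set y | 0 < bmp z y].
 by apply: open_sm_gt => y; exact: Cc_sm (bmp_Cc z) y.
have [b [Bb' bz] hb] := Bb z _ (onbhs (conj oz (bumpat_gt0 z))).
have [k _ fk] := Bf _ Bb'; exists k; case: xgetP => [x _ hx|h].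
 by apply: hx; rewrite fk.
by exfalso; apply: (h z); rewrite fk.
Qed.

(** The field F d/dx_i of the chart [c], expressed in the preferred frames that encode vector
    fields. *)
Definition crd_fld c i F x : 'rV[R]_n :=
 F x *: (delta_mx 0 i *m tjac c (at_ x) x).

Lemma in_chart_crd_fld c i F x : atlas S c -> dom c x ->
 in_chart S c (crd_fld c i F) x = F x *: delta_mx 0 i.
move=> ac cx; rewrite in_chartZ /in_chart -mulmxA (@jacK _ _ _ S) ?mulmx1 //.
- exact: chatP.
- exact: chart_at_dom.
Qed.

Lemma crd_fld_smooth c i F (K : set M) : atlas S c -> compact K -> K `<=` dom c ->
 (forall x, ~ K x -> F x = 0) -> (forall x, K x -> sma S F x) ->
 smooth_field S (crd_fld c i F) /\ compactly_supported (crd_fld c i F).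
move=> ac cK Kc F0 sF.
have X0 x : ~ K x -> crd_fld c i F x = 0 by move=> /F0; rewrite /crd_fld => ->; rewrite scale0r.
split; last by exists K.
apply/smooth_fldP; apply: sm_fld_supp cK X0 _ => x Kx.
exists c; split=> [//||k]; first exact: Kc.
apply: (@sma_eq _ _ _ S (fun z => F z * (delta_mx 0 i : 'rV[R]_n) 0 k)).
 by apply: filterS (nbhs_dom (Kc _ Kx)) => z dz; rewrite in_chart_crd_fld // [RHS]mxE.
by apply: smaM; [exact: sF|exact: sma_cst].
Qed.
End cutoffs.

(** * Change of variables, from sets to functions *)

Section transfer.
Import HBNNSimple.
Context {d1 d2} {T1 : measurableType d1} {T2 : measurableType d2} {R : realType}.
Variables (m1 : {measure set T1 -> \bar R}) (m2 : {measure set T2 -> \bar R}).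
Variables (E : set T1) (D : set T2) (phi : T2 -> T1) (w : T2 -> R).
Hypotheses (mE : measurable E) (mD : measurable D) (mphi : measf D phi).
Hypotheses (mw : measf D w) (w0 : forall y, D y -> 0 <= w y).
Hypothesis phiE : forall y, D y -> E (phi y).
Hypothesis m12 : forall A, measurable A -> A `<=` E ->
 m1 A = (\int[m2]_(y in D) (\1_A (phi y) * w y)%:E)%E.

Lemma int_transf_nnsfun (h : {nnsfun T1 >-> R}) :
 (\int[m1]_(x in E) (h x)%:E = \int[m2]_(y in D) (h (phi y) * w y)%:E)%E.
have mh r : measurable (h @^-1` [set r]) by rewrite -[X in measurable X]setTI; exact: measurable_funP.
have mi r : measf D (fun y => \1_(h @^-1` [set r]) (phi y) : R).
 exact: (measurable_comp measurableT).
transitivity (\int[m1]_(x in E)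
 (\sum_(r \in range h) (r * \1_(h @^-1` [set r]) x)%:E))%E.
 by apply: eqint => x xE; rewrite fimfunE -fsumEFin.
rewrite ge0_integral_fsum //; last 2 first.
- by move=> r; apply/mEFinP; exact: mfM.
- by move=> r x Ex; exact: nnfun_muleindic_ge0.
transitivity (\int[m2]_(y in D)
 (\sum_(r \in range h) (r * \1_(h @^-1` [set r]) (phi y) * w y)%:E))%E; last first.
 apply: eqint => y yD; rewrite (fimfunE h) EFinM -fsumEFin //.
 rewrite ge0_mule_fsuml => [|r]; last exact: nnfun_muleindic_ge0. by apply: eq_fsbigr => r _; rewrite EFinM.
rewrite ge0_integral_fsum //; last 2 first.
- move=> r; apply/mEFinP; apply: mfM => //. exact: mfM.
- move=> r y Dy; rewrite EFinM mule_ge0 //; first exact: nnfun_muleindic_ge0. by rewrite lee_fin w0.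
apply: eq_fsbigr => r; rewrite inE => -[x _ <-].
have r0 : 0 <= h x by exact: fun_ge0.
under eqint do rewrite EFinM.
rewrite ge0_integralZl_EFin //; last first.
 by apply/mEFinP; apply: mfTS; apply: mindic; exact: mh.
rewrite integral_indic // m12 //; last exact: measurableI.
under [RHS]eqint do rewrite -mulrA EFinM.
rewrite ge0_integralZl_EFin //; last 2 first.
- by move=> y Dy; rewrite lee_fin mulr_ge0 // w0.
- by apply/mEFinP; exact: mfM.
congr (_ * _)%E; apply: eqint => y; rewrite inE => Dy.
by congr (_ * _)%:E; rewrite /indic in_setI (mem_set (phiE Dy)) andbT.
Qed.

(** The formula for sets extends to simple functions by linearity and then by monotone
    convergence. *)
Lemma int_transf (F : T1 -> \bar R) : measf setT F ->
 (forall x, 0 <= F x)%E ->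
 (\int[m1]_(x in E) F x = \int[m2]_(y in D) (F (phi y) * (w y)%:E))%E.
move=> mF F0; pose h := nnsfun_approx measurableT mF.
have F0' x : setT x -> (0 <= F x)%E by [].
have FE x : F x = limn (fun k => (h k x)%:E).
 by apply/esym/cvg_lim => //; exact: (cvg_nnsfun_approx measurableT mF F0').
transitivity (limn (fun k => \int[m1]_(x in E) (h k x)%:E)%E).
 under eqint do rewrite FE. apply: monotone_convergence => //.
 - by move=> k; apply/mEFinP; apply: mfTS.
 - by move=> k x _; rewrite lee_fin.
 - by move=> x _ a b ab; rewrite lee_fin; exact/lefP/nd_nnsfun_approx.
transitivity (limn (fun k => \int[m2]_(y in D) (h k (phi y) * w y)%:E)%E).
 by congr (limn _); apply/funext => k; exact: int_transf_nnsfun.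
apply/esym; transitivity (\int[m2]_(y in D) limn (fun k => (h k (phi y) * w y)%:E))%E.
 apply: eqint => y; rewrite inE => Dy; apply/esym/cvg_lim => //. under eq_fun do rewrite EFinM.
 by apply: cvgeZr => //; exact: (cvg_nnsfun_approx measurableT mF F0').
apply: monotone_convergence => //.
- move=> k; apply/mEFinP; apply: mfM => //. exact: (measurable_comp measurableT).
- by move=> k y Dy; rewrite lee_fin mulr_ge0 // w0.
- move=> y Dy a b ab; rewrite lee_fin ler_wpM2r ?w0 //. exact/lefP/nd_nnsfun_approx.
Qed.
End transfer.

(** * Weighted L^2 spaces *)

Section weighted_L2.
Context {d} {T : measurableType d} {R : realType}.
Variables (m : {measure set T -> \bar R}) (w : T -> R) (mw : measf setT w) (w_gt0 : forall x, 0 < w x).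
Implicit Types f h : T -> R.
Definition wL2 f : Prop := measf setT f /\ (\int[m]_x (f x ^+ 2 * w x)%:E < +oo)%E.
Definition wscal f h : R := \int[m]_x (f x * h x * w x).

Let sw x := Num.sqrt (w x).

Let sw2 x : sw x * sw x = w x.
by rewrite -expr2 sqr_sqrtr // ltW. Qed.

Let sw0 x : sw x != 0. Proof. by rewrite gt_eqF // sqrtr_gt0. Qed.

Let msw : measf setT sw.
have ms : measf [set: mTR R] (Num.sqrt : R -> R).
 by apply: continuous_measurable_fun; exact: sqrt_continuous.
exact: (mfT_comp ms mw).
Qed.

(** Multiplication by the square root of the weight is an isometry to the unweighted space, along
    which completeness is transported. *)
Lemma wL2_sqint f : wL2 f <-> sqi m (fun x => f x * sw x).
have E : (\int[m]_x (f x ^+ 2 * w x)%:E = \int[m]_x ((f x * sw x) ^+ 2)%:E)%E.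
 by apply: eqint => x _; rewrite exprMn [sw x ^+ 2]expr2 sw2.
split=> [[mf i]|[mf i]]; split; rewrite ?E //; first exact: mfM.
 by rewrite -E.
have e : f = (fun x => f x * sw x * (sw x)^-1) by apply/funext => x; rewrite mulfK.
rewrite e; apply: mfM => //.
have -> : (fun x => (sw x)^-1) = (fun x => sw x `^ (-1)).
 by apply/funext => x; rewrite powR_inv1 // sqrtr_ge0.
exact: mfT_comp (measurable_powR _) msw.
Qed.

Lemma wscalE f h : wscal f h = sqi_scal m (fun x => f x * sw x) (fun x => h x * sw x).
by apply: eqRint => x _; rewrite mulrACA sw2. Qed.

Lemma wL2i f h : wL2 f -> wL2 h -> m.-integrable setT (EFin \o (fun x => f x * h x * w x)).
move=> /wL2_sqint sf /wL2_sqint sh; have := sqiM sf sh.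
by apply: eq_integrable => // x _ /=; rewrite mulrACA sw2.
Qed.

Let lin_sw a f h : (fun x => linf_ a f h x * sw x) =
 linf_ a (fun x => f x * sw x) (fun x => h x * sw x).
by apply/funext => x; rewrite /linf_ mulrDl mulrA. Qed.

Lemma wL2_prehilbert : prehilbert (@linf_ _ T R) wL2 wscal.
have P := sqi_prehilbert m; split.
- move=> a f h /wL2_sqint sf /wL2_sqint sh; apply/wL2_sqint; rewrite lin_sw. exact: (ph_lin P).
- move=> a f h z /wL2_sqint sf /wL2_sqint sh /wL2_sqint sz. by rewrite !wscalE lin_sw (ph_linl P).
- by move=> f h /wL2_sqint sf /wL2_sqint sh; rewrite !wscalE (ph_sym P).
- by move=> f /wL2_sqint sf; rewrite wscalE (ph_ge0 P).
Qed.

Lemma wL2_compl : compl2 (@linf_ _ T R) wL2 wscal.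
move=> u su cu.
have dE f h : dist2 (@linf_ _ T R) wscal f h =
 dist2 (@linf_ _ T R) (sqi_scal m) (fun x => f x * sw x) (fun x => h x * sw x).
 by rewrite /dist2 /dif wscalE lin_sw.
have [||v sv cv] := @sqi_compl _ T R m (fun k x => u k x * sw x).
- by move=> k; apply/wL2_sqint.
- move=> e e0; have [N hN] := cu e e0; exists N => i j Ni Nj. by rewrite -dE; exact: hN.
have E : (fun x => v x / sw x * sw x) = v by apply/funext => x; rewrite divfK.
exists (fun x => v x / sw x); first by apply/wL2_sqint; rewrite E.
by move=> e e0; have [N hN] := cv e e0; exists N => i Ni; rewrite dE E; exact: hN.
Qed.

Lemma wL2_dom (C : R) f h : measf setT f -> wL2 h ->
 (forall x, `|f x| <= C * `|h x|) -> wL2 f.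
move=> mf /wL2_sqint sh fh; apply/wL2_sqint; apply: sqi_dom sh _; first exact: mfM.
by move=> x; rewrite !normrM mulrA ler_wpM2r.
Qed.

Lemma wL2_ae f h : wL2 f -> measf setT h -> {ae m, forall x, f x = h x} -> wL2 h.
move=> [mf fi] mh fh; split=> //.
have <- // : (\int[m]_x (f x ^+ 2 * w x)%:E = \int[m]_x (h x ^+ 2 * w x)%:E)%E.
apply: ae_eq_integral => //.
- by apply/mEFinP; apply: mfM => //; exact: mfX.
- by apply/mEFinP; apply: mfM => //; exact: mfX.
- by apply: ae1 fh => x ->.
Qed.

Lemma wscal_eq0 f : wL2 f -> wscal f f = 0 -> {ae m, forall x, f x = 0}.
move=> /wL2_sqint sf; rewrite wscalE => h.
have : {ae m, forall x, f x * sw x = 0}.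
 by apply: Rint_sqr_eq0 => //; rewrite -[RHS]h; exact: eqRint.
by apply: ae1 => x /eqP; rewrite mulf_eq0 (negbTE (sw0 x)) orbF => /eqP.
Qed.

Lemma wscal_ae f f' h h' : measf setT f -> measf setT f' ->
 measf setT h -> measf setT h' ->
 {ae m, forall x, f x = f' x} -> {ae m, forall x, h x = h' x} -> wscal f h = wscal f' h'.
move=> mf mf' mh mh' ff hh; apply: ae_eq_Rint.
- by apply: mfM => //; exact: mfM.
- by apply: mfM => //; exact: mfM.
- by apply: ae2 ff hh => x -> ->.
Qed.

Lemma wdist2 f h : dist2 (@linf_ _ T R) wscal f h = \int[m]_x ((f x - h x) ^+ 2 * w x).
by apply: eqRint => x _; rewrite /dif /linf_; ring. Qed.
End weighted_L2.

(** * Squared distances in a prehilbert form *)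

Section dist2.
Context {R : realType} {E : Type}.
Variables (lin : R -> E -> E -> E) (D : set E) (b : E -> E -> R).
Hypothesis H : prehilbert lin D b.
Local Notation dist2 := (dist2 lin b).
Lemma dq_exp x y : D x -> D y -> dist2 x y = b x x - 2 * b x y + b y y.
by move=> Dx Dy; rewrite /dist2 /dif (ph_exp H) // (ph_sym H Dy Dx); ring. Qed.

Lemma dist2_sym x y : D x -> D y -> dist2 x y = dist2 y x.
by move=> Dx Dy; rewrite !dq_exp // (ph_sym H Dy Dx); ring. Qed.

Lemma dq_ge0 x y : D x -> D y -> 0 <= dist2 x y.
by move=> Dx Dy; apply: (ph_ge0 H); exact: (ph_dif H). Qed.

Lemma dist2_tri (t : R) x y z : 0 < t -> D x -> D y -> D z ->
 dist2 x z <= (1 + t) * dist2 x y + (1 + t^-1) * dist2 y z.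
move=> t0 Dx Dy Dz; have Dxy := ph_dif H Dx Dy; have Dyz := ph_dif H Dy Dz.
have := ph_amgm H t0 Dxy Dyz; rewrite -/(dist2 x y) -/(dist2 y z).
have -> : b (dif lin x y) (dif lin y z) = 2^-1 * (dist2 x z - dist2 x y - dist2 y z).
 rewrite /dif (ph_linl H) // !(ph_linr H) // !dq_exp //. by field.
have := ler_norm (2^-1 * (dist2 x z - dist2 x y - dist2 y z)); lra.
Qed.

Lemma dist2_tri2 x y z : D x -> D y -> D z ->
 dist2 x z <= 2 * (dist2 x y + dist2 y z).
move=> Dx Dy Dz; have := dist2_tri ltr01 Dx Dy Dz; rewrite invr1; lra. Qed.

Lemma dist2_lin (a : R) x y x' y' : D x -> D y -> D x' -> D y' ->
 dist2 (lin a x y) (lin a x' y') <= 2 * (a ^+ 2 * dist2 x x' + dist2 y y').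
move=> Dx Dy Dx' Dy'; have Du := ph_dif H Dx Dx'; have Dv := ph_dif H Dy Dy'.
have DL := ph_lin H a Dx Dy; have DL' := ph_lin H a Dx' Dy'.
have -> : dist2 (lin a x y) (lin a x' y') =
 b (lin a (dif lin x x') (dif lin y y')) (lin a (dif lin x x') (dif lin y y')).
 rewrite dq_exp // !(ph_exp H) //. rewrite /dif !(ph_linl H) // !(ph_linr H) //.
 rewrite (ph_sym H Dy Dx') (ph_sym H Dx' Dx) ?(ph_sym H Dy' Dy) ?(ph_sym H Dx' Dy'); ring.
rewrite (ph_exp H) // -/(dist2 _ _) -/(dist2 _ _).
have := ph_ge0 H (ph_lin H (- a) Du Dv).
rewrite (ph_exp H) // -/(dist2 _ _) -/(dist2 _ _) sqrrN; lra.
Qed.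

Lemma dist2_mid x y z : D x -> D y -> D z ->
 dist2 (mid lin x y) z <= 2^-1 * (dist2 x z + dist2 y z).
move=> Dx Dy Dz; have Dm := midE H Dx Dy.
have := dq_ge0 Dx Dy; rewrite !dq_exp // (mid_exp H) // dq_exp //.
by rewrite /mid (ph_linl H) ?(ph_linl H) //; [lra|exact: (ph_lin H)].
Qed.

(** In the weighted triangle inequality the factor 1 + t can be taken close to 1, so the radius is
    preserved exactly in the limit. *)
Lemma dist2_clsd (r : R) x z : D x -> D z -> 0 <= r ->
 (forall e : R, 0 < e -> exists c, [/\ D c, dist2 c z <= r & dist2 c x < e]) -> dist2 x z <= r.
move=> Dx Dz r0 h; apply/ler_addgt0Pl => d d0.
pose t := d / (2 * (r + 1)); have t0 : 0 < t by rewrite divr_gt0 //; lra.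
have s0 : 0 < 1 + t by lra.
have p0 : 0 < 1 + t^-1 by have := invr_gt0 t; rewrite t0 => ?; lra.
have [c [Dc cz cx]] := h _ (divr_gt0 (divr_gt0 d0 (ltr0n R 2)) p0).
have := dist2_tri (x := x) (z := z) (y := c) (t := t^-1) _ Dx Dc Dz; rewrite invr_gt0 => /(_ t0).
rewrite invrK (dist2_sym Dx Dc) => h1; apply: le_trans h1 _.
have h2 : (1 + t) * dist2 c z <= (1 + t) * r by rewrite ler_wpM2l // ltW.
have h3 : (1 + t^-1) * dist2 c x <= d / 2 by rewrite mulrC -ler_pdivlMr //; exact: ltW.
have h4 : t * r <= d / 2.
 rewrite /t mulrAC ler_pdivrMr; last by lra. have -> : d / 2 * (2 * (r + 1)) = d * r + d by field. lra.
lra.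
Qed.
End dist2.

Lemma Rint_dom d (T : measurableType d) (R : realType) (m : {measure set T -> \bar R})
 (F : nat -> T -> R) (f h : T -> R) : (forall k, measf setT (F k)) ->
 measf setT f -> m.-integrable setT (EFin \o h) ->
 (forall x, F k x @[k --> \oo] --> f x) -> (forall k x, `|F k x| <= h x) ->
 \int[m]_x F k x @[k --> \oo] --> \int[m]_x f x.
by move=> mF mf ih cF hF; apply: (Rint_dom_ae measurableT mF mf ih); exact: aeT.
Qed.

Lemma der_lip1 (R : realType) (G G1 : R -> R) : (forall s : R, isD s (1 : R) G (G1 s)) ->
 (forall s, `|G1 s| <= 1) -> forall s t, `|G s - G t| <= `|s - t|.
move=> dG b s t; wlog ts : s t / t <= s.
 move=> hw; case/orP: (le_total t s) => [/hw//|/hw]. by rewrite (distrC (G t)) (distrC t).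
have cd : {within `[t, s], continuous G}.
 by apply: derivable_within_continuous => x _; have [] := dG x.
have [x _ ->] := MVT_segment ts (fun x _ => dG x) cd.
by rewrite normrM ler_piMl.
Qed.

Section weighted_manifold.
Context {R : realType} {n : nat} {M : ptopologicalType}.
Variables (S : smooth_manifold R n M) (g : riemannian_metric S) (vol : {measure set (borel M) -> \bar R}) (vol_g : is_riemannian_measure g vol) (Psi : M -> R) (Psi_smooth : smooth S Psi) (Psi_gt0 : forall x, 0 < Psi x) (mu : {measure set (borel M) -> \bar R}) (mu_Psi : is_weighted_measure vol Psi mu).
Local Notation bmeas := (measf [set: borel M]).
Local Notation mint f := (mu.-integrable [set: borel M] (EFin \o f)).

(** * The weighted measure in charts *)

Section chart_measure.
Implicit Types (c d : chart R n M) (x z : M) (F H : M -> R).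
Local Notation Om c := (fwd c @` dom c).
Local Notation dens := (dens g Psi).
Lemma ms_smooth F : (forall x, sma S F x) -> bmeas F.
move=> sF; apply: (@cont_on_meas _ M setT) => [|x _]; first exact: openT.
exact: sma_cont (sF x).
Qed.

Lemma ms_smooth_on (D : set M) F : open D -> (forall x, D x -> sma S F x) ->
 measf (D : set (borel M)) F.
move=> oD sF; apply: cont_on_meas => // x Dx.
exact: sma_cont (sF x Dx).
Qed.

Lemma ms_dom c : measurable (dom c : set (borel M)).
by apply: om_borel; exact: open_dom. Qed.

Lemma ms_Om c : measurable (Om c : set (borel 'rV[R]_n)).
by apply: om_borel; exact: open_codom. Qed.

Lemma ms_bwd c : measf (Om c : set (borel 'rV[R]_n)) (bwd c : _ -> borel M).
apply: borel_meas_fun; first exact: ms_Om.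
by move=> A oA; apply: om_borel; exact: open_chart_im.
Qed.

Lemma ms_on_chart c F : measf (dom c : set (borel M)) F ->
 measf (Om c : set (borel 'rV[R]_n)) (F \o bwd c).
move=> mF; apply: (@measurable_comp _ _ _ _ (borel M) _ (dom c)) => //.
- exact: ms_dom.
- by move=> _ [y Oy <-]; exact: (ch_bwd Oy).1.
- exact: ms_bwd.
Qed.

Lemma sma_sqrt_det c x : atlas S c -> dom c x -> sma S (sqrt_det g c) x.
move=> ac cx; apply: sma_sqrt; first exact: det_gramc_gt0.
by apply: sma_det => i j; exact: sma_gramc.
Qed.

Lemma vol_chart c (F : M -> \bar R) : atlas S c -> bmeas F ->
 (forall x, 0 <= F x)%E ->
 (\int[vol]_(x in dom c) F x =
 \int[leb n]_(y in Om c) (F (bwd c y) * (sqrt_det g c (bwd c y))%:E))%E.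
move=> ac mF F0.
have ms : measf (Om c : set (borel 'rV[R]_n)) (sqrt_det g c \o bwd c).
 apply: ms_on_chart; apply: ms_smooth_on; first exact: open_dom. by move=> x cx; exact: sma_sqrt_det.
apply: (@int_transf _ _ (borel M) (borel 'rV[R]_n) R vol (leb n) (dom c) (Om c)
 (bwd c) (sqrt_det g c \o bwd c)) => //.
- exact: ms_dom.
- exact: ms_Om.
- exact: ms_bwd.
- by move=> y _; exact: sqrtr_ge0.
- by move=> y Oy; exact: (ch_bwd Oy).1.
move=> A mA Ac; rewrite (vol_g ac mA Ac).
have E : (fun y => (\1_(fwd c @` A) y * sqrt_det g c (bwd c y))%:E) =
 ((fun y => (\1_A (bwd c y) * sqrt_det g c (bwd c y))%:E) \_ (Om c)).
 apply/funext => y; rewrite patchE; case: ifPn; rewrite ?inE ?notin_setE => Oy.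
 congr (_ * _)%:E; rewrite /indic; congr (nat_of_bool _)%:R. apply/idP/idP => /set_mem h; apply/mem_set.
 by case: h => x Ax <-; rewrite fwdK //; exact: Ac.
 by exists (bwd c y) => //; exact: (ch_bwd Oy).2.
 rewrite /indic memNset ?mul0r // => -[x Ax xy]; apply: Oy. by exists x => //; exact: Ac.
rewrite E -leb_int.
- by rewrite [RHS]integral_mkcond.
- apply/(measurable_restrictT _ (ms_Om c)). apply/mEFinP; apply: mfM => //.
 apply: (@ms_on_chart c (\1_A)); apply: mfTS. exact: mindic.
- move=> y; rewrite patchE; case: ifP => // _; rewrite lee_fin mulr_ge0 //. exact: sqrtr_ge0.
Qed.

Lemma mu_chart c (F : M -> \bar R) : atlas S c -> bmeas F ->
 (forall x, 0 <= F x)%E ->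
 (\int[mu]_(x in dom c) F x =
 \int[leb n]_(y in Om c) (F (bwd c y) * (dens c (bwd c y))%:E))%E.
move=> ac mF F0.
have md : measf (Om c : set (borel 'rV[R]_n)) (dens c \o bwd c).
 apply: ms_on_chart; apply: ms_smooth_on; first exact: open_dom. by move=> x cx; exact: sma_dens.
have mPsi := ms_smooth ((smoothP S Psi).1 Psi_smooth).
apply: (@int_transf _ _ (borel M) (borel 'rV[R]_n) R mu (leb n) (dom c) (Om c)
 (bwd c) (dens c \o bwd c)) => //.
- exact: ms_dom.
- exact: ms_Om.
- exact: ms_bwd.
- by move=> y Oy; apply: ltW; apply: dens_gt0 => //; exact: (ch_bwd Oy).1.
- by move=> y Oy; exact: (ch_bwd Oy).1.
move=> A mA Ac; rewrite mu_Psi //.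
transitivity (\int[vol]_(x in dom c) (\1_A x * Psi x)%:E)%E.
 rewrite integral_mkcond [RHS]integral_mkcond; apply: eqint => x _; rewrite !patchE.
 have [Ax|Ax] := pselect (A x).
 by rewrite !mem_set ?indicE ?mem_set ?mul1r //; exact: Ac.
 by rewrite memNset // indicE (memNset Ax) mul0r; case: ifP.
rewrite vol_chart //.
- by apply: eqint => y _ /=; rewrite /dens -EFinM mulrA.
- by apply/mEFinP; apply: mfM => //; exact: mindic.
- by move=> x; rewrite lee_fin mulr_ge0 // ltW.
Qed.

(** Density of F mu with respect to Lebesgue measure in the chart, continued by zero. *)
Definition pull c F (y : 'rV[R]_n) : R :=
 if `[< Om c y >] then F (bwd c y) * dens c (bwd c y) else 0.

Lemma ms_pull c F : atlas S c -> measf (dom c : set (borel M)) F ->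
 measf [set: borel 'rV[R]_n] (pull c F).
move=> ac mF; have -> : pull c F = (fun y => F (bwd c y) * dens c (bwd c y)) \_ (Om c).
 by apply/funext => y; rewrite /pull patchE /in_mem /=.
apply/(measurable_restrictT _ (ms_Om c)); apply: mfM.
 exact: ms_on_chart.
apply: ms_on_chart; apply: ms_smooth_on; first exact: open_dom.
by move=> x cx; exact: sma_dens.
Qed.

Lemma ge0_int_pull c F : atlas S c -> bmeas F ->
 (forall x, 0 <= F x) -> (forall x, ~ dom c x -> F x = 0) ->
 (\int[mu]_x (F x)%:E = \int[leb n]_y (pull c F y)%:E)%E.
move=> ac mF F0 Fc; have mF' : bmeas (EFin \o F) by exact/mEFinP.
transitivity (\int[mu]_(x in dom c) (F x)%:E)%E.
 rewrite [RHS]integral_mkcond; apply: eqint => x _; rewrite patchE.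
 by case: ifPn => //; rewrite notin_setE => /Fc ->.
rewrite (mu_chart ac mF') => [|x]; last by rewrite lee_fin.
rewrite integral_mkcond; apply: eqint => y _; rewrite patchE /pull.
case: ifPn; rewrite ?inE ?notin_setE => Oy; case: asboolP => //.
Qed.

Lemma pull_ge0 c F y : atlas S c -> (forall x, 0 <= F x) -> 0 <= pull c F y.
move=> ac F0; rewrite /pull; case: asboolP => // Oy; rewrite mulr_ge0 // ltW //.
by apply: dens_gt0 => //; exact: (ch_bwd Oy).1.
Qed.

Lemma pull_maxr c F y : atlas S c -> pull c (fun x => Num.max (F x) 0) y = Num.max (pull c F y) 0.
move=> ac; rewrite /pull; case: asboolP => Oy; last by rewrite maxxx.
have d0 : 0 < dens c (bwd c y) by apply: dens_gt0 => //; exact: (ch_bwd Oy).1.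
by rewrite maxr_pMl ?mul0r // ltW.
Qed.

Lemma pullN c F y : pull c (fun x => - F x) y = - pull c F y.
by rewrite /pull; case: asboolP => _; rewrite ?oppr0 ?mulNr. Qed.

Lemma int_pull c F : atlas S c -> bmeas F ->
 (forall x, ~ dom c x -> F x = 0) ->
 (\int[mu]_x (F x)%:E = \int[leb n]_y (pull c F y)%:E)%E.
move=> ac mF Fc; rewrite integralE [RHS]integralE; congr (_ - _)%E.
 have -> : (fun x => (F x)%:E)^\+%E = (fun x => (Num.max (F x) 0)%:E).
 by apply/funext => x; rewrite funeposE -EFin_max.
 have -> : (fun y => (pull c F y)%:E)^\+%E = (fun y => (pull c (fun x => Num.max (F x) 0) y)%:E).
 by apply/funext => x; rewrite funeposE -EFin_max pull_maxr.
 apply: ge0_int_pull => // [|x|x /Fc ->]; last by rewrite maxxx.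
 exact: measurable_funrpos.
 by rewrite le_max lexx orbT.
have -> : (fun x => (F x)%:E)^\-%E = (fun x => (Num.max (- F x) 0)%:E).
 by apply/funext => x; rewrite funenegE -EFin_max.
have -> : (fun y => (pull c F y)%:E)^\-%E = (fun y => (pull c (fun x => Num.max (- F x) 0) y)%:E).
 by apply/funext => x; rewrite funenegE pull_maxr // pullN -EFin_max.
apply: ge0_int_pull => // [|x|x /Fc ->]; last by rewrite oppr0 maxxx.
 exact: measurable_funrneg.
by rewrite le_max lexx orbT.
Qed.

Lemma Rint_pull c F : atlas S c -> bmeas F ->
 (forall x, ~ dom c x -> F x = 0) ->
 \int[mu]_x F x = \int[leb n]_y (pull c F y).
by move=> ac mF Fc; rewrite /Rintegral (int_pull ac). Qed.

Lemma ms_charts F : (forall c, atlas S c -> measf (dom c : set (borel M)) F) ->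
 bmeas F.
move=> h; have [p hp] := ctbl_bumps S.
have -> : [set: borel M] = \bigcup_k (dom (chart_at S (p k)) : set (borel M)).
 rewrite eqEsubset; split=> // z _; have [k hk] := hp z; exists k => //.
 by apply: contrapT => nd; move: hk; rewrite bmp_out ?ltxx // => -[].
apply/measurable_fun_bigcup => [k|k]; first exact: ms_dom.
by apply: h; exact: chatP.
Qed.

Lemma ms_scal (X Y : M -> 'rV[R]_n) : mfld S X -> mfld S Y ->
 bmeas (scal g X Y).
move=> mX mY; apply: ms_charts => c ac.
apply: (eq_measurable_fun (fun x : borel M => \sum_j (\sum_i in_chart S c X x 0 i * gram_in_chart S g c x i j)
 * in_chart S c Y x 0 j)).
 move=> x; rewrite inE => cx; rewrite (scal_chart g X Y ac cx) /qf [RHS]mxE.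
 by apply: eq_bigr => j _; congr (_ * _); rewrite [RHS]mxE.
apply: measurable_sum => j; apply: mfM; last exact: mY.
apply: measurable_sum => i; apply: mfM; first exact: mX.
by apply: ms_smooth_on; [exact: open_dom|move=> x cx; exact: sma_gramc].
Qed.

Lemma ms_smooth_fld (X : M -> 'rV[R]_n) : (forall x, sm_fld_at S X x) -> mfld S X.
move=> sX c ac k; apply: ms_smooth_on; first exact: open_dom.
by move=> x cx; exact: (sm_fld_chart ac cx (sX x)).
Qed.

Lemma ms_fld_lin (a : R) (X Y : M -> 'rV[R]_n) : mfld S X ->
 mfld S Y -> mfld S (fun x => a *: X x + Y x).
move=> mX mY c ac k; under eq_fun do rewrite in_chart_lin mxE [X in X + _]mxE.
by apply: measurable_funD; [apply: mfM => //; exact: mX|exact: mY].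
Qed.

Lemma ms_fldZ F (X : M -> 'rV[R]_n) : bmeas F ->
 mfld S X -> mfld S (fun x => F x *: X x).
move=> mF mX c ac k; under eq_fun do rewrite in_chartZ mxE.
by apply: mfM; [exact: mfTS|exact: mX].
Qed.

Lemma mu_cellat_fin x : (mu (cellat S x) < +oo)%E.
have [r0 r4 QO] := radiusP S x; set c := chart_at S x in QO; set a := fwd c x in QO.
have ac : atlas S c by exact: chatP.
have mC : measurable (cellat S x : set (borel M)).
 apply: clsd_meas_borel; apply: compact_closed; first exact: manifold_hausdorff S. exact: cpt_cellat.
have cd y : cube a (radius S x) y -> dom c (bwd c y) by move=> /QO/ch_bwd[].
have [C hC] : exists C : R, forall z, cellat S x z -> dens c z <= C.
 have wd : {within cellat S x, continuous (dens c)}.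
 apply: continuous_in_subspaceT => z; rewrite inE => -[cz _]. by apply: (@sma_cont _ _ _ S); exact: sma_dens.
 have ne : cellat S x !=set0.
 exists x; split; first exact: chart_at_dom. by move=> i /=; rewrite subrr normr0 ltW.
 have [z _ hz] := compact_EVT_max ne (cpt_cellat (x := x)) wd. by exists (dens c z) => t Ct; apply: hz; rewrite inE.
rewrite -[cellat S x]setIT -integral_indic // (ge0_int_pull (F := \1_(cellat S x)) ac) //; last first.
- by move=> z cz; rewrite indicE memNset // => -[].
apply: (@le_lt_trans _ _ (\int[leb n]_y (`|C| * \1_(cube a (radius S x)) y)%:E)%E).
 apply: ge0_le_integral => //.
 - by move=> y _; rewrite lee_fin pull_ge0.
 - by apply/mEFinP; apply: ms_pull.
 - apply/mEFinP; apply: mfM => //. by apply: mindic; exact: ms_cube.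
 - move=> y _; rewrite lee_fin /pull; case: asboolP => Oy; last by rewrite mulr_ge0.
 have [Cy|Cy] := pselect (cellat S x (bwd c y)); last first.
 by rewrite [X in X * _]indicE memNset // mul0r mulr_ge0.
 have Qy : cube a (radius S x) y by case: Cy => _ /=; rewrite (ch_bwd Oy).2.
 rewrite !indicE !mem_set // mul1r mulr1; exact: le_trans (hC _ Cy) (ler_norm _).
under eqint do rewrite EFinM.
rewrite ge0_integralZl_EFin //; last first.
 by apply/mEFinP; apply: mindic; exact: ms_cube.
rewrite integral_indic //; last exact: ms_cube.
rewrite setIT lte_mul_pinfty //.
exact: leb_cube_fin.
Qed.

(** Finitely many cells cover [K], and each cell has finite measure because the density is bounded
    on it. *)
Lemma mu_cpt_fin (K : set M) : compact K -> (mu K < +oo)%E.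
move=> cK; have [l hl] := cpt_bumps S cK.
have mC x : measurable (cellat S x : set (borel M)).
 apply: clsd_meas_borel; apply: compact_closed; first exact: manifold_hausdorff S. exact: cpt_cellat.
have mK : measurable (K : set (borel M)).
 by apply: clsd_meas_borel; apply: compact_closed => //; exact: manifold_hausdorff S.
pose U := \big[setU/set0]_(x <- l) (cellat S x : set (borel M)).
have KU : K `<=` U.
 move=> z /hl; rewrite /U; elim: l {hl U} => [|x l IH]; first by rewrite !big_nil ltxx.
 rewrite !big_cons; have [cz|cz] := pselect (cellat S x z); first by left.
 by rewrite bmp_out // add0r => /IH; right.
have mU : measurable (U : set (borel M)) by apply: bigsetU_measurable => x _; exact: mC.
apply: (@le_lt_trans _ _ (mu U)); first by apply: le_measure; rewrite ?inE.
rewrite /U; elim: l {hl KU mU U} => [|x l IH]; first by rewrite big_nil measure0.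
rewrite big_cons; apply: le_lt_trans (measureU2 _ _ _) _ => //.
 by apply: bigsetU_measurable => y _; exact: mC.
by apply: lte_add_pinfty => //; exact: mu_cellat_fin.
Qed.
End chart_measure.

(** * Vanishing almost everywhere, tested by smooth functions *)

Section divergence.
Implicit Types (c d : chart R n M) (x z : M) (F H : M -> R) (Y Z : M -> 'rV[R]_n).
Local Notation at_ x := (chart_at S x).
Local Notation Om c := (fwd c @` dom c).
Local Notation dens := (dens g Psi).
Local Notation divc := (divc g Psi).
Local Notation wdiv := (weighted_div g Psi).
Lemma cpt_meas (K : set M) : compact K -> measurable (K : set (borel M)).
by move=> cK; apply: clsd_meas_borel; apply: compact_closed => //;
 exact: manifold_hausdorff S.
Qed.

Lemma cont_bdd_cpt (K : set M) F : compact K ->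
 (forall x, K x -> {for x, continuous F}) -> exists2 C : R, 0 <= C & forall x, K x -> `|F x| <= C.
move=> cK cF; have [K0|/set0P ne] := eqVneq K set0.
 by exists 0 => // x; rewrite K0.
have w : {within K, continuous (fun x => `|F x|)}.
 apply: continuous_in_subspaceT => x; rewrite inE => Kx.
 by apply: continuous_comp; [exact: cF|exact: norm_continuous].
have [z _ hz] := compact_EVT_max ne cK w.
by exists `|F z| => // x Kx; apply: hz; rewrite inE.
Qed.

Lemma bdd_intble_cpt (K : set M) F : compact K ->
 measf (K : set (borel M)) F ->
 (exists C : R, forall x, K x -> `|F x| <= C) -> mu.-integrable (K : set (borel M)) (EFin \o F).
move=> cK mF [C hC].
apply: (measurable_bounded_integrable (cpt_meas cK)) => //.
 exact: (mu_cpt_fin cK).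
exists C; split; first exact: num_real.
by move=> y Cy x Kx; apply: le_trans (ltW Cy); exact: hC.
Qed.

Lemma loc_L1_cont F : continuous F -> locally_L1 mu F.
move=> cF; have mF : bmeas F.
 by apply: (@cont_on_meas _ M setT) => [|x _]; [exact: openT|exact: cF].
split=> // K cK; apply: bdd_intble_cpt => //; first exact: mfTS.
have [C _ hC] := cont_bdd_cpt cK (fun x _ => cF x).
by exists C.
Qed.

Lemma intble_supp (K : set M) F : compact K -> bmeas F ->
 (forall x, ~ K x -> F x = 0) ->
 mu.-integrable (K : set (borel M)) (EFin \o F) -> mint F.
move=> cK mF F0 /(integrable_mkcond _ (cpt_meas cK)).
apply: eq_integrable => // x _; rewrite patchE /=; case: ifPn => //.
by rewrite notin_setE => /F0 ->.
Qed.

Lemma Cc_intble F : Cc_infty S F -> mint F.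
move=> cF; have sF := Cc_sm cF; have [_ [K cK K0]] := cF.
have [mF lF] := loc_L1_cont (fun x => sma_cont (sF x)).
exact: (intble_supp cK mF K0 (lF K cK)).
Qed.

Lemma loc_L1_mul_Cc f F : locally_L1 mu f -> Cc_infty S F ->
 mint (fun x => f x * F x).
move=> [mf lf] cF; have sF := Cc_sm cF; have [_ [K cK K0]] := cF.
have mF := ms_smooth sF.
have [C C0 hC] := cont_bdd_cpt cK (fun x _ => sma_cont (sF x)).
apply: (intble_supp cK); first exact: mfM.
 by move=> x /K0 ->; rewrite mulr0.
have := integrableZl (cpt_meas cK) C (lf K cK).
apply: le_integrable; first exact: cpt_meas.
 by apply/mEFinP; apply: mfTS; exact: mfM.
move=> x Kx /=; rewrite lee_fin !normrM mulrC ler_wpM2r //.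
by apply: le_trans (hC x Kx) (ler_norm _).
Qed.

Lemma bump_in_cpt (A : set M) z : open A -> A z -> exists eta, exists K : set M,
 [/\ Cc_infty S eta, forall x, 0 <= eta x, 0 < eta z, compact K /\ K `<=` A &
 forall x, ~ K x -> eta x = 0].
move=> oA Az; set c := at_ z; set a := fwd c z.
have ac : atlas S c by exact: chatP.
have cz : dom c z by exact: chart_at_dom.
have h : nbhs a (Om c `&` bwd c @^-1` A).
 apply: onbhs; split; first exact: open_chart_im. by split; [exact: fwd_in|rewrite /= fwdK].
move: h => /nbhs_ballP[e /= e0 he].
have e2 : 0 < e / 2 by lra.
have Qe y : cube a (e / 2) y -> (Om c `&` bwd c @^-1` A) y.
 move=> Qy; apply: he; rewrite -ball_normE /=; apply: (@le_lt_trans _ _ (e / 2)); last lra.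
 apply: norm_row_le; first lra. by move=> i; have := Qy i; rewrite !mxE distrC.
exists (push c (cube_bump a (e / 2))), (cell c a (e / 2)); split.
- apply: (@push_Cc _ _ _ S c _ a (e / 2)) => //; first by move=> y /Qe [].
 exact: cube_bump_smooth.
 by move=> y; exact: cube_bump_out.
- by move=> x; rewrite /push; case: asboolP => // _; exact: cube_bump_ge0.
- by rewrite pushE //; exact: cube_bump_gt0.
- split; first by apply: cpt_cell => y /Qe []. by move=> x [cx /Qe [_]] /=; rewrite fwdK.
- by move=> x; apply: push_out => y; exact: cube_bump_out.
Qed.

Lemma bump_in (A : set M) z : open A -> A z -> exists eta, [/\ Cc_infty S eta,
 forall x, 0 <= eta x, 0 < eta z & forall x, eta x != 0 -> A x].
move=> oA Az; have [eta [K [ce e0 ez [cK KA] K0]]] := bump_in_cpt oA Az.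
exists eta; split=> // x ex; apply: KA; apply: contrapT => /K0 e.
by rewrite e eqxx in ex.
Qed.

Lemma bp1_Cc eta k : Cc_infty S eta -> Cc_infty S (fun x => bp1 (k.+1%:R * eta x)).
move=> ce; have se := Cc_sm ce; have [_ [K cK K0]] := ce.
apply: (Cc_supp cK) => [x /K0 ->|x _]; first by rewrite mulr0 bp1_eq0.
apply: (@sma_comp1 _ _ _ S setT bp1) => //; [exact: openT|exact: smooth1_flat|].
by apply: smaM => //; exact: sma_cst.
Qed.

(** Positivity sets of test functions: products make them stable under intersection, second
    countability makes them generate the Borel sets, and their indicators are limits of test
    functions. *)
Definition pos_sets : set (set M) :=
 [set A | exists eta, [/\ Cc_infty S eta, forall x, 0 <= eta x & A = [set x | 0 < eta x]]].

Lemma positivity_sets_borel : @measurable _ (borel M) = <<s pos_sets >>.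
rewrite eqEsubset; split; last first.
 apply: smallest_sub; first exact: sigma_algebra_measurable.
 move=> _ [eta [ce e0 ->]]; apply: om_borel; apply: open_sm_gt. exact: Cc_sm ce.
apply: smallest_sub; first exact: smallest_sigma_algebra.
move=> A oA.
have [B cB [Bo Bb]] := manifold_second_countable S.
have [h hinj] : exists h : set M -> nat, {in B &, injective h} by apply/countable_injP.
(* For each index of a basic open set, one positivity set between it and [A] is chosen, so that [A]
   becomes a countable union. *)
pose P k (G : set M) := pos_sets G /\ G `<=` A /\ exists2 b, B b /\ h b = k & b `<=` G.
pose G k := xget set0 (P k).
have Gp k : pos_sets (G k) \/ G k = set0.
 by rewrite /G; case: xgetP => [g' _ []|_]; [left|right].
have GA k : G k `<=` A by rewrite /G; case: xgetP => [g' _ [_ []]//|_]; exact: sub0set.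
have -> : A = \bigcup_k G k.
 rewrite eqEsubset; split=> [z Az|z [k _ /GA//]]. have [eta [ce e0 ez eA]] := bump_in oA Az.
 have oz : open [set x | 0 < eta x] by apply: open_sm_gt; exact: Cc_sm ce.
 have [b [Bb' bz] hb] := Bb z _ (onbhs (conj oz ez)).
 exists (h b) => //; rewrite /G; case: xgetP => [G' _ [_ [_ [b' [Bb'' e] bG]]]|].
 by apply: bG; have -> : b' = b by apply: hinj => //; rewrite inE.
 move=> /(_ [set x | 0 < eta x]); case; split; first by exists eta. split; last by exists b.
 by move=> x /= ex; apply: eA; rewrite gt_eqF.
apply: (@bigcupT_measurable _ (g_sigma_algebraType pos_sets)) => k.
have [p|->] := Gp k; last exact: measurable0.
exact: sub_sigma_algebra.
Qed.

(** The test functions [bp1] of (k+1) eta are bounded by 1 and tend to the indicator of {eta > 0},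
    so [h] has zero integral over every positivity set. *)
Lemma ae_zero_Cc h : locally_L1 mu h ->
 (forall eta, Cc_infty S eta -> \int[mu]_x (h x * eta x) = 0) -> {ae mu, forall x, h x = 0}.
move=> lh h0; have [mh hK] := lh.
have [p hp] := ctbl_bumps S.
apply: (@ae_zero_pi _ (borel M) _ mu pos_sets (fun k => [set x | 0 < bmp S (p k) x])) => //.
- exact: positivity_sets_borel.
- move=> _ _ [e1 [c1 p1 ->]] [e2 [c2 p2 ->]]; exists (fun x => e1 x * e2 x); split.
 + by apply: Cc_mul => //; exact: Cc_sm.
 + by move=> x; exact: mulr_ge0.
 + rewrite eqEsubset; split=> x /=; first by move=> [a b]; exact: mulr_gt0.
 move=> h12; have := p1 x; have := p2 x; rewrite !le_eqVlt => /predU1P[e|->].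
 by move: h12; rewrite -e mulr0 ltxx.
 by move=> /predU1P[e|->//]; move: h12; rewrite -e mul0r ltxx.
- by move=> k; exists (bmp S (p k)); split=> //; [exact: bmp_Cc|exact: bmp_ge0].
- by rewrite eqEsubset; split=> // z _; have [k hk] := hp z; exists k.
- move=> _ [eta [ce e0 ->]]; have [_ [K cK K0]] := ce. apply: (@integrableS _ _ _ mu (K : set (borel M))) (hK K cK).
 + exact: cpt_meas.
 + by apply: om_borel; apply: open_sm_gt; exact: Cc_sm ce.
 + by move=> x /= ex; apply: contrapT => /K0 e; move: ex; rewrite e ltxx.
move=> _ [eta [ce e0 ->]]; have [_ [K cK K0]] := ce; set A := [set x | 0 < eta x].
have mA : measurable (A : set (borel M)).
 by apply: om_borel; apply: open_sm_gt; exact: Cc_sm ce.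
have AK : A `<=` K by move=> x /= ex; apply: contrapT => /K0 e; move: ex; rewrite /A /= e ltxx.
rewrite integral_mkcond.
have m1 k : bmeas (fun x => (h x * bp1 (k.+1%:R * eta x))%:E).
 apply/mEFinP; apply: mfM => //. by apply: ms_smooth; exact: Cc_sm (bp1_Cc k ce).
have m2 : bmeas ((fun x => (h x)%:E) \_ A).
 by apply/(measurable_restrictT _ mA); apply: mfTS; apply/mEFinP.
have i3 : mu.-integrable setT (fun x => `|((fun x => (h x)%:E) \_ (K : set (borel M))) x|)%E.
 by apply: integrable_abse; apply/(integrable_mkcond _ (cpt_meas cK)); exact: hK.
have [||_ _ cv] := dominated_convergence measurableT m1 m2 _ i3 _.
- apply: nearW => x _; rewrite patchE; case: ifPn; rewrite ?inE ?notin_setE /A /= => ex.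
 apply: cvg_EFin; first exact: nearW.
 by rewrite -[X in _ --> X]mulr1; apply: cvgM; [exact: cvg_cst|exact: bp1_cvg].
 have e1 : eta x = 0 by apply/eqP; rewrite eq_le e0 andbT leNgt; exact/negP.
 rewrite e1; under eq_fun do rewrite mulr0 bp1_eq0 // mulr0; exact: cvg_cst.
- apply: nearW => x k _; rewrite patchE; case: ifPn; rewrite ?inE ?notin_setE => Kx.
 rewrite !abse_EFin lee_fin normrM ler_piMr //. by rewrite ger0_norm ?bp1_le1 // bp1_ge0.
 by rewrite (K0 _ Kx) mulr0 bp1_eq0 // mulr0 abse0.
have z k : (\int[mu]_x (h x * bp1 (k.+1%:R * eta x))%:E = 0)%E.
 rewrite int_Rint ?h0 //; first exact: bp1_Cc. exact: loc_L1_mul_Cc lh (bp1_Cc k ce).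
by rewrite -(cvg_lim _ cv) //; under eq_fun do rewrite z; rewrite lim_cst.
Qed.

Lemma leb_cube_gt0 (a : 'rV[R]_n) (r : R) : 0 < r -> (0 < leb n (cube a r))%E.
move=> r0.
have E : leb n (cube a r) = (\prod_(i < n) (2 * r)%:E)%E.
 rewrite -[X in leb n X]setIT -integral_indic //; last exact: ms_cube.
 pose q (i : 'I_n) (t : R) : \bar R := (\1_(`[a 0 i - r, a 0 i + r]%classic : set R) t)%:E.
 rewrite (eqint (fun v : borel 'rV[R]_n => \prod_i q i ((v : 'rV[R]_n) 0%R i))%E); last first.
 move=> v _; rewrite /q prodEFin; congr EFin. have [Qy|Qy] := pselect (cube a r v).
 rewrite indicE mem_set // big1 // => i _; rewrite indicE mem_set //= in_itv /=.
 by have := Qy i; rewrite ler_distl.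
 rewrite indicE memNset //; have [i hi] : exists i, ~ `|(v : 'rV[R]_n) 0 i - a 0 i| <= r by apply/existsNP.
 by rewrite (bigD1 i) //= indicE memNset ?mul0r //= in_itv /= -ler_distl.
 rewrite int_leb_prod // => [|i|i t]; last by rewrite lee_fin.
 apply: eq_bigr => i _; rewrite /q integral_indic // setIT.
 rewrite [LHS](lebesgue_measure_itv `[a 0 i - r, a 0 i + r]) /= lte_fin ifT; last by lra.
 by rewrite -EFinB; congr EFin; ring.
 apply/mEFinP; apply: mindic; exact: measurable_itv.
by rewrite E prodEFin lte_fin; apply: prodr_gt0 => i _; lra.
Qed.

(** After a cutoff to a chart around [z], the product with the density stays above half its value at
    [z] on a small cube, and that cube has positive volume. *)
Lemma Cc_ae0 eta z : Cc_infty S eta -> (forall x, 0 <= eta x) -> 0 < eta z ->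
 ~ {ae mu, forall x, eta x = 0}.
move=> ce e0 ez ae0; set c := at_ z; set a := fwd c z.
have ac : atlas S c by exact: chatP.
have cz : dom c z by exact: chart_at_dom.
have [b [cb b0 bz bc]] := bump_in (@open_dom _ _ _ c) cz.
pose F x := eta x * b x.
have cF : Cc_infty S F by apply: Cc_mul => //; exact: Cc_sm.
have mF := ms_smooth (Cc_sm cF).
have Fd x : ~ dom c x -> F x = 0.
 by move=> cx; rewrite /F; have [->|/bc//] := eqVneq (b x) 0; rewrite mulr0.
have F0 x : 0 <= F x by exact: mulr_ge0.
have iF : (\int[mu]_x (F x)%:E = 0)%E.
 rewrite -(integral0 mu setT); apply: ae_eq_integral => //.
 - exact/mEFinP.
 - by apply: ae1 ae0 => x ex _; rewrite /F ex mul0r.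
rewrite (ge0_int_pull ac mF F0 Fd) in iF.
have Fz : 0 < F z * dens c z by apply: mulr_gt0; [exact: mulr_gt0|exact: dens_gt0].
have : \forall y \near a, F z * dens c z / 2 < F (bwd c y) * dens c (bwd c y).
 have cc : {for a, continuous (fun y => F (bwd c y) * dens c (bwd c y))}.
 apply: (@continuous_comp _ _ _ (bwd c) (fun x => F x * dens c x)).
 by apply: bwd_continuous; exact: fwd_in.
 rewrite /a fwdK //; apply: (@sma_cont _ _ _ S); apply: smaM; first exact: Cc_sm cF z. exact: sma_dens.
 apply: (cc [set s | F z * dens c z / 2 < s]); apply: onbhs; split; first exact: open_gt.
 by rewrite /= /a fwdK //; lra.
have : \forall y \near a, Om c y.
 by apply: onbhs; split; [exact: open_codom|exact: fwd_in].
move=> h1 h2; have [e /= e1 he] : exists2 e : R, 0 < e & ball a e `<=` [set y | Om c y /\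
 F z * dens c z / 2 < F (bwd c y) * dens c (bwd c y)].
 by apply/nbhs_ballP; apply: filterI.
have : ((F z * dens c z / 2)%:E * leb n (cube a (e / 2)) <= \int[leb n]_y (pull c F y)%:E)%E.
 rewrite -[X in (_ * leb n X)%E]setIT -integral_indic //; last exact: ms_cube.
 rewrite -ge0_integralZl_EFin //; last 2 first.
 - by apply/mEFinP; apply: mindic; exact: ms_cube.
 - lra.
 apply: ge0_le_integral => //.
 - by move=> y _; rewrite -EFinM lee_fin mulr_ge0 //; lra.
 - apply/mEFinP; apply: mfM => //; apply: mindic; exact: ms_cube.
 - by apply/mEFinP; apply: ms_pull => //; exact: mfTS.
 - move=> y _; rewrite -EFinM lee_fin. have [Qy|Qy] := pselect (cube a (e / 2) y); last first.
 by rewrite indicE memNset // mulr0; apply: pull_ge0.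
 rewrite indicE mem_set // mulr1 /pull.
 have [Oy Fy] : Om c y /\ F z * dens c z / 2 < F (bwd c y) * dens c (bwd c y).
 apply: he; rewrite -ball_normE /=; apply: (@le_lt_trans _ _ (e / 2)); last lra. apply: norm_row_le; first lra.
 by move=> i; have := Qy i; rewrite !mxE distrC.
 by rewrite (asboolT Oy); exact: ltW Fy.
rewrite iF leNgt => /negP; apply; apply: mule_gt0; first by rewrite lte_fin; lra.
by apply: leb_cube_gt0; lra.
Qed.

Lemma ae0_smooth h : (forall x, sma S h x) -> {ae mu, forall x, h x = 0} -> forall x, h x = 0.
move=> sh ae0 x; apply/eqP; apply: contraT => hx; exfalso.
have oA : open [set z | 0 < h z * h z] by apply: open_sm_gt => z; exact: smaM.
have Ax : 0 < h x * h x by rewrite -expr2 exprn_even_gt0.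
have [eta [ce e0 ex eA]] := bump_in oA Ax.
apply: (Cc_ae0 ce e0 ex); apply: ae1 ae0 => y hy.
by apply/eqP; apply: contraT => /eA /=; rewrite hy mulr0 ltxx.
Qed.
End divergence.

(** * Divergence theorem and gradients of smooth functions *)

Section divergence2.
Implicit Types (c d : chart R n M) (x z : M) (F H : M -> R) (Y Z : M -> 'rV[R]_n).
Local Notation at_ x := (chart_at S x).
Local Notation Om c := (fwd c @` dom c).
Local Notation dens := (dens g Psi).
Local Notation divc := (divc g Psi).
Local Notation wdiv := (weighted_div g Psi).
(** The function in coordinates continued by zero; unlike [pull], without the density factor. *)
Definition extend c F (y : 'rV[R]_n) : R := if `[< Om c y >] then F (bwd c y) else 0.

Lemma extd_near_in c F y : Om c y -> \forall z \near y, F (bwd c z) = extend c F z.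
move=> Oy; apply: filterS (onbhs (conj (@open_codom _ _ _ c) Oy)) => z Oz.
by rewrite /extend; case: asboolP.
Qed.

Lemma cpt_fwd c (K : set M) : compact K -> K `<=` dom c -> compact (fwd c @` K).
move=> cK Kc; apply: continuous_compact => //; apply: continuous_in_subspaceT => x.
by rewrite inE => /Kc cx; exact: fwd_continuous.
Qed.

Lemma extd_out c F (K : set M) y : K `<=` dom c -> (forall x, ~ K x -> F x = 0) ->
 ~ (fwd c @` K) y -> extend c F y = 0.
move=> Kc F0 Ky; rewrite /extend; case: asboolP => // Oy; apply: F0 => Ky'.
by apply: Ky; exists (bwd c y) => //; exact: (ch_bwd Oy).2.
Qed.

Lemma extd_near_out c F (K : set M) y : compact K -> K `<=` dom c ->
 (forall x, ~ K x -> F x = 0) -> ~ (fwd c @` K) y -> \forall z \near y, 0 = extend c F z.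
move=> cK Kc F0 Ky; have oK : open (~` (fwd c @` K)).
 apply: closed_openC; apply: compact_closed; first exact: norm_hausdorff. exact: cpt_fwd.
apply: filterS (onbhs (conj oK Ky)) => z Kz.
by rewrite (extd_out Kc F0).
Qed.

Lemma extd_cont c F (K : set M) : atlas S c -> compact K -> K `<=` dom c ->
 (forall x, ~ K x -> F x = 0) -> (forall x, K x -> sma S F x) -> continuous (extend c F).
move=> ac cK Kc F0 sF y; have [Ky|Ky] := pselect ((fwd c @` K) y); last first.
 have h := extd_near_out cK Kc F0 Ky.
 rewrite /continuous_at (extd_out Kc F0 Ky); have h0 : (fun=> 0 : R) z @[z --> y] --> (0 : R) by exact: (@cst_continuous _ _ (0 : R) y).
 apply: cvg_trans h0; apply: (@near_eq_cvg _ _ (nbhs y) _ (fun=> 0) (extend c F)). exact: h.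
have [x Kx xy] := Ky; have Oy : Om c y by exists x => //; exact: Kc.
have cf : {for y, continuous (F \o bwd c)}.
 apply: continuous_comp; first exact: bwd_continuous. by rewrite -xy fwdK; [exact: sma_cont (sF x Kx)|exact: Kc].
have e : extend c F y = (F \o bwd c) y by rewrite /extend; case: asboolP.
rewrite /continuous_at e; apply: cvg_trans cf; apply: (@near_eq_cvg _ _ (nbhs y) _ (F \o bwd c) (extend c F)).
exact: extd_near_in.
Qed.

Lemma chart_parts c i F (K : set M) : atlas S c -> compact K -> K `<=` dom c ->
 (forall x, ~ K x -> F x = 0) -> (forall x, K x -> sma S F x) ->
 (leb n).-integrable setT (EFin \o extend c (fun x => dform F c x 0 i)) /\
 (\int[leb n]_y (extend c (fun x => dform F c x 0 i) y)%:E = 0)%E.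
move=> ac cK Kc F0 sF.
have sF' := sma_supp cK F0 sF.
pose G x := if `[< dom c x >] then dform F c x 0 i else 0.
have G0 x : ~ K x -> G x = 0.
 move=> Kx; rewrite /G; case: asboolP => // cx. have oK : open (~` K).
 exact: (cpt_openC S).
 rewrite -(@dform_near _ _ _ S F (fun=> 0)) //; last first.
 by apply: filterS (onbhs (conj oK Kx)) => z /F0.
 by rewrite dform_cst mxE.
have sG x : K x -> sma S G x.
 move=> Kx; have cx := Kc x Kx; apply: (@sma_eq _ _ _ S (fun z => dform F c z 0 i)).
 by apply: filterS (nbhs_dom cx) => z cz; rewrite /G; case: asboolP.
 exact: sma_dform.
have E : extend c (fun x => dform F c x 0 i) = extend c G.
 apply/funext => y; rewrite /extend; case: asboolP => // Oy; rewrite /G.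
 by case: asboolP => // -[]; exact: (ch_bwd Oy).1.
rewrite E; have cG := extd_cont ac cK Kc G0 sG.
have [B KB] : exists B : R, forall y, (fwd c @` K) y -> cube 0 B y.
 have [B [_ hB]] := compact_bounded (cpt_fwd cK Kc).
 exists (B + 1) => y Ky k; rewrite mxE subr0; apply: le_trans (crd_le_norm _ _) _. by apply: hB => //; rewrite ltrDl.
have [C C0 hC] := cont_bdd_cpt cK (fun x Kx => sma_cont (sG x Kx)).
have GC y : `|extend c G y| <= C.
 rewrite /extend; case: asboolP => Oy; last by rewrite normr0.
 have [Ky|Ky] := pselect (K (bwd c y)); first exact: hC. by rewrite G0 // normr0.
have GB y : ~ cube 0 B y -> extend c G y = 0.
 by move=> Qy; rewrite (extd_out Kc G0) // => /KB.
split; first exact: (@intble_cube R n (extend c G) B C).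
apply: (@int_partial R n i (extend c F) (extend c G) B C) => //.
- move=> y; have [Ky|Ky] := pselect ((fwd c @` K) y); last first.
 rewrite (extd_out Kc G0 Ky). have h := extd_near_out cK Kc F0 Ky.
 have := @near_pder R n (fun=> 0) (extend c F) y (urow i) h.
 by rewrite derive_cst; apply; exact: derivable_cst.
 have [x Kx xy] := Ky; have Oy : Om c y by exists x => //; exact: Kc. have h := @extd_near_in c F y Oy.
 have [dF _] := sma_dvble (urow i) ac (Kc x Kx) (sF x Kx). rewrite -xy in h *; have := near_pder h dF.
 have -> // : extend c G (fwd c x) = 'D_(urow i) (F \o bwd c) (fwd c x). rewrite /extend asboolT; last by rewrite xy.
 by rewrite fwdK /G ?asboolT ?mxE //; exact: Kc.
- by move=> y Qy; rewrite (extd_out Kc F0) // => /KB.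
Qed.

(** The density in the measure cancels the one in the divergence, leaving a sum of partial
    derivatives of compactly supported functions. *)
Lemma int_divc c Y (K : set M) : atlas S c -> compact K -> K `<=` dom c ->
 (forall x, ~ K x -> Y x = 0) -> (forall x, sm_fld_at S Y x) ->
 \int[mu]_x (if `[< dom c x >] then divc c Y x else 0) = 0.
move=> ac cK Kc Y0 sY.
have oK : open (~` K).
 exact: (cpt_openC S).
pose F i x := if `[< dom c x >] then dens c x * in_chart S c Y x 0 i else 0.
have F0 i x : ~ K x -> F i x = 0.
 by move=> Kx; rewrite /F; case: asboolP => // cx; rewrite /in_chart Y0 // mul0mx mxE mulr0.
have FE i x : dom c x -> \forall z \near x, dens c z * in_chart S c Y z 0 i = F i z.
 by move=> cx; apply: filterS (nbhs_dom cx) => z cz; rewrite /F asboolT.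
have sDY i x : dom c x -> sma S (fun z => dens c z * in_chart S c Y z 0 i) x.
 by move=> cx; apply: smaM; [exact: sma_dens|exact: sm_fld_chart].
have sF i x : K x -> sma S (F i) x.
 by move=> /Kc cx; apply: sma_eq (FE i x cx) _; exact: sDY.
pose D x := if `[< dom c x >] then divc c Y x else 0.
have sD x : sma S D x.
 apply: (sma_supp cK) => z; last first.
 move=> /Kc cz; apply: (@sma_eq _ _ _ S (divc c Y)); last exact: sma_divc.
 by apply: filterS (nbhs_dom cz) => y cy; rewrite /D asboolT.
 move=> Kz; rewrite /D; case: asboolP => // cz. rewrite (@divc_near _ _ _ S g Psi Psi_smooth c (fun=> 0)) //.
 - rewrite /divc big1 ?mul0r // => i _. rewrite (_ : (fun z0 => _) = fun=> 0) ?dform_cst ?mxE //.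
 by apply/funext => y; rewrite /in_chart mul0mx mxE mulr0.
 - exists c; split=> // k; rewrite (_ : (fun z0 => _) = fun=> 0); first exact: sma_cst.
 by apply/funext => y; rewrite /in_chart mul0mx mxE.
 - by apply: filterS (onbhs (conj oK Kz)) => y /Y0 ->.
have mD := ms_smooth sD.
rewrite -/D (Rint_pull ac mD); last first.
 by move=> x cx; rewrite /D asboolF.
have pE y : pull c D y = \sum_i extend c (fun x => dform (F i) c x 0 i) y.
 rewrite /pull /extend; case: asboolP => Oy; last by rewrite big1.
 have [cb _] := ch_bwd Oy; have d0 := dens_gt0 g Psi_gt0 ac cb. rewrite /D asboolT // /divc divfK ?gt_eqF //.
 apply: eq_bigr => i _; congr (fun_of_matrix _ 0 i); apply/esym.
 by apply: (@dform_near _ _ _ S) => //; [exact: sDY|exact: FE].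
have h i := chart_parts i ac cK Kc (F0 i) (sF i).
rewrite /Rintegral (eqint (fun y : borel 'rV[R]_n =>
 \sum_i (extend c (fun x => dform (F i) c x 0 i) y)%:E)%E); last first. by move=> y _; rewrite pE sumEFin.
rewrite integral_sum //; last by move=> i; exact: (h i).1.
by rewrite big1 // => i _; exact: (h i).2.
Qed.

(* Both sides are the divergence of [Y] in the weak sense. *)
Lemma divc_inv c d Y x : atlas S c -> atlas S d -> dom c x -> dom d x ->
 (forall z, sm_fld_at S Y z) -> divc c Y x = divc d Y x.
move=> ac ad cx dx sY.
pose W := dom c `&` dom d.
have oW : open W by apply: openI; exact: open_dom.
have [b [K [cb b0 bx [cK KW] K0]]] := bump_in_cpt oW (conj cx dx).
have KW' z : K z -> dom c z /\ dom d z by move=> /KW.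
have oK : open (~` K).
 exact: (cpt_openC S).
have nz F z : (forall z, ~ K z -> F z = 0) -> ~ K z -> scal g (nab g F) Y z = 0.
 move=> F0 Kz; rewrite /scal; have -> : nab g F z = 0.
 rewrite -(nab_cst g 0 z); apply: nab_near; first exact: sma_cst.
 by apply: filterS (onbhs (conj oK Kz)) => y /F0.
 by rewrite mul0mx mul0mx mxE.
have cA F : Cc_infty S F -> (forall z, ~ K z -> F z = 0) -> Cc_infty S (scal g (nab g F) Y).
 move=> cF F0; apply: (Cc_supp cK) => [z|z _]; first exact: nz.
 by apply: sma_scal => //; apply: sm_fld_nab; exact: Cc_sm cF z.
have cB e F : atlas S e -> W `<=` dom e -> Cc_infty S F -> (forall z, ~ K z -> F z = 0) ->
 Cc_infty S (fun z => F z * divc e Y z).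
 move=> ae We cF F0; apply: (Cc_supp cK) => [z /F0 ->|z Kz]; first by rewrite mul0r.
 by apply: smaM; [exact: Cc_sm cF z|apply: sma_divc => //; exact/We/KW].
have key e F : atlas S e -> W `<=` dom e -> Cc_infty S F -> (forall z, ~ K z -> F z = 0) ->
 \int[mu]_z (F z * divc e Y z) = - \int[mu]_z scal g (nab g F) Y z.
 move=> ae We cF F0; have sF := Cc_sm cF. have h := @int_divc e (fun z => F z *: Y z) K ae cK.
 apply/eqP; rewrite -addr_eq0 -[X in X + _]mul1r -(@RiL _ (borel M)); last 2 first.
 - by apply: (Cc_intble); exact: cB.
 - by apply: (Cc_intble); exact: cA.
 rewrite -[X in _ == X]h; first last.
 - by move=> z; exact: sm_fldZ.
 - by move=> z /F0 ->; rewrite scale0r.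
 - by move=> z /KW /We.
 apply/eqP; apply: eqRint => z _; case: asboolP => ez.
 by rewrite divcZ // mul1r.
 have Kz : ~ K z by move=> /KW /We. by rewrite F0 // nz // mul0r mulr0 addr0.
pose D z := divc c Y z - divc d Y z.
have sD z : K z -> sma S D z.
 move=> /KW' [cz dz]; rewrite /D.
 have -> : (fun z => divc c Y z - divc d Y z) = (fun z => divc c Y z + -1 * divc d Y z).
 by apply/funext => y; rewrite mulN1r.
 apply: smaD; first exact: sma_divc. by apply: smaM; [exact: sma_cst|exact: sma_divc].
pose h z := b z * D z.
have h0 z : ~ K z -> h z = 0 by move=> /K0 bz; rewrite /h bz mul0r.
have sb := Cc_sm cb.
have ch : Cc_infty S h.
 by apply: (Cc_supp cK) => // z Kz; apply: smaM => //; exact: sD.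
have sh := Cc_sm ch.
have hz : forall z, h z = 0.
 apply: (ae0_smooth sh). apply: (ae_zero_Cc).
 by apply: (loc_L1_cont) => z; exact: sma_cont.
 move=> eta ce; have se := Cc_sm ce. have cF : Cc_infty S (fun z => b z * eta z) by apply: Cc_mul.
 have F0 z : ~ K z -> b z * eta z = 0 by move=> /K0 ->; rewrite mul0r. have kc := key c _ ac (@subIsetl _ _ _) cF F0.
 have kd := key d _ ad (@subIsetr _ _ _) cF F0. have ic := Cc_intble (cB c _ ac (@subIsetl _ _ _) cF F0).
 have id := Cc_intble (cB d _ ad (@subIsetr _ _ _) cF F0).
 move: kc kd ic id; rewrite /h /D; move: (divc c Y) (divc d Y) => Dc Dd kc kd ic id.
 have -> : \int[mu]_z (b z * (Dc z - Dd z) * eta z) =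
 \int[mu]_z (-1 * (b z * eta z * Dd z) + b z * eta z * Dc z).
 by apply: eqRint => z _; ring.
 by rewrite (@RiL _ (borel M)) // kc kd mulN1r opprK subrr.
have : b x * D x = 0 by exact: (hz x).
move/eqP; rewrite mulf_eq0 (gt_eqF bx) orFb /D subr_eq0 => /eqP e; exact: e.
Qed.

Lemma wdivc c Y x : atlas S c -> dom c x -> (forall z, sm_fld_at S Y z) ->
 wdiv Y x = divc c Y x.
move=> ac cx sY; rewrite wted_divE; apply: divc_inv => //.
 exact: chatP.
exact: chart_at_dom.
Qed.

Lemma wdivZ F Y x : sma S F x -> sm_fld_at S Y x ->
 wdiv (fun z => F z *: Y z) x = F x * wdiv Y x + scal g (nab g F) Y x.
move=> sF sY; rewrite !wted_divE divcZ //; [exact: chatP|exact: chart_at_dom].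
Qed.

Lemma sma_wdiv Y x : (forall z, sm_fld_at S Y z) -> sma S (wdiv Y) x.
move=> sY; apply: (@sma_eq _ _ _ S (divc (at_ x) Y)).
 apply: filterS (nbhs_dom (chart_at_dom S x)) => z cz. by rewrite (wdivc _ cz) //; exact: chatP.
by apply: sma_divc => //; [exact: chatP|exact: chart_at_dom].
Qed.

Lemma Cc_div Y F : (forall z, sm_fld_at S Y z) -> Cc_infty S F ->
 Cc_infty S (wdiv (fun z => F z *: Y z)).
move=> sY cF; have sF := Cc_sm cF; have [_ [K cK K0]] := cF.
have oK : open (~` K).
 exact: (cpt_openC S).
apply: (Cc_supp cK) => [z Kz|z _]; last by apply: sma_wdiv => y; exact: sm_fldZ.
rewrite wdivZ // K0 // mul0r add0r /scal.
have -> : nab g F z = 0.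
 rewrite -(nab_cst g 0 z); apply: nab_near; first exact: sma_cst.
 by apply: filterS (onbhs (conj oK Kz)) => y /K0.
by rewrite mul0mx mul0mx mxE.
Qed.

(** Induction on the list: each piece is supported in the cell of a single chart, where [int_divc]
    applies. *)
Lemma int_wdiv_bumps (l : seq M) Y : (forall z, sm_fld_at S Y z) ->
 \int[mu]_x wdiv (fun z => (\sum_(p <- l) bmp S p z) *: Y z) x = 0.
move=> sY.
have cl l' : Cc_infty S (fun z => \sum_(p <- l') bmp S p z).
 by apply: Cc_sum => p; exact: bmp_Cc.
elim: l => [|p l IH].
 rewrite (_ : wdiv _ = fun=> 0); first by rewrite /Rintegral integral0. apply/funext => x.
 have -> : (fun z => (\sum_(p <- [::]) bmp S p z) *: Y z) = (fun z => (fun=> 0) z *: Y z).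
 by apply/funext => z; rewrite big_nil.
 rewrite wdivZ //; last exact: sma_cst. by rewrite mul0r add0r /scal nab_cst mul0mx mul0mx mxE.
have E x : wdiv (fun z => (\sum_(q <- p :: l) bmp S q z) *: Y z) x =
 1 * wdiv (fun z => bmp S p z *: Y z) x + wdiv (fun z => (\sum_(q <- l) bmp S q z) *: Y z) x.
 have sp := Cc_sm (bmp_Cc S p) x; have sl := Cc_sm (cl l) x.
 rewrite mul1r !wdivZ //; last exact: Cc_sm (cl (p :: l)) x.
 have -> : (fun z => \sum_(q <- p :: l) bmp S q z) = (fun z => bmp S p z + \sum_(q <- l) bmp S q z).
 by apply/funext => z; rewrite big_cons.
 have e := nabD g sp sl; rewrite /= in e. rewrite big_cons /scal e !mulmxDl [X in _ + X = _]mxE mulrDl.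
 by rewrite addrACA.
under eqRint do rewrite E.
rewrite (@RiL _ (borel M)); last 2 first.
- by apply: (Cc_intble); apply: Cc_div => //; exact: bmp_Cc.
- by apply: (Cc_intble); exact: Cc_div.
rewrite IH addr0 mul1r.
have [r0 r4 hr] := radiusP S p; have cb := bmp_Cc S p.
have ap := chatP S p.
rewrite -(@int_divc (at_ p) (fun z => bmp S p z *: Y z) (cellat S p) ap); first last.
- by move=> z; apply: sm_fldZ => //; exact: Cc_sm cb z.
- by move=> z cz; rewrite bmp_out // scale0r.
- by move=> z [].
- exact: cpt_cellat.
apply: eqRint => z _; case: asboolP => cz.
 apply: wdivc => // y; apply: sm_fldZ => //; exact: Cc_sm cb y.
have oK : open (~` cellat S p).
 apply: closed_openC; apply: compact_closed; first exact: manifold_hausdorff S. exact: cpt_cellat.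
have Kz : ~ cellat S p z by move=> [].
rewrite wdivZ //; last exact: Cc_sm cb z.
rewrite bmp_out // mul0r add0r /scal.
have -> : nab g (bmp S p) z = 0.
 rewrite -(nab_cst g 0 z); apply: nab_near; first exact: sma_cst.
 by apply: filterS (onbhs (conj oK Kz)) => y /bmp_out ->.
by rewrite mul0mx mul0mx mxE.
Qed.

(** [Y] equals N (Y / N), where N is a sum of bumps that is positive on the support of [Y]. *)
Theorem dvg_theorem Y : smooth_field S Y -> compactly_supported Y ->
 \int[mu]_x wdiv Y x = 0.
move=> /smooth_fldP sY [K cK K0].
have [l hl] := cpt_bumps S cK.
pose N z := \sum_(p <- l) bmp S p z.
have sN z : sma S N z by apply: sma_big => p; exact: Cc_sm (bmp_Cc S p) z.
have sZ : forall z, sm_fld_at S (fun z => (N z)^-1 *: Y z) z.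
 apply: (sm_fld_supp cK) => z Kz; first by rewrite K0 // scaler0.
 by apply: sm_fldZ => //; apply: sma_inv => //; exact: hl.
rewrite -[RHS](int_wdiv_bumps l sZ); apply: eqRint => x _.
congr (weighted_div g Psi _ x); apply/funext => z.
have [Kz|Kz] := pselect (K z); last by rewrite K0 // !scaler0.
by rewrite scalerA divff ?scale1r // gt_eqF // hl.
Qed.

(** The divergence theorem for F Y, expanded by the Leibniz rule. *)
Lemma smooth_grd F : (forall x, sma S F x) ->
 is_distributional_gradient g Psi mu F (nab g F).
move=> sF; have sn x := sm_fld_nab g (sF x).
have cF x := sma_cont (sF x).
split.
- exact: (loc_L1_cont).
- exact: ms_smooth_fld.
- apply: (loc_L1_cont) => x. apply: (@continuous_comp _ _ _ (scal g (nab g F) (nab g F)) Num.sqrt).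
 by apply: sma_cont; exact: sma_scal.
 exact: sqrt_continuous.
move=> Y /smooth_fldP sY [K cK K0].
have oK : open (~` K).
 exact: (cpt_openC S).
have c1 : Cc_infty S (scal g (nab g F) Y).
 apply: (Cc_supp cK) => [z /K0 e|z _]; last exact: sma_scal. by rewrite /scal e trmx0 mulmx0 mxE.
have c2 : Cc_infty S (fun x => F x * wdiv Y x).
 apply: (Cc_supp cK) => [z Kz|z _]; last by apply: smaM => //; exact: sma_wdiv.
 rewrite wted_divE (@divc_near _ _ _ S g Psi Psi_smooth (at_ z) (fun=> 0)).
 - rewrite /divc big1 ?mul0r ?mulr0 // => i _. rewrite (_ : (fun z0 => _) = fun=> 0) ?dform_cst ?mxE //.
 by apply/funext => y; rewrite /in_chart mul0mx mxE mulr0.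
 - exact: chatP.
 - exact: chart_at_dom.
 - exists (at_ z); split; [exact: chatP|exact: chart_at_dom|] => k.
 rewrite (_ : (fun z0 => _) = fun=> 0); first exact: sma_cst. by apply/funext => y; rewrite /in_chart mul0mx mxE.
 - by apply: filterS (onbhs (conj oK Kz)) => y /K0 ->.
apply/eqP; rewrite -addr_eq0 -[X in X + _]mul1r -(@RiL _ (borel M)); last 2 first.
- exact: (Cc_intble).
- exact: (Cc_intble).
rewrite -[X in _ == X](@dvg_theorem (fun z => F z *: Y z)).
- by apply/eqP; apply: eqRint => z _; rewrite wdivZ // mul1r addrC.
- by apply/smooth_fldP => z; exact: sm_fldZ.
- by exists K => // z /K0 ->; rewrite scaler0.
Qed.
End divergence2.

(** * Distributional gradients: linearity, uniqueness, product rule *)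

Section gradients.
Implicit Types (c d : chart R n M) (x z : M) (f h F H : M -> R) (X Y Z : M -> 'rV[R]_n).
Local Notation at_ x := (chart_at S x).
Local Notation wdiv := (weighted_div g Psi).
Local Notation wgrad := (is_distributional_gradient g Psi mu).
Local Notation scal := (scal g).
Lemma ae_all_ord m (P : 'I_m -> M -> Prop) : (forall i, {ae mu, forall x, P i x}) ->
 {ae mu, forall x, forall i, P i x}.
move=> h; have h' k : {ae mu, forall x, forall i : 'I_m, val i = k -> P i x}.
 have [km|km] := ltnP k m.
 by apply: ae1 (h (Ordinal km)) => x Px i ik; have -> : i = Ordinal km by exact/val_inj.
 apply: aeT => x i ik; exfalso; have := ltn_ord i. by rewrite -[nat_of_ord i]/(val i) ik ltnNge km.
by apply: ae1 (ae_all_nat h') => x Px i; exact: Px.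
Qed.

Definition nrm X x : R := Num.sqrt (scal X X x).

Lemma nrm_ge0 X x : 0 <= nrm X x. Proof. exact: sqrtr_ge0. Qed.

Lemma nrm_sqr X x : nrm X x ^+ 2 = scal X X x.
by rewrite sqr_sqrtr // scal_ge0. Qed.

Lemma scal_nrm X Y x : `|scal X Y x| <= nrm X x * nrm Y x.
rewrite -(@ler_pXn2r _ 2) ?nnegrE ?mulr_ge0 ?nrm_ge0 //.
rewrite real_normK ?num_real // exprMn !nrm_sqr.
exact: (qf_cauchy (gram_sym g x) (gram_posdef g x)).
Qed.

Lemma scal_linr (a : R) X Y Z x :
 scal Z (fun z => a *: X z + Y z) x = a * scal Z X x + scal Z Y x.
by rewrite scal_sym scal_linl !(scal_sym g Z). Qed.

Lemma scalZl F X Y x : scal (fun z => F z *: X z) Y x = F x * scal X Y x.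
by rewrite /Defs.scal -!scalemxAl mxE. Qed.

Lemma scalZr F X Y x : scal X (fun z => F z *: Y z) x = F x * scal X Y x.
by rewrite scal_sym scalZl scal_sym. Qed.

Lemma nrm_lin (a : R) X Y x : nrm (fun z => a *: X z + Y z) x <= `|a| * nrm X x + nrm Y x.
rewrite -(@ler_pXn2r _ 2) ?nnegrE ?addr_ge0 ?mulr_ge0 ?nrm_ge0 //.
rewrite nrm_sqr scal_linl !scal_linr sqrrD exprMn !nrm_sqr real_normK ?num_real //.
rewrite (scal_sym g Y X); have := scal_nrm X Y x.
have h : a * scal X Y x <= `|a| * `|scal X Y x| by rewrite -normrM ler_norm.
have := normr_ge0 a; move: (nrm_ge0 X x) (nrm_ge0 Y x).
move: (nrm X x) (nrm Y x) (scal X X x) (scal Y Y x) h => nx ny sx sy.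
move: (scal X Y x) => s; move: `|a| `|s| => b t h nx0 ny0 b0 st.
have : b * t <= b * (nx * ny) by rewrite ler_wpM2l.
lra.
Qed.

Lemma nrmZ F X x : nrm (fun z => F z *: X z) x = `|F x| * nrm X x.
by rewrite /nrm scalZl scalZr mulrA -expr2 sqrtrM ?sqr_ge0 // sqrtr_sqr. Qed.

Lemma ms_nrm X : mfld S X -> bmeas (nrm X).
move=> mX; have ms : measf [set: mTR R] (Num.sqrt : R -> R).
 by apply: continuous_measurable_fun; exact: sqrt_continuous.
exact: (mfT_comp ms (ms_scal mX mX)).
Qed.

Lemma loc_L1_dom f h : bmeas f -> locally_L1 mu h ->
 (forall K : set M, compact K -> exists2 C : R, 0 <= C & forall x, K x -> `|f x| <= C * `|h x|) ->
 locally_L1 mu f.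
move=> mf [mh lh] fh; split=> // K cK; have [C C0 hC] := fh K cK.
have mK := cpt_meas cK.
have := integrableZl mK C (lh K cK).
apply: le_integrable => //; first by apply/mEFinP; exact: mfTS.
move=> x Kx /=; rewrite lee_fin normrM (ger0_norm C0); exact: hC.
Qed.

Lemma loc_L1_lin (a : R) f h : locally_L1 mu f -> locally_L1 mu h ->
 locally_L1 mu (fun x => a * f x + h x).
move=> [mf lf] [mh lh]; split=> [|K cK].
 by apply: measurable_funD => //; exact: mfM.
have mK := cpt_meas cK.
have := integrableD mK (integrableZl mK a (lf K cK)) (lh K cK).
by apply: eq_integrable.
Qed.

Lemma cont_nrm X : (forall x, sm_fld_at S X x) -> continuous (nrm X).
move=> sX x; apply: (@continuous_comp _ _ _ (scal X X) Num.sqrt).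
 by apply: (@sma_cont _ _ _ S); exact: sma_scal.
exact: sqrt_continuous.
Qed.

Lemma wdiv_supp Y (K : set M) z : compact K -> (forall x, ~ K x -> Y x = 0) -> ~ K z ->
 wdiv Y z = 0.
move=> cK K0 Kz; have oK : open (~` K).
 exact: (cpt_openC S).
rewrite wted_divE (@divc_near _ _ _ S g Psi Psi_smooth (at_ z) (fun=> 0)).
- rewrite /divc big1 ?mul0r // => i _. rewrite (_ : (fun z0 => _) = fun=> 0) ?dform_cst ?mxE //.
 by apply/funext => y; rewrite /in_chart mul0mx mxE mulr0.
- exact: chatP.
- exact: chart_at_dom.
- exists (at_ z); split; [exact: chatP|exact: chart_at_dom|] => k.
 rewrite (_ : (fun z0 => _) = fun=> 0); first exact: sma_cst. by apply/funext => y; rewrite /in_chart mul0mx mxE.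
- by apply: filterS (onbhs (conj oK Kz)) => y /K0 ->.
Qed.

Lemma Cc_wdiv Y : smooth_field S Y -> compactly_supported Y -> Cc_infty S (wdiv Y).
move=> /smooth_fldP sY [K cK K0].
apply: (Cc_supp cK) => [z Kz|z _]; last exact: (sma_wdiv).
exact: wdiv_supp Kz.
Qed.

Lemma scal_intble X Y : mfld S X -> locally_L1 mu (nrm X) ->
 smooth_field S Y -> compactly_supported Y -> mint (scal X Y).
move=> mX lX /smooth_fldP sY [K cK K0].
have mY := ms_smooth_fld sY.
apply: (intble_supp cK); first exact: ms_scal.
 by move=> x /K0 e; rewrite /Defs.scal e trmx0 mulmx0 mxE.
have [|_ h] := @loc_L1_dom (scal X Y) (nrm X) (ms_scal mX mY) lX; last exact: h.
move=> K' cK'; have [C C0 hC] := cont_bdd_cpt cK' (fun x _ => cont_nrm sY (x := x)).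
exists C => // x Kx; apply: le_trans (scal_nrm X Y x) _; rewrite mulrC (ger0_norm (nrm_ge0 X x)).
by rewrite ler_wpM2r ?nrm_ge0 //; apply: le_trans (ler_norm _) (hC x Kx).
Qed.

Lemma wgrad_test_intble f X Y : wgrad f X -> smooth_field S Y -> compactly_supported Y ->
 mint (scal X Y) /\
 mint (fun x => f x * wdiv Y x).
move=> [lf mX lX _] sY cY; split; first exact: scal_intble.
by apply: (loc_L1_mul_Cc) => //; exact: Cc_wdiv.
Qed.

Lemma wgrad_lin (a : R) f h X Z : wgrad f X -> wgrad h Z ->
 wgrad (fun x => a * f x + h x) (fun x => a *: X x + Z x).
move=> wf wh; have [lf mX lX fX] := wf; have [lh mZ lZ hZ] := wh.
have mL := ms_fld_lin a mX mZ.
split=> //; first exact: loc_L1_lin.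
 have l2 : locally_L1 mu (fun x => `|a| * nrm X x + nrm Z x) := loc_L1_lin `|a| lX lZ.
 apply: (loc_L1_dom (ms_nrm mL) l2) => K cK; exists 1 => // x Kx.
 rewrite mul1r (ger0_norm (nrm_ge0 _ _)) ger0_norm; first exact: nrm_lin. by rewrite addr_ge0 ?mulr_ge0 ?nrm_ge0.
move=> Y sY cY; have [i1 i2] := wgrad_test_intble wf sY cY.
have [i3 i4] := wgrad_test_intble wh sY cY.
have -> : \int[mu]_x scal (fun x => a *: X x + Z x) Y x = \int[mu]_x (a * scal X Y x + scal Z Y x).
 by apply: eqRint => x _; rewrite scal_linl.
have -> : \int[mu]_x ((a * f x + h x) * wdiv Y x) =
 \int[mu]_x (a * (f x * wdiv Y x) + h x * wdiv Y x).
 by apply: eqRint => x _; rewrite mulrDl mulrA.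
rewrite (@RiL _ (borel M)) // (@RiL _ (borel M)) // fX // hZ //.
by rewrite opprD mulrN.
Qed.

(** Coordinate fields times bumps as tests show that each covariant component of [Z] vanishes almost
    everywhere in each of countably many charts; the Gram matrix is invertible. *)
Lemma field_zero Z : mfld S Z -> locally_L1 mu (nrm Z) ->
 (forall Y, smooth_field S Y -> compactly_supported Y -> \int[mu]_x scal Z Y x = 0) ->
 {ae mu, forall x, Z x = 0}.
move=> mZ lZ hZ; have [p hp] := ctbl_bumps S.
pose hf k i x := if `[< dom (at_ (p k)) x >] then
 bmp S (p k) x * (in_chart S (at_ (p k)) Z x *m gram_in_chart S g (at_ (p k)) x) 0 i else 0.
suff key k i : {ae mu, forall x, hf k i x = 0}.
 have h2 k : {ae mu, forall x, forall i, hf k i x = 0} by exact: ae_all_ord.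
 apply: ae1 (ae_all_nat h2) => x hx; have [k hk] := hp x. have ac : atlas S (at_ (p k)) by exact: chatP.
 have cx : dom (at_ (p k)) x.
 by apply: contrapT => nd; move: hk; rewrite bmp_out ?ltxx // => -[].
 have e : in_chart S (at_ (p k)) Z x *m gram_in_chart S g (at_ (p k)) x = 0.
 apply/rowP => i; rewrite [RHS]mxE; have := hx k i; rewrite /hf asboolT //.
 by move/eqP; rewrite mulf_eq0 (gt_eqF hk) orFb => /eqP.
 have e2 : in_chart S (at_ (p k)) Z x = 0.
 by apply: (can_inj (mulmxK (gramc_unit g ac cx))); rewrite e mul0mx.
 by rewrite -(in_chartK Z ac cx) e2 mul0mx.
set c := at_ (p k); have ac : atlas S c by exact: chatP.
have mhf : bmeas (hf k i).
 have -> : hf k i = (fun x => bmp S (p k) x *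
 (in_chart S c Z x *m gram_in_chart S g c x) 0 i) \_ (dom c).
 by apply/funext => x; rewrite /hf patchE; case: asboolP => cx; [rewrite mem_set|rewrite memNset].
 apply/(measurable_restrictT _ (ms_dom c)); apply: mfM.
 by apply: mfTS; apply: ms_smooth; exact: Cc_sm (bmp_Cc S (p k)).
 under eq_fun do rewrite mxE. apply: measurable_sum => j; apply: mfM; first exact: mZ.
 by apply: ms_smooth_on; [exact: open_dom|move=> x cx; exact: sma_gramc].
have [C C0 hC] := @cont_bdd_cpt (cellat S (p k)) (fun x => gram_in_chart S g c x i i)
 (@cpt_cellat _ _ _ S (p k)) (fun x xc => sma_cont (sma_gramc g i i ac xc.1)).
apply: (ae_zero_Cc).
 apply: (loc_L1_dom mhf lZ) => K cK; exists (1 + C); first by rewrite addr_ge0.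
 move=> x Kx; rewrite (ger0_norm (nrm_ge0 Z x)) /hf; case: asboolP => cx; last first.
 by rewrite normr0 mulr_ge0 ?nrm_ge0 // addr_ge0.
 have [cell|ncell] := pselect (cellat S (p k) x); last first.
 by rewrite bmp_out // mul0r normr0 mulr_ge0 ?nrm_ge0 // addr_ge0.
 rewrite normrM (ger0_norm (bmp_ge0 S _ _)).
 apply: (@le_trans _ _ (1 * `|(in_chart S c Z x *m gram_in_chart S g c x) 0 i|)).
 by rewrite ler_wpM2r // bumpat_le1.
 rewrite mul1r -(@ler_pXn2r _ 2) ?nnegrE ?mulr_ge0 ?nrm_ge0 ?addr_ge0 //.
 rewrite real_normK ?num_real // exprMn nrm_sqr (scal_chart g Z Z ac cx).
 have gs := gramc_sym g c x; have gp := gramc_pos g ac cx.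
 apply: le_trans (qf_cocrd gs gp _ i) _; rewrite mulrC ler_wpM2r ?qf_ge0 //.
 have := hC x cell; have := ler_norm (gram_in_chart S g c x i i). move: (gram_in_chart S g c x i i) => t; nra.
move=> eta ce.
have cF : Cc_infty S (fun x => bmp S (p k) x * eta x).
 by apply: Cc_mul (bmp_Cc S (p k)) _; exact: Cc_sm ce.
have [sY cY] := @crd_fld_smooth R n M S c i (fun x => bmp S (p k) x * eta x) (cellat S (p k)) ac
 (@cpt_cellat _ _ _ S (p k)) (fun x xc => xc.1)
 (fun x xc => etrans (congr1 (fun t => t * eta x) (bmp_out xc)) (mul0r _))
 (fun x _ => Cc_sm cF x).
rewrite -[RHS](hZ _ sY cY); apply: eqRint => x _.
rewrite /hf; case: asboolP => cx; last first.
 rewrite mul0r /Defs.scal /crd_fld bmp_out ?mul0r ?scale0r ?trmx0 ?mulmx0 ?mxE //. by move=> [].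
rewrite (scal_chart g _ _ ac cx) in_chart_crd_fld // /qf linearZ /= -scalemxAr [RHS]mxE.
by rewrite trmx_delta -colE [X in _ = _ * X]mxE mulrAC.
Qed.

Lemma ae_eq_test f h Y : bmeas f -> bmeas h ->
 {ae mu, forall x, f x = h x} -> smooth_field S Y -> compactly_supported Y ->
 \int[mu]_x (f x * wdiv Y x) = \int[mu]_x (h x * wdiv Y x).
move=> mf mh fh sY cY; have mw := ms_smooth (Cc_sm (Cc_wdiv sY cY)).
apply: (@ae_eq_Rint _ (borel M)); [exact: mfM|exact: mfM|].
by apply: ae1 fh => x ->.
Qed.

Lemma wgrad_unique f h X Z : {ae mu, forall x, f x = h x} -> wgrad f X -> wgrad h Z ->
 {ae mu, forall x, X x = Z x}.
move=> fh wf wh; have wd := wgrad_lin (-1) wh wf; have [ld md nd hd] := wd.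
have := @field_zero (fun x => -1 *: Z x + X x) md nd; move=> h0.
apply: ae1 (h0 _) => [x /eqP|Y sY cY].
 by rewrite scaleN1r addrC subr_eq0 => /eqP.
have [[mf _] _ _ _] := wf; have [[mh _] _ _ _] := wh.
rewrite hd // (@ae_eq_test _ (fun=> 0) Y) //.
- rewrite (_ : (fun x => _) = fun=> 0); first by rewrite /Rintegral integral0 oppr0.
 by apply/funext => x; rewrite mul0r.
- by have [] := ld.
- by apply: ae1 fh => x ->; rewrite mulN1r addNr.
Qed.

Lemma loc_L1_ae f h : locally_L1 mu f -> bmeas h ->
 {ae mu, forall x, f x = h x} -> locally_L1 mu h.
move=> [mf lf] mh fh; split=> // K cK; have mK := cpt_meas cK.
have /integrableP[_ i1] := lf K cK; apply/integrableP; split.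
 by apply/mEFinP; exact: mfTS.
rewrite (@ae_eq_integral _ (borel M) _ mu K (fun x => `|(f x)%:E|%E)) //.
- by apply: mfT_comp => //; apply/mEFinP; exact: mfTS.
- by apply: mfT_comp => //; apply/mEFinP; exact: mfTS.
- by apply: ae1 fh => x /= -> _.
Qed.

Lemma wgrad_ae f h X Z : wgrad f X -> bmeas h ->
 mfld S Z -> {ae mu, forall x, f x = h x} -> {ae mu, forall x, X x = Z x} ->
 wgrad h Z.
move=> [lf mX lX hX] mh mZ fh XZ; have [mf _] := lf; split=> //.
- exact: loc_L1_ae fh.
- apply: (loc_L1_ae lX); first exact: ms_nrm. by apply: ae1 XZ => x e; rewrite /nrm /Defs.scal e.
move=> Y sY cY; rewrite -(@ae_eq_test f h Y) // -hX //.
have mY := ms_smooth_fld ((smooth_fldP S Y).1 sY).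
apply: (@ae_eq_Rint _ (borel M)); [exact: ms_scal|exact: ms_scal|].
by apply: ae1 XZ => x e; rewrite /Defs.scal e.
Qed.

Lemma grad_wgrad f X : wgrad f X -> wgrad f (grad g Psi mu f).
by move=> wX; rewrite /grad; case: xgetP => // /(_ X). Qed.

Lemma gradE f X : wgrad f X -> {ae mu, forall x, grad g Psi mu f x = X x}.
move=> wX; apply: wgrad_unique (grad_wgrad wX) wX; exact: aeT.
Qed.

(** The identity for f is tested with chi Y, whose divergence is expanded by the Leibniz rule. *)
Lemma wgradM f X chi : wgrad f X -> (forall x, sma S chi x) ->
 wgrad (fun x => chi x * f x) (fun x => chi x *: X x + f x *: nab g chi x).
move=> wf sc; have [lf mX lX hX] := wf; have [mf _] := lf.
have mc := ms_smooth sc; have sn x := sm_fld_nab g (sc x).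
have mn := ms_smooth_fld sn.
have bc K : compact K -> exists2 C : R, 0 <= C & forall x, K x -> `|chi x| <= C.
 by move=> cK; exact: (cont_bdd_cpt cK (fun x _ => sma_cont (sc x))).
have bn K : compact K -> exists2 C : R, 0 <= C & forall x, K x -> `|nrm (nab g chi) x| <= C.
 by move=> cK; exact: (cont_bdd_cpt cK (fun x _ => cont_nrm sn (x := x))).
have mcX := ms_fldZ mc mX.
have mfn := ms_fldZ mf mn.
have mL : mfld S (fun x => chi x *: X x + f x *: nab g chi x).
 by have := ms_fld_lin 1 mcX mfn; under eq_fun do rewrite scale1r.
have l1 : locally_L1 mu (fun x => chi x * f x).
 apply: (loc_L1_dom _ lf); first exact: mfM.
 move=> K /bc[C C0 hC]; exists C => // x Kx; rewrite normrM ler_wpM2r //; exact: hC.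
split=> //.
- have la : locally_L1 mu (fun x => nrm (fun z => chi z *: X z) x).
 apply: (loc_L1_dom (ms_nrm mcX) lX) => K /bc[C C0 hC]; exists C => // x Kx.
 rewrite !ger0_norm ?nrm_ge0 // nrmZ ler_wpM2r ?nrm_ge0 //; exact: hC.
 have lb : locally_L1 mu (fun x => nrm (fun z => f z *: nab g chi z) x).
 apply: (loc_L1_dom (ms_nrm mfn) lf) => K /bn[C C0 hC]; exists C => // x Kx.
 rewrite ger0_norm ?nrm_ge0 // nrmZ mulrC ler_wpM2r //. by apply: le_trans (ler_norm _) (hC x Kx).
 apply: (loc_L1_dom (ms_nrm mL) (loc_L1_lin 1 la lb)) => K cK; exists 1 => // x Kx.
 rewrite !mul1r !ger0_norm ?addr_ge0 ?nrm_ge0 //.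
 have := nrm_lin 1 (fun z => chi z *: X z) (fun z => f z *: nab g chi z) x.
 by rewrite normr1 mul1r /nrm /Defs.scal scale1r.
move=> Y sY cY; have sY' := (smooth_fldP S Y).1 sY.
have [K cK K0] := cY.
have scY : smooth_field S (fun x => chi x *: Y x) by apply/smooth_fldP => z; exact: sm_fldZ.
have ccY : compactly_supported (fun x => chi x *: Y x).
 by exists K => // x /K0 ->; rewrite scaler0.
have [i1 i2] := wgrad_test_intble wf scY ccY.
have i3 : mint (fun x => f x * scal (nab g chi) Y x).
 apply: (loc_L1_mul_Cc) => //; apply: (Cc_supp cK) => [x /K0 e|x _]; last exact: sma_scal.
 by rewrite /Defs.scal e trmx0 mulmx0 mxE.
have -> : \int[mu]_x scal (fun x => chi x *: X x + f x *: nab g chi x) Y x =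
 \int[mu]_x (1 * scal X (fun x => chi x *: Y x) x + f x * scal (nab g chi) Y x).
 apply: eqRint => x _; rewrite mul1r scalZr -!scalZl /Defs.scal. by rewrite !mulmxDl mxE.
rewrite (@RiL _ (borel M)) // mul1r hX //.
have -> : \int[mu]_x (f x * wdiv (fun x => chi x *: Y x) x) =
 \int[mu]_x (1 * (chi x * f x * wdiv Y x) + f x * scal (nab g chi) Y x).
 apply: eqRint => x _; rewrite wdivZ // mulrDr mul1r mulrA (mulrC (f x)). by [].
rewrite (@RiL _ (borel M)) //.
 by rewrite mul1r opprD addrNK.
by apply: (loc_L1_mul_Cc) => //; exact: Cc_wdiv.
Qed.
End gradients.

(** * Square integrable vector fields *)

Section sobolev.
Implicit Types (c d : chart R n M) (x z : M) (f h F H : M -> R) (X Y Z : M -> 'rV[R]_n).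
Local Notation at_ x := (chart_at S x).
Local Notation wdiv := (weighted_div g Psi).
Local Notation wgrad := (is_distributional_gradient g Psi mu).
Local Notation scal := (scal g).
Local Notation nrm := (nrm).
Local Notation linf := (@linf_ _ (borel M) R).
Definition F2 X : Prop := mfld S X /\ (\int[mu]_x (scal X X x)%:E < +oo)%E.
Definition linF (a : R) X Y : M -> 'rV[R]_n := fun x => a *: X x + Y x.
Definition Fscal X Y : R := \int[mu]_x scal X Y x.

Lemma F2_sqint X : F2 X -> sqi (mu : {measure set (borel M) -> \bar R}) (nrm X).
move=> [mX iX]; split; first exact: ms_nrm.
by under eqint do rewrite nrm_sqr.
Qed.

Lemma F2_int X Y : F2 X -> F2 Y -> mint (scal X Y).
move=> fX fY; have := sqiM (F2_sqint fX) (F2_sqint fY); have [mX _] := fX; have [mY _] := fY.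
apply: (@ae_le_intble _ (borel M)); first exact: ms_scal.
by move=> x; exact: scal_nrm.
Qed.

Lemma F2_of_sqint X : mfld S X -> sqi (mu : {measure set (borel M) -> \bar R}) (nrm X) -> F2 X.
by move=> mX [_]; under eqint do rewrite nrm_sqr. Qed.

Lemma F2_lin (a : R) X Y : F2 X -> F2 Y -> F2 (linF a X Y).
move=> fX fY; have [mX _] := fX; have [mY _] := fY.
have mL := ms_fld_lin a mX mY.
apply: F2_of_sqint => //.
have := sqi_lin `|a| (F2_sqint fX) (F2_sqint fY); move=> h.
apply: (@sqi_dom _ (borel M) _ _ 1 _ _ _ h); first exact: ms_nrm.
move=> x; rewrite mul1r (ger0_norm (nrm_ge0 _ _)).
by apply: le_trans (nrm_lin a X Y x) (ler_norm _).
Qed.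

Lemma F2_prehilbert : prehilbert linF F2 Fscal.
split=> [a X Y|a X Y Z fX fY fZ|X Y _ _|X _].
- exact: F2_lin.
- rewrite /Fscal -(@RiL _ (borel M)); [|exact: F2_int..]. by apply: eqRint => x _; rewrite /linF scal_linl.
- by apply: eqRint => x _; exact: scal_sym.
- by apply: Rintegral_ge0 => x _; exact: scal_ge0.
Qed.

Lemma scal_sum X Y x : scal X Y x = \sum_j (\sum_i X x 0 i * g x i j) * Y x 0 j.
rewrite /Defs.scal mxE; apply: eq_bigr => j _; congr (_ * _); last by rewrite mxE.
by rewrite mxE.
Qed.

Lemma cvg_sum_ord k (u : nat -> 'I_k -> R) (l : 'I_k -> R) :
 (forall i, u j i @[j --> \oo] --> l i) -> \sum_i u j i @[j --> \oo] --> \sum_i l i.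
by move=> h; apply: cvg_big => //; exact: add_continuous. Qed.

(** Along a fast subsequence the pointwise norms of the increments decay geometrically off a null
    set. They bound the components through [qf_crd], so the components converge there; Fatou's lemma
    does the rest. *)
Lemma F2_compl : compl2 linF F2 Fscal.
move=> u su cu; have [k kj hk] := fast_subseq cu.
have md i j : F2 (linF (-1) (u i) (u j)) by exact: F2_lin.
have dE i j : (\int[mu]_x (nrm (linF (-1) (u i) (u j)) x ^+ 2)%:E =
 (dist2 linF Fscal (u j) (u i))%:E)%E.
 under eqint do rewrite nrm_sqr. rewrite (@int_Rint _ (borel M)) //; exact: F2_int.
have [||E [mE E0 hE]] := @fast_decay _ (borel M) _ mu (fun j => nrm (linF (-1) (u (k j)) (u (k j.+1)))).
- by move=> j; apply: ms_nrm; have [] := md (k j) (k j.+1).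
- by move=> j; rewrite dE lee_fin.
pose v x : 'rV[R]_n := \1_E x *: \row_i limn (fun j => u (k j) x 0 i).
have vE x : E x -> forall i, u (k j) x 0 i @[j --> \oo] --> v x 0 i.
 move=> Ex i; have [C hC] := hE x Ex. rewrite /v indicE mem_set // scale1r mxE.
 have gs := gram_sym g x; have gp := gram_posdef g x. have g0 : 0 <= invmx (g x) i i.
 rewrite -(@pmulr_rge0 _ 1) // mul1r. have := qf_crd gs gp (delta_mx 0 i) i; rewrite mxE !eqxx expr1n.
 have q1 : 0 <= qf (g x) (delta_mx 0 i) (delta_mx 0 i) by exact: qf_ge0. move=> h; rewrite leNgt; apply/negP => h2.
 have : qf (g x) (delta_mx 0 i) (delta_mx 0 i) * invmx (g x) i i <= 0.
 by rewrite mulr_ge0_le0 // ltW.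
 lra.
 apply: (@cvg_of_geomet_step R _ (C * Num.sqrt (invmx (g x) i i))) => j.
 have := hC j; rewrite (ger0_norm (nrm_ge0 _ _)) => h1.
 have -> : u (k j.+1) x 0 i - u (k j) x 0 i = linF (-1) (u (k j)) (u (k j.+1)) x 0 i.
 by rewrite /linF scaleN1r !mxE addrC.
 have C0 : 0 <= C by have := le_trans (nrm_ge0 _ _) (le_trans (ler_norm _) (hC 0%N)); rewrite expr0 mulr1.
 have q0 := qf_crd gs gp (linF (-1) (u (k j)) (u (k j.+1)) x) i.
 rewrite -(@ler_pXn2r _ 2) ?nnegrE ?mulr_ge0 ?sqrtr_ge0 ?exprn_ge0 ?invr_ge0 //.
 rewrite real_normK ?num_real //; apply: le_trans q0 _.
 rewrite mulrAC exprMn (sqr_sqrtr g0) ler_wpM2r // -[X in X <= _](nrm_sqr).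
 by rewrite ler_pXn2r ?nnegrE ?nrm_ge0 // mulr_ge0 // exprn_ge0 // invr_ge0.
have v0 x : ~ E x -> v x = 0 by move=> Ex; rewrite /v indicE memNset // scale0r.
have m1 : bmeas (\1_E : M -> R) by exact: mindic.
have mv : mfld S v.
 move=> c ac l; apply: (@measurable_fun_cvg _ (borel M) _ _ (fun j x => \1_E x * in_chart S c (u (k j)) x 0 l)).
 move=> j; apply: mfM; first exact: mfTS. by have [mu' _] := su (k j); exact: mu'.
 move=> x cx; have [Ex|Ex] := pselect (E x); last first.
 rewrite indicE memNset //; under eq_fun do rewrite mul0r. by rewrite /in_chart v0 // mul0mx mxE; exact: cvg_cst.
 rewrite indicE mem_set //; under eq_fun do rewrite mul1r mxE.
 by rewrite mxE; apply: cvg_sum_ord => i; apply: cvgM; [exact: vE|exact: cvg_cst].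
have mn i : bmeas (nrm (linF (-1) (u i) v)).
 by apply: ms_nrm; apply: ms_fld_lin => //; have [] := su i.
have bound (e : R) : 0 < e -> exists N, forall i, (N <= i)%N ->
 (\int[mu]_x (nrm (linF (-1) (u i) v) x ^+ 2)%:E <= e%:E)%E.
 move=> e0; have [N hN] := cu e e0; exists N => i Ni.
 apply: (@fatou_bd _ (borel M) _ mu (fun j x => nrm (linF (-1) (u i) (u (k j))) x ^+ 2) _ E) => //.
 - by move=> j; apply: mfX; apply: ms_nrm; have [] := md i (k j).
 - exact: mfX.
 - by move=> j x; exact: sqr_ge0.
 - by move=> x; exact: sqr_ge0.
 - move=> x Ex; rewrite nrm_sqr scal_sum; under eq_fun do rewrite nrm_sqr scal_sum.
 have vl a : linF (-1) (u i) (u (k j)) x 0 a @[j --> \oo] --> linF (-1) (u i) v x 0 a.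
 rewrite /linF [X in _ --> X]mxE; under eq_fun do rewrite mxE. by apply: cvgD; [exact: cvg_cst|exact: vE].
 apply: cvg_sum_ord => a; apply: cvgM; last exact: vl.
 by apply: cvg_sum_ord => b; apply: cvgM; [exact: vl|exact: cvg_cst].
 - exists N => j Nj; rewrite dE lee_fin; apply/ltW/hN => //. exact: leq_trans (kj j).
have sv : F2 v.
 have [N hN] := bound 1 ltr01. have h : F2 (linF (-1) (u N) v).
 apply: F2_of_sqint; first by apply: ms_fld_lin => //; have [] := su N.
 by split=> //; exact: le_lt_trans (hN N (leqnn N)) (ltry _).
 have -> : v = linF 1 (linF (-1) (u N) v) (u N).
 by apply/funext => x; rewrite /linF scale1r scaleN1r addrAC addNr add0r.
 exact: F2_lin.
exists v => // e e0; have e2 : 0 < e / 2 by lra.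
have [N hN] := bound _ e2; exists N => i Ni.
have := hN i Ni.
under eqint do rewrite nrm_sqr.
rewrite (@int_Rint _ (borel M)); last by apply: F2_int; exact: F2_lin.
rewrite lee_fin => h; apply: le_lt_trans (_ : e / 2 < e); last by lra.
apply: le_trans h; rewrite /dist2 /dif le_eqVlt; apply/orP; left; apply/eqP.
apply: eqRint => x _; rewrite /Defs.scal.
have -> : linF (-1) v (u i) x = - linF (-1) (u i) v x.
 by rewrite /linF !scaleN1r opprD opprK addrC.
by rewrite linearN /= mulNmx mulNmx mulmxN opprK.
Qed.
End sobolev.

Section weighted_sobolev.
Variables (w : M -> R) (w_smooth : forall x, sma S w x) (w_gt0 : forall x, 0 < w x).
Local Notation L2w := (@wL2 _ (borel M) R mu w).
Local Notation L2s := (@wscal _ (borel M) R mu w).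
Local Notation linf := (@linf_ _ (borel M) R).
Local Notation wgrad := (is_distributional_gradient g Psi mu).
Local Notation scal := (scal g).
Let mw : bmeas w.
exact: (ms_smooth w_smooth). Qed.

(** * The Hilbert space of pairs behind W^1 *)

Section sobolev_hilbert.
Implicit Types (c d : chart R n M) (x z : M) (f h F H : M -> R) (X Y Z : M -> 'rV[R]_n).
Local Notation at_ x := (chart_at S x).
Local Notation wdiv := (weighted_div g Psi).
Local Notation nrm := (nrm).
(** Pointwise |f| <= f^2 w + 1/w, and 1/w is continuous. *)
Lemma L2_loc_L1 f : L2w f -> locally_L1 mu f.
move=> fL; have [mf fi] := fL; split=> // K cK; have mK := cpt_meas cK.
have sV x : sma S (fun z => (w z)^-1) x by exact: sma_inv.
have [mV lV] := loc_L1_cont (fun x => sma_cont (sV x)).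
have i1 := integrableS measurableT mK (@subsetT _ _) (wL2i mw w_gt0 fL fL).
have := integrableD mK i1 (lV K cK); apply: le_integrable => //.
 by apply/mEFinP; exact: mfTS.
move=> x Kx /=; rewrite lee_fin; apply: le_trans (ler_norm _).
have w0 := w_gt0 x; rewrite -[f x * f x]expr2 -(real_normK (num_real (f x))).
have h : 0 <= (`|f x| * w x - 1) ^+ 2 by exact: sqr_ge0.
have h2 := normr_ge0 (f x).
rewrite -(ler_pM2r w0) mulrDl mulVf ?gt_eqF //; nra.
Qed.

Lemma F2_loc_L1 X : F2 X -> locally_L1 mu (nrm X).
move=> fX; have sX := F2_sqint fX; have [mX _] := sX; split=> // K cK; have mK := cpt_meas cK.
have [m1 l1] := loc_L1_cont (@cst_continuous M R 1).
have i1 := integrableS measurableT mK (@subsetT _ _) (sqi_sqr sX).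
have := integrableD mK i1 (l1 K cK); apply: le_integrable => //.
 by apply/mEFinP; exact: mfTS.
move=> x Kx /=; rewrite lee_fin; apply: le_trans (ler_norm _).
rewrite (ger0_norm (nrm_ge0 _ _)); have := sqr_ge0 (nrm X x - 1); have := nrm_ge0 X x; nra.
Qed.

(** A function together with a chosen gradient. [grad] picks a representative and is linear only
    almost everywhere; with pairs, linear combinations are exact. *)
Definition E1 : Type := ((M -> R) * (M -> 'rV[R]_n))%type.
Definition plin (a : R) (p q : E1) : E1 := (linf a p.1 q.1, linF a p.2 q.2).
Definition pW1 (p : E1) : Prop := [/\ L2w p.1, F2 p.2 & wgrad p.1 p.2].
Definition pform (p q : E1) : R := Fscal p.2 q.2 + L2s p.1 q.1.

Lemma b1_prehilbert : prehilbert plin pW1 pform.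
have PL := wL2_prehilbert mu mw w_gt0; have PF := F2_prehilbert.
split=> [a p q [p1 p2 p3] [q1 q2 q3]|a p q r [p1 p2 p3] [q1 q2 q3] [r1 r2 r3]|p q [p1 p2 p3] [q1 q2 q3]|p [p1 p2 p3]].
- split; [exact: (ph_lin PL)|exact: (ph_lin PF)|]. exact: (wgrad_lin a p3 q3).
- rewrite /pform /= (ph_linl PL) // (ph_linl PF) //; ring.
- by rewrite /pform (ph_sym PL) // (ph_sym PF).
- by rewrite addr_ge0 //; [exact: (ph_ge0 PF)|exact: (ph_ge0 PL)].
Qed.

Lemma dist1E p q : dist2 plin pform p q = dist2 linF Fscal p.2 q.2 + dist2 linf L2s p.1 q.1.
by []. Qed.

Lemma F2_Cc_fld Y : smooth_field S Y -> compactly_supported Y -> F2 Y.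
move=> sY cY; have sY' := (smooth_fldP S Y).1 sY; have [K cK K0] := cY.
have mY := ms_smooth_fld sY'; split=> //.
have cS : Cc_infty S (scal Y Y).
 apply: (Cc_supp cK) => [x /K0 e|x _]; last exact: sma_scal. by rewrite /Defs.scal e mul0mx mul0mx mxE.
have /integrableP[_] := Cc_intble cS.
apply: le_lt_trans; apply: ge0_le_integral => //.
- by move=> x _; rewrite lee_fin scal_ge0.
- by apply/mEFinP; exact: ms_scal.
- apply: mfT_comp => //; apply/mEFinP; exact: ms_scal.
- by move=> x _ /=; rewrite lee_fin ler_norm.
Qed.

Lemma L2_Cc F : Cc_infty S F -> L2w F.
move=> cF; have sF := Cc_sm cF; have mF := ms_smooth sF; split=> //.
have cS : Cc_infty S (fun x => F x * (F x * w x)) by apply: Cc_mul => // x; exact: smaM.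
have /integrableP[_] := Cc_intble cS.
apply: le_lt_trans; apply: ge0_le_integral => //.
- by move=> x _; rewrite lee_fin mulr_ge0 ?sqr_ge0 // ltW.
- by apply/mEFinP; apply: mfM => //; exact: mfX.
- by apply: mfT_comp => //; apply/mEFinP; apply: mfM => //; exact: mfM.
- by move=> x _ /=; rewrite lee_fin expr2 -mulrA ler_norm.
Qed.

Lemma nab_supp F (K : set M) x : compact K -> (forall z, ~ K z -> F z = 0) -> ~ K x -> nab g F x = 0.
move=> cK K0 Kx; rewrite -(nab_cst g 0 x); apply: nab_near; first exact: sma_cst.
have oK : open (~` K).
 exact: (cpt_openC S).
by apply: filterS (onbhs (conj oK Kx)) => y /K0.
Qed.

Lemma Cc_D1 F : Cc_infty S F -> pW1 (F, nab g F).
move=> cF; have sF := Cc_sm cF; split; first exact: L2_Cc.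
 apply: F2_Cc_fld; first by apply/smooth_fldP => x; exact: sm_fld_nab.
 by have [_ [K cK K0]] := cF; exists K => // x; exact: nab_supp.
exact: (smooth_grd).
Qed.

(** The defect in the defining identity of the gradient vanishes on [pW1], and by Cauchy-Schwarz in
    both components it is continuous for the norm of pairs. *)
Lemma wgrad_limit f X : L2w f -> F2 X ->
 (forall e : R, 0 < e -> exists2 p, pW1 p & dist2 plin pform p (f, X) < e) -> wgrad f X.
move=> fL fX hp; have PL := wL2_prehilbert mu mw w_gt0; have PF := F2_prehilbert.
have [mX _] := fX; split=> //; [exact: L2_loc_L1|exact: F2_loc_L1|].
move=> Y sY cY; have fY := F2_Cc_fld sY cY.
(* Dividing by the weight turns the integral against the divergence into an inner product of L^2(w
   mu). *)
pose phi x := wdiv Y x / w x.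
have cw : Cc_infty S (wdiv Y) by exact: (Cc_wdiv).
have Lphi : L2w phi.
 by apply: L2_Cc; apply: Cc_mul => // x; exact: sma_inv.
have phiE h : \int[mu]_x (h x * wdiv Y x) = L2s h phi.
 by apply: eqRint => x _; rewrite /phi mulrA divfK // gt_eqF.
rewrite phiE; apply/eqP; rewrite -addr_eq0; apply/eqP.
set N := (X in X = 0).
pose A := Fscal Y Y; pose B := L2s phi phi.
have A0 : 0 <= A by exact: (ph_ge0 PF).
have B0 : 0 <= B by exact: (ph_ge0 PL).
have key (e : R) : 0 < e -> N ^+ 2 <= e * (2 * (A + B)).
 move=> e0; have [[h Z] [hL fZ wh] hd] := hp e e0; rewrite /= in hL fZ wh. have hN : Fscal Z Y + L2s h phi = 0.
 by have [_ _ _ hY] := wh; rewrite /Fscal hY // phiE addNr.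
 have NE : N = - (Fscal (dif linF Z X) Y + L2s (dif linf h f) phi).
 rewrite /dif (ph_linl PF) // (ph_linl PL) //. have -> : N = Fscal X Y + L2s f phi by [].
 by rewrite !mulN1r addrACA hN addr0 -opprD opprK.
 have c1 := ph_CS PF (ph_dif PF fZ fX) fY. have c2 := ph_CS PL (ph_dif PL hL fL) Lphi. rewrite dist1E /= in hd.
 have d1 : 0 <= dist2 linF Fscal Z X by apply: (ph_ge0 PF); exact: (ph_dif PF fZ fX).
 have d2 : 0 <= dist2 linf L2s h f by apply: (ph_ge0 PL); exact: (ph_dif PL hL fL).
 rewrite NE sqrrN; move: c1 c2 hd d1 d2; rewrite -/(dist2 linF Fscal Z X) -/(dist2 linf L2s h f).
 rewrite -/A -/B; move: (Fscal _ _) (L2s _ phi) (dist2 _ _ _ _) (dist2 _ _ _ _) => p q r s c1 c2 hd r0 s0.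
 have h1 : (p + q) ^+ 2 <= 2 * (p ^+ 2 + q ^+ 2) by have := sqr_ge0 (p - q); nra.
 have h2 : s * A <= e * A by rewrite ler_wpM2r //; lra. have h3 : r * B <= e * B by rewrite ler_wpM2r //; lra. lra.
apply/eqP; rewrite -sqrf_eq0 eq_le sqr_ge0 andbT; apply/ler_addgt0Pl => e e0; rewrite addr0.
have C0 : 0 < 2 * (A + B) + 1 by lra.
apply: le_trans (key (e / (2 * (A + B) + 1)) _) _; first exact: divr_gt0.
by rewrite mulrAC ler_pdivrMr // ler_wpM2l ?ltW //; lra.
Qed.

Lemma D1_compl : compl2 plin pW1 pform.
have PL := wL2_prehilbert mu mw w_gt0; have PF := F2_prehilbert.
move=> u su cu.
have d1 i j : dist2 linF Fscal (u i).2 (u j).2 <= dist2 plin pform (u i) (u j).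
 by rewrite dist1E lerDl; apply: (ph_ge0 PL); apply: (ph_dif PL); [have [] := su i|have [] := su j].
have d2 i j : dist2 linf L2s (u i).1 (u j).1 <= dist2 plin pform (u i) (u j).
 by rewrite dist1E lerDr; apply: (ph_ge0 PF); apply: (ph_dif PF); [have [] := su i|have [] := su j].
have [||X fX cX] := @F2_compl (fun k => (u k).2).
- by move=> k; have [] := su k.
- move=> e e0; have [N hN] := cu e e0; exists N => i j Ni Nj. exact: le_lt_trans (d1 i j) (hN _ _ Ni Nj).
have [||f fL cf] := @wL2_compl _ (borel M) R mu w mw w_gt0 (fun k => (u k).1).
- by move=> k; have [] := su k.
- move=> e e0; have [N hN] := cu e e0; exists N => i j Ni Nj. exact: le_lt_trans (d2 i j) (hN _ _ Ni Nj).
have cc : conv2 plin pform u (f, X).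
 move=> e e0; have e2 : 0 < e / 2 by lra. have [N1 h1] := cX _ e2; have [N2 h2] := cf _ e2.
 exists (maxn N1 N2) => i; rewrite geq_max => /andP[i1 i2]. rewrite dist1E /=; have := h1 i i1; have := h2 i i2; lra.
exists (f, X) => //; split=> //=; apply: wgrad_limit => // e e0.
by have [N hN] := cc e e0; exists (u N) => //; exact: hN.
Qed.

Lemma W1P f : W1 g Psi mu w f <-> exists X, pW1 (f, X).
split=> [[fL [X wX iX]]|[X [fL [mX iX] wX]]]; last by split=> //; exists X.
by exists X; split=> //; split=> //; have [] := wX.
Qed.

Lemma W1_normE f X : pW1 (f, X) -> W1_norm g Psi mu w f = Num.sqrt (pform (f, X) (f, X)).
move=> [fL [mX iX] wX]; rewrite /W1_norm /pform /Fscal; congr (Num.sqrt (_ + _)).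
 have wg := grad_wgrad wX; have [_ mg _ _] := wg.
 apply: (@ae_eq_Rint _ (borel M)); [exact: ms_scal|exact: ms_scal|].
 by apply: ae1 (gradE wX) => x e; rewrite /Defs.scal e.
Qed.

Definition pW10 (p : E1) : Prop := pW1 p /\ forall e : R, 0 < e ->
 exists2 h, Cc_infty S h & dist2 plin pform (h, nab g h) p < e.

Lemma W10P f X : pW1 (f, X) -> (W10 g Psi mu w f <-> pW10 (f, X)).
move=> fX; have P := b1_prehilbert.
have E h : Cc_infty S h -> W1_norm g Psi mu w (f \- h) =
 Num.sqrt (dist2 plin pform (h, nab g h) (f, X)).
 move=> ch; have dh := Cc_D1 ch; have dd := ph_dif P fX dh.
 have e1 : dif plin (f, X) (h, nab g h) = (f \- h, linF (-1) (nab g h) X).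
 by rewrite /dif /plin /=; congr pair; apply/funext => x; rewrite /linf_ /= mulN1r addrC.
 rewrite e1 in dd; rewrite (W1_normE dd) -e1; congr (Num.sqrt _). have d2 := ph_dif P dh fX.
 have e2 : dif plin (f, X) (h, nab g h) = plin (-1) (dif plin (h, nab g h) (f, X)) (plin (-1) (f,X) (f,X)).
 rewrite /dif /plin /linf_ /linF /=; congr pair; apply/funext => x.
 by ring.
 by rewrite !scaleN1r opprD opprK addNr addr0 addrC.
 rewrite /dist2 /dif ![pform (plin _ _ _) (plin _ _ _)](ph_exp P) // (ph_sym P dh fX); ring.
split=> [[wf hf]|[_ hf]].
 split=> // e e0; have [|h ch hn] := hf (Num.sqrt e); first by rewrite sqrtr_gt0.
 by exists h => //; move: hn; rewrite E // ltr_sqrt.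
split; first by apply/W1P; exists X.
move=> e e0; have [|h ch hn] := hf (e ^+ 2); first exact: exprn_gt0.
exists h => //; rewrite E //; rewrite -[e]ger0_norm ?ltW // -sqrtr_sqr ltr_sqrt //.
exact: exprn_gt0.
Qed.

Lemma Cc_N10 h : Cc_infty S h -> pW10 (h, nab g h).
move=> ch; have P := b1_prehilbert; split; first exact: Cc_D1.
move=> e e0; exists h => //; rewrite /dist2 /dif (ph_exp P); try exact: Cc_D1.
have -> // : (-1) ^+ 2 * pform (h, nab g h) (h, nab g h) + 2 * -1 * pform (h, nab g h) (h, nab g h) +
 pform (h, nab g h) (h, nab g h) = 0 by ring.
Qed.
End sobolev_hilbert.

Local Notation lin1 := plin.
Local Notation D1 := pW1.
Local Notation b1 := pform.
Local Notation N10 := pW10.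
Let P1 := b1_prehilbert.
Let PL := wL2_prehilbert mu mw w_gt0.
Let PF := F2_prehilbert.

(** * The closed subspace behind W^1_0 *)

Section sob2.
Implicit Types (c d : chart R n M) (x z : M) (f h F H : M -> R) (X Y Z : M -> 'rV[R]_n).
Lemma N10_D1 : N10 `<=` D1. Proof. by move=> p []. Qed.

Lemma N10_lin (a : R) p q : N10 p -> N10 q -> N10 (lin1 a p q).
move=> [dp hp] [dq hq]; split; first exact: (ph_lin P1).
move=> e e0.
have [|h ch hd] := hp (e / 4 / (a ^+ 2 + 1)); first by rewrite divr_gt0 //; have := sqr_ge0 a; lra.
have [|k ck kd] := hq (e / 4); first by lra.
exists (fun z => a * h z + k z); first exact: Cc_lin.
have sh := Cc_sm ch; have sk := Cc_sm ck.
have -> : (fun z => a * h z + k z, nab g (fun z => a * h z + k z)) =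
 lin1 a (h, nab g h) (k, nab g k).
 congr pair; apply/funext => x; rewrite nabD //; last by apply: smaM => //; exact: sma_cst.
 by rewrite nabM ?nab_cst ?scaler0 ?addr0 //; exact: sma_cst.
have dh := Cc_D1 ch.
have dk := Cc_D1 ck.
apply: le_lt_trans (dist2_lin P1 a dh dk dp dq) _.
have a0 : 0 < a ^+ 2 + 1 by have := sqr_ge0 a; lra.
have d0 := dq_ge0 P1 dh dp.
move: hd kd d0; move: (dist2 _ _ _ _) (dist2 _ _ _ _) => r s.
rewrite ltr_pdivlMr // => hr hs r0; nra.
Qed.

Lemma N10_clsd : clsd2 lin1 D1 b1 N10.
move=> p dp hp; split=> // e e0.
have [|q [dq hq] qp] := hp (e / 4); first by lra.
have [|h ch hd] := hq (e / 4); first by lra.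
exists h => //; have dh := Cc_D1 ch.
have := dist2_tri2 P1 dh dq dp; lra.
Qed.

Lemma N10_neq0 : N10 !=set0.
exists (fun=> 0, nab g (fun=> 0)).
by apply: (Cc_N10); exact: Cc0.
Qed.

Lemma D1_ae f h X Z : D1 (f, X) -> bmeas h -> mfld S Z ->
 {ae mu, forall x, f x = h x} -> {ae mu, forall x, X x = Z x} -> D1 (h, Z).
move=> [fL [mX iX] wX] mh mZ fh XZ; split=> /=.
- exact: (wL2_ae mw fL).
- split=> //; have <- // : (\int[mu]_x (scal X X x)%:E = \int[mu]_x (scal Z Z x)%:E)%E.
 apply: (@ae_eq_integral _ (borel M)) => //; try by apply/mEFinP; exact: ms_scal.
 by apply: ae1 XZ => x e _; rewrite /Defs.scal e.
- exact: (wgrad_ae wX).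
Qed.

(** The function component determines the gradient component almost everywhere, so a pair may be
    replaced by any other with the same function. *)
Lemma b1_ae p q r : D1 p -> D1 q -> D1 r ->
 {ae mu, forall x, p.1 x = q.1 x} -> b1 p r = b1 q r.
move=> [pL [mp _] pg] [qL [mq _] qg] [rL [mr _] _] pq; congr (_ + _).
 apply: (@ae_eq_Rint _ (borel M)); [exact: ms_scal|exact: ms_scal|].
 apply: ae1 (wgrad_unique pq pg qg) => x e. by rewrite /Defs.scal e.
have [m1 _] := pL; have [m2 _] := qL; have [m3 _] := rL.
by apply: wscal_ae => //; exact: aeT.
Qed.

Lemma N10_ae f h X Z : N10 (f, X) -> D1 (h, Z) -> {ae mu, forall x, f x = h x} -> N10 (h, Z).
move=> [dp hp] dq fh; split=> // e e0; have [k ck kd] := hp e e0; exists k => //.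
have dk := Cc_D1 ck.
move: kd; rewrite !(dq_exp P1) // (ph_sym P1 dk dp) (ph_sym P1 dk dq).
rewrite (b1_ae dp dq dk fh) (b1_ae dp dq dp fh) // (ph_sym P1 dq dp).
by rewrite (b1_ae dp dq dq fh).
Qed.

(* A bounded sequence of the closed subspace converging weakly only in the
 second component: elements of small norm near the limit form nested
 closed convex sets. *)
Lemma N10_weak_clsd (B : R) (u : nat -> E1) f : (forall k, N10 (u k)) ->
 (forall k, b1 (u k) (u k) <= B) -> L2w f ->
 dist2 linf L2s (u k).1 f @[k --> \oo] --> (0 : R) -> exists X, N10 (f, X).
move=> Nu uB fL cu.
pose C (m : nat) p := N10 p /\ dist2 linf L2s p.1 f <= m.+1%:R^-1.
have L p : N10 p -> L2w p.1 by move=> [[]].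
have [||||||m hm] := @nest_cvx _ _ lin1 D1 b1 P1 _ C B.
- exact: (D1_compl).
- by move=> k p [Np _]; exact: N10_D1.
- move=> k p [Np hp]; split=> //; apply: le_trans hp _. by rewrite lef_pV2 ?posrE ?ltr0n // ler_nat.
- move=> k p q [Np hp] [Nq hq]; split; first exact: N10_lin Np (N10_lin _ Nq Nq).
 apply: le_trans (dist2_mid PL (L _ Np) (L _ Nq) fL) _.
 by move: hp hq; move: (dist2 _ _ _ _) (dist2 _ _ _ _) (_^-1) => r s t; lra.
- move=> k p dp hp; have Np : N10 p.
 by apply: N10_clsd => // e e0; have [c [Nc _] cp] := hp e e0; exists c.
 split=> //; apply: (dist2_clsd PL) => //; first exact: L.
 move=> e e0; have [c [Nc cf] cp] := hp e e0; exists c.1; split=> //; first exact: L.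
 apply: le_lt_trans cp; rewrite dist1E lerDr; have [[_ c2 _] _] := Nc; have [_ p2 _] := dp. exact: (dq_ge0 PF).
- move=> k; have k0 : 0 < k.+1%:R^-1 :> R by rewrite invr_gt0 ltr0n. have /cvgrPdist_lt/(_ _ k0)[N _ hN] := cu.
 exists (u N) => //; split=> //; have := hN N (leqnn N); rewrite sub0r normrN => h.
 exact: le_trans (ler_norm _) (ltW h).
have [Nm _] := hm 0%N; have [[mL [mX _] _] _] := Nm.
have d0 : dist2 linf L2s m.1 f = 0.
 apply/eqP; rewrite eq_le (dq_ge0 PL) // andbT. apply/ler_addgt0Pl => e e0; rewrite addr0.
 have /cvgrPdist_lt/(_ _ e0)[N _ hN] := @cvg_harmonic R.
 have [_ h] := hm N; have := hN N (leqnn N); rewrite /harmonic /= sub0r normrN => h2.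
 exact: le_trans h (le_trans (ler_norm _) (ltW h2)).
have mf : {ae mu, forall x, m.1 x = f x}.
 have := wscal_eq0 mw w_gt0 (ph_dif PL mL fL) d0.
 by apply: ae1 => x; rewrite /dif /linf_ mulN1r => /eqP; rewrite addrC subr_eq0 => /eqP.
exists m.2; have [fm _] := fL; have mm : m = (m.1, m.2) by case: (m).
have dm : D1 (f, m.2).
 have [dm _] := Nm; rewrite mm in dm. by apply: D1_ae dm _ _ mf _ => //; exact: aeT.
by rewrite mm in Nm; exact: N10_ae Nm dm mf.
Qed.
End sob2.

(** * Elements of W^1 multiplied by a cutoff belong to W^1_0 *)

Section localization.
Implicit Types (x z : M) (f h F H : M -> R) (X Y Z : M -> 'rV[R]_n) (y s : 'rV[R]_n).
Local Notation nrm := (nrm).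
Local Notation gramc := (gram_in_chart S g).
Local Notation dens := (dens g Psi).
Local Notation leb := (@leb R n).
Lemma Cc_bdd F : Cc_infty S F -> exists2 C : R, 0 <= C & forall x, `|F x| <= C.
move=> cF; have sF := Cc_sm cF; have [_ [K cK K0]] := cF.
have [C C0 hC] := cont_bdd_cpt cK (fun x _ => sma_cont (sF x)).
exists C => // x; have [Kx|Kx] := pselect (K x); first exact: hC.
by rewrite K0 // normr0.
Qed.

(** The term f nabla(chi) is controlled by the weighted norm of f, since |nabla(chi)|^2 / w is
    continuous with compact support and hence bounded. *)
Lemma D1_mul chi f X : Cc_infty S chi -> D1 (f, X) ->
 D1 ((fun x => chi x * f x), (fun x => chi x *: X x + f x *: nab g chi x)).
move=> cc [fL fX wX]; have sc := Cc_sm cc; have mc := ms_smooth sc.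
have [mf fi] := fL; have [mX _] := fX.
have wg := wgradM wX sc.
split=> //=.
 have [C C0 hC] := Cc_bdd cc. apply: (@wL2_dom _ _ _ _ _ mw w_gt0 C _ f) => //; first exact: mfM.
 by move=> x; rewrite normrM ler_wpM2r.
have sn x := sm_fld_nab g (sc x).
have mn := ms_smooth_fld sn.
have mZ : mfld S (fun x => chi x *: X x + f x *: nab g chi x) by have [] := wg.
have [C C0 hC] := Cc_bdd cc.
have cn : Cc_infty S (fun x => scal (nab g chi) (nab g chi) x / w x).
 have [_ [K cK K0]] := cc; apply: (Cc_supp cK) => [x Kx|x _].
 by rewrite /Defs.scal (nab_supp cK K0 Kx) mul0mx mul0mx mxE mul0r.
 by apply: smaM; [exact: sma_scal|exact: sma_inv].
have [D D0 hD] := Cc_bdd cn.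
apply: F2_of_sqint => //; split; first exact: ms_nrm.
have i1 := F2_int fX fX; have i2 := wL2i mw w_gt0 fL fL.
have i3 := integrableD measurableT (integrableZl measurableT (2 * C ^+ 2) i1) (integrableZl measurableT (2 * D) i2).
have /integrableP[_] := i3; apply: le_lt_trans; apply: ge0_le_integral => //.
- by move=> x _; rewrite lee_fin sqr_ge0.
- by apply/mEFinP; apply: mfX; exact: ms_nrm.
- by apply: mfT_comp => //; have /integrableP[] := i3.
- move=> x _ /=; rewrite lee_fin; apply: le_trans (ler_norm _).
 have := nrm_lin 1 (fun x => chi x *: X x) (fun x => f x *: nab g chi x) x. rewrite /= normr1 mul1r !nrmZ.
 have -> : nrm (fun z => 1 *: (chi z *: X z) + f z *: nab g chi z) x =
 nrm (fun x => chi x *: X x + f x *: nab g chi x) x. by congr (Num.sqrt _); rewrite /Defs.scal scale1r.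
 have h1 := hC x; have h2 : scal (nab g chi) (nab g chi) x <= D * w x.
 by rewrite -ler_pdivrMr //; apply: le_trans (hD x); exact: ler_norm.
 rewrite -nrm_sqr in h2; rewrite -[scal X X x]nrm_sqr.
 have := nrm_ge0 (fun x => chi x *: X x + f x *: nab g chi x) x.
 have := nrm_ge0 X x; have := nrm_ge0 (nab g chi) x; have w0 := w_gt0 x.
 have := normr_ge0 (chi x); rewrite -[f x * f x]expr2 -(real_normK (num_real (f x))). have := normr_ge0 (f x).
 move: (nrm _ x) (nrm _ x) (nrm _ x) `|f x| `|chi x| (w x) h1 h2 w0 => a b c p q v h1 h2 v0 p0 q0 b0 c0 a0 h.
 have e1 : a ^+ 2 <= 2 * ((q * b) ^+ 2 + (p * c) ^+ 2).
 have h3 : a ^+ 2 <= (q * b + p * c) ^+ 2.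
 by rewrite ler_pXn2r // nnegrE // addr_ge0 // mulr_ge0.
 apply: le_trans h3 _; have := sqr_ge0 (q * b - p * c); nra.
 apply: le_trans e1 _. have e2 : (q * b) ^+ 2 <= C ^+ 2 * b ^+ 2.
 by rewrite exprMn ler_wpM2r ?sqr_ge0 // ler_pXn2r // nnegrE.
 have e3 : (p * c) ^+ 2 <= D * (p ^+ 2 * v).
 have -> : D * (p ^+ 2 * v) = p ^+ 2 * (D * v) by ring. by rewrite exprMn ler_wpM2l // sqr_ge0.
 lra.
Qed.

Section cell.
Variable p : M.
Local Notation c := (chart_at S p).
Local Notation a := (fwd c p).
Local Notation r := (radius S p).
Local Notation K := (cellat S p).
Local Notation be := (bmp S p).
Local Notation Om := (fwd c @` dom c).
Local Notation Q := (cube a 2^-1).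
Let ac : atlas S c. Proof. exact: chatP. Qed.
Let cK : compact K. Proof. exact: cpt_cellat. Qed.
Let mK : measurable (K : set (borel M)). Proof. exact: (cpt_meas cK). Qed.
Let Kdom : K `<=` dom c. Proof. by move=> x []. Qed.
Let r0 : 0 < r. Proof. by have [] := radiusP S p. Qed.
Let cubeOm : cube a r `<=` Om. Proof. by have [] := radiusP S p. Qed.
Let cubeQ : cube a r `<=` Q.
by have [_ r4 _] := radiusP S p => y hy i; apply: le_trans (hy i) _; lra. Qed.

(** [cut] stays on the manifold while [ext] passes to R^n; both restrict to the closed cell and
    continue by zero. *)
Definition cut F x : R := if `[< K x >] then F x else 0.
Definition ext F y : R := if `[< cube a r y >] then F (bwd c y) else 0.

Let Kbwd y : cube a r y -> K (bwd c y).
by move=> hy; have [dy e] := ch_bwd (cubeOm hy); split=> //; rewrite /preimage /= e. Qed.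

Let fwdbwd y : cube a r y -> fwd c (bwd c y) = y.
by move=> hy; have [] := ch_bwd (cubeOm hy). Qed.

Lemma extE F y : cube a r y -> ext F y = F (bwd c y).
by move=> hy; rewrite /ext asboolT. Qed.

Lemma ext_out F y : ~ cube a r y -> ext F y = 0.
by move=> hy; rewrite /ext asboolF. Qed.

Lemma cut_id F : (forall x, ~ K x -> F x = 0) -> cut F = F.
by move=> F0; apply/funext => x; rewrite /cut; case: asboolP => // /F0. Qed.

Lemma ms_cut F : measf (K : set (borel M)) F -> bmeas (cut F).
move=> mF; have -> : cut F = (F : borel M -> R) \_ (K : set (borel M)).
 by apply/funext => x; rewrite /cut patchE /in_mem.
exact/(measurable_restrictT _ mK).
Qed.

Lemma pull_cut F y : pull c (cut F) y = ext (fun x => F x * dens c x) y.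
rewrite /pull /cut /ext; case: (asboolP (cube a r y)) => hy.
 by rewrite (asboolT (cubeOm hy)) (asboolT (Kbwd hy)).
case: asboolP => // Oy; rewrite asboolF ?mul0r // => -[dy]; rewrite /preimage /=.
by have [_ ->] := ch_bwd Oy.
Qed.

Lemma ext_pull F : ext F = pull c (cut (fun x => F x / dens c x)).
apply/funext => y; rewrite pull_cut; have [hy|hy] := pselect (cube a r y).
 by rewrite !extE // divfK // gt_eqF // dens_gt0 //; apply: Kdom; exact: Kbwd.
by rewrite !ext_out.
Qed.

Let sm_dens x : K x -> sma S (fun z => (dens c z)^-1) x.
by move=> Kx; apply: sma_inv; [exact: dens_gt0 (Kdom Kx)|exact: sma_dens (Kdom Kx)]. Qed.

Lemma ms_on_cell F : (forall x, dom c x -> sma S F x) -> measf (K : set (borel M)) F.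
move=> sF; apply: (@measurable_funS _ _ (borel M) _ (dom c)); [exact: ms_dom|exact: Kdom|].
exact: (ms_smooth_on (open_dom c) sF).
Qed.

Let mdi : measf (K : set (borel M)) (fun x => (dens c x)^-1).
apply: ms_on_cell => x cx.
by apply: sma_inv; [exact: dens_gt0|exact: sma_dens].
Qed.

Lemma ms_ext F : measf (K : set (borel M)) F ->
 measf [set: borel 'rV[R]_n] (ext F).
move=> mF; rewrite ext_pull; apply: ms_pull => //; apply: mfTS.
by apply: ms_cut; exact: mfM.
Qed.

Lemma Rint_cut F : measf (K : set (borel M)) F ->
 \int[mu]_x cut F x = \int[leb]_y ext (fun x => F x * dens c x) y.
move=> mF; rewrite (Rint_pull ac (ms_cut mF)).
 by apply: eqRint => y _; rewrite pull_cut.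
by move=> x cx; rewrite /cut asboolF // => /Kdom.
Qed.

Lemma sqi_ext_le (C : R) F H : measf (K : set (borel M)) F ->
 mint H -> (forall x, K x -> F x ^+ 2 <= C * H x) -> sqi leb (ext F).
move=> mF iH FH; split; first exact: ms_ext.
have [D D0 hD] := cont_bdd_cpt cK (fun x Kx => sma_cont (sm_dens Kx)).
have E y : ext F y ^+ 2 = pull c (cut (fun x => F x ^+ 2 / dens c x)) y.
 rewrite -ext_pull; have [hy|hy] := pselect (cube a r y); first by rewrite !extE. by rewrite !ext_out // expr0n.
have m1 : bmeas (cut (fun x => F x ^+ 2 / dens c x)).
 by apply: ms_cut; apply: mfM => //; exact: mfX.
have p1 x : 0 <= cut (fun x => F x ^+ 2 / dens c x) x.
 rewrite /cut; case: asboolP => // Kx; apply: divr_ge0; first exact: sqr_ge0.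
 by apply: ltW; exact: dens_gt0 (Kdom Kx).
rewrite (eqint (fun y : borel 'rV[R]_n => (pull c (cut (fun x => F x ^+ 2 / dens c x)) y)%:E)); last first.
 by move=> y _; rewrite E.
rewrite -(ge0_int_pull ac m1 p1); last first.
 by move=> x cx; rewrite /cut asboolF // => /Kdom.
have /integrableP[_] := integrableZl measurableT (C * D) iH.
apply: le_lt_trans; apply: ge0_le_integral => //.
- by move=> x _; rewrite lee_fin.
- exact/mEFinP.
- by apply: mfT_comp => //; have /integrableP[] := integrableZl measurableT (C * D) iH.
move=> x _; rewrite /= lee_fin /cut; case: asboolP => Kx; last exact: normr_ge0.
apply: le_trans (ler_norm _).
have h1 := FH _ Kx; have := hD x Kx; have h2 : 0 <= (dens c x)^-1.
 by rewrite invr_ge0 ltW //; exact: dens_gt0 (Kdom Kx).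
rewrite ger0_norm // => h3.
apply: (@le_trans _ _ (C * H x * (dens c x)^-1)); first exact: ler_wpM2r.
have -> : C * D * H x = C * H x * D by ring.
by apply: ler_wpM2l => //; exact: le_trans (sqr_ge0 _) h1.
Qed.

(** Covariant components of [X]: its scalar products with the coordinate fields of the chart. *)
Definition cov i X x : R := (in_chart S c X x *m gramc c x) 0 i.
Local Notation comp i X x := (in_chart S c X x 0 i).
Lemma scal_cov X Y x : dom c x -> scal X Y x = \sum_i comp i X x * cov i Y x.
move=> cx; rewrite (scal_chart g X Y ac cx) /qf -mulmxA mxE; apply: eq_bigr => i _.
congr (_ * _); rewrite /cov mxE [RHS]mxE; apply: eq_bigr => k _.
by rewrite -{1}(gramc_sym g c x) !mxE mulrC.
Qed.

Lemma comp_sqr i X x : dom c x -> comp i X x ^+ 2 <= invmx (gramc c x) i i * scal X X x.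
move=> cx; rewrite (scal_chart g X X ac cx) mulrC.
exact: (qf_crd (gramc_sym g c x) (gramc_pos g ac cx)).
Qed.

Lemma cov_sqr i X x : dom c x -> cov i X x ^+ 2 <= gramc c x i i * scal X X x.
move=> cx; rewrite (scal_chart g X X ac cx) mulrC.
exact: (qf_cocrd (gramc_sym g c x) (gramc_pos g ac cx)).
Qed.

Let mcomp i X : mfld S X -> measf (K : set (borel M)) (fun x => comp i X x).
move=> mX; apply: (@measurable_funS _ _ (borel M) _ (dom c)); [exact: ms_dom|exact: Kdom|].
exact: mX.
Qed.

Let mcov i X : mfld S X -> measf (K : set (borel M)) (cov i X).
move=> mX; rewrite /cov; under eq_fun do rewrite mxE.
apply: measurable_sum => k; apply: mfM; first exact: mcomp.
by apply: ms_on_cell => x cx; exact: sma_gramc.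
Qed.

Lemma sm_bdd F : (forall x, dom c x -> sma S F x) ->
 exists2 C : R, 0 <= C & forall x, K x -> `|F x| <= C.
move=> sF; apply: cont_bdd_cpt cK _ => x Kx.
by apply: sma_cont (sF _ (Kdom Kx)).
Qed.

Let sqi_ext_mul (F G H W : M -> R) : (forall x, dom c x -> sma S F x) -> (forall x, dom c x -> sma S W x) ->
 measf (K : set (borel M)) G -> mint H ->
 (forall x, K x -> 0 <= H x) -> (forall x, K x -> G x ^+ 2 <= W x * H x) ->
 sqi leb (ext (fun x => F x * G x)).
move=> sF sW mG iH H0 GH.
have [|C C0 hC] := @sm_bdd (fun x => F x * (F x * W x)).
 by move=> x cx; apply: smaM; [exact: sF|apply: smaM; [exact: sF|exact: sW]].
apply: (@sqi_ext_le C _ H) => //; first by apply: mfM => //; exact: ms_on_cell.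
move=> x Kx; have h0 := H0 x Kx; rewrite exprMn.
apply: (@le_trans _ _ (F x ^+ 2 * (W x * H x))); first by rewrite ler_wpM2l ?sqr_ge0 //; exact: GH.
have -> : F x ^+ 2 * (W x * H x) = F x * (F x * W x) * H x by ring.
by apply: ler_wpM2r => //; apply: le_trans (hC _ Kx); exact: ler_norm.
Qed.

Lemma sqi_ext_cov i F X : (forall x, dom c x -> sma S F x) -> F2 X ->
 sqi leb (ext (fun x => F x * cov i X x)).
move=> sF fX; have [mX _] := fX.
apply: (@sqi_ext_mul F _ (scal X X) (fun x => gramc c x i i)) => //.
- by move=> x cx; exact: sma_gramc.
- exact: mcov.
- exact: F2_int.
- by move=> x _; exact: scal_ge0.
- by move=> x Kx; exact: cov_sqr (Kdom Kx).
Qed.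

Lemma sqi_ext_comp i F X : (forall x, dom c x -> sma S F x) -> F2 X ->
 sqi leb (ext (fun x => F x * comp i X x)).
move=> sF fX; have [mX _] := fX.
apply: (@sqi_ext_mul F _ (scal X X) (fun x => invmx (gramc c x) i i)) => //.
- by move=> x cx; exact: sma_invgramc.
- exact: mcomp.
- exact: F2_int.
- by move=> x _; exact: scal_ge0.
- by move=> x Kx; exact: comp_sqr (Kdom Kx).
Qed.

Lemma sqi_ext_fun F f : (forall x, dom c x -> sma S F x) -> L2w f ->
 sqi leb (ext (fun x => F x * f x)).
move=> sF fL; have [mf _] := fL.
apply: (@sqi_ext_mul F _ (fun x => f x * f x * w x) (fun x => (w x)^-1)) => //.
- by move=> x _; exact: sma_inv.
- exact: mfTS.
- exact: (wL2i mw w_gt0 fL fL).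
- by move=> x _; apply: mulr_ge0; [rewrite -expr2; exact: sqr_ge0|exact: ltW].
- by move=> x _; rewrite mulrCA mulVf ?mulr1 ?expr2 // gt_eqF.
Qed.

Lemma extD F H y : ext (fun x => F x + H x) y = ext F y + ext H y.
by have [hy|hy] := pselect (cube a r y); [rewrite !extE|rewrite !ext_out // addr0].
Qed.

Lemma extM F H y : ext (fun x => F x * H x) y = ext F y * ext H y.
by have [hy|hy] := pselect (cube a r y); [rewrite !extE|rewrite !ext_out // mulr0].
Qed.

Lemma extC F (q : 'rV[R]_n -> R) y : ext (fun x => F x * q (fwd c x)) y = ext F y * q y.
by have [hy|hy] := pselect (cube a r y); [rewrite !extE // fwdbwd|rewrite !ext_out // mul0r].
Qed.

Lemma ext_intble F q : sqi leb (ext F) -> Cinfty setT q ->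
 leb.-integrable setT (EFin \o (fun y => ext F y * q y)).
move=> sF sq; have cq y : {for y, continuous q} by exact: (Ck_cont (sq 0%N)).
have /compact_bounded[C [Creal hC]] : compact (q @` Q).
 apply: continuous_compact; last exact: cpt_cube. by apply: csubT => y; exact: cq.
have C1 : C < `|C| + 1 by have := ler_norm C; lra.
have bq y : Q y -> `|q y| <= `|C| + 1.
 by move=> Qy; apply: (hC _ C1 (q y)); exists y.
have s1 : sqi leb (fun y => \1_Q y * q y).
 apply: (@sqi_dom _ _ _ leb (`|C| + 1) _ (\1_Q)); last 2 first.
 - exact: sqi_indic_cube.
 - move=> y; rewrite normrM mulrC; have [Qy|Qy] := pselect (Q y).
 by rewrite indicE mem_set // normr1 !mulr1 bq.
 by rewrite indicE memNset // normr0 !mulr0.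
 apply: mfM; first by apply: mindic; exact: ms_cube.
 by apply: cont_on_meas => //; exact: openT.
have := sqiM sF s1; apply: eq_integrable => // y _ /=; congr EFin.
have [hy|hy] := pselect (cube a r y); last by rewrite ext_out // !mul0r.
by rewrite indicE mem_set ?mul1r //; exact: cubeQ.
Qed.

Let sbe x : sma S be x. Proof. exact: (Cc_sm (bmp_Cc S p)). Qed.
Let sdbe i x : dom c x -> sma S (fun z => dform be c z 0 i) x.
by move=> cx; exact: sma_dform. Qed.

Let bump_push (q : 'rV[R]_n -> R) : Cinfty setT q ->
 let psi := push c (fun y => cube_bump a r y * q y) in
 [/\ Cc_infty S psi, forall x, ~ K x -> psi x = 0 &
 forall x, dom c x -> psi x = be x * q (fwd c x) /\
 forall i, dform psi c x 0 i = be x * pder i q (fwd c x) +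
 q (fwd c x) * dform be c x 0 i].
move=> sq psi; have out y : ~ cube a r y -> cube_bump a r y * q y = 0.
 by move=> hy; rewrite cube_bump_out // mul0r.
have E x : dom c x -> psi x = be x * q (fwd c x).
 by move=> cx; rewrite /psi /bmp !pushE.
have oT : open [set: 'rV[R]_n] := openT.
split=> [|x Kx|x cx].
- apply: (push_Cc (a := a) (r := r)) => // k. by apply: CkM => //; exact: cube_bump_smooth.
- exact: push_out out Kx.
split; first exact: E.
have sqf : sma S (fun z => q (fwd c z)) x by exact: (@sma_fwd _ _ _ S c q x setT).
move=> i; have -> : dform psi c x = dform (fun z => be z * q (fwd c z)) c x.
 apply: (dform_near cx ac); first exact: smaM. by apply: filterS (nbhs_dom cx) => z cz; rewrite E.
rewrite (dformM ac cx (sbe x) sqf) mxE rowZE rowZE; congr (_ * _ + _).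
rewrite mxE /partial_derivative.
have [_ /(_ i)[/(_ (fwd c x) I) dq _]] := sq 1%N.
apply: (@derive_val _ _ _ _ _ _ _ (near_pder _ dq)).
have hO : nbhs (fwd c x) Om by apply: onbhs; split; [exact: open_codom|exact: fwd_in].
by apply: filterS hO => y Oy; rewrite /= (ch_bwd Oy).2.
Qed.

Let densK (u : R) z : dom c z -> u / dens c z * dens c z = u.
by move=> cz; exact: (divfK (lt0r_neq0 (dens_gt0 g Psi_gt0 ac cz))). Qed.

Let divc_crd_fld i F H x : dom c x -> sma S H x ->
 (forall z, dom c z -> dens c z * F z = H z) ->
 divc g Psi c (crd_fld S c i F) x = dform H c x 0 i / dens c x.
move=> cx sH FH.
have hd k : dform (fun z => dens c z * comp k (crd_fld S c i F) z) c x 0 k =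
 (k == i)%:R * dform H c x 0 i.
 have E z : dom c z -> dens c z * comp k (crd_fld S c i F) z = (k == i)%:R * H z.
 move=> cz; rewrite in_chart_crd_fld // rowZE urowE -(FH _ cz); move: (_%:R) => b; ring.
 have -> : dform (fun z => dens c z * comp k (crd_fld S c i F) z) c x =
 dform (fun z => (k == i)%:R * H z) c x.
 apply: (@dform_near _ _ _ S _ _ _ _ cx ac).
 by apply: smaM => //; exact: sma_cst.
 by apply: filterS (nbhs_dom cx) => z cz; rewrite E.
 rewrite (dformM ac cx (sma_cst _ _ _) sH) dform_cst scaler0 addr0 rowZE.
 by case: eqP => [->|_]; rewrite ?mul0r ?mul1r.
rewrite /divc (eq_bigr _ (fun k _ => hd k)) (bigD1 i) //= eqxx mul1r.
by rewrite big1 ?addr0 // => k /negbTE ->; rewrite mul0r.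
Qed.

(** Weak derivative, in the chart, of be f continued by zero. The test field is (psi / dens) d/dx_i
    with psi = be q in coordinates, so that the densities cancel. The bump supplies the compact
    support, which is why [q] may be a polynomial. *)
Lemma ext_parts f X i (q : 'rV[R]_n -> R) : D1 (f, X) -> Cinfty setT q ->
 \int[leb]_y (ext (fun x => be x * f x) y * pder i q y) =
 - \int[leb]_y (ext (fun x => be x * cov i X x + f x * dform be c x 0 i) y * q y).
move=> [fL fX wX] sq; rewrite /= in fL fX wX; have [pC p0 pE] := bump_push sq.
have [mf _] := fL; have [mX _] := fX; have [_ _ _ hX] := wX.
set psi := push _ _ in pC p0 pE.
have sq' : Cinfty setT (pder i q) by move=> k; have [_ /(_ i)[]] := sq k.+1.
pose F x := psi x / dens c x.
have F0 x : ~ K x -> F x = 0 by move=> Kx; rewrite /F p0 // mul0r.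
have sF x : K x -> sma S F x.
 by move=> Kx; apply: smaM; [exact: (Cc_sm pC)|exact: sm_dens].
have [sY cY] := crd_fld_smooth i ac cK Kdom F0 sF; set Y := crd_fld S c i F in sY cY.
have sY' := (smooth_fldP S Y).1 sY.
have Y0 x : ~ K x -> Y x = 0 by move=> /F0; rewrite /Y /crd_fld => ->; rewrite scale0r.
have E1 : scal X Y = cut (fun x => F x * cov i X x).
 apply/funext => x; rewrite /cut; case: asboolP => Kx; last first.
 by rewrite /Defs.scal Y0 // trmx0 mulmx0 mxE.
 have cx := Kdom Kx; rewrite scal_sym scal_cov // (bigD1 i) //=.
 rewrite in_chart_crd_fld // rowZE mxE !eqxx mulr1 big1 ?addr0 // => k ki.
 by rewrite rowZE mxE (negbTE ki) andbF mulr0 mul0r.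
have E2 : (fun x => f x * weighted_div g Psi Y x) =
 cut (fun x => f x * (dform psi c x 0 i / dens c x)).
 apply/funext => x; rewrite /cut; case: asboolP => Kx; last first.
 by rewrite (wdiv_supp cK Y0 Kx) mulr0.
 have cx := Kdom Kx; have wE := wdivc ac cx sY'.
 suff e : weighted_div g Psi Y x = dform psi c x 0 i / dens c x by rewrite e.
 rewrite wE; apply: divc_crd_fld cx (Cc_sm pC x) _ => z cz. by rewrite mulrC; exact: densK.
have mF : measf (K : set (borel M)) F.
 by apply: ms_on_cell => x cx; apply: smaM; [exact: (Cc_sm pC)|apply: sma_inv; [exact: dens_gt0|exact: sma_dens]].
have md : measf (K : set (borel M)) (fun x => dform psi c x 0 i / dens c x).
 apply: ms_on_cell => x cx; apply: smaM; first by apply: sma_dform => //; exact: (Cc_sm pC).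
 by apply: sma_inv; [exact: dens_gt0|exact: sma_dens].
have := hX Y sY cY; rewrite E1 E2.
rewrite Rint_cut; last by apply: mfM => //; exact: mcov.
rewrite Rint_cut; last by apply: mfM => //; exact: mfTS.
have s1 := sqi_ext_fun (fun x _ => sbe x) fL.
have s2 := sqi_ext_cov i (fun x _ => sbe x) fX.
have s3 := sqi_ext_fun (@sdbe i) fL.
have i1 := ext_intble s1 sq'.
have i2 := ext_intble s2 sq.
have i3 := ext_intble s3 sq.
have e1 : \int[leb]_y ext (fun x => F x * cov i X x * dens c x) y =
 \int[leb]_y (ext (fun x => be x * cov i X x) y * q y).
 apply: eqRint => y _; rewrite -extC. have [hy|hy] := pselect (cube a r y); last by rewrite !ext_out.
 have cx := Kdom (Kbwd hy); rewrite !extE // mulrAC /F densK // (pE _ cx).1; ring.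
have e2 : \int[leb]_y ext (fun x => f x * (dform psi c x 0 i / dens c x) * dens c x) y =
 \int[leb]_y (1 * (ext (fun x => be x * f x) y * pder i q y) +
 ext (fun x => dform be c x 0 i * f x) y * q y).
 apply: eqRint => y _; rewrite mul1r -!extC -extD.
 have [hy|hy] := pselect (cube a r y); last by rewrite !ext_out.
 have cx := Kdom (Kbwd hy); rewrite !extE // -mulrA densK // (pE _ cx).2; ring.
have e3 : \int[leb]_y (ext (fun x => be x * cov i X x + f x * dform be c x 0 i) y * q y) =
 \int[leb]_y (1 * (ext (fun x => be x * cov i X x) y * q y) +
 ext (fun x => dform be c x 0 i * f x) y * q y).
 by apply: eqRint => y _; rewrite extD [ext (fun x => f x * _) y]extM [ext (fun x => dform _ _ _ _ _ * _) y]extM; ring.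
rewrite e1 e2 e3 !RiL //.
by move: (Rintegral _ _ _) (Rintegral _ _ _) (Rintegral _ _ _) => A B C ->; ring.
Qed.

Let cov_lin i (F G : M -> R) X Y x : cov i (fun z => F z *: X z + G z *: Y z) x = F x * cov i X x + G x * cov i Y x.
by rewrite /cov /in_chart mulmxDl mulmxDl -!scalemxAl mxE rowZE rowZE. Qed.

Let cov_nab i F x : dom c x -> sma S F x -> cov i (nab g F) x = dform F c x 0 i.
by move=> cx sF; rewrite /cov in_chart_nab // mulmxKV // gramc_unit. Qed.

Definition wt_fld QQ i := ext (fun x => be x * dens c x * comp i QQ x).
Definition wt_fun q QQ := ext (fun x =>
 \sum_i dform be c x 0 i * dens c x * comp i QQ x + be x * dens c x * w x * q x).

(** Against a fixed pair the form is linear in the Euclidean data of [u], with the L^2 coefficients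
    [wt_fld] and [wt_fun]: the shape to which weak convergence applies. *)
Lemma b1_cell q QQ u U (P : 'rV[R]_n -> R) (Pi : 'I_n -> 'rV[R]_n -> R) :
 D1 (q, QQ) -> D1 (u, U) -> (forall x, ~ K x -> u x = 0) -> (forall x, ~ K x -> U x = 0) ->
 (forall x, K x -> u x = be x * P (fwd c x)) ->
 (forall i x, K x -> cov i U x = be x * Pi i (fwd c x) + P (fwd c x) * dform be c x 0 i) ->
 b1 (q, QQ) (u, U) =
 \int[leb]_y (\sum_i wt_fld QQ i y * Pi i y + wt_fun q QQ y * P y).
move=> [qL qF _] [uL uF _] u0 U0 uE UE; rewrite /= in qL qF uL uF.
have [mq _] := qL; have [mQ _] := qF; have [mu' _] := uL; have [mU _] := uF.
have mS := ms_scal mQ mU.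
have i1 := F2_int qF uF; have i2 := wL2i mw w_gt0 qL uL.
have E : b1 (q, QQ) (u, U) = \int[mu]_x (1 * scal QQ U x + q x * u x * w x).
 by rewrite (@RiL _ (borel M)) // mul1r.
rewrite {}E -(@cut_id (fun x => 1 * scal QQ U x + q x * u x * w x)); last first.
 by move=> x Kx; rewrite u0 // /Defs.scal U0 // trmx0 mulmx0 mxE !mulr0 mul0r addr0.
rewrite Rint_cut; last first.
 apply: mfTS; apply: measurable_funD; first exact: mfM.
 by apply: mfM => //; exact: mfM.
apply: eqRint => y _; have [hy|hy] := pselect (cube a r y); last first.
 rewrite /wt_fun !ext_out // mul0r addr0 big1 // => i _. by rewrite /wt_fld ext_out // mul0r.
have Kx := Kbwd hy; have cx := Kdom Kx.
rewrite /wt_fun !extE // scal_cov // uE // mul1r fwdbwd // !mulrDl !mulr_suml addrA -big_split /=.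
congr (_ + _); last by ring.
apply: eq_bigr => i _; rewrite /wt_fld extE // UE // fwdbwd //; ring.
Qed.

Lemma sqi_sum (m : nat) (F : 'I_m -> 'rV[R]_n -> R) : (forall i, sqi leb (F i)) ->
 sqi leb (fun y => \sum_i F i y).
elim: m F => [|m IH] F sF.
 have -> : (fun y => \sum_i F i y) = (fun=> 0) by apply/funext => y; rewrite big_ord0.
 by split => //; under eqint do rewrite expr0n /=; rewrite integral0.
have -> : (fun y => \sum_i F i y) = (fun y => 1 * F ord0 y + \sum_i F (lift ord0 i) y).
 by apply/funext => y; rewrite big_ord_recl mul1r.
by apply: sqi_lin => //; exact: IH.
Qed.

Let sqi_wt_fld q QQ i : D1 (q, QQ) -> sqi leb (wt_fld QQ i).
move=> [_ qF _]; apply: sqi_ext_comp => // x cx; apply: smaM => //; exact: sma_dens.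
Qed.

Let sqi_wt_fun q QQ : D1 (q, QQ) -> sqi leb (wt_fun q QQ).
move=> [qL qF _]; rewrite /= in qL qF.
have sd x : dom c x -> sma S (dens c) x by move=> cx; exact: sma_dens.
have s1 i : sqi leb (ext (fun x => dform be c x 0 i * dens c x * comp i QQ x)).
 by apply: sqi_ext_comp => // x cx; apply: smaM; [exact: sdbe|exact: sd].
have s2 : sqi leb (ext (fun x => be x * dens c x * w x * q x)).
 by apply: sqi_ext_fun => // x cx; apply: smaM => //; apply: smaM => //; exact: sd.
apply: (sqi_ext _ (sqi_lin 1 (sqi_sum s1) s2)) => y.
rewrite /wt_fun mul1r extD; congr (_ + _).
have [hy|hy] := pselect (cube a r y).
 by rewrite extE //; apply: eq_bigr => i _; rewrite extE.
by rewrite ext_out // big1 // => i _; rewrite ext_out.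
Qed.

Lemma wts_int q QQ (P : 'rV[R]_n -> R) (Pi : 'I_n -> 'rV[R]_n -> R) :
 D1 (q, QQ) -> sqi leb P -> (forall i, sqi leb (Pi i)) ->
 \int[leb]_y (\sum_i wt_fld QQ i y * Pi i y + wt_fun q QQ y * P y) =
 \sum_i \int[leb]_y (wt_fld QQ i y * Pi i y) + \int[leb]_y (wt_fun q QQ y * P y).
move=> dq sP sPi.
have [i1 e1] := @intble_lin_sum R n n (fun i y => wt_fld QQ i y * Pi i y) (fun=> 1)
 (fun i => sqiM (sqi_wt_fld i dq) (sPi i)).
have i2 := sqiM (sqi_wt_fun dq) sP.
have E : \int[leb]_y (\sum_i wt_fld QQ i y * Pi i y + wt_fun q QQ y * P y) =
 \int[leb]_y (1 * (\sum_i 1 * (wt_fld QQ i y * Pi i y)) + wt_fun q QQ y * P y).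
 by apply: eqRint => y _; rewrite mul1r; under [in RHS]eq_bigr do rewrite mul1r.
by rewrite E RiL // mul1r e1; under eq_bigr do rewrite mul1r.
Qed.

Definition bp2 f := fun x => be x * (be x * f x).
Definition bp2_grad f X := fun x => be x *: (be x *: X x + f x *: nab g be x) + (be x * f x) *: nab g be x.

Lemma bp2_D1 f X : D1 (f, X) -> D1 (bp2 f, bp2_grad f X).
by move=> d; do 2 apply: D1_mul (bmp_Cc S p) _. Qed.

(* Test the orthogonality against the push-forwards of [be * (h * k_j)], [k_j] the
 Landau kernels and [h] the extension by zero of [be * f] in the chart. *)
Lemma bp2_orth f X q QQ : D1 (f, X) -> D1 (q, QQ) ->
 (forall phi, Cc_infty S phi -> b1 (q, QQ) (phi, nab g phi) = 0) ->
 b1 (q, QQ) (bp2 f, bp2_grad f X) = 0.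
move=> dX dq orth; have [fL fX _] := dX; rewrite /= in fL fX.
pose hf := ext (fun x => be x * f x).
pose hi i := ext (fun x => be x * cov i X x + f x * dform be c x 0 i).
have sh : sqi leb hf by exact: (sqi_ext_fun (fun x _ => sbe x) fL).
have shi i : sqi leb (hi i).
 have s2 := sqi_ext_cov i (fun x _ => sbe x) fX. have s3 := sqi_ext_fun (@sdbe i) fL.
 apply: (sqi_ext _ (sqi_lin 1 s2 s3)) => y; rewrite mul1r /hi extD. by congr (_ + _); rewrite !extM mulrC.
have outQ F y : ~ Q y -> ext F y = 0 by move=> Qy; rewrite ext_out // => /cubeQ.
have dz := bp2_D1 dX.
have bK x : ~ K x -> be x = 0 by exact: bmp_out.
have nK x : ~ K x -> nab g be x = 0 by exact: nab_supp cK bK.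
have Ez : b1 (q, QQ) (bp2 f, bp2_grad f X) =
 \sum_i \int[leb]_y (wt_fld QQ i y * (\1_Q y * hi i y)) +
 \int[leb]_y (wt_fun q QQ y * (\1_Q y * hf y)).
 rewrite (b1_cell (P := hf) (Pi := hi) dq dz).
 - rewrite wts_int //; congr (_ + _).
 apply: eq_bigr => i _; apply: eqRint => y _; congr (_ * _).
 have [Qy|Qy] := pselect (Q y); first by rewrite indicE mem_set // mul1r. by rewrite /hi outQ // mulr0.
 apply: eqRint => y _; congr (_ * _).
 have [Qy|Qy] := pselect (Q y); first by rewrite indicE mem_set // mul1r. by rewrite /hf outQ // mulr0.
 - by move=> x Kx; rewrite /bp2 bK // mul0r.
 - by move=> x Kx; rewrite /bp2_grad bK // nK // mul0r !scale0r addr0.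
 - move=> x Kx; have cx := Kdom Kx; have [_ hx] := Kx. by rewrite /hf extE // fwdK.
 - move=> i x Kx; have cx := Kdom Kx; have [_ hx] := Kx.
 rewrite /hf /hi !extE // !fwdK // /bp2_grad cov_lin cov_lin !cov_nab //.
have ih q' : Cinfty setT q' -> leb.-integrable setT (EFin \o (fun s => hf s * q' s)).
 exact: ext_intble sh.
pose P j y := \int[leb]_s (hf s * lconv j y s).
have sP j : Cinfty setT (P j) by exact: lconv_smooth ih j.
have dP j i y : pder i (P j) y = \int[leb]_s (hi i s * lconv j y s).
 apply: (@derive_val _ _ _ _ _ _ _ (lconv_partial ih j (hi := hi i) _ y)) => q' sq'. exact: ext_parts.
(* The function be P_j is a test function, so the form vanishes on it; on the cell P_j and its
   partial derivatives are the averages of [hf] and of the [hi i]. *)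
have Ej j : 0 = \sum_i \int[leb]_y (wt_fld QQ i y * lavg a j (hi i) y) +
 \int[leb]_y (wt_fun q QQ y * lavg a j hf y).
 have [pC p0 pE] := bump_push (sP j); set psi := push _ _ in pC p0 pE. have dpsi := Cc_D1 pC.
 rewrite -[LHS](orth _ pC) (b1_cell (P := P j) (Pi := fun i => pder i (P j)) dq dpsi p0).
 - have W := wts_int dq (lavg_bd a j sh).1 (fun i => (lavg_bd a j (shi i)).1).
 rewrite -W; apply: eqRint => y _; have [hy|hy] := pselect (cube a r y); last first.
 rewrite /wt_fun !ext_out // !mul0r !addr0 !big1 // => i _; by rewrite /wt_fld ext_out // mul0r.
 have Qy := cubeQ hy; rewrite /P -(lavg_lconv j Qy (outQ _)); congr (_ + _).
 apply: eq_bigr => i _; by rewrite dP -(lavg_lconv j Qy (outQ _)).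
 - by move=> x; exact: nab_supp cK p0.
 - by move=> x Kx; have [] := pE _ (Kdom Kx).
 - move=> i x Kx; have [_ e] := pE _ (Kdom Kx); rewrite cov_nab //; first exact: Kdom. exact: (Cc_sm pC).
rewrite Ez; symmetry; apply: (@cvg_unique _ (@Rhausdorff R) ((fun=> 0 : R) @ \oo)).
 exact: cvg_cst.
rewrite (_ : (fun=> 0) = (fun j => \sum_i \int[leb]_y (wt_fld QQ i y * lavg a j (hi i) y) +
 \int[leb]_y (wt_fun q QQ y * lavg a j hf y))); last by apply/funext => j; exact: Ej.
apply: cvgD; last by apply: lavg_weak => //; exact: sqi_wt_fun.
apply: cvg_sum_ord => i; apply: lavg_weak => //; exact: sqi_wt_fld dq.
Qed.

(** With m the projection of z, the difference z - m is orthogonal to the subspace and, by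
    [bp2_orth], to z itself; hence its norm is 0. *)
Lemma bp2_N10 f X : D1 (f, X) -> N10 (bp2 f, bp2_grad f X).
move=> dX; have dz := bp2_D1 dX.
have [m Nm hm] := orth_proj P1
 (D1_compl) N10_D1
 (N10_neq0)
 (N10_lin)
 (N10_clsd) dz.
set z := (bp2 f, _) in dz hm *; have dm := N10_D1 Nm.
have dd := ph_dif P1 dz dm.
have h0 : b1 (dif lin1 z m) z = 0.
 rewrite (_ : dif lin1 z m = ((dif lin1 z m).1, (dif lin1 z m).2)) // in dd hm *.
 apply: bp2_orth => // phi cphi; apply: hm. exact: (Cc_N10).
apply: (N10_clsd) => // e e0; exists m => //.
rewrite (dist2_sym P1) // /dist2 {2}/dif (ph_linr P1) // hm // h0; lra.
Qed.
End cell.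
(** By [Cc_part], chi f is a finite sum of terms be^2 kappa f, and [bp2_N10] covers each of them. *)
Theorem loclz chi f X : Cc_infty S chi -> D1 (f, X) ->
 N10 ((fun x => chi x * f x), (fun x => chi x *: X x + f x *: nab g chi x)).
move=> cc dX; have [l [kappa ck kE]] := Cc_part cc.
have [Z NZ] : exists Z, N10 ((fun z => \sum_(x <- l) bp2 x (fun z => kappa z * f z) z), Z).
 elim: l {kE} => [|x l [Z NZ]].
 have := Cc_N10 (Cc0 S). have -> : (fun z => \sum_(x <- [::]) bp2 x (fun z => kappa z * f z) z) = (fun=> 0).
 by apply/funext => z; rewrite big_nil.
 by exists (nab g (fun=> 0)).
 have := N10_lin 1 (bp2_N10 x (D1_mul ck dX)) NZ. rewrite /plin /=.
 have -> : linf 1 (bp2 x (fun z => kappa z * f z)) (fun z => \sum_(x <- l) bp2 x (fun z => kappa z * f z) z) =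
 (fun z => \sum_(x <- x :: l) bp2 x (fun z => kappa z * f z) z).
 by apply/funext => z; rewrite /linf_ big_cons mul1r.
 by move=> h; exists (linF 1 (bp2_grad x (fun z => kappa z * f z) (fun z => kappa z *: X z + f z *: nab g kappa z)) Z).
apply: (N10_ae NZ); first exact: D1_mul.
apply: aeT => z; rewrite kE big_distrl /=; apply: eq_bigr => x _.
rewrite /bp2; ring.
Qed.
End localization.

(** * Chain rule, truncation and the order ideal property of W^1_0 *)

Section truncation.
Implicit Types (x z : M) (f h F H u v : M -> R) (X Y Z U : M -> 'rV[R]_n).
Local Notation wdiv := (weighted_div g Psi).
Local Notation nrm := (nrm).
Lemma F2_mul (c : M -> R) X : bmeas c -> (forall x, `|c x| <= 1) -> F2 X ->
 F2 (fun x => c x *: X x) /\ Fscal (fun x => c x *: X x) (fun x => c x *: X x) <= Fscal X X.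
move=> mc c1 fX; have [mX _] := fX; have mZ := ms_fldZ mc mX.
have i := F2_int fX fX; have sE x : scal (fun x => c x *: X x) (fun x => c x *: X x) x = c x ^+ 2 * scal X X x.
 by rewrite scalZl scal_sym scalZl mulrA expr2.
have le1 x : c x ^+ 2 * scal X X x <= scal X X x.
 by rewrite ler_piMl ?scal_ge0 // -real_normK ?num_real // exprn_ile1.
have iZ : mint (scal (fun x => c x *: X x) (fun x => c x *: X x)).
 apply: (@ae_le_intble _ (borel M) _ mu _ (scal X X)) i; first exact: ms_scal.
 by move=> x; rewrite sE ger0_norm // mulr_ge0 ?sqr_ge0 ?scal_ge0.
split; first by split=> //; rewrite (@int_Rint _ (borel M)) ?ltry.
by apply: (@ae_Rint_le _ (borel M)) => //; apply: aeT => x; rewrite sE.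
Qed.

Section chain_rule.
Variables (G G1 : R -> R) (L : R).
Variables (G_Cc : forall F, Cc_infty S F -> Cc_infty S (fun x => G (F x))) (dG : forall s : R, isD s (1 : R) G (G1 s)) (G1_le1 : forall s, `|G1 s| <= 1) (G1_lip : forall s t, `|G1 s - G1 t| <= L * `|s - t|) (G0 : G 0 = 0) (mG1 : measf [set: R] G1).
Let mG : measf [set: R] G.
apply: continuous_measurable_fun => s.
by apply: differentiable_continuous; apply/derivable1_diffP; have [] := dG s.
Qed.

Let G_lip := der_lip1 dG G1_le1.

Let G_le s : `|G s| <= `|s|.
by have := G_lip s 0; rewrite G0 !subr0. Qed.

(** For test functions the rule is classical. Replacing [v] by a nearby test function creates three
    errors, controlled by the L^2 distance of the gradients, by the Lipschitz bound of [G1] and by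
    that of [G]. *)
Lemma chain_rule_test v X Y : N10 (v, X) -> smooth_field S Y -> compactly_supported Y ->
 \int[mu]_x (G1 (v x) * scal X Y x) = - \int[mu]_x (G (v x) * wdiv Y x).
move=> [[vL vX _] hN] sY cY; rewrite /= in vL vX; have [mv _] := vL; have [mX _] := vX.
have fY := F2_Cc_fld sY cY; have [mY _] := fY; have sY' := (smooth_fldP S Y).1 sY.
have sw x : sma S (fun z => (w z)^-1) x by exact: sma_inv.
pose p x := wdiv Y x / w x; pose s x := scal X Y x / w x.
have pL : L2w p by apply: L2_Cc; apply: Cc_mul => //; exact: Cc_wdiv.
have [C C0 hC] : exists2 C : R, 0 <= C & forall x, `|scal Y Y x / w x| <= C.
 have [K cK K0] := cY; apply: Cc_bdd; apply: (Cc_supp cK) => [x /K0 e|x _].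
 by rewrite /Defs.scal e !mul0mx mxE mul0r.
 by apply: smaM => //; exact: sma_scal.
have mGu u : bmeas u -> bmeas (fun x => G (u x)) /\ bmeas (fun x => G1 (u x)).
 by move=> mu'; split; [exact: (mfT_comp mG mu')|exact: (mfT_comp mG1 mu')].
have dom (K : R) f h : bmeas f -> L2w h -> (forall x, `|f x| <= K * `|h x|) ->
 L2w f /\ L2s f f <= K ^+ 2 * L2s h h.
 move=> mf hL fh; have fL := wL2_dom mw w_gt0 mf hL fh; split=> //.
 have i := wL2i mw w_gt0 hL hL; rewrite -(@RintegralZl _ (borel M)) //.
 apply: (@ae_Rint_le _ (borel M)); first exact: (wL2i mw w_gt0).
 by apply: eq_integrable (integrableZl measurableT (K ^+ 2) i) => // x _; rewrite /= EFinM.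
 apply: aeT => x; have q : `|f x| ^+ 2 <= (K * `|h x|) ^+ 2.
 by rewrite ler_pXn2r ?nnegrE // (le_trans _ (fh x)).
 by rewrite exprMn !real_normK ?num_real // in q; rewrite -!expr2 mulrA ler_wpM2r // ltW.
have sL : L2w s.
 have ms : bmeas s by apply: mfM; [exact: ms_scal|exact: ms_smooth sw].
 split=> //; rewrite (@int_Rint _ (borel M)) ?ltry //.
 apply: (@ae_le_intble _ (borel M) _ mu _ (fun x => C * scal X X x)).
 - by apply: mfM => //; exact: mfX.
 - move=> x; have w0 := w_gt0 x; rewrite normrM (ger0_norm (sqr_ge0 (s x))) (gtr0_norm w0).
 have -> : s x ^+ 2 * w x = scal X Y x ^+ 2 / w x by rewrite /s; field; rewrite gt_eqF.
 have h1 := qf_cauchy (gram_sym g x) (gram_posdef g x) (X x) (Y x).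
 apply: (@le_trans _ _ (scal X X x * scal Y Y x / w x)).
 by apply: ler_wpM2r h1; rewrite invr_ge0 ltW.
 rewrite -mulrA mulrC ler_wpM2r ?scal_ge0 //; exact: le_trans (ler_norm _) (hC x).
 - by apply: eq_integrable (integrableZl measurableT C (F2_int vX vX)) => // x _; rewrite /= EFinM.
apply/eqP; rewrite -addr_eq0; set N := (X in X == 0).
(* I - 1 collects the constants of the three errors; a defect [N] other than 0 is refuted by the
   squared distance N^2 / I. *)
pose I := 3 * (L ^+ 2 * L2s s s + L2s p p + Fscal Y Y) + 1.
have s0 := ph_ge0 PL sL; have p0 := ph_ge0 PL pL; have Y0 := ph_ge0 PF fY.
have I0 : 0 < I by rewrite ltr_wpDl // mulr_ge0 // !addr_ge0 // mulr_ge0 // sqr_ge0.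
suff key (t : R) : 0 < t -> N ^+ 2 <= (I - 1) * t.
 apply/contraT => N0; have N2 : 0 < N ^+ 2 by rewrite lt_neqAle sqr_ge0 eq_sym sqrf_eq0 N0.
 have := key _ (divr_gt0 N2 I0); rewrite mulrA ler_pdivlMr // mulrC.
 by move: (N ^+ 2) N2 => q q0; rewrite ler_pM2r //; lra.
move=> t0; have [phi cp hd] := hN _ t0; have [fL fX _] := Cc_D1 cp; rewrite /= in fL fX.
have [mf _] := fL; have sp := Cc_sm cp; have [_ _ _ hG] := smooth_grd (Cc_sm (G_Cc cp)).
pose a x := G1 (v x) - G1 (phi x); pose c x := G (v x) - G (phi x).
have [mGv mG1v] := mGu v mv; have [mGf mG1f] := mGu phi mf.
have dL := ph_dif PL fL vL; have dX := ph_dif PF fX vX.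
have dE x : `|v x - phi x| = `|dif linf phi v x| by rewrite /dif /linf_ mulN1r distrC addrC.
have [aL a2] : L2w a /\ L2s a a <= L ^+ 2 * dist2 linf L2s phi v.
 by apply: dom => // [|x]; [exact: mfB|rewrite -dE; exact: G1_lip].
have [cL c2] : L2w c /\ L2s c c <= 1 ^+ 2 * dist2 linf L2s phi v.
 by apply: dom => // [|x]; [exact: mfB|rewrite -dE mul1r; exact: G_lip].
have [GL _] : L2w (fun x => G (phi x)) /\ L2s (fun x => G (phi x)) (fun x => G (phi x)) <= 1 ^+ 2 * L2s phi phi.
 by apply: dom => // x; rewrite mul1r; exact: G_le.
have WE : nab g (fun x => G (phi x)) = fun x => G1 (phi x) *: nab g phi x.
 by apply/funext => x; exact: nab_comp1.
have [WF _] := F2_mul mG1f (fun x => G1_le1 (phi x)) fX.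
have [ZF z2] := F2_mul mG1f (fun x => G1_le1 (phi x)) dX.
have := hG Y sY cY; rewrite WE; set Z := fun x => _ in ZF z2; set W := fun x => _ in WF *; move=> W0.
have i1 := F2_int ZF fY; have i2 := wL2i mw w_gt0 aL sL; have i3 := F2_int WF fY.
have i4 := wL2i mw w_gt0 cL pL; have i5 := wL2i mw w_gt0 GL pL.
have f1 : \int[mu]_x (G1 (v x) * scal X Y x) = (-1) * Fscal Z Y + (1 * L2s a s + Fscal W Y).
 rewrite -(@RiL _ (borel M) _ mu 1 _ _ i2 i3).
 rewrite -(@RiL _ (borel M) _ mu (-1) _ _ i1 (intble_lin 1 i2 i3)).
 apply: eqRint => x _; rewrite /Z /W !scalZl scal_linl /a /s; have w0 := w_gt0 x. by field; rewrite gt_eqF.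
have f2 : \int[mu]_x (G (v x) * wdiv Y x) = 1 * L2s c p + \int[mu]_x (G (phi x) * wdiv Y x).
 have -> : \int[mu]_x (G (phi x) * wdiv Y x) = L2s (fun x => G (phi x)) p.
 by apply: eqRint => x _; rewrite /p; have w0 := w_gt0 x; field; rewrite gt_eqF.
 rewrite -(@RiL _ (borel M) _ mu 1 _ _ i4 i5); apply: eqRint => x _.
 by rewrite /p /c; have w0 := w_gt0 x; field; rewrite gt_eqF.
have NE : N = - Fscal Z Y + L2s a s + L2s c p.
 rewrite /N f1 f2 -[Fscal W Y]/(\int[mu]_x scal W Y x) W0.
 by move: (Fscal _ _) (L2s _ _) (L2s _ _) (Rintegral _ _ _) => x1 x2 x3 x4; ring.
have cZ := ph_CS PF ZF fY; have ca := ph_CS PL aL sL.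
have cc := ph_CS PL cL pL.
have := dq_ge0 PF fX vX; have := dq_ge0 PL fL vL; move: hd; rewrite dist1E /= => hd dL0 dX0.
have hZ : Fscal Z Y ^+ 2 <= t * Fscal Y Y.
 apply: le_trans cZ (ler_wpM2r Y0 _); apply: le_trans z2 _.
 by move: hd dL0 dX0; rewrite /dist2; move: (Fscal _ _) (L2s _ _) => x1 x2; lra.
have dt : dist2 linf L2s phi v <= t by move: hd dL0 dX0; move: (dist2 _ _ _ _) (dist2 _ _ _ _) => x1 x2; lra.
have ha : L2s a s ^+ 2 <= L ^+ 2 * t * L2s s s.
 by apply: le_trans ca (ler_wpM2r s0 _); apply: le_trans a2 _; rewrite ler_wpM2l ?sqr_ge0.
have hc : L2s c p ^+ 2 <= t * L2s p p.
 by apply: le_trans cc (ler_wpM2r p0 _); apply: le_trans c2 _; rewrite expr1n mul1r.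
rewrite NE /I addrK; move: hZ ha hc.
move: (Fscal Z Y) (L2s a s) (L2s c p) (L2s s s) (L2s p p) (Fscal Y Y) (L ^+ 2) => x1 x2 x3 k1 k2 k3 l h1 h2 h3.
apply: (@le_trans _ _ (3 * (x1 ^+ 2 + x2 ^+ 2 + x3 ^+ 2))).
 have := sqr_ge0 (x1 + x2); have := sqr_ge0 (x2 - x3); have := sqr_ge0 (x1 + x3); nra.
have -> : 3 * (l * k1 + k2 + k3) * t = 3 * (t * k3 + l * t * k1 + t * k2) by ring.
lra.
Qed.

(** Multiplying by a cutoff that is 1 near the support of [Y] changes neither integral and brings
    the pair into the subspace. *)
Lemma chain_rule v X Y : D1 (v, X) -> smooth_field S Y -> compactly_supported Y ->
 \int[mu]_x (G1 (v x) * scal X Y x) = - \int[mu]_x (G (v x) * wdiv Y x).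
move=> dv sY cY; have [K cK K0] := cY; have [chi [cc _ c1]] := cutoff S cK.
have := chain_rule_test (loclz cc dv) sY cY.
have e1 x : K x -> chi x = 1 /\ nab g chi x = 0.
 move=> Kx; split; first exact: nbhs_singleton (c1 x Kx).
 rewrite -(nab_cst g 1 x); apply: nab_near; first exact: sma_cst. by apply: filterS (c1 x Kx) => z ->.
have -> : \int[mu]_x (G1 (chi x * v x) * scal (fun x => chi x *: X x + v x *: nab g chi x) Y x) =
 \int[mu]_x (G1 (v x) * scal X Y x).
 apply: eqRint => x _; have [Kx|Kx] := pselect (K x); last first.
 by rewrite /Defs.scal K0 // trmx0 !mulmx0 mxE !mulr0.
 have [h1 h2] := e1 x Kx; rewrite h1 mul1r; congr (_ * _). by rewrite /Defs.scal h1 h2 scale1r scaler0 addr0.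
move=> ->; congr (- _); apply: eqRint => x _; have [Kx|Kx] := pselect (K x); last first.
 by rewrite (wdiv_supp cK K0 Kx) !mulr0.
by have [h1 _] := e1 x Kx; rewrite h1 mul1r.
Qed.
End chain_rule.
Definition trunc (c : R) v x : R := Num.max (v x - c) 0.
Definition tgrad (c : R) v X x : 'rV[R]_n := (\1_[set z | c < v z] x : R) *: X x.

Let mgt (c : R) v : bmeas v -> measurable ([set z | c < v z] : set (borel M)).
move=> mv; have -> : [set z | c < v z] = setT `&` v @^-1` `]c, +oo[.
 by rewrite setTI; apply/seteqP; split=> z /=; rewrite in_itv /= andbT.
exact: mv.
Qed.

Let mtrunc (c : R) v : bmeas v -> bmeas (trunc c v).
by move=> mv; apply: measurable_maxr => //; exact: mfB. Qed.

Let mtgrad (c : R) v X : bmeas v -> mfld S X ->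
 mfld S (tgrad c v X).
by move=> mv mX; apply: ms_fldZ => //; apply: mindic; exact: mgt.
Qed.

Lemma indic_gt (c : R) v x : (\1_[set z | c < v z] x : R) = (c < v x)%R%:R.
rewrite indicE; have [h|h] := ltP c (v x); first by rewrite mem_set.
by rewrite memNset //=; apply/negP; rewrite -leNgt.
Qed.

Lemma scal_tgrad (c : R) v X Z x :
 scal (tgrad c v X) Z x = (c < v x)%R%:R * scal X Z x.
by rewrite (scalZl (\1_[set z | c < v z])) indic_gt. Qed.

Lemma trunc_abs (c : R) v x : 0 <= c -> `|trunc c v x| <= `|v x|.
move=> c0; rewrite /trunc ger0_norm ?le_max ?lexx ?orbT //.
by rewrite ge_max normr_ge0 andbT; have := ler_norm (v x); lra.
Qed.

Lemma trunc_lip (c : R) u v x : `|trunc c u x - trunc c v x| <= `|u x - v x|.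
rewrite /trunc; have -> : u x - v x = u x - c - (v x - c) by ring.
move: (u x - c) (v x - c) => p q.
have h1 := ler_norm (p - q); have h2 := ler_norm (- (p - q)); rewrite normrN in h2.
by rewrite ler_norml; have [?|?] := leP p 0; have [?|?] := leP q 0; apply/andP; split; lra.
Qed.

Lemma trunc_F2 (c : R) v X : bmeas v -> F2 X -> F2 (tgrad c v X).
move=> mv fX; have mi : bmeas (\1_[set z | c < v z] : M -> R) by apply: mindic; exact: mgt.
have [] // := F2_mul mi _ fX => x.
by rewrite ger0_norm // indic_gt; case: (_ < _).
Qed.

Lemma trunc_L2 (c : R) v : 0 <= c -> L2w v -> L2w (trunc c v).
move=> c0 vL; have [mv _] := vL; apply: (@wL2_dom _ _ _ _ _ mw w_gt0 1 _ v) => //; first exact: mtrunc.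
by move=> x; rewrite mul1r; exact: trunc_abs.
Qed.

(** Smooth approximation of (s - c)^+ with slope in [0, 1]. It vanishes for s <= c, so it maps 0 to
    0 when c >= 0 and preserves compact supports. *)
Let ramp (a c s : R) : R := (s - c) * bp1 (a * (s - c)).

Let ramp_le (a c s : R) : 0 < a -> s <= c -> ramp a c s = 0.
by move=> a0 h; rewrite /ramp bp1_eq0 ?mulr0 // pmulr_rle0 // subr_le0. Qed.

Let ramp_der (a c s : R) : 0 < a -> isD s (1 : R) (ramp a c) (dramp (a * (s - c))).
move=> a0; have h1 : isD s (1 : R) (fun t => a * (t - c)) a.
 by apply: is_derive_eq; rewrite subr0 /GRing.scale /= mulr1.
have h2 := @is_derive1_comp _ (fun t => t * bp1 t) (fun t : R => a * (t - c)) s _ _ (is_der_ramp _) h1.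
have h3 := is_deriveZ a^-1 h2.
have E : ramp a c = a^-1 \*: ((fun t => t * bp1 t) \o (fun t : R => a * (t - c))).
 by apply/funext => t; rewrite /ramp /= /GRing.scale /= mulrA mulrA mulVf ?mul1r // gt_eqF.
by rewrite E; apply: is_derive_eq h3 _; rewrite /GRing.scale /= mulrCA mulVf ?mulr1 // gt_eqF.
Qed.

(** The chain rule for the ramps passes to the limit by dominated convergence, their derivatives
    tending to the indicator of {v > c}. *)
Theorem trunc_D1 (c : R) v X : 0 <= c -> D1 (v, X) -> D1 (trunc c v, tgrad c v X).
move=> c0 dv; have [vL vX _] := dv; rewrite /= in vL vX; have [mv _] := vL; have [mX _] := vX.
have tL := trunc_L2 c0 vL; have tF := trunc_F2 c mv vX; split=> //.
rewrite /=; split; [|exact: mtgrad| |].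
- exact: (L2_loc_L1 tL).
- exact: (F2_loc_L1 tF).
move=> Y sY cY; have fY := F2_Cc_fld sY cY; have [mY _] := fY.
have cw : Cc_infty S (wdiv Y) by exact: (Cc_wdiv).
have mwd := ms_smooth (Cc_sm cw).
have cphi : Cc_infty S (fun x => wdiv Y x / w x).
 by apply: Cc_mul => // x; exact: sma_inv.
have Lphi := L2_Cc cphi.
have [L L0 hL] := @dramp_lip R.
have md : measf [set: R] (dramp : R -> R).
 apply: continuous_measurable_fun => s; apply: differentiable_continuous; apply/derivable1_diffP.
 by have [] := is_der_flat (1 + 'X) s.
have E j : \int[mu]_x (dramp (j.+1%:R * (v x - c)) * scal X Y x) =
 - \int[mu]_x (ramp j.+1%:R c (v x) * wdiv Y x).
 have j0 : 0 < j.+1%:R :> R by rewrite ltr0n.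
 apply: (@chain_rule (ramp j.+1%:R c) (fun s => dramp (j.+1%:R * (s - c))) (L * j.+1%:R)) => //.
 - move=> F cF; have sF := Cc_sm cF; have [_ [K cK K0]] := cF.
 have sB x : sma S (fun z => F z - c) x by apply: smaD => //; exact: sma_cst.
 apply: (Cc_supp cK) => [x /K0 e|x _]; first by rewrite e ramp_le. rewrite /ramp.
 apply: smaM => //; apply: (@sma_comp1 _ _ _ S setT bp1) => //; [exact: openT|exact: smooth1_flat|].
 by apply: smaM => //; exact: sma_cst.
 - by move=> s; exact: ramp_der.
 - by move=> s; rewrite ger0_norm ?dramp_ge0 // dramp_le1.
 - move=> s t; apply: le_trans (hL _ _) _; rewrite -mulrBr opprB addrA subrK. by rewrite normrM (gtr0_norm j0) mulrA.
 - exact: ramp_le.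
 - apply: (mfT_comp md); apply: mfM => //; exact: mfB.
have i1 := F2_int vX fY; have i2 := wL2i mw w_gt0 vL Lphi.
have mb : measf [set: R] (bp1 : R -> R).
 apply: continuous_measurable_fun => s; apply: differentiable_continuous; apply/derivable1_diffP.
 by have [] := is_der_flat 1 s.
have mvc j : bmeas (fun x => j.+1%:R * (v x - c)).
 by apply: mfM => //; exact: mfB.
have A1 : \int[mu]_x (dramp (k.+1%:R * (v x - c)) * scal X Y x) @[k --> \oo] -->
 \int[mu]_x scal (tgrad c v X) Y x.
 apply: (@Rint_dom _ (borel M) _ mu _ _ (fun x => `|scal X Y x|)).
 - move=> k; apply: mfM; last exact: ms_scal. exact: (mfT_comp md (mvc k)).
 - by apply: ms_scal => //; exact: mtgrad.
 - exact: integrable_norm.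
 - move=> x; rewrite scal_tgrad; apply: cvgM; last exact: cvg_cst.
 case: ltP => /= h; first by apply: dramp_cvg; rewrite subr_gt0. have e k : dramp (k.+1%:R * (v x - c)) = 0.
 by rewrite /dramp flat_le0 // mulr_ge0_le0 // subr_le0.
 by under eq_fun do rewrite e; exact: cvg_cst.
 - by move=> k x; rewrite normrM ler_piMl // ger0_norm ?dramp_ge0 // dramp_le1.
have A2 : \int[mu]_x (ramp k.+1%:R c (v x) * wdiv Y x) @[k --> \oo] -->
 \int[mu]_x (trunc c v x * wdiv Y x).
 have rle a s : 0 < a -> `|ramp a c s| <= `|s|.
 move=> a0; have [h|h] := leP s c.
 by rewrite ramp_le // normr0.
 rewrite /ramp normrM; apply: (@le_trans _ _ `|s - c|).
 by rewrite ler_piMr // ger0_norm ?bp1_ge0 // bp1_le1.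
 by rewrite !ger0_norm; lra.
 apply: (@Rint_dom _ (borel M) _ mu _ _ (fun x => `|v x * (wdiv Y x / w x) * w x|)).
 - move=> k; apply: mfM => //; apply: mfM; first exact: mfB.
 exact: (mfT_comp mb (mvc k)).
 - by apply: mfM => //; exact: mtrunc.
 - exact: integrable_norm.
 - move=> x; apply: cvgM; last exact: cvg_cst; rewrite /ramp /trunc. have [h|h] := leP (v x - c) 0.
 have e k : bp1 (k.+1%:R * (v x - c)) = 0 by rewrite bp1_eq0 // mulr_ge0_le0.
 by under eq_fun do rewrite e mulr0; exact: cvg_cst.
 by rewrite -[X in _ --> X]mulr1; apply: cvgM; [exact: cvg_cst|exact: bp1_cvg].
 - move=> k x; rewrite -mulrA divfK ?gt_eqF // normrM [X in _ <= X]normrM; apply: ler_wpM2r => //; exact: rle.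
by rewrite (funext E) in A1; exact: (@cvg_unique _ (@Rhausdorff R) _ _ _ _ A1 (cvgN A2)).
Qed.

Lemma D1_add u U f (F : M -> 'rV[R]_n) : D1 (u, U) -> D1 (f, F) -> D1 (fun x => u x + f x, fun x => U x + F x).
move=> du df; have := ph_lin P1 1 du df; rewrite /plin /=.
have -> : linf 1 u f = (fun x => u x + f x) by apply/funext => x; rewrite /linf_ mul1r.
have -> // : linF 1 U F = (fun x => U x + F x).
by apply/funext => x; rewrite /linF scale1r.
Qed.

Lemma b1_add_le u U f (F : M -> 'rV[R]_n) : D1 (u, U) -> D1 (f, F) ->
 b1 (fun x => u x + f x, fun x => U x + F x) (fun x => u x + f x, fun x => U x + F x) <=
 2 * (b1 (u, U) (u, U) + b1 (f, F) (f, F)).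
move=> du df.
have -> : (fun x => u x + f x, fun x => U x + F x) = lin1 1 (u, U) (f, F).
 rewrite /plin /=; congr pair; apply/funext => x; first by rewrite /linf_ mul1r. by rewrite /linF scale1r.
have := ph_ge0 P1 (ph_lin P1 (-1) du df); rewrite !(ph_exp P1) //.
by move: (b1 _ _) (b1 _ _) (b1 _ _) => p q r; lra.
Qed.

Lemma b1_near p q : D1 p -> D1 q -> b1 p p <= 2 * (dist2 lin1 b1 p q + b1 q q).
move=> dp dq; have := ph_ge0 P1 (ph_lin P1 (-2) dq dp).
rewrite (ph_exp P1) // (dq_exp P1) // (ph_sym P1 dq dp).
by move: (b1 _ _) (b1 _ _) (b1 _ _) => x y z; lra.
Qed.

Lemma trunc_b1 (c : R) v X : 0 <= c -> D1 (v, X) ->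
 b1 (trunc c v, tgrad c v X) (trunc c v, tgrad c v X) <= b1 (v, X) (v, X).
move=> c0 dv; have [tL tF _] := trunc_D1 c0 dv; have [vL vF _] := dv; rewrite /= in tL tF vL vF.
rewrite /pform /=; apply: lerD.
 apply: (@ae_Rint_le _ (borel M)); [exact: F2_int|exact: F2_int|].
 apply: aeT => x; rewrite scal_tgrad (scal_sym g X) scal_tgrad.
 have := scal_ge0 g X x; by case: (_ < _) => /= h; rewrite ?mul1r ?mul0r.
apply: (@ae_Rint_le _ (borel M)); [exact: (wL2i mw w_gt0)|exact: (wL2i mw w_gt0)|].
apply: aeT => x; apply: ler_wpM2r; first exact: ltW.
rewrite -!expr2 -(real_normK (num_real (v x))) -(real_normK (num_real (trunc c v x))).
by rewrite ler_pXn2r ?nnegrE // trunc_abs.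
Qed.

Lemma trunc_dist (c : R) u v : L2w u -> L2w v -> 0 <= c ->
 dist2 linf L2s (trunc c u) (trunc c v) <= dist2 linf L2s u v.
move=> uL vL c0; have dt := ph_dif PL (trunc_L2 c0 uL) (trunc_L2 c0 vL); have d := ph_dif PL uL vL.
apply: (@ae_Rint_le _ (borel M)); [exact: (wL2i mw w_gt0)|exact: (wL2i mw w_gt0)|].
apply: aeT => x; apply: ler_wpM2r; first exact: ltW.
have e f h : dif linf f h x = f x - h x by rewrite /dif /linf_; ring.
rewrite !e -!expr2 -(real_normK (num_real (trunc c u x - _))) -(real_normK (num_real (u x - _))).
by rewrite ler_pXn2r ?nnegrE // trunc_lip.
Qed.

Lemma N10_seq p : N10 p -> exists phi : nat -> M -> R, forall k, Cc_infty S (phi k) /\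
 dist2 lin1 b1 (phi k, nab g (phi k)) p < k.+1%:R^-1.
move=> [_ hp]; suff /choice[phi h] : forall k : nat, exists h : M -> R,
 Cc_infty S h /\ dist2 lin1 b1 (h, nab g h) p < k.+1%:R^-1 by exists phi.
move=> k; have [|h ch hd] := hp k.+1%:R^-1; first by rewrite invr_gt0 ltr0n.
by exists h.
Qed.

(** For a test function phi near [u], the truncation of phi + f vanishes almost everywhere off the
    support of phi, so it equals its product with a cutoff and [loclz] applies. These truncations
    are bounded in the form norm and converge in L^2, which is what [N10_weak_clsd] asks for. *)
Theorem ideal (c : R) u U f (F : M -> 'rV[R]_n) : 0 <= c -> N10 (u, U) -> D1 (f, F) -> {ae mu, forall x, f x <= c} ->
 N10 (trunc c (fun x => u x + f x), tgrad c (fun x => u x + f x) (fun x => U x + F x)).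
move=> c0 Nu df fc; have du := N10_D1 Nu.
have [phi hphi] := N10_seq Nu.
have dphi k := Cc_D1 (hphi k).1.
have da k := D1_add (dphi k) df; have dt k := trunc_D1 c0 (da k).
have dua := D1_add du df; have dut := trunc_D1 c0 dua.
have Nt k : N10 (trunc c (fun x => phi k x + f x),
 tgrad c (fun x => phi k x + f x) (fun x => nab g (phi k) x + F x)).
 have [[_ [K cK K0]] _] := hphi k; have [chi [cc _ c1]] := cutoff S cK. have := loclz cc (dt k).
 move=> h; apply: (N10_ae h (dt k)). apply: ae1 fc => x fx; have [Kx|Kx] := pselect (K x).
 by rewrite (nbhs_singleton (c1 x Kx)) mul1r.
 rewrite /trunc K0 // add0r; have -> : Num.max (f x - c) 0 = 0 by apply/max_idPr; rewrite subr_le0. by rewrite mulr0.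
have [duL _ _] := dua; have [dutL _ _] := dut; rewrite /= in duL dutL.
have [X NX] : exists X, N10 (trunc c (fun x => u x + f x), X).
 apply: (N10_weak_clsd
 (B := 2 * (2 * (1 + b1 (u, U) (u, U)) + b1 (f, F) (f, F))) Nt) => //.
 move=> k; apply: le_trans (trunc_b1 c0 (da k)) _; apply: le_trans (b1_add_le (dphi k) df) _.
 have := b1_near (dphi k) du; have [_ hk] := hphi k.
 have : k.+1%:R^-1 <= 1 :> R by rewrite invf_le1 ?ltr0n // ler1n.
 move: hk; move: (dist2 _ _ _ _) (b1 (phi k, nab g (phi k)) _) (b1 (u, U) _) (b1 (f, F) _) (k.+1%:R^-1) => p q r s t; lra.
 apply: (@squeeze_cvgr _ _ _ _ (fun=> 0) harmonic); last 2 first.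
 - exact: cvg_cst.
 - exact: cvg_harmonic.
 apply: nearW => k; have [tL _ _] := dt k; have [aL _ _] := da k; rewrite /= in tL aL.
 rewrite (dq_ge0 PL) //=; apply: le_trans (trunc_dist aL duL c0) _.
 have [uL uF _] := du; have [pL pF _] := dphi k; rewrite /= in uL uF pL pF.
 have e : dist2 linf L2s (fun x => phi k x + f x) (fun x => u x + f x) = dist2 linf L2s (phi k) u.
 by apply: eqRint => x _; rewrite /dif /linf_; ring.
 rewrite e; apply: ltW; apply: le_lt_trans (hphi k).2; rewrite dist1E lerDr. exact: (dq_ge0 PF).
apply: (N10_ae NX dut).
exact: aeT.
Qed.

Corollary N10_trunc (c : R) u U : 0 <= c -> N10 (u, U) -> N10 (trunc c u, tgrad c u U).
move=> c0 Nu; have d0 := Cc_D1 (Cc0 S).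
have := ideal c0 Nu d0 (aeT _ (fun=> c0)).
have -> : (fun x => u x + (fun=> 0) x) = u by apply/funext => x; rewrite addr0.
have -> // : (fun x => U x + nab g (fun=> 0) x) = U.
by apply/funext => x; rewrite nab_cst addr0.
Qed.
End truncation.
End weighted_sobolev.

(** * Generator and resolvent of the semigroup *)

Section semigroup.
Variables (V : M -> R) (V_smooth : smooth S V) (V_ge0 : forall x, 0 <= V x) (rho : M -> R) (rho_smooth : smooth S rho) (rho_gt0 : forall x, 0 < rho x) (T : R -> (M -> R) -> (M -> R)) (T_semigroup : is_semigroup_of_form g Psi mu rho V T).
Implicit Types (x z : M) (f h u v k : M -> R) (X Y Z U : M -> 'rV[R]_n).
Definition sumw : M -> R := rho \+ V.
Local Notation w := sumw.
Local Notation linf := (@linf_ _ (borel M) R).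
Local Notation lin1 := plin.
Local Notation Lr := (@wL2 _ (borel M) R mu rho).
Local Notation sr := (@wscal _ (borel M) R mu rho).
Local Notation nr := (fun f => sr f f).
Local Notation L2w := (@wL2 _ (borel M) R mu w).
Local Notation L2s := (@wscal _ (borel M) R mu w).
Local Notation D1 := (pW1 w).
Local Notation b1 := (pform w).
Local Notation N10 := (pW10 w).
Local Notation graph := (operator_graph g Psi mu rho V).
Lemma sm_w x : sma S w x.
by apply: smaD; [exact: (smoothP S rho).1|exact: (smoothP S V).1]. Qed.

Lemma wgt0 x : 0 < w x.
by rewrite /sumw /=; have := rho_gt0 x; have := V_ge0 x; lra. Qed.

Lemma rho_le x : rho x <= w x. Proof. by rewrite /sumw /= lerDl. Qed.

Let mw : bmeas w.
exact: (ms_smooth sm_w). Qed.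
Lemma ms_rho : bmeas rho.
by apply: ms_smooth; exact: (smoothP S rho).1. Qed.
Let mr := ms_rho.

Let P1 := b1_prehilbert sm_w wgt0.
Let PR := wL2_prehilbert mu mr rho_gt0.
Let PF := F2_prehilbert.

Lemma L2w_Lr f : L2w f -> Lr f.
move=> [mf fi]; split=> //; apply: le_lt_trans fi; apply: ge0_le_integral => //.
- by move=> x _; rewrite lee_fin mulr_ge0 ?sqr_ge0 // ltW.
- by apply/mEFinP; apply: mfM => //; exact: mfX.
- by apply/mEFinP; apply: mfM => //; exact: mfX.
- by move=> x _; rewrite lee_fin ler_wpM2l ?sqr_ge0 // rho_le.
Qed.

Lemma sr_le f : L2w f -> sr f f <= L2s f f.
move=> fL; have fR := L2w_Lr fL.
apply: (@ae_Rint_le _ (borel M)); [exact: (wL2i mr rho_gt0)|exact: (wL2i mw wgt0)|].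
by apply: aeT => x; rewrite ler_wpM2l ?rho_le // -expr2 sqr_ge0.
Qed.

Lemma D1_Lr p : D1 p -> Lr p.1. Proof. by move=> [pL _ _]; exact: L2w_Lr. Qed.

Lemma sr_b1 p : D1 p -> sr p.1 p.1 <= b1 p p.
move=> [pL pF _]; apply: le_trans (sr_le pL) _; rewrite /pform lerDr.
exact: (ph_ge0 PF).
Qed.

Lemma formE f X h Z : D1 (f, X) -> D1 (h, Z) -> Defs.form g Psi mu V f h = b1 (f, X) (h, Z) - sr f h.
move=> [fL fF wf] [hL hF wh]; rewrite /= in fL fF wf hL hF wh.
have [mX _] := fF; have [mZ _] := hF.
rewrite /Defs.form /pform /= -addrA; congr (_ + _).
 have [_ mg1 _ _] := grad_wgrad wf; have [_ mg2 _ _] := grad_wgrad wh.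
 apply: (@ae_eq_Rint _ (borel M)); [exact: ms_scal|exact: ms_scal|].
 apply: ae2 (gradE wf) (gradE wh) => x e1 e2. by rewrite /Defs.scal e1 e2.
have i1 := wL2i mw wgt0 fL hL; have i2 := wL2i mr rho_gt0 (L2w_Lr fL) (L2w_Lr hL).
rewrite -mulN1r addrC -(@RiL _ (borel M)) //; apply: eqRint => x _.
by rewrite /sumw /=; ring.
Qed.

Lemma form_domainP f : form_domain g Psi mu rho V f <-> exists U, N10 (f, U).
split=> [hf|[U Nf]].
 have [/W1P[U dU] _] := hf; exists U. exact: (W10P sm_w wgt0 dU).1.
have dU := N10_D1 Nf.
exact: (W10P sm_w wgt0 dU).2.
Qed.

Lemma graphP u v : graph u v <->
 exists U, [/\ N10 (u, U), Lr v & forall q, N10 q -> b1 (u, U) q = sr u q.1 - sr v q.1].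
split=> [[/form_domainP[U Nu] Lv h]|[U [Nu Lv h]]].
 exists U; split=> // -[q Q] Nq; have := h q; rewrite (formE (N10_D1 Nu) (N10_D1 Nq)).
 rewrite /L2_scal -/(sr v q) /= => e.
 have : b1 (u, U) (q, Q) - sr u q = - sr v q by apply: e; apply/form_domainP; exists Q.
 by move: (b1 _ _) (sr u q) (sr v q) => a b c; lra.
split=> //; first by apply/form_domainP; exists U.
move=> q /form_domainP[Q Nq]; rewrite (formE (N10_D1 Nu) (N10_D1 Nq)) h //=.
by rewrite /L2_scal -/(sr v q); move: (sr u q) (sr v q) => a b; lra.
Qed.

(** The resolvent of the generator at 1, by Riesz representation: pairing with [k] is bounded
    because the form norm dominates that of L^2(rho mu). *)
Lemma res k : Lr k -> exists U : E1, N10 U /\ forall q, N10 q -> b1 U q = sr k q.1.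
move=> Lk.
have [|U NU hU] := riesz P1 (D1_compl sm_w wgt0)
 (l := fun q => sr k q.1) (@N10_D1 _) (N10_neq0 sm_w wgt0)
 (N10_lin sm_w wgt0)
 (N10_clsd sm_w wgt0); last by exists U.
split=> [a p q dp dq|]; first by rewrite /= (ph_linr PR) //; exact: D1_Lr.
exists (sr k k) => q dq; apply: le_trans (ph_CS PR Lk (D1_Lr dq)) _.
by apply: ler_wpM2l (sr_b1 dq); exact: (ph_ge0 PR).
Qed.

Lemma res_graph k (U : E1) : Lr k -> N10 U -> (forall q, N10 q -> b1 U q = sr k q.1) ->
 graph U.1 (linf (-1) k U.1).
move=> Lk NU hU; have dU := N10_D1 NU; have LU := D1_Lr dU.
apply/graphP; exists U.2; rewrite -surjective_pairing; split=> //; first exact: (ph_lin PR).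
by move=> q Nq; have Lq := D1_Lr (N10_D1 Nq); rewrite hU // (ph_linl PR) //; ring.
Qed.

Let T_L2 t f : 0 < t -> Lr f -> Lr (T t f).
by have [h _ _ _ _] := T_semigroup => t0 Lf; have [] := h t f t0 Lf. Qed.

Let T_nr t f : 0 < t -> Lr f -> nr (T t f) <= nr f.
have [h _ _ _ _] := T_semigroup => t0 Lf; have [LT] := h t f t0 Lf.
by rewrite /L2_norm ler_sqrt //; exact: (ph_ge0 PR).
Qed.

Let T_lin t (a : R) f h : 0 < t -> Lr f -> Lr h ->
 {ae mu, forall x, T t (linf a f h) x = a * T t f x + T t h x}.
by have [_ hl _ _ _] := T_semigroup; exact: hl. Qed.

Let T_add s t f : 0 < s -> 0 < t -> Lr f -> {ae mu, forall x, T (s + t) f x = T s (T t f) x}.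
by have [_ _ ha _ _] := T_semigroup; exact: ha. Qed.

Let mL f : Lr f -> bmeas f. Proof. by move=> []. Qed.

Lemma sr_ae f f' h : Lr f -> Lr f' -> Lr h -> {ae mu, forall x, f x = f' x} -> sr f h = sr f' h.
move=> Lf Lf' Lh e; have mf := mL Lf; have mf' := mL Lf'; have mh := mL Lh.
by apply: wscal_ae => //; exact: aeT.
Qed.

Lemma nr_ae f f' : Lr f -> Lr f' -> {ae mu, forall x, f x = f' x} -> nr f = nr f'.
move=> Lf Lf' e; have mf := mL Lf; have mf' := mL Lf'.
by apply: wscal_ae.
Qed.

Lemma sg_linl (t a : R) f h (z : M -> R) : 0 < t -> Lr f -> Lr h -> Lr z ->
 sr (T t (linf a f h)) z = a * sr (T t f) z + sr (T t h) z.
move=> t0 Lf Lh Lz; rewrite -(ph_linl PR) //; [|exact: T_L2..].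
by apply: sr_ae => //; [apply: T_L2 => //|apply: (ph_lin PR)|exact: T_lin]; try exact: T_L2; exact: (ph_lin PR).
Qed.

(** T_s u - u - s v, the error of the first order expansion; [graph u v] means that it is o(s). *)
Definition rem (s : R) u v : M -> R := linf (- s) v (linf (-1) u (T s u)).

Let rem_L2 s u v : 0 < s -> Lr u -> Lr v -> Lr (rem s u v).
by move=> s0 Lu Lv; do 2 apply: (ph_lin PR) => //; exact: T_L2. Qed.

Let nrZ (a : R) f : Lr f -> nr (fun x => a * f x) = a ^+ 2 * nr f.
move=> Lf; have := wL2i mr rho_gt0 Lf Lf => i.
rewrite /= -(@RintegralZl _ (borel M)) //; apply: eqRint => x _; ring.
Qed.

Lemma graphE u v : Lr u -> Lr v -> (graph u v <->
 (s^-1 ^+ 2 * nr (rem s u v)) @[s --> 0^'+] --> (0 : R)).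
move=> Lu Lv; have [_ _ _ _ hg] := T_semigroup; rewrite -(hg u v Lu Lv).
have E s : 0 < s -> L2_scal mu rho (fun x => s^-1 * (T s u x - u x) - v x)
 (fun x => s^-1 * (T s u x - u x) - v x) = s^-1 ^+ 2 * nr (rem s u v).
 move=> s0; rewrite -nrZ; last exact: rem_L2.
 have -> // : (fun x => s^-1 * (T s u x - u x) - v x) = (fun x => s^-1 * rem s u v x).
 by apply/funext => x; rewrite /rem /linf_; field; rewrite gt_eqF.
have nE : \forall s \near (0 : R)^'+, Num.sqrt (s^-1 ^+ 2 * nr (rem s u v)) =
 L2_norm mu rho (fun x => s^-1 * (T s u x - u x) - v x).
 by near=> s; rewrite /L2_norm E.
have nE2 : \forall s \near (0 : R)^'+, L2_norm mu rho (fun x => s^-1 * (T s u x - u x) - v x) ^+ 2 =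
 s^-1 ^+ 2 * nr (rem s u v).
 near=> s; rewrite -(near nE s) // sqr_sqrtr // mulr_ge0 ?sqr_ge0 //; apply: (ph_ge0 PR). by apply: rem_L2.
split=> h.
 have h2 := cvgM h h; rewrite mulr0 in h2.
 have h3 : L2_norm mu rho (fun x => s^-1 * (T s u x - u x) - v x) ^+ 2 @[s --> 0^'+] --> (0 : R).
 by under eq_fun do rewrite expr2; exact: h2.
 by apply: cvg_trans h3; apply: near_eq_cvg; apply: filterS nE2 => s ->.
have h2 : Num.sqrt (s^-1 ^+ 2 * nr (rem s u v)) @[s --> 0^'+] --> Num.sqrt (0 : R).
 by apply: continuous_cvg => //; exact: sqrt_continuous.
by rewrite sqrtr0 in h2; apply: cvg_trans h2; apply: near_eq_cvg; apply: filterS nE => s ->.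
Unshelve. all: by end_near. Qed.

(* The remainder at a later time is the image of the remainder at time 0. *)
Lemma rem_shift s t u v : 0 < s -> 0 < t -> Lr u -> Lr v ->
 {ae mu, forall x, rem s (T t u) (T t v) x = T t (rem s u v) x}.
move=> s0 t0 Lu Lv; have Ls := T_L2 s0 Lu.
have Li := ph_lin PR (-1) Lu Ls.
have h1 := T_lin (- s) t0 Lv Li; have h2 := T_lin (-1) t0 Lu Ls.
have h3 := T_add s0 t0 Lu; have h4 := T_add t0 s0 Lu; rewrite addrC in h4.
have h34 : {ae mu, forall x, T s (T t u) x = T t (T s u) x}.
 by apply: ae2 h3 h4 => x <- <-.
by apply: ae_imp3 h1 h2 h34 => x e1 e2 e3; rewrite /rem e1 e2 /linf_ e3; ring.
Qed.

Lemma graph_L2 u v : graph u v -> Lr u /\ Lr v.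
by move=> /graphP[U [Nu Lv _]]; split=> //; exact: (D1_Lr (N10_D1 Nu)). Qed.

Lemma graph_T t u v : 0 < t -> graph u v -> graph (T t u) (T t v).
move=> t0 guv; have [Lu Lv] := graph_L2 guv; move: guv.
rewrite !graphE //; [|exact: T_L2..] => h.
apply: (@squeeze_cvgr _ _ _ _ (fun=> 0) (fun s => s^-1 ^+ 2 * nr (rem s u v))) => //; last exact: cvg_cst.
near=> s; have s0 : 0 < s by [].
have L1 := rem_L2 s0 (T_L2 t0 Lu) (T_L2 t0 Lv); have L2 := rem_L2 s0 Lu Lv.
rewrite mulr_ge0 ?sqr_ge0 //=; last exact: (ph_ge0 PR).
apply: ler_wpM2l; first exact: sqr_ge0.
rewrite (nr_ae L1 (T_L2 t0 L2) (rem_shift s0 t0 Lu Lv)); exact: T_nr.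
Unshelve. all: by end_near. Qed.

Lemma graph_lin (a : R) u v u' v' : graph u v -> graph u' v' -> graph (linf a u u') (linf a v v').
move=> guv guv'; have [Lu Lv] := graph_L2 guv; have [Lu' Lv'] := graph_L2 guv'.
move: guv guv' => /graphP[U [Nu _ hU]] /graphP[U' [Nu' _ hU']].
have NN := N10_lin sm_w wgt0 a Nu Nu'.
apply/graphP; exists (linF a U U'); split=> //; first exact: (ph_lin PR).
move=> q Nq; have Lq := D1_Lr (N10_D1 Nq).
have -> : b1 (linf a u u', linF a U U') q = a * b1 (u, U) q + b1 (u', U') q.
 exact: (ph_linl P1 a (N10_D1 Nu) (N10_D1 Nu') (N10_D1 Nq)).
by rewrite hU // hU' // !(ph_linl PR) //; ring.
Qed.

Lemma graph_exists k : Lr k -> exists (U : E1), [/\ N10 U, forall q, N10 q -> b1 U q = sr k q.1 &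
 graph U.1 (linf (-1) k U.1)].
by move=> Lk; have [U [NU hU]] := res Lk; exists U; split=> //; exact: res_graph. Qed.

Lemma nr_eq0_le f : Lr f -> nr f <= 0 -> {ae mu, forall x, f x = 0}.
move=> Lf h; apply: (wscal_eq0 mr rho_gt0) => //.
by apply/eqP; rewrite eq_le h (ph_ge0 PR).
Qed.

Let nr0 f : Lr f -> {ae mu, forall x, f x = 0} -> nr f = 0.
move=> Lf f0; have mf := mL Lf.
rewrite (@wscal_ae _ _ _ _ _ mr f (fun=> 0) f (fun=> 0)) //.
by rewrite /wscal; under eqRint do rewrite !mul0r; rewrite /Rintegral integral0.
Qed.

(** If u = 0 then T_s u = 0 and the remainder is -s v, which is o(s) only for v = 0. *)
Lemma graph_zero u v : graph u v -> {ae mu, forall x, u x = 0} -> {ae mu, forall x, v x = 0}.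
move=> guv u0; have [Lu Lv] := graph_L2 guv; move: (guv); rewrite graphE // => h.
apply: nr_eq0_le => //; suff e : nr v = 0 by rewrite /= e.
apply: (@cvg_unique _ (@Rhausdorff R) ((fun=> nr v) @ (0 : R)^'+)); first exact: cvg_cst.
apply: cvg_trans h; apply: near_eq_cvg; near=> s; have s0 : 0 < s by [].
have Ls := T_L2 s0 Lu; have Lrm := rem_L2 s0 Lu Lv.
have Ts0 : {ae mu, forall x, T s u x = 0}.
 by apply: nr_eq0_le => //; apply: le_trans (T_nr s0 Lu) _; rewrite /= nr0.
have -> : nr (rem s u v) = nr (fun x => - s * v x).
 have Lsv : Lr (fun x => - s * v x).
 apply: (@wL2_dom _ _ _ _ _ mr rho_gt0 s _ v) => //; first by apply: mfM => //; exact: mL.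
 by move=> x; rewrite normrM normrN (gtr0_norm s0).
 by apply: nr_ae => //; apply: ae2 u0 Ts0 => x e1 e2; rewrite /rem /linf_ e1 e2; ring.
by rewrite nrZ // sqrrN mulrA -exprMn mulVf ?gt_eqF // expr1n mul1r.
Unshelve. all: by end_near. Qed.

(** A vector k orthogonal to the domain is orthogonal to its own resolvent, whose form norm is
    therefore 0; [graph_zero] then yields k = 0. *)
Lemma graph_dense f (e : R) : Lr f -> 0 < e -> exists u v, graph u v /\ dist2 linf sr u f < e.
move=> Lf e0.
pose N : set (borel M -> R) := [set h | Lr h /\ forall e : R, 0 < e ->
 exists u v, graph u v /\ dist2 linf sr u h < e].
suff [_ /(_ e e0)] : N f by [].
have Ngr u v : graph u v -> N u.
 move=> guv; have [Lu Lv] := graph_L2 guv; split=> // d d0; exists u, v; split=> //.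
 by rewrite (dq_exp PR) //; move: (sr u u) => a; lra.
have Ncl : clsd2 linf Lr sr N.
 move=> h Lh hh; split=> // d d0; have [|k [Lk hk] kd] := hh (d / 4); first by lra.
 have [|u [v [guv ud]]] := hk (d / 4); first by lra. exists u, v; split=> //; have [Lu _] := graph_L2 guv.
 have := dist2_tri2 PR Lu Lk Lh. by move: (dist2 _ _ _ _) (dist2 _ _ _ _) (dist2 _ _ _ _) ud kd => a b c; lra.
have [|||||p Np hp] := @orth_proj _ _ linf Lr sr PR (@wL2_compl _ (borel M) R mu rho mr rho_gt0) N f.
- by move=> h [].
- by have [U [_ _ gU]] := graph_exists Lf; exists U.1; exact: Ngr gU.
- move=> a h h' [Lh hh] [Lh' hh']; split; first exact: (ph_lin PR).
 move=> d d0; have a0 : 0 < a ^+ 2 + 1 by have := sqr_ge0 a; lra.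
 have [|u [v [guv ud]]] := hh (d / 4 / (a ^+ 2 + 1)); first by rewrite divr_gt0 //; lra.
 have [|u' [v' [guv' ud']]] := hh' (d / 4); first by lra.
 exists (linf a u u'), (linf a v v'); split; first exact: graph_lin.
 have [Lu _] := graph_L2 guv; have [Lu' _] := graph_L2 guv'. apply: le_lt_trans (dist2_lin PR a Lu Lu' Lh Lh') _.
 have := dq_ge0 PR Lu Lh; move: ud ud'; rewrite ltr_pdivlMr //.
 by move: (dist2 _ _ _ _) (dist2 _ _ _ _) => r s; have := sqr_ge0 a; nra.
- exact: Ncl.
- exact: Lf.
have [Lp _] := Np; have Lk := ph_dif PR Lf Lp.
have [U [NU hU gU]] := graph_exists Lk.
have U0 : {ae mu, forall x, U.1 x = 0}.
 apply: nr_eq0_le; first exact: D1_Lr (N10_D1 NU).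
 by apply: le_trans (sr_b1 (N10_D1 NU)) _; rewrite hU // hp //; exact: Ngr gU.
have v0 := graph_zero gU U0.
apply: Ncl => // d d0; exists p => //.
rewrite (dist2_sym PR) // /dist2 nr0 //.
by apply: ae2 U0 v0 => x; rewrite /linf_ => ->; rewrite addr0 mulN1r => /eqP; rewrite oppr_eq0 => /eqP.
Qed.

(** * Positivity of the semigroup through negative parts *)

Definition negp f : M -> R := trunc 0 (fun x => - f x).

Let opp_L2 f : Lr f -> Lr (fun x => - f x).
move=> Lf; apply: (@wL2_dom _ _ _ _ _ mr rho_gt0 1 _ f) => //; last by move=> x; rewrite mul1r normrN.
by apply: mfT_comp => //; exact: mL.
Qed.

Lemma negp_L2 f : Lr f -> Lr (negp f).
by move=> Lf; exact: (trunc_L2 ((smoothP S rho).1 rho_smooth) rho_gt0 (lexx 0) (opp_L2 Lf)). Qed.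

Lemma negp_le f x : negp f x ^+ 2 <= f x ^+ 2.
rewrite -(real_normK (num_real (negp f x))) -(real_normK (num_real (f x))) -(normrN (f x)).
by rewrite ler_pXn2r ?nnegrE //; exact: trunc_abs.
Qed.

Lemma negpE f x : negp f x * f x = - negp f x ^+ 2.
by rewrite /negp /trunc subr0; have [h|h] := leP (- f x) 0; ring. Qed.

(** Second order bound for the function (x^-)^2, whose derivative is -2 x^-. *)
Lemma negp_add f h x : negp h x ^+ 2 <= negp f x ^+ 2 - 2 * negp f x * (h x - f x) + (h x - f x) ^+ 2.
rewrite /negp /trunc !subr0.
have [h1|h1] := leP (- f x) 0; have [h2|h2] := leP (- h x) 0.
- rewrite expr0n /= mulr0 mul0r subr0 add0r; exact: sqr_ge0.
- rewrite expr0n /= mulr0 mul0r subr0 add0r; nra.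
- rewrite expr0n /=; have := sqr_ge0 (h x); nra.
- nra.
Qed.

(** u^- belongs to the form domain by truncation, and <u^-, L u> = - Q(u, u^-) = Q(u^-, u^-). *)
Lemma negp_graph u v : graph u v -> 0 <= sr (negp u) v.
move=> /graphP[U [Nu Lv hU]]; have [_ uF _] := N10_D1 Nu; rewrite /= in uF.
have Nm : N10 (fun x => - u x, fun x => - U x).
 (* [plin a x y] stands for a x + y and gives no plain multiples, so -u is obtained as -2 u + u;
    later C u is obtained as (C - 1) u + u. *)
 have := N10_lin sm_w wgt0 (-2) Nu Nu. rewrite /plin /=.
 have -> : linf (-2) u u = (fun x => - u x) by apply/funext => x; rewrite /linf_; ring.
 have -> // : linF (-2) U U = (fun x => - U x). by apply/funext => x; apply/rowP => i; rewrite /linF !mxE; ring.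
have Nq := N10_trunc sm_w wgt0 (lexx 0) Nm.
rewrite -/(negp u) in Nq; set Q := tgrad _ _ _ in Nq.
have := hU _ Nq; have [qL qF _] := N10_D1 Nq; rewrite /= in qL qF.
have Lq := L2w_Lr qL; have Lu := D1_Lr (N10_D1 Nu); rewrite /= in Lu.
rewrite (ph_sym PR Lq Lv) /pform /=.
have e1 : L2s u (negp u) = - L2s (negp u) (negp u).
 rewrite -mulN1r -(@RintegralZl _ (borel M)) //; last exact: (wL2i mw wgt0).
 by apply: eqRint => x _; rewrite (mulrC (u x)) negpE; ring.
have e2 : sr u (negp u) = - sr (negp u) (negp u).
 rewrite -mulN1r -(@RintegralZl _ (borel M)) //; last exact: (wL2i mr rho_gt0).
 by apply: eqRint => x _; rewrite (mulrC (u x)) negpE; ring.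
have e3 : Fscal U Q <= 0.
 have [mU _] := uF; have [mQ _] := qF.
 have i1 := F2_int uF qF; rewrite -oppr_ge0 -mulN1r -(@RintegralZl _ (borel M)) //.
 apply: Rintegral_ge0 => x _; rewrite scal_sym scal_tgrad.
 have -> : scal g (fun x => - U x) U x = - scal g U U x by rewrite /scal !mulNmx mxE.
 by rewrite mulrN mulN1r opprK mulr_ge0 ?scal_ge0 // ler0n.
have e4 := sr_le qL; rewrite /= in e4.
by rewrite e1 e2 /=; move: (Fscal _ _) (L2s _ _) (sr (negp u) _) (sr v _) e3 e4 => a b c d; lra.
Qed.

(** [negp_add] with the increment s v + rem: the term -2 s <u^-, v> has the favourable sign by
    [negp_graph], and the pairing with the remainder is split with the weight s th. *)
Lemma negp_step u v (s th : R) : 0 < s -> 0 < th -> graph u v ->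
 nr (negp (T s u)) <= nr (negp u) + s * th * nr u +
 ((s * th)^-1 + 2) * nr (rem s u v) + 2 * s ^+ 2 * nr v.
move=> s0 th0 guv; have [Lu Lv] := graph_L2 guv; have Ls := T_L2 s0 Lu.
have Ln := negp_L2 Lu; have Lns := negp_L2 Ls; have Lrm := rem_L2 s0 Lu Lv.
pose b := dif linf (T s u) u; have Lb : Lr b by exact: (ph_dif PR).
have bE x : b x = T s u x - u x by rewrite /b /dif /linf_; ring.
have st0 : 0 < s * th by exact: mulr_gt0.
have h1 : nr (negp (T s u)) <= nr (negp u) - 2 * sr (negp u) b + nr b.
 have i1 := wL2i mr rho_gt0 Ln Ln; have i2 := wL2i mr rho_gt0 Ln Lb.
 have i3 := wL2i mr rho_gt0 Lb Lb; have i4 := wL2i mr rho_gt0 Lns Lns.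
 have i12 := intble_lin (-2) i2 i1; have i123 := intble_lin 1 i12 i3.
 have -> : nr (negp u) - 2 * sr (negp u) b + nr b =
 \int[mu]_x (1 * (-2 * (negp u x * b x * rho x) + negp u x * negp u x * rho x) + b x * b x * rho x).
 rewrite (@RiL _ (borel M)) // (@RiL _ (borel M)) // /wscal.
 by move: (Rintegral _ _ _) (Rintegral _ _ _) (Rintegral _ _ _) => p q r; ring.
 apply: (@ae_Rint_le _ (borel M)) => //; apply: aeT => x.
 have -> : 1 * (-2 * (negp u x * b x * rho x) + negp u x * negp u x * rho x) + b x * b x * rho x =
 (negp u x ^+ 2 - 2 * negp u x * b x + b x ^+ 2) * rho x by ring.
 by apply: ler_wpM2r; [exact: ltW|rewrite -expr2 bE; exact: negp_add].
have bR : b = linf s v (rem s u v) by apply/funext => x; rewrite bE /rem /linf_; ring.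
have h2 : sr (negp u) b = s * sr (negp u) v + sr (negp u) (rem s u v) by rewrite bR (ph_linr PR).
have h3 := negp_graph guv.
have h4 := ph_amgm PR st0 Ln Lrm.
have h5 : nr (negp u) <= nr u.
 apply: (@ae_Rint_le _ (borel M)); [exact: (wL2i mr rho_gt0)|exact: (wL2i mr rho_gt0)|].
 by apply: aeT => x; apply: ler_wpM2r; [exact: ltW|rewrite -!expr2; exact: negp_le].
have h6 : nr b <= 2 * (s ^+ 2 * nr v + nr (rem s u v)).
 rewrite /= bR (ph_exp PR) //; have := ph_ge0 PR (ph_lin PR (- s) Lv Lrm).
 by rewrite (ph_exp PR) // sqrrN; move: (sr v v) (sr v _) (sr (rem _ _ _) _) => p q r; lra.
have h7 := ler_norm (- sr (negp u) (rem s u v)); rewrite normrN in h7.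
have h8 : 0 <= s * sr (negp u) v by rewrite mulr_ge0 // ltW.
have h9 : s * th * nr (negp u) <= s * th * nr u by rewrite ler_pM2l.
move: h1 h2 h4 h6 h7 h8 h9 => /=.
move: (sr (negp u) b) (sr (negp u) (rem s u v)) (`|_|) (sr (negp u) v) (sr (negp (T s u)) _) (sr (negp u) (negp u)) => a1 a2 a3 a4 a5 a6.
move: (sr b b) (sr (rem s u v) _) (sr v v) (sr u u) => c1 c2 c3 c4.
move: ((s * th)^-1) => c5; lra.
Qed.

Let negp_ae f h : {ae mu, forall x, f x = h x} -> {ae mu, forall x, negp f x = negp h x}.
by apply: ae1 => x e; rewrite /negp /trunc e. Qed.

Let nr_negp_ae f h : Lr f -> Lr h -> {ae mu, forall x, f x = h x} -> nr (negp f) = nr (negp h).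
by move=> Lf Lh e; apply: nr_ae; [exact: negp_L2|exact: negp_L2|exact: negp_ae]. Qed.

Lemma negp_orbit u v (s th : R) N : 0 < s -> 0 < th -> graph u v ->
 nr (negp (T (N.+1%:R * s) u)) <= nr (negp u) + N.+1%:R * (s * th * nr u +
 ((s * th)^-1 + 2) * nr (rem s u v) + 2 * s ^+ 2 * nr v).
move=> s0 th0 guv; have [Lu Lv] := graph_L2 guv.
elim: N => [|N IH].
 by rewrite !mul1r; have := negp_step s0 th0 guv; rewrite !addrA.
have t0 : 0 < N.+1%:R * s by rewrite mulr_gt0 // ltr0n.
set t := _ * s in IH t0; have Lt := T_L2 t0 Lu; have Ltv := T_L2 t0 Lv.
have -> : N.+2%:R * s = s + t by rewrite /t [N.+2%:R]mulrSr; ring.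
have st0 : 0 < s + t by exact: addr_gt0.
rewrite (nr_negp_ae (T_L2 st0 Lu) (T_L2 s0 Lt) (T_add s0 t0 Lu)).
apply: le_trans (negp_step s0 th0 (graph_T t0 guv)) _.
have Lrm := rem_L2 s0 Lu Lv.
have e1 := T_nr t0 Lu; have e2 := T_nr t0 Lv; have e3 := T_nr t0 Lrm.
have e4 := nr_ae (rem_L2 s0 Lt Ltv) (T_L2 t0 Lrm) (rem_shift s0 t0 Lu Lv).
have st1 : 0 < s * th by exact: mulr_gt0.
have st2 : 0 < (s * th)^-1 by rewrite invr_gt0.
have m1 : s * th * nr (T t u) <= s * th * nr u by rewrite ler_pM2l.
have m2 : ((s * th)^-1 + 2) * nr (rem s (T t u) (T t v)) <= ((s * th)^-1 + 2) * nr (rem s u v).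
 by apply: ler_wpM2l; [lra|rewrite e4].
have m3 : 2 * s ^+ 2 * nr (T t v) <= 2 * s ^+ 2 * nr v by apply: ler_wpM2l => //; rewrite mulr_ge0 // sqr_ge0.
have eN : N.+2%:R = N.+1%:R + 1 :> R by rewrite -natr1.
have -> (A : R) : N.+2%:R * A = N.+1%:R * A + A by rewrite eN; ring.
by move: IH m1 m2 m3 => /=; lra.
Qed.

(** With N steps of length t/N the errors add up to t th |u|^2 and terms that vanish as N grows, the
    remainder being o(s); then th tends to 0. *)
Lemma negp_graph_le t u v : 0 < t -> graph u v -> nr (negp (T t u)) <= nr (negp u).
move=> t0 guv; have [Lu Lv] := graph_L2 guv; have u0 := ph_ge0 PR Lu.
have key (th : R) : 0 < th -> nr (negp (T t u)) <= nr (negp u) + t * th * nr u.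
 move=> th0; pose s N : R := t / N.+1%:R. have s0 N : 0 < s N by rewrite divr_gt0 // ltr0n.
 have sc : s N @[N --> \oo] --> (0 : R).
 by rewrite -(mulr0 t); apply: cvgM; [exact: cvg_cst|exact: cvg_harmonic].
 have etac : ((s N)^-1 ^+ 2 * nr (rem (s N) u v)) @[N --> \oo] --> (0 : R).
 exact: ((cvg_at_rightP _ _ _).1 ((graphE Lu Lv).1 guv) s (conj s0 sc)).
 have lim : nr (negp u) + (t * th * nr u + ((t / th + 2 * t * s N) * ((s N)^-1 ^+ 2 * nr (rem (s N) u v))
 + 2 * t * s N * nr v)) @[N --> \oo] --> nr (negp u) + (t * th * nr u + ((t / th + 2 * t * 0) * 0 + 2 * t * 0 * nr v)).
 apply: cvgD; first exact: cvg_cst. apply: cvgD; first exact: cvg_cst.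
 have h1 : (2 * t * s N) @[N --> \oo] --> 2 * t * 0 by apply: cvgM => //; exact: cvg_cst.
 apply: cvgD; last by apply: cvgM => //; exact: cvg_cst. by apply: cvgM => //; apply: cvgD => //; exact: cvg_cst.
 have -> : nr (negp u) + t * th * nr u = nr (negp u) + (t * th * nr u + ((t / th + 2 * t * 0) * 0 + 2 * t * 0 * nr v)) by ring.
 apply: (cvgr_to_ge lim); apply: nearW => N. have := negp_orbit N (s0 N) th0 guv.
 have -> : N.+1%:R * s N = t by rewrite /s mulrC divfK // pnatr_eq0. have eN : N.+1%:R = t / s N.
 by rewrite /s invf_div mulrCA divff ?mulr1 // gt_eqF.
 have sN := s0 N; rewrite eN; move: (s N) sN => q q0. congr (_ <= _ + _); field; rewrite !gt_eqF //.
apply/ler_addgt0Pl => e e0; have p0 : 0 < t * (nr u + 1) by rewrite mulr_gt0 // ltr_wpDl.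
apply: le_trans (key (e / (t * (nr u + 1))) _) _; first exact: divr_gt0.
rewrite addrC lerD2r; have -> : t * (e / (t * (nr u + 1))) * nr u = e * (nr u / (nr u + 1)).
 by field; rewrite !gt_eqF //; lra.
have n1 : 0 < sr u u + 1 by rewrite ltr_wpDl.
by rewrite ler_piMr ?(ltW e0) // ler_pdivrMr // mul1r lerDl.
Qed.

(** [f] is approximated by elements of the domain; the negative part is Lipschitz and T_t a
    contraction, so [negp_graph_le] survives the limit. *)
Theorem sg_ge0 t f : 0 < t -> Lr f -> {ae mu, forall x, 0 <= f x} ->
 {ae mu, forall x, 0 <= T t f x}.
move=> t0 Lf f0; have LT := T_L2 t0 Lf.
have cmp h h' : Lr h -> Lr h' -> nr (negp h) <= 2 * (nr (negp h') + dist2 linf sr h h').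
 move=> Lh Lh'; have Ld := ph_dif PR Lh Lh'; have Ln := negp_L2 Lh'.
 have i1 := wL2i mr rho_gt0 Ln Ln; have i2 := wL2i mr rho_gt0 Ld Ld.
 have -> : 2 * (nr (negp h') + dist2 linf sr h h') = 2 *
 \int[mu]_x (1 * (negp h' x * negp h' x * rho x) + dif linf h h' x * dif linf h h' x * rho x).
 by rewrite (@RiL _ (borel M)) // mul1r.
 have i3 := intble_lin 1 i1 i2. rewrite -(@RintegralZl _ (borel M)) //.
 apply: (@ae_Rint_le _ (borel M)); [by apply: (wL2i mr rho_gt0); exact: negp_L2| |].
 by apply: eq_integrable (integrableZl measurableT 2 i3) => // x _; rewrite /= EFinM.
 apply: aeT => x; have := trunc_lip 0 (fun x => - h x) (fun x => - h' x) x. rewrite -/(negp h) -/(negp h').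
 have -> : - h x - - h' x = - dif linf h h' x by rewrite /dif /linf_; ring. rewrite normrN => h1.
 have h2 : (negp h x - negp h' x) ^+ 2 <= dif linf h h' x ^+ 2.
 by rewrite -(real_normK (num_real (negp h x - _))) -(real_normK (num_real (dif _ _ _ _))) ler_pXn2r ?nnegrE.
 have r0 := rho_gt0 x.
 have -> : 2 * (1 * (negp h' x * negp h' x * rho x) + dif linf h h' x * dif linf h h' x * rho x) =
 2 * (negp h' x ^+ 2 + dif linf h h' x ^+ 2) * rho x by ring.
 apply: ler_wpM2r; first exact: ltW.
 by move: (negp h x) (negp h' x) (dif _ _ _ x) h2 => a b c h2; have := sqr_ge0 (a - 2 * b); nra.
suff n0 : nr (negp (T t f)) <= 0.
 apply: ae1 (nr_eq0_le (negp_L2 LT) n0) => x; rewrite /negp /trunc subr0 => h.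
 have : - T t f x <= 0 by rewrite -h le_max lexx. by rewrite oppr_le0.
have nf : nr (negp f) = 0.
 apply: nr0; first exact: negp_L2. by apply: ae1 f0 => x h; apply/max_idPr; rewrite subr0 oppr_le0.
apply/ler_addgt0Pl => e e0; rewrite addr0.
(* Two comparisons, each with a factor 2: 2 (2 e/6 + e/6) = e. *)
have [|u [v [guv ud]]] := @graph_dense f (e / 6) Lf; first by lra.
have [Lu Lv] := graph_L2 guv.
have h1 := cmp _ _ LT (T_L2 t0 Lu); have h2 := negp_graph_le t0 guv; have h3 := cmp _ _ Lu Lf.
have h4 : dist2 linf sr (T t f) (T t u) <= dist2 linf sr u f.
 rewrite (dist2_sym PR Lu Lf) /dist2; apply: le_trans (T_nr t0 (ph_dif PR Lf Lu)).
 rewrite (nr_ae (ph_dif PR LT (T_L2 t0 Lu)) (T_L2 t0 (ph_dif PR Lf Lu))) //.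
 apply: ae1 (T_lin (-1) t0 Lu Lf) => x; rewrite /dif => ->. by rewrite /linf_.
rewrite nf in h3; move: h1 h2 h3 h4 ud => /=.
by move: (sr _ _) (sr _ _) (sr _ _) (dist2 _ _ _ _) (dist2 _ _ _ _); move=> *; lra.
Qed.

(** * Orbits: continuity, differentiability and time integrals *)

Definition orb0 (s : R) f : M -> R := if 0 < s then T s f else f.
(** Negative times carry the value at time 0, which makes the pairing continuous on the whole
    line. *)
Definition orb (f h : M -> R) (s : R) : R := sr (orb0 s f) h.

Lemma orb0_L2 s f : Lr f -> Lr (orb0 s f).
by move=> Lf; rewrite /orb0; case: ifP => // s0; exact: T_L2. Qed.

Let mod f (d : R) := dist2 linf sr (orb0 d f) f.

Let mod_cvg f : Lr f -> mod f d @[d --> (0 : R)] --> (0 : R).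
move=> Lf; have [_ _ _ hc _] := T_semigroup; have h := hc f Lf.
have h2 := cvgM h h; rewrite mulr0 in h2.
have h3 : L2_norm mu rho (T t f \- f) * L2_norm mu rho (T t f \- f) @[t --> (0 : R)^'+] --> (0 : R) by exact: h2.
apply/cvgrPdist_lt => e e0; move/cvgrPdist_lt : h3 => /(_ e e0); rewrite !near_simpl /at_right; move=> /nbhs_ballP[d /= d0 hd].
apply/nbhs_ballP; exists d => //= s sd; have [s0|s0] := ltP 0 s; last first.
 have E0 : orb0 s f = f by rewrite /orb0 ltNge s0. rewrite /mod E0 (dq_exp PR) //.
 have -> : sr f f - 2 * sr f f + sr f f = 0 by ring. by rewrite subr0 normr0.
have := hd s sd s0; rewrite /mod /orb0 s0 !sub0r !normrN /= /L2_norm.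
have Ld := ph_dif PR (T_L2 s0 Lf) Lf; have E : L2_scal mu rho (T s f \- f) (T s f \- f) = dist2 linf sr (T s f) f.
 by apply: eqRint => x _; rewrite /dif /linf_ /=; ring.
by rewrite E -expr2 sqr_sqrtr //; exact: (ph_ge0 PR).
Qed.

Let orbit_step f s s' : Lr f -> 0 <= s -> s <= s' ->
 dist2 linf sr (orb0 s' f) (orb0 s f) <= mod f (s' - s).
move=> Lf s0 ss; have [->|sne] := eqVneq s s'.
 rewrite /mod subrr {3}/orb0 ltxx !(dq_exp PR) //; try exact: orb0_L2. by move: (sr _ _) (sr _ _) => a b; lra.
have d0 : 0 < s' - s by rewrite subr_gt0 lt_neqAle sne.
have [s00|sn0] := eqVneq s 0.
 by rewrite s00 subr0 {2}/orb0 ltxx.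
have sp : 0 < s by rewrite lt_neqAle eq_sym sn0.
have sp' : 0 < s' by exact: lt_le_trans ss.
rewrite /mod /orb0 sp sp' d0; have LT := T_L2 d0 Lf.
apply: le_trans (T_nr sp (ph_dif PR LT Lf)); rewrite /dist2.
rewrite (nr_ae (ph_dif PR (T_L2 sp' Lf) (T_L2 sp Lf)) (T_L2 sp (ph_dif PR LT Lf))) //.
have h1 := T_add sp d0 Lf; have e : s + (s' - s) = s' by ring.
rewrite e in h1; apply: ae2 h1 (T_lin (-1) sp Lf LT) => x e1; rewrite /dif => ->.
by rewrite /linf_ e1.
Qed.

(** By the semigroup law and contractivity, an increment of the orbit is at most the increment from
    time 0 over the same duration. *)
Lemma orb_cont f h : Lr f -> Lr h -> continuous (orb f h).
move=> Lf Lh s0.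
have red s : orb0 s f = orb0 (Num.max s 0) f.
 by rewrite /orb0; have [h1|h1] := ltP 0 s; rewrite ?h1 ?ltxx.
have key s : (orb f h s - orb f h s0) ^+ 2 <= mod f `|Num.max s 0 - Num.max s0 0| * nr h.
 have L1 := orb0_L2 s Lf; have L2' := orb0_L2 s0 Lf.
 have -> : orb f h s - orb f h s0 = sr (dif linf (orb0 s f) (orb0 s0 f)) h.
 by rewrite /dif (ph_linl PR) // /orb; ring.
 apply: le_trans (ph_CS PR (ph_dif PR L1 L2') Lh) _. apply: ler_wpM2r; first exact: (ph_ge0 PR).
 rewrite -/(dist2 linf sr _ _) red (red s0). have m1 : 0 <= Num.max s 0 by rewrite le_max lexx orbT.
 have m2 : 0 <= Num.max s0 0 by rewrite le_max lexx orbT. move: (Num.max s 0) (Num.max s0 0) m1 m2 => p q p0 q0.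
 case/orP: (le_total q p) => pq.
 by rewrite ger0_norm ?subr_ge0 //; exact: orbit_step.
 rewrite (dist2_sym PR (orb0_L2 p Lf) (orb0_L2 q Lf)) distrC ger0_norm ?subr_ge0 //. exact: orbit_step.
have cm : `|Num.max s 0 - Num.max s0 0| @[s --> s0] --> (0 : R).
 apply/cvgrPdist_lt => e e0; apply/nbhs_ballP; exists e => //= s sd.
 rewrite sub0r normrN normr_id; apply: le_lt_trans sd. have := trunc_lip 0 (fun=> s) (fun=> s0) (point : M).
 by rewrite /trunc !subr0 (distrC s0 s).
have cc : mod f `|Num.max s 0 - Num.max s0 0| * nr h @[s --> s0] --> (0 : R).
 have c1 : mod f `|Num.max s 0 - Num.max s0 0| @[s --> s0] --> (0 : R).
 exact: (cvg_comp _ _ cm (mod_cvg Lf)).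
 have c2 := cvgM c1 (@cvg_cst _ (nr h) _ (nbhs s0) _); rewrite mul0r in c2; exact: c2.
apply/cvgrPdist_lt => e e0; have e20 : 0 < e ^+ 2 by exact: exprn_gt0.
move/cvgrPdist_lt: cc => /(_ _ e20); apply: filterS => s; rewrite sub0r normrN => h1.
have := le_lt_trans (key s) (le_lt_trans (ler_norm _) h1).
by rewrite -[X in X < _]real_normK ?num_real // ltr_pXn2r ?nnegrE ?(ltW e0) // distrC.
Qed.

Lemma orbit_bd f h s : Lr f -> Lr h -> `|orb f h s| <= Num.sqrt (nr f) * Num.sqrt (nr h).
move=> Lf Lh; have L1 := orb0_L2 s Lf; rewrite -sqrtrM ?(ph_ge0 PR) // -sqrtr_sqr.
rewrite ler_sqrt; last by rewrite mulr_ge0 // (ph_ge0 PR).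
apply: le_trans (ph_CS PR L1 Lh) _; apply: ler_wpM2r; first exact: (ph_ge0 PR).
by rewrite /orb0; case: ifP => // s0; exact: T_nr.
Qed.

Local Notation leb1 := (@lebesgue_measure R).
Lemma orb_int f h (a b : R) : Lr f -> Lr h ->
 leb1.-integrable `[a, b] (EFin \o orb f h).
move=> Lf Lh; apply: continuous_compact_integrable; first exact: segment_compact.
by apply: csubT; exact: orb_cont.
Qed.

Lemma orbit_int f h t : Lr f -> Lr h -> \int[leb1]_(s in `]0%R, t[) sr (T s f) h =
 \int[leb1]_(s in `[0%R, t]) orb f h s.
move=> Lf Lh.
have i1 := orb_int 0 t Lf Lh.
have i2 : leb1.-integrable `]0%R, t[ (EFin \o orb f h).
 by apply: integrableS i1 => //; exact: subset_itv_oo_cc.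
have i3 : leb1.-integrable `[0%R, t[ (EFin \o orb f h).
 by apply: integrableS i1 => //; exact: subset_itv_co_cc.
rewrite -(Rintegral_itv_bndo_bndc i3) -(Rintegral_itv_obnd_cbnd i2).
by apply: eqRint => s; rewrite inE /= in_itv /= => /andP[s0 _]; rewrite /orb /orb0 s0.
Qed.

Lemma orbit_int_bd (t : R) f h : 0 < t -> Lr f -> Lr h ->
 `|\int[leb1]_(s in `[0%R, t]) orb f h s| <= t * (Num.sqrt (nr f) * Num.sqrt (nr h)).
move=> t0 Lf Lh; set B := Num.sqrt (nr f) * Num.sqrt (nr h).
apply: le_trans (le_normr_Rintegral _ (orb_int 0 t Lf Lh)) _ => //.
apply: (@le_trans _ _ (\int[leb1]_(s in `[0%R, t]) B)).
 apply: le_Rintegral => //.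
 - by apply: (integrable_norm); exact: orb_int.
 - apply: continuous_compact_integrable; first exact: segment_compact.
 by apply: csubT; exact: cst_continuous.
 - by move=> s _; exact: orbit_bd.
rewrite Rintegral_cst //= lebesgue_measure_itv /= lte_fin t0 /= subr0 mulrC //.
Qed.

(** The functional to be represented is bounded by t |f| |h|, so the vector that defines the
    integral by duality exists and [xget] does not default. *)
Lemma time_intP t f : 0 < t -> Lr f -> Lr (time_integral mu rho T t f) /\
 forall h, Lr h -> sr (time_integral mu rho T t f) h = \int[leb1]_(s in `[0%R, t]) orb f h s.
move=> t0 Lf; suff [u Lu hu] : exists2 u, Lr u & forall h, Lr h -> sr u h = \int[leb1]_(s in `[0%R, t]) orb f h s.
 rewrite /time_integral; case: xgetP => [y _ [Ly hy]|/(_ u)[]].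
 by split=> // h Lh; rewrite -orbit_int //; exact: hy.
 by split=> // h Lh; rewrite orbit_int //; exact: hu.
have [|||||u Lu hu] := @riesz _ _ linf Lr sr PR (@wL2_compl _ (borel M) R mu rho mr rho_gt0) Lr
 (fun h => \int[leb1]_(s in `[0%R, t]) orb f h s) => //; last by exists u.
- by exists f.
- by move=> a h h'; exact: (ph_lin PR).
split=> [a h h' Lh Lh'|].
 rewrite -RintegralZl //; last exact: orb_int.
 have i1 : leb1.-integrable `[0%R, t] (EFin \o (fun s => a * orb f h s)).
 by apply: eq_integrable (integrableZl _ a (orb_int 0 t Lf Lh)) => // x _; rewrite /= EFinM.
 rewrite -RintegralD //; last exact: orb_int.
 apply: eqRint => s _; rewrite /orb (ph_linr PR) //; exact: orb0_L2.
exists ((t * Num.sqrt (nr f)) ^+ 2) => h Lh.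
have -> : (t * Num.sqrt (nr f)) ^+ 2 * nr h = (t * (Num.sqrt (nr f) * Num.sqrt (nr h))) ^+ 2.
 by rewrite !exprMn [Num.sqrt (nr h) ^+ 2]sqr_sqrtr ?mulrA //; exact: (ph_ge0 PR).
rewrite -(real_normK (num_real (\int[leb1]_(s in _) _))) ler_pXn2r ?nnegrE //.
 exact: orbit_int_bd.
by rewrite mulr_ge0 ?(ltW t0) // mulr_ge0 // sqrtr_ge0.
Qed.

Lemma orb_lin (a : R) f h phi s : Lr f -> Lr h -> Lr phi ->
 orb (linf a f h) phi s = a * orb f phi s + orb h phi s.
move=> Lf Lh Lp; rewrite /orb /orb0; case: ifP => s0; first exact: sg_linl.
exact: (ph_linl PR).
Qed.

Let orbit_incr u v h (p q : R) : graph u v -> Lr h -> 0 < p -> p < q ->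
 (orb u h q - orb u h p - (q - p) * orb v h p) ^+ 2 <= nr (rem (q - p) u v) * nr h.
move=> guv Lh p0 pq; have [Lu Lv] := graph_L2 guv; have d0 : 0 < q - p by rewrite subr_gt0.
have q0 := lt_trans p0 pq; have Lp := T_L2 p0 Lu; have Lpv := T_L2 p0 Lv.
have Lq := T_L2 d0 Lp.
have Lrm := rem_L2 d0 Lp Lpv.
have e : orb u h q = sr (T (q - p) (T p u)) h.
 rewrite /orb /orb0 q0; apply: sr_ae => //; first exact: T_L2. by have := T_add d0 p0 Lu; rewrite subrK.
have -> : orb u h q - orb u h p - (q - p) * orb v h p = sr (rem (q - p) (T p u) (T p v)) h.
 rewrite e /rem (ph_linl PR) ?(ph_linl PR) //; last exact: (ph_lin PR). by rewrite /orb /orb0 p0; ring.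
apply: le_trans (ph_CS PR Lrm Lh) _; apply: ler_wpM2r; first exact: (ph_ge0 PR).
rewrite (nr_ae Lrm (T_L2 p0 (rem_L2 d0 Lu Lv)) (rem_shift d0 p0 Lu Lv)).
by apply: T_nr => //; exact: rem_L2.
Qed.

Lemma is_der_cvg (F : R -> R) (s l : R) :
 (d^-1 * (F (d + s) - F s)) @[d --> (0 : R)^'] --> l -> isD s (1 : R) F l.
move=> h; have h' : (d^-1 *: (F (d *: (1 : R) + s) - F s)) @[d --> (0 : R)^'] --> l.
 by under eq_fun do rewrite [_ *: 1]mulr1.
by apply: DeriveDef; [apply/cvg_ex; exists l|exact: cvg_lim].
Qed.

(** On either side of [s] the difference quotient is an increment over some [p, q]. Its remainder is
    bounded uniformly in p by contractivity, and continuity replaces T_p v by T_s v. *)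
Lemma orbit_der u v h (s : R) : graph u v -> Lr h -> 0 < s -> isD s (1 : R) (orb u h) (orb v h s).
move=> guv Lh s0; have [Lu Lv] := graph_L2 guv; apply: is_der_cvg.
apply/cvgrPdist_lt => e e0.
have e20 : 0 < e / 2 by rewrite divr_gt0.
have := orb_cont Lv Lh (x := s); move/cvgrPdist_lt => /(_ _ e20) /nbhs_ballP[d1 /= d10 hd1].
pose D := (e / 2) ^+ 2 / (nr h + 1).
have h1 : 0 < nr h + 1 by rewrite ltr_wpDl //; exact: (ph_ge0 PR).
have D0 : 0 < D by rewrite divr_gt0 // exprn_gt0.
have := (graphE Lu Lv).1 guv; move/cvgrPdist_lt => /(_ _ D0) /nbhs_ballP[d2 /= d20 hd2].
pose d := Num.min s (Num.min d1 d2).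
have d0 : 0 < d by rewrite !lt_min s0 d10 d20.
apply/nbhs_ballP; exists d => //= x xd xne.
move: xd; rewrite /ball /= sub0r normrN !lt_min => /andP[xs /andP[x1 x2]].
have small (q : R) : 0 < q -> q = `|x| -> nr (rem q u v) * nr h < q ^+ 2 * (e / 2) ^+ 2.
 move=> q0 qx; have bq : ball (0 : R) d2 q by rewrite /ball /= sub0r normrN gtr0_norm // qx.
 have hq0 : `|0 - q^-1 ^+ 2 * nr (rem q u v)| < D by exact: hd2 q bq q0. have hq : nr (rem q u v) < D * q ^+ 2.
 rewrite -ltr_pdivrMr ?exprn_gt0 //; apply: le_lt_trans hq0. by rewrite sub0r normrN mulrC -exprVn ler_norm.
 have r0 := ph_ge0 PR (rem_L2 q0 Lu Lv).
 apply: (@le_lt_trans _ _ (nr (rem q u v) * (nr h + 1))); first by apply: ler_wpM2l => //; lra.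
 rewrite -ltr_pdivlMr //; apply: lt_le_trans hq _; rewrite /D le_eqVlt; apply/orP; left; apply/eqP.
 by rewrite mulrAC [(e / 2) ^+ 2 * _]mulrC.
have fin (p q : R) : 0 < p -> p < q -> q - p = `|x| -> `|s - p| < d1 ->
 x^-1 * (orb u h (x + s) - orb u h s) = (q - p)^-1 * (orb u h q - orb u h p) ->
 `|orb v h s - x^-1 * (orb u h (x + s) - orb u h s)| < e.
 move=> p0 pq qpx sp ->; have qp0 : 0 < q - p by rewrite subr_gt0.
 have k1 := orbit_incr guv Lh p0 pq; have k2 := small _ qp0 qpx.
 have k3 : `|(q - p)^-1 * (orb u h q - orb u h p) - orb v h p| < e / 2.
 rewrite -(ltr_pM2l qp0) -{1}(gtr0_norm qp0) -normrM mulrBr mulrA divff ?gt_eqF // mul1r.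
 rewrite -(@ltr_pXn2r _ 2) ?nnegrE ?mulr_ge0 ?(ltW qp0) ?(ltW e20) ?(ltW e0) //.
 by rewrite real_normK ?num_real // exprMn; exact: le_lt_trans k2.
 have k4 : `|orb v h s - orb v h p| < e / 2 by apply: hd1.
 have -> : orb v h s - (q - p)^-1 * (orb u h q - orb u h p) =
 (orb v h s - orb v h p) - ((q - p)^-1 * (orb u h q - orb u h p) - orb v h p) by ring.
 by apply: le_lt_trans (ler_normB _ _) _; lra.
have [x0|x0] := ltP 0 x.
 apply: (fin s (x + s)) => //; rewrite ?ltrDr //; last by rewrite addrK.
 by rewrite addrK gtr0_norm.
 by rewrite subrr normr0.
have xn : x < 0 by rewrite lt_neqAle xne.
rewrite ltr0_norm // in xs x1 *.
have e1 : s - (x + s) = - x by ring.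
have p1 : 0 < x + s by lra.
have p2 : x + s < s by lra.
have p3 : `|s - (x + s)| < d1 by rewrite e1 gtr0_norm; lra.
apply: (fin (x + s) s p1 p2 _ p3); first by rewrite e1 ltr0_norm.
by rewrite e1 invrN mulNr -mulrN opprB.
Qed.

Let ftc_open (F dF : R -> R) (t : R) : 0 < t -> {within `[0, t], continuous dF} ->
 F x @[x --> (0 : R)^'+] --> F 0 -> F x @[x --> t^'-] --> F t ->
 (forall s : R, 0 < s < t -> isD s (1 : R) F (dF s)) ->
 \int[leb1]_(s in `[0%R, t]) dF s = F t - F 0.
move=> t0 cd c0 ct d; rewrite /Rintegral (continuous_FTC2 t0 cd (F := F)) //.
- by split=> // s; rewrite in_itv /= => /d [].
- by move=> s; rewrite in_itv /= => /d ds; rewrite derive1E; have [_ ->] := ds.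
Qed.

Lemma orbit_ftc u v h (t : R) : graph u v -> Lr h -> 0 < t ->
 \int[leb1]_(s in `[0%R, t]) orb v h s = orb u h t - sr u h.
move=> guv Lh t0; have [Lu Lv] := graph_L2 guv; have cu := orb_cont Lu Lh.
suff -> : \int[leb1]_(s in `[0%R, t]) orb v h s = orb u h t - orb u h 0.
 by rewrite {2}/orb /orb0 ltxx.
apply: ftc_open => //.
- by apply: csubT; exact: orb_cont.
- exact: cvg_at_right_filter (cu 0).
- exact: cvg_at_left_filter (cu t).
- by move=> s /andP[s0 _]; exact: orbit_der.
Qed.

Let is_der_int (F : R -> R) (s t : R) : 0 < s -> s < t -> continuous F ->
 leb1.-integrable `[0, t] (EFin \o F) ->
 isD s (1 : R) (fun x : R => \int[leb1]_(r in `[0%R, x]) F r) (F s).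
move=> s0 st cF iF; have [d1 d2] := continuous_FTC1_closed st iF s0 (cF s).
move: d2; rewrite derive1E => d2; exact: DeriveDef d1 d2.
Qed.

(** -e^-s (<T_s u, phi> + b(s)) is an antiderivative of the integrand, because L u = u - e - h. *)
Lemma lapl_id u e h phi (t : R) : Lr e -> Lr h -> Lr phi -> 0 < t ->
 graph u (linf (-1) (linf 1 e h) u) ->
 let b (s : R) : R := \int[leb1]_(r in `[0%R, s]) orb h phi r in
 \int[leb1]_(s in `[0%R, t]) (expR (- s) * (orb e phi s + b s)) =
 sr u phi - expR (- t) * (orb u phi t + b t).
move=> Le Lh Lp t0 gu b; have [Lu Lv] := graph_L2 gu.
have cu := orb_cont Lu Lp; have ce := orb_cont Le Lp; have ch := orb_cont Lh Lp.
have ih c d := orb_int c d Lh Lp.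
have cexp : continuous (fun s : R => expR (- s)).
 by move=> s; apply: continuous_comp; [exact: opp_continuous|exact: continuous_expR].
have cb : {within `[0, t], continuous b} by exact: parameterized_integral_continuous (ltW t0) (ih 0 t).
have b0 : b 0 = 0 by rewrite /b set_itv1 Rintegral_set1.
have b0c : b x @[x --> (0 : R)^'+] --> b 0.
 have b0' : b x @[x --> (0 : R)^'+] --> (0 : R) by apply: cvg_at_right_filter; exact: (parameterized_integral_cvg_left t0 (ih 0 t)).
 have tr (z : R) : 0 = z -> b x @[x --> (0 : R)^'+] --> z by move=> <-. exact: tr (esym b0).
have btc : b x @[x --> t^'-] --> b t by exact: parameterized_integral_cvg_at_left t0 (ih 0 t).
pose F (s : R) : R := - (expR (- s) * (orb u phi s + b s)).
have -> : sr u phi - expR (- t) * (orb u phi t + b t) = F t - F 0.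
 by rewrite /F b0 addr0 oppr0 expR0 mul1r {3}/orb /orb0 ltxx; ring.
apply: ftc_open => //.
- have c1 : {within `[0, t], continuous (fun s : R => expR (- s))} by apply: csubT.
 have c2 : {within `[0, t], continuous (orb e phi)} by apply: csubT; exact: ce.
 by move=> x; exact: (cvgM (c1 x) (cvgD (c2 x) (cb x))).
- apply: cvgN; apply: cvgM; first exact: cvg_at_right_filter (cexp 0).
 by apply: cvgD => //; exact: cvg_at_right_filter (cu 0).
- apply: cvgN; apply: cvgM; first exact: cvg_at_left_filter (cexp t).
 by apply: cvgD => //; exact: cvg_at_left_filter (cu t).
move=> s /andP[s0 st].
have db : isD s (1 : R) b (orb h phi s) by exact: is_der_int s0 st ch (ih 0 t).
have du := orbit_der gu Lp s0.
have dexp : isD s (1 : R) (fun s => expR (- s)) (- expR (- s)).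
 have := @is_derive1_comp _ expR -%R s _ _ (is_derive_expR _) (is_deriveNid s 1). by rewrite mulrN1.
have d3 := is_der_mul dexp (is_deriveD du db).
have d4 : isD s (1 : R) F (- (- expR (- s) * (orb u phi s + b s) +
 expR (- s) * (orb (linf (-1) (linf 1 e h) u) phi s + orb h phi s))) by exact: is_deriveN d3.
apply: (is_derive_eq d4).
rewrite orb_lin ?orb_lin //; last exact: (ph_lin PR).
move: (expR _) (orb u phi s) (b s) (orb e phi s) (orb h phi s) => x1 x2 x3 x4 x5; ring.
Qed.

Let msr f h : Lr f -> Lr h -> bmeas (fun x => f x * h x * rho x).
by move=> Lf Lh; apply/mEFinP; exact: measurable_int (wL2i mr rho_gt0 Lf Lh). Qed.

(** * Order properties, maximum principles and approximating sequences *)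

Lemma sr_ge0 f h : Lr f -> Lr h -> {ae mu, forall x, 0 <= f x} -> {ae mu, forall x, 0 <= h x} ->
 0 <= sr f h.
move=> Lf Lh f0 h0; apply: (@ae_Rint_ge0 _ (borel M)); first exact: msr.
by apply: ae2 f0 h0 => x h1 h2; rewrite !mulr_ge0 // ltW.
Qed.

Lemma sr_negp (z : M -> R) : Lr z -> sr z (negp z) = - nr (negp z).
move=> Lz; have Ln := negp_L2 Lz; rewrite -mulN1r -(@RintegralZl _ (borel M)) //; last exact: (wL2i mr rho_gt0).
by apply: eqRint => x _; rewrite (mulrC (z x)) negpE; ring.
Qed.

Lemma negp_zero_ge0 (z : M -> R) : Lr z -> nr (negp z) <= 0 -> {ae mu, forall x, 0 <= z x}.
move=> Lz /(nr_eq0_le (negp_L2 Lz)); apply: (@ae1 _ (borel M)) => x; rewrite /negp /trunc subr0.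
by have [|h] := leP (- z x) 0; [rewrite oppr_le0|move=> e; rewrite e ltxx in h].
Qed.

Lemma sr_test_ge0 (z : M -> R) : Lr z -> (forall phi, Lr phi -> (forall x, 0 <= phi x) -> 0 <= sr z phi) ->
 {ae mu, forall x, 0 <= z x}.
move=> Lz h; apply: negp_zero_ge0 => //; rewrite -oppr_ge0 -sr_negp //; apply: h; first exact: negp_L2.
by move=> x; rewrite le_max lexx orbT.
Qed.

Definition resolves k (U : E1) : Prop := N10 U /\ forall q, N10 q -> b1 U q = sr k q.1.

Lemma res_ge0 k (U : E1) : Lr k -> {ae mu, forall x, 0 <= k x} -> resolves k U ->
 {ae mu, forall x, 0 <= U.1 x}.
move=> Lk k0 [NU hU]; have gu := res_graph Lk NU hU; have [Lu _] := graph_L2 gu.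
have Ln := negp_L2 Lu; apply: negp_zero_ge0 => //; have := negp_graph gu.
rewrite (ph_linr PR) // (ph_sym PR Ln Lu) sr_negp //.
have : 0 <= sr (negp U.1) k.
 by apply: sr_ge0 => //; apply: aeT => x; rewrite le_max lexx orbT.
by move: (sr _ _) (sr _ _) => a b; lra.
Qed.

(** Where the truncation q is not 0 one has v = q + c, with the same gradient as q. *)
Lemma trunc_test (c : R) v (Z : M -> 'rV[R]_n) : 0 <= c -> D1 (v, Z) -> let q := (trunc c v, tgrad c v Z) in
 mint (fun x => c * trunc c v x * w x) /\
 b1 (v, Z) q = b1 q q + \int[mu]_x (c * trunc c v x * w x).
move=> c0 Dv q; have Dq : D1 q by exact: (trunc_D1 sm_w wgt0 c0 Dv).
have [Lv Fv _] := Dv; have [Lq Fq _] := Dq; rewrite /q /= in Lv Fv Lq Fq.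
have i1 := wL2i mw wgt0 Lv Lq; have i2 := wL2i mw wgt0 Lq Lq.
have E : (fun x => c * trunc c v x * w x) = fun x =>
 (-1) * (trunc c v x * trunc c v x * w x) + v x * trunc c v x * w x.
 apply/funext => x; rewrite /trunc; have [h|h] := leP (v x - c) 0; ring.
have eF : Fscal Z (tgrad c v Z) = Fscal (tgrad c v Z) (tgrad c v Z).
 apply: eqRint => x _; rewrite scal_sym !scal_tgrad scal_sym scal_tgrad.
 by case: (c < v x); rewrite ?mul1r ?mul0r.
split; first by rewrite E; exact: (@intble_lin _ (borel M) R mu (-1) _ _ i2 i1).
rewrite E (@RiL _ (borel M) R mu (-1) _ _ i2 i1) /pform /= eF /wscal.
by move: (Rintegral _ _ _) (Rintegral _ _ _) (Fscal _ _) => p1 p2 p3; ring.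
Qed.

Lemma trunc_zero_le (c : R) v (Z : M -> 'rV[R]_n) : D1 (trunc c v, tgrad c v Z) ->
 b1 (trunc c v, tgrad c v Z) (trunc c v, tgrad c v Z) <= 0 -> {ae mu, forall x, v x <= c}.
move=> Dq h; have Lq := D1_Lr Dq; have h2 := le_trans (sr_b1 Dq) h.
move: (nr_eq0_le Lq h2); apply: (@ae1 _ (borel M)) => x; rewrite /= /trunc.
by have [|h3] := leP (v x - c) 0; [rewrite subr_le0|move=> e; rewrite e ltxx in h3].
Qed.

(** The truncation q of C u + f at C is admissible by [ideal]. Testing with q gives C <k, q> on one
    side, and the squared form norm of q plus C int q w on the other; as k rho <= w, the norm of q
    is 0. *)
Lemma res_bd (C : R) k (U : E1) f (F : M -> 'rV[R]_n) : 0 <= C -> Lr k ->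
 {ae mu, forall x, k x <= 1 + V x / rho x} -> resolves k U ->
 D1 (f, F) -> (forall q, N10 q -> b1 (f, F) q = 0) -> {ae mu, forall x, f x <= C} ->
 {ae mu, forall x, C * U.1 x + f x <= C}.
case: U => u X C0 Lk hk [NU hU] Df ortho fC.
have NU' := N10_lin sm_w wgt0 (C - 1) NU NU.
have Nq := ideal sm_w wgt0 C0 NU' Df fC.
have E : (fun x => linf (C - 1) u u x + f x, fun x => linF (C - 1) X X x + F x) = lin1 C (u, X) (f, F).
 rewrite /plin /=; congr pair; apply/funext => x; first by rewrite /linf_; ring.
 by rewrite /linF scalerBl scale1r subrK.
have Dv := ph_lin P1 C (N10_D1 NU) Df; rewrite -E in Dv.
have Dq := N10_D1 Nq.
have [i1 e1] := trunc_test C0 Dv; have := ph_linl P1 C (N10_D1 NU) Df Dq; rewrite -E e1 hU // ortho // addr0.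
have Lq := D1_Lr Dq; set psi := trunc C _ in i1 Lq *.
have i2 := wL2i mr rho_gt0 Lk Lq.
have i3 := @intble_lin _ (borel M) R mu (C - 1) _ _ i2 i2.
have le1 : C * sr k psi <= \int[mu]_x (C * psi x * w x).
 have -> : C * sr k psi = \int[mu]_x ((C - 1) * (k x * psi x * rho x) + k x * psi x * rho x).
 by rewrite (@RiL _ (borel M) R mu (C - 1) _ _ i2 i2) /wscal; move: (Rintegral _ _ _) => p; ring.
 apply: (@ae_Rint_le _ (borel M)) => //; apply: ae1 hk => x hx. have p0 : 0 <= psi x by rewrite le_max lexx orbT.
 have -> : (C - 1) * (k x * psi x * rho x) + k x * psi x * rho x = C * psi x * (k x * rho x) by ring.
 apply: ler_wpM2l; first exact: mulr_ge0.
 have := ler_wpM2r (ltW (rho_gt0 x)) hx; rewrite mulrDl mul1r divfK // gt_eqF //.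
move=> e2; have le2 : b1 (psi, tgrad C (fun x => linf (C - 1) u u x + f x) (fun x => linF (C - 1) X X x + F x))
 (psi, tgrad C (fun x => linf (C - 1) u u x + f x) (fun x => linF (C - 1) X X x + F x)) <= 0.
 by move: e2 le1; rewrite /=; move: (b1 _ _) (C * sr _ _) (Rintegral _ _ _) => p1 p2 p3; lra.
have := trunc_zero_le Dq le2; apply: (@ae1 _ (borel M)) => x; rewrite /= /linf_ => h.
by apply: le_trans h; rewrite le_eqVlt; apply/orP; left; apply/eqP; ring.
Qed.

(** The argument of [res_bd] with source 0, and -p in place of C u. *)
Lemma orth_bd (C : R) (p : E1) h (H : M -> 'rV[R]_n) : 0 <= C -> N10 p -> D1 (h, H) ->
 (forall q, N10 q -> b1 (lin1 (-1) p (h, H)) q = 0) -> {ae mu, forall x, h x <= C} ->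
 {ae mu, forall x, (lin1 (-1) p (h, H)).1 x <= C}.
case: p => p P C0 Np Dh ortho hC.
have Np' := N10_lin sm_w wgt0 (-2) Np Np.
have Nq := ideal sm_w wgt0 C0 Np' Dh hC.
have E : (fun x => linf (-2) p p x + h x, fun x => linF (-2) P P x + H x) = lin1 (-1) (p, P) (h, H).
 rewrite /plin /=; congr pair; apply/funext => x; first by rewrite /linf_; ring.
 by apply/rowP => i; rewrite /linF !mxE; ring.
have Dv := ph_lin P1 (-1) (N10_D1 Np) Dh; rewrite -E in Dv.
have Dq := N10_D1 Nq; have [i1 e1] := trunc_test C0 Dv.
have := ortho _ Nq; rewrite -E e1 => e2.
have i0 : 0 <= \int[mu]_x (C * trunc C (fun x => linf (-2) p p x + h x) x * w x).
 by apply: Rintegral_ge0 => x _; rewrite !mulr_ge0 ?(ltW (wgt0 _)) // le_max lexx orbT.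
apply: (trunc_zero_le Dq); move: e2 i0; rewrite /=.
by move: (b1 _ _) (Rintegral _ _ _) => p1 p2; lra.
Qed.

Lemma approx_facts (F : M -> R) (f : nat -> M -> R) : approximations mu rho (fun x => (F x)%:E) f ->
 (forall k : nat, Lr (f k)) /\ {ae mu, forall x, [/\ forall k : nat, 0 <= f k x, forall k : nat, f k x <= f k.+1 x,
 forall k : nat, f k x <= F x & f k x @[k --> \oo] --> F x]}.
move=> [Lf f0 fS cf]; split=> //.
have h0 := @ae_all_nat _ (borel M) R mu _ f0; have hS := @ae_all_nat _ (borel M) R mu _ fS.
apply: ae_imp3 h0 hS cf => x p0 pS pc; have pc' : f k x @[k --> \oo] --> F x by exact: (fine_cvg pc).
by split=> //; exact: nondecreasing_le.
Qed.

(** The minimum of F and k times the sum of the first k bumps: the bumps put it in L^2, and at each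
    point it is eventually equal to F. *)
Lemma approx_ne (F : M -> R) : bmeas F -> (forall x, 0 <= F x) ->
 exists f : nat -> M -> R, approximations mu rho (fun x => (F x)%:E) f.
move=> mF F0; have [p hp] := ctbl_bumps S.
pose sg (k : nat) : M -> R := fun x => \sum_(i < k) bmp S (p i) x.
have sg0 (k : nat) x : 0 <= sg k x by apply: sumr_ge0 => i _; exact: bmp_ge0.
have L0 : Lr (fun=> 0).
 by split; [exact: measurable_cst|under eqint do rewrite expr0n mul0r; rewrite integral0].
have Lsg (k : nat) : Lr (sg k).
 elim: k => [|k IH].
 by have -> : sg 0%N = fun=> 0 by apply/funext => x; rewrite /sg big_ord0.
 have -> : sg k.+1 = linf 1 (sg k) (bmp S (p k)).
 by apply/funext => x; rewrite /sg big_ord_recr /= /linf_ mul1r.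
 apply: (ph_lin PR) => //; apply: L2w_Lr. exact: (L2_Cc sm_w wgt0 (bmp_Cc S (p k))).
pose f (k : nat) x : R := Num.min (F x) (k%:R * sg k x).
have mf (k : nat) : bmeas (f k).
 by apply: measurable_minr => //; apply: mfM => //; exact: mL (Lsg k).
have up (k : nat) x : sg k x <= sg k.+1 x by rewrite /sg big_ord_recr /= lerDl bmp_ge0.
have fS (k : nat) x : f k x <= f k.+1 x.
 rewrite /f le_min ge_min lexx /= ge_min; apply/orP; right. by apply: ler_pM => //; rewrite ler_nat.
exists f; split.
- move=> k; apply: (@wL2_dom _ (borel M) R mu rho mr rho_gt0 k%:R _ _ (mf k) (Lsg k)) => x.
 rewrite !ger0_norm ?le_min ?F0 ?mulr_ge0 //. by rewrite /f ge_min lexx orbT.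
- by move=> k; apply: aeT => x; rewrite /f le_min F0 mulr_ge0.
- by move=> k; apply: aeT => x.
apply: aeT => x; have [i bi] := hp x.
have [N hN] : exists N : nat, F x / bmp S (p i) x <= N%:R.
 by exists (Num.bound (F x / bmp S (p i) x)); rewrite ltW // archi_boundP // divr_ge0 // ltW.
have up2 (j k : nat) : (j <= k)%N -> sg j x <= sg k x.
 by move=> jk; have /nondecreasing_seqP nd := (fun k : nat => up k x); exact: nd.
apply: cvg_EFin; first exact: nearW.
apply: cvg_near_cst; exists (maxn i.+1 N) => // k /=; rewrite geq_max => /andP[ik Nk].
rewrite /f; apply: min_l; rewrite ler_pdivrMr // in hN; apply: le_trans hN _.
apply: ler_pM => //; rewrite ?ler_nat //; first exact: bmp_ge0.
apply: le_trans (up2 _ _ ik); rewrite /sg big_ord_recr /= lerDr.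
by apply: sumr_ge0 => j _; exact: bmp_ge0.
Qed.

(** The left side of the conservation identity, evaluated on approximants of 1 and V/rho. *)
Definition evolve (t : R) (e h : M -> R) : M -> R := linf 1 (T t e) (time_integral mu rho T t h).

Lemma orbit_ge0 f h s : Lr f -> Lr h -> {ae mu, forall x, 0 <= f x} -> {ae mu, forall x, 0 <= h x} ->
 0 <= orb f h s.
move=> Lf Lh f0 h0; apply: sr_ge0 => //; first exact: orb0_L2.
by rewrite /orb0; case: ifP => // s0; exact: sg_ge0.
Qed.

Lemma time_int_le t h h' : 0 < t -> Lr h -> Lr h' -> {ae mu, forall x, h x <= h' x} ->
 {ae mu, forall x, time_integral mu rho T t h x <= time_integral mu rho T t h' x}.
move=> t0 Lh Lh' hh; have [L1 e1] := time_intP t0 Lh; have [L2' e2] := time_intP t0 Lh'.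
have Lz := ph_lin PR (-1) L1 L2'.
suff : {ae mu, forall x, 0 <= linf (-1) (time_integral mu rho T t h) (time_integral mu rho T t h') x}.
 by apply: (@ae1 _ (borel M)) => x; rewrite /linf_ mulN1r addrC subr_ge0.
apply: (sr_test_ge0 Lz) => phi Lp p0; have combine (p q p' q' r : R) : r = -1 * p + q -> p = p' -> q = q' -> p' <= q' -> 0 <= r.
 by move=> -> -> -> pq; rewrite mulN1r addrC subr_ge0.
apply: (combine _ _ _ _ _ (ph_linl PR (-1) L1 L2' Lp) (e1 phi Lp) (e2 phi Lp)).
apply: le_Rintegral => //; try exact: orb_int.
move=> s _; have Ld := ph_lin PR (-1) Lh Lh'.
have h1 : {ae mu, forall x, 0 <= linf (-1) h h' x}.
 by apply: (ae1 _ hh) => x; rewrite /linf_ mulN1r addrC subr_ge0.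
have := orbit_ge0 s Ld Lp h1 (@aeT _ (borel M) R mu _ p0).
by rewrite (orb_lin (-1) s Lh Lh' Lp) mulN1r addrC subr_ge0.
Qed.

Lemma sg_le t f f' : 0 < t -> Lr f -> Lr f' -> {ae mu, forall x, f x <= f' x} ->
 {ae mu, forall x, T t f x <= T t f' x}.
move=> t0 Lf Lf' ff; have Ld := ph_lin PR (-1) Lf Lf'.
have h1 : {ae mu, forall x, 0 <= linf (-1) f f' x}.
 by apply: ae1 ff => x; rewrite /linf_ mulN1r addrC subr_ge0.
apply: ae2 (sg_ge0 t0 Ld h1) (T_lin (-1) t0 Lf Lf') => x + e; rewrite e.
by rewrite mulN1r addrC subr_ge0.
Qed.

Lemma evolveP t f h : 0 < t -> Lr f -> Lr h -> Lr (evolve t f h) /\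
 forall phi, Lr phi -> sr (evolve t f h) phi = orb f phi t + \int[leb1]_(s in `[0%R, t]) orb h phi s.
move=> t0 Lf Lh; have [L1 e1] := time_intP t0 Lh; have L2' := T_L2 t0 Lf.
split=> [|phi Lp]; first exact: (ph_lin PR).
have := ph_linl PR 1 L2' L1 Lp; rewrite mul1r (e1 phi Lp) => e; apply: etrans e _.
by rewrite /orb /orb0 t0.
Qed.

Lemma time_int_ge0 t h : 0 < t -> Lr h -> {ae mu, forall x, 0 <= h x} ->
 {ae mu, forall x, 0 <= time_integral mu rho T t h x}.
move=> t0 Lh h0; have [L1 e1] := time_intP t0 Lh.
apply: (sr_test_ge0 L1) => phi Lp p0; rewrite (e1 phi Lp); apply: Rintegral_ge0 => s _.
by apply: orbit_ge0 => //; exact: aeT.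
Qed.

Lemma lapl_cont f h phi (t : R) : Lr f -> Lr h -> Lr phi -> 0 < t ->
 {within `[0, t], continuous (fun s : R => expR (- s) * (orb f phi s + \int[leb1]_(r in `[0%R, s]) orb h phi r))}.
move=> Lf Lh Lp t0.
have c1 : {within `[0, t], continuous (fun s : R => expR (- s))}.
 apply: csubT => s; apply: continuous_comp; [exact: opp_continuous|exact: continuous_expR].
have c2 : {within `[0, t], continuous (orb f phi)} by apply: csubT; exact: orb_cont.
have c3 := parameterized_integral_continuous (ltW t0) (orb_int 0 t Lh Lp).
by move=> x; exact: (cvgM (c1 x) (cvgD (c2 x) (c3 x))).
Qed.

Lemma expR_int (t a : R) : 0 < t -> \int[leb1]_(s in `[0%R, t]) (expR (- s) * a) = (1 - expR (- t)) * a.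
move=> t0; pose F (s : R) : R := - (expR (- s) * a).
have cexp : continuous (fun s : R => expR (- s)).
 by move=> s; apply: continuous_comp; [exact: opp_continuous|exact: continuous_expR].
have cE : continuous (fun s : R => expR (- s) * a) by move=> s; exact: (cvgM (cexp s) (cvg_cst a)).
have cF : continuous F by move=> s; exact: (cvgN (cE s)).
have -> : (1 - expR (- t)) * a = F t - F 0 by rewrite /F oppr0 expR0; ring.
apply: ftc_open => //.
- exact: csubT.
- exact: cvg_at_right_filter (cF 0).
- exact: cvg_at_left_filter (cF t).
move=> s _.
have dexp : isD s (1 : R) (fun s => expR (- s)) (- expR (- s)).
 have := @is_derive1_comp _ expR -%R s _ _ (is_derive_expR _) (is_deriveNid s 1). by rewrite mulrN1.
have d3 := is_der_mul dexp (is_derive_cst a s 1).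
have d4 : isD s (1 : R) F (- (- expR (- s) * a + expR (- s) * 0)) by exact: is_deriveN d3.
by apply: (is_derive_eq d4); ring.
Qed.

(** * From conservation to the equality of W^1 and W^1_0 *)

Section conservation.
Variables (e h : nat -> M -> R).
Variables (e_approx : approximations mu rho (fun=> 1%:E) e) (h_approx : approximations mu rho (fun x => (V x / rho x)%:E) h).
Let Le (j : nat) : Lr (e j). Proof. by have [] := approx_facts e_approx. Qed.
Let Lh (j : nat) : Lr (h j). Proof. by have [] := approx_facts h_approx. Qed.
Let eP := (approx_facts e_approx).2.
Let hP := (approx_facts h_approx).2.
Let kn (j : nat) : M -> R := linf 1 (e j) (h j).
Let Lk (j : nat) : Lr (kn j). Proof. exact: (ph_lin PR). Qed.

Let kn_ge0 (j : nat) : {ae mu, forall x, 0 <= kn j x}.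
by apply: ae2 eP hP => x [h1 _ _ _] [h2 _ _ _]; rewrite /kn /linf_ mul1r addr_ge0. Qed.

Let kn_le (j : nat) : {ae mu, forall x, kn j x <= 1 + V x / rho x}.
by apply: ae2 eP hP => x [_ _ h1 _] [_ _ h2 _]; rewrite /kn /linf_ mul1r lerD. Qed.

Let e_ge0 (j : nat) : {ae mu, forall x, 0 <= e j x}. Proof. by apply: ae1 eP => x []. Qed.
Let h_ge0 (j : nat) : {ae mu, forall x, 0 <= h j x}. Proof. by apply: ae1 hP => x []. Qed.

Let T_mono t : 0 < t -> {ae mu, forall x, forall j : nat, T t (e j) x <= T t (e j.+1) x}.
move=> t0; apply: (@ae_all_nat _ (borel M)) => j; apply: sg_le => //.
by apply: ae1 eP => x [].
Qed.

Let ti_mono t : 0 < t ->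
 {ae mu, forall x, forall j : nat, time_integral mu rho T t (h j) x <= time_integral mu rho T t (h j.+1) x}.
move=> t0; apply: (@ae_all_nat _ (borel M)) => j; apply: time_int_le => //.
by apply: ae1 hP => x [].
Qed.

Let evolve_ge0 t : 0 < t -> {ae mu, forall x, forall j : nat, 0 <= evolve t (e j) (h j) x}.
move=> t0; apply: (@ae_all_nat _ (borel M)) => j.
apply: ae2 (sg_ge0 t0 (Le j) (e_ge0 j)) (time_int_ge0 t0 (Lh j) (h_ge0 j)) => x h1 h2.
by rewrite /evolve /linf_ mul1r addr_ge0.
Qed.

Let evolve_mono t : 0 < t -> {ae mu, forall x, forall j : nat, evolve t (e j) (h j) x <= evolve t (e j.+1) (h j.+1) x}.
by move=> t0; apply: ae2 (T_mono t0) (ti_mono t0) => x h1 h2 j; rewrite /evolve /linf_ !mul1r lerD.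
Qed.

Definition conserved (t : R) := {ae mu, forall x, evolve t (e j) (h j) x @[j --> \oo] --> (1 : R)}.

Lemma conservedP t : 0 < t -> (conserved t <-> {ae mu, forall x,
 (limn (fun j : nat => (T t (e j) x)%:E) + limn (fun j : nat => (time_integral mu rho T t (h j) x)%:E) = 1%:E)%E}).
move=> t0; split=> hh; apply: ae_imp3 hh (T_mono t0) (ti_mono t0) => x h1 h2 h3; have := monotone_sum_limit h2 h3.
- case=> _; apply; move: h1; rewrite /evolve /linf_.
 by have -> : (fun j : nat => 1 * T t (e j) x + time_integral mu rho T t (h j) x) =
 (fun j : nat => T t (e j) x + time_integral mu rho T t (h j) x) by apply/funext => j; rewrite mul1r.
- case=> /(_ h1) h4 _; rewrite /evolve /linf_.
 by have -> : (fun j : nat => 1 * T t (e j) x + time_integral mu rho T t (h j) x) =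
 (fun j : nat => T t (e j) x + time_integral mu rho T t (h j) x) by apply/funext => j; rewrite mul1r.
Qed.

Let mean (phi : M -> R) : R := \int[mu]_x (phi x * rho x).

Lemma pair_limit (z : nat -> M -> R) phi : (forall j : nat, Lr (z j)) -> Lr phi ->
 mint (fun x => phi x * rho x) -> (forall x, 0 <= phi x) ->
 {ae mu, forall x, (forall j : nat, 0 <= z j x <= 1) /\ z j x @[j --> \oo] --> (1 : R)} ->
 sr (z j) phi @[j --> \oo] --> mean phi /\ forall j : nat, 0 <= sr (z j) phi <= mean phi.
move=> Lz Lp ip p0 hz; have pr0 x : 0 <= phi x * rho x by rewrite mulr_ge0 // ltW.
have zp0 j : {ae mu, forall x, 0 <= z j x} by apply: ae1 hz => x [/(_ j)/andP[]].
split=> [|j]; last first.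
 rewrite sr_ge0 //=; last exact: aeT.
 apply: (@ae_Rint_le _ (borel M)) => //; first exact: (wL2i mr rho_gt0 (Lz j) Lp).
 apply: ae1 hz => x [/(_ j)/andP[_ z1] _]. by rewrite -mulrA -[leRHS]mul1r ler_wpM2r.
apply: (@Rint_dom_ae _ (borel M) R mu _ _ _ (fun x => phi x * rho x)) => //.
- by move=> j; exact: msr.
- by apply/mEFinP; exact: measurable_int ip.
- apply: ae1 hz => x [_ cz] _; have -> : (fun j : nat => z j x * phi x * rho x) = (fun j : nat => z j x * (phi x * rho x)).
 by apply/funext => j; rewrite mulrA.
 have c2 := cvgM cz (@cvg_cst _ (phi x * rho x) _ \oo _); rewrite mul1r in c2; exact: c2.
- apply: ae1 hz => x [hz1 _] _ j; have /andP[z0 z1] := hz1 j.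
 by rewrite -mulrA normrM (ger0_norm (pr0 x)) ger0_norm // -[leRHS]mul1r ler_wpM2r.
Qed.

(** [lapl_id] and [res_bd] give C int_0^t e^-s b_j(s) ds <= C <u_j, phi> <= C mean(phi) - <f, phi>.
    Under conservation b_j(s) tends to mean(phi), so the left side tends to C (1 - e^-t) mean(phi);
    stopping at a finite time leaves the factor e^-t. *)
Lemma pair_bd (C t : R) f (F : M -> 'rV[R]_n) phi : 0 <= C -> 0 < t ->
 (forall s : R, 0 < s -> conserved s) ->
 D1 (f, F) -> (forall q, N10 q -> b1 (f, F) q = 0) -> {ae mu, forall x, f x <= C} ->
 Lr phi -> mint (fun x => phi x * rho x) -> (forall x, 0 <= phi x) ->
 sr f phi <= C * expR (- t) * mean phi.
move=> C0 t0 cons Df ortho fC Lp ip p0; have Lf := D1_Lr Df.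
have m0 : 0 <= mean phi by apply: Rintegral_ge0 => x _; rewrite mulr_ge0 // ltW.
pose b (j : nat) (s : R) : R := orb (e j) phi s + \int[leb1]_(r in `[0%R, s]) orb (h j) phi r.
have lim s : 0 <= s -> b j s @[j --> \oo] --> mean phi /\ forall j : nat, 0 <= b j s <= mean phi.
 (* Conservation concerns positive times only; at time 0 the limit is that of the approximants of
    1. *)
 rewrite le_eqVlt => /orP[/eqP <-|s0].
 have -> : b^~ 0 = (fun j : nat => sr (e j) phi).
 apply/funext => j; rewrite /b set_itv1 Rintegral_set1 addr0 /orb /orb0 ltxx //.
 have bE (j : nat) : b j 0 = sr (e j) phi.
 by rewrite /b set_itv1 Rintegral_set1 addr0 /orb /orb0 ltxx.
 have [|c1 c2] := pair_limit Le Lp ip p0.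
 by apply: ae1 eP => x [h1 _ h2 h3]; split=> // j; rewrite h1 h2.
 by split=> // j; rewrite bE.
 have bE (j : nat) : b j s = sr (evolve s (e j) (h j)) phi by have [_ ->] := evolveP s0 (Le j) (Lh j).
 have -> : b^~ s = (fun j : nat => sr (evolve s (e j) (h j)) phi) by apply/funext.
 have [||c1 c2] := @pair_limit (fun j : nat => evolve s (e j) (h j)) phi _ Lp ip p0.
 - by move=> j; have [] := evolveP s0 (Le j) (Lh j).
 - apply: ae_imp3 (evolve_ge0 s0) (evolve_mono s0) (cons s s0) => x h1 h2 h3; split=> // j.
 by rewrite h1 /=; exact: (@nondecreasing_le R (fun j : nat => evolve s (e j) (h j) x)).
 by split=> // j; rewrite bE.
have J : \int[leb1]_(s in `[0%R, t]) (expR (- s) * b j s) @[j --> \oo] --> (1 - expR (- t)) * mean phi.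
 rewrite -expR_int //. apply: (@Rint_dom_ae _ _ R leb1 _ _ _ (fun=> mean phi)).
 - exact: measurable_itv.
 - move=> j; apply: subspace_continuous_measurable_fun; first exact: measurable_itv. exact: lapl_cont.
 - apply: subspace_continuous_measurable_fun; first exact: measurable_itv.
 apply: csubT => s; apply: cvgM; last exact: cvg_cst.
 by apply: continuous_comp; [exact: opp_continuous|exact: continuous_expR].
 - apply: continuous_compact_integrable; first exact: segment_compact.
 by apply: csubT; exact: cst_continuous.
 - apply: aeT => s; rewrite /= in_itv /= => /andP[s0 _]; have [c1 _] := lim s s0.
 by apply: cvgM => //; exact: cvg_cst.
 - apply: aeT => s; rewrite /= in_itv /= => /andP[s0 _] j; have [_ /(_ j)/andP[b0 b1']] := lim s s0.
 rewrite normrM (ger0_norm b0) ger0_norm ?expR_ge0 // -[leRHS]mul1r ler_pM ?expR_ge0 //.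
 by rewrite -expR0 ler_expR oppr_le0.
have key (j : nat) : C * \int[leb1]_(s in `[0%R, t]) (expR (- s) * b j s) <= C * mean phi - sr f phi.
 have [U [NU hU gU]] := graph_exists (Lk j); have [Lu _] := graph_L2 gU.
 have u0 := res_ge0 (Lk j) (kn_ge0 j) (conj NU hU). have uC := res_bd C0 (Lk j) (kn_le j) (conj NU hU) Df ortho fC.
 rewrite (lapl_id (Le j) (Lh j) Lp t0 gU).
 have o0 : 0 <= orb U.1 phi t by apply: orbit_ge0 => //; exact: aeT.
 have h0 : 0 <= \int[leb1]_(r in `[0%R, t]) orb (h j) phi r.
 by apply: Rintegral_ge0 => s _; apply: orbit_ge0 => //; exact: aeT.
 apply: (@le_trans _ _ (C * sr U.1 phi)).
 by apply: ler_wpM2l => //; rewrite gerBl mulr_ge0 ?expR_ge0 ?addr_ge0.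
 rewrite lerBrDr. have i1 := wL2i mr rho_gt0 Lu Lp; have i2 := wL2i mr rho_gt0 Lf Lp.
 rewrite -(@RiL _ (borel M) R mu C _ _ i1 i2). rewrite -(@RintegralZl _ (borel M)) //.
 apply: (@ae_Rint_le _ (borel M)).
 - exact: (@intble_lin _ (borel M) R mu C _ _ i1 i2).
 - by apply: eq_integrable (integrableZl measurableT C ip) => // x _; rewrite /= EFinM.
 apply: ae1 uC => x ux; have -> : C * (U.1 x * phi x * rho x) + f x * phi x * rho x = (C * U.1 x + f x) * (phi x * rho x) by ring.
 by apply: ler_wpM2r => //; rewrite mulr_ge0 // ltW.
have lim2 : C * mean phi - C * \int[leb1]_(s in `[0%R, t]) (expR (- s) * b j s) @[j --> \oo] -->
 C * mean phi - C * ((1 - expR (- t)) * mean phi).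
 by apply: cvgB; [exact: cvg_cst|apply: cvgM J; exact: cvg_cst].
have -> : C * expR (- t) * mean phi = C * mean phi - C * ((1 - expR (- t)) * mean phi) by ring.
apply: (cvgr_to_ge lim2); apply: nearW => j; rewrite lerBrDr addrC -lerBrDr.
exact: key.
Qed.

Lemma pair_npos (C : R) f (F : M -> 'rV[R]_n) phi : 0 <= C ->
 (forall s : R, 0 < s -> conserved s) ->
 D1 (f, F) -> (forall q, N10 q -> b1 (f, F) q = 0) -> {ae mu, forall x, f x <= C} ->
 Lr phi -> mint (fun x => phi x * rho x) -> (forall x, 0 <= phi x) ->
 sr f phi <= 0.
move=> C0 cons Df ortho fC Lp ip p0; rewrite leNgt; apply/negP => s0.
have m0 : 0 <= mean phi by apply: Rintegral_ge0 => x _; rewrite mulr_ge0 // ltW.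
(* Since t e^-t < 1, this [t] makes the bound of [pair_bd] smaller than <f, phi>. *)
pose t := C * mean phi / sr f phi + 1.
have t0 : 0 < t by rewrite ltr_wpDl // divr_ge0 ?mulr_ge0 // ltW.
have := pair_bd C0 t0 cons Df ortho fC Lp ip p0; rewrite leNgt => /negP; apply.
have e1 : expR (- t) * t < 1.
 rewrite expRN mulrC ltr_pdivrMr ?expR_gt0 // mul1r; apply: lt_le_trans (expR_ge1Dx t). by rewrite ltrDr.
rewrite -(ltr_pM2r t0).
have -> : C * expR (- t) * mean phi * t = C * mean phi * (expR (- t) * t) by ring.
rewrite [sr f phi * t]mulrC.
apply: (@le_lt_trans _ _ (C * mean phi)); first by rewrite ler_piMr ?mulr_ge0 // ltW.
by rewrite /t mulrDl mul1r divfK ?gt_eqF // ltrDl.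
Qed.

(** The difference f = u - p is at most C by [orth_bd]. With be^2 f^+ as test function, made
    integrable by the bump, [pair_npos] yields be f^+ = 0 for countably many bumps, one of which is
    positive at any given point. *)
Lemma orth_npos (C : R) (p : E1) u (U : M -> 'rV[R]_n) : 0 <= C ->
 (forall s : R, 0 < s -> conserved s) -> N10 p -> D1 (u, U) ->
 (forall q, N10 q -> b1 (lin1 (-1) p (u, U)) q = 0) -> {ae mu, forall x, u x <= C} ->
 {ae mu, forall x, u x <= p.1 x}.
move=> C0 cons Np Du ortho uC.
have Df := ph_lin P1 (-1) (N10_D1 Np) Du.
have fC := orth_bd C0 Np Du ortho uC.
set f := (lin1 (-1) p (u, U)).1 in fC; set F := (lin1 (-1) p (u, U)).2.
have Lf : Lr f := D1_Lr Df.
have Lfp : Lr (trunc 0 f) by exact: (trunc_L2 ((smoothP S rho).1 rho_smooth) rho_gt0 (lexx 0) Lf).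
have [q hq] := ctbl_bumps S.
have tz i : {ae mu, forall x, bmp S (q i) x * trunc 0 f x = 0}.
 set be := bmp S (q i). have Lb : Lr be by apply: L2w_Lr; exact: (L2_Cc sm_w wgt0 (bmp_Cc S (q i))).
 have tp x : 0 <= trunc 0 f x by rewrite le_max lexx orbT. have bp x : 0 <= be x := bmp_ge0 S (q i) x.
 have bl x : be x <= 1 := bumpat_le1 S (q i) x. have small (z : M -> R) : Lr z -> Lr (fun x => be x * z x).
 move=> Lz; apply: (@wL2_dom _ (borel M) R mu rho mr rho_gt0 1 _ _ _ Lz).
 by apply: mfM; [exact: mL Lb|exact: mL Lz].
 by move=> x; rewrite normrM ler_wpM2r // ger0_norm.
 have L1 := small _ Lfp; have L2' := small _ L1. apply: (nr_eq0_le L1).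
 have := @pair_npos C f F _ C0 cons Df ortho fC L2' (wL2i mr rho_gt0 Lb L1).
 have -> : sr f (fun x => be x * (be x * trunc 0 f x)) = nr (fun x => be x * trunc 0 f x).
 apply: eqRint => x _; rewrite /trunc subr0. by have [h1|h1] := leP (f x) 0; ring.
 by apply=> x; rewrite !mulr_ge0.
move: (@ae_all_nat _ (borel M) R mu _ tz); apply: (@ae1 _ (borel M)) => x hx.
have [i bi] := hq x; have /eqP := hx i; rewrite mulf_eq0 gt_eqF //= /trunc subr0 => /eqP m0.
have : f x <= 0 by rewrite -m0 le_max lexx.
by rewrite /f /= /linf_ mulN1r addrC subr_le0.
Qed.

(** [orth_npos] for u and for -u shows that u agrees with its projection. *)
Lemma bdd_N10 (C : R) u (U : M -> 'rV[R]_n) : 0 <= C ->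
 (forall s : R, 0 < s -> conserved s) -> D1 (u, U) -> (forall x, `|u x| <= C) -> N10 (u, U).
move=> C0 cons Du uC.
have cD := D1_compl sm_w wgt0.
have [|||||[p P] Np ortho] := @orth_proj _ _ lin1 D1 b1 P1 cD N10 (u, U).
- exact: N10_D1.
- exact: (N10_neq0 sm_w wgt0).
- by move=> a x y; exact: (N10_lin sm_w wgt0).
- exact: (N10_clsd sm_w wgt0).
- exact: Du.
have Dp := N10_D1 Np.
have h1 : {ae mu, forall x, u x <= p x}.
 apply: (orth_npos C0 cons Np Du ortho); apply: aeT => x. exact: le_trans (ler_norm _) (uC x).
have Np' := N10_lin sm_w wgt0 (-2) Np Np.
have Du' := ph_lin P1 (-2) Du Du.
have h2 : {ae mu, forall x, linf (-2) u u x <= linf (-2) p p x}.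
 apply: (orth_npos C0 cons Np' Du').
 move=> q Nq; have Dq := N10_D1 Nq. have := ortho q Nq; rewrite /dif (ph_linl P1 (-1) Dp Du Dq).
 rewrite (ph_linl P1 (-1) (N10_D1 Np') Du' Dq) (ph_linl P1 (-2) Dp Dp Dq) (ph_linl P1 (-2) Du Du Dq).
 by move: (b1 _ _) (b1 _ _) => x y; lra.
 apply: aeT => x; have -> : linf (-2) u u x = - u x by rewrite /linf_; ring.
 by apply: le_trans (uC x); rewrite -normrN ler_norm.
apply: (N10_ae sm_w wgt0 Np Du).
by apply: ae2 h1 h2 => x; rewrite /= /linf_ => k1 k2; apply/eqP; rewrite eq_le k1 andbT; lra.
Qed.

(** min(u, k) = u - (u - k)^+ is bounded, hence in the subspace; its form norms are bounded in k and
    it tends to u in L^2. *)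
Lemma nneg_N10 u (U : M -> 'rV[R]_n) : (forall s : R, 0 < s -> conserved s) ->
 D1 (u, U) -> (forall x, 0 <= u x) -> exists X, N10 (u, X).
move=> cons Du u0; have [Lu _ _] := Du; rewrite /= in Lu.
pose c (k : nat) : R := k%:R; have c0 (k : nat) : 0 <= c k by rewrite ler0n.
have Dt (k : nat) := trunc_D1 sm_w wgt0 (c0 k) Du.
pose q (k : nat) : E1 := lin1 (-1) (trunc (c k) u, tgrad (c k) u U) (u, U).
have qE (k : nat) x : (q k).1 x = Num.min (u x) (c k).
 rewrite /q /= /linf_ /trunc; have [h1|h1] := leP (u x - c k) 0; have [h2|h2] := leP (u x) (c k); lra.
have Nq (k : nat) : N10 (q k).
 have := @bdd_N10 (c k) (q k).1 (q k).2 (c0 k) cons (ph_lin P1 (-1) (Dt k) Du); apply=> x.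
 by rewrite qE ger0_norm ?le_min ?u0 ?c0 // ge_min lexx orbT.
apply: (@N10_weak_clsd _ sm_w wgt0 (4 * b1 (u, U) (u, U)) q u Nq _ Lu).
 move=> k; have t1 := trunc_b1 sm_w wgt0 (c0 k) Du.
 have := ph_ge0 P1 (ph_lin P1 1 (Dt k) Du); rewrite /q !(ph_exp P1) //.
 by move: (b1 _ _) (b1 _ _) (b1 _ _) t1 => p1 p2 p3; lra.
have -> : (fun k : nat => dist2 linf L2s (q k).1 u) = (fun k : nat => \int[mu]_x (trunc (c k) u x ^+ 2 * w x)).
 apply/funext => k; rewrite wdist2; apply: eqRint => x _; rewrite /q /= /linf_; ring.
have z0 : \int[mu]_x (0 : R) = 0 by rewrite /Rintegral integral0.
rewrite -[X in _ --> X]z0.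
have iu := wL2i mw wgt0 Lu Lu.
apply: (@Rint_dom_ae _ (borel M) R mu _ _ _ (fun x => u x * u x * w x)) => //.
- move=> k; have [Lt _ _] := Dt k; rewrite /= in Lt.
 have -> : (fun x => trunc (c k) u x ^+ 2 * w x) = (fun x => trunc (c k) u x * trunc (c k) u x * w x).
 by apply/funext => x; rewrite expr2.
 by apply/mEFinP; exact: measurable_int (wL2i mw wgt0 Lt Lt).
- apply: aeT => x _; apply: cvg_near_cst; exists (Num.bound (u x)) => // k /= hk. have h1 : u x <= c k.
 by apply: le_trans (ltW (archi_boundP (u0 x))) _; rewrite ler_nat.
 by rewrite /trunc max_r ?subr_le0 // expr0n mul0r.
apply: aeT => x _ k; have wx := ltW (wgt0 x).
rewrite ger0_norm; last by rewrite mulr_ge0 ?sqr_ge0.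
apply: ler_wpM2r => //.
have t0 : 0 <= trunc (c k) u x by rewrite le_max lexx orbT.
have := trunc_abs u x (c0 k); rewrite (ger0_norm t0) (ger0_norm (u0 x)) => tu.
by rewrite expr2 ler_pM.
Qed.

Lemma conserved_N10 u (U : M -> 'rV[R]_n) : (forall s : R, 0 < s -> conserved s) ->
 D1 (u, U) -> exists X, N10 (u, X).
move=> cons Du; have Dm := ph_lin P1 (-2) Du Du.
have tp f x : 0 <= trunc 0 f x by rewrite le_max lexx orbT.
have [X NX] := nneg_N10 cons (trunc_D1 sm_w wgt0 (lexx 0) Du) (tp _).
have [Y NY] := nneg_N10 cons (trunc_D1 sm_w wgt0 (lexx 0) Dm) (tp _).
exists (linF (-1) Y X).
have := N10_lin sm_w wgt0 (-1) NY NX.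
rewrite /plin /=; have -> // : linf (-1) (trunc 0 (linf (-2) u u)) (trunc 0 u) = u.
apply/funext => x; rewrite /linf_ /trunc !subr0.
by have [h1|h1] := leP (u x) 0; have [h2|h2] := leP (-2 * u x + u x) 0; lra.
Qed.

(** * From the constant 1 in W^1_0 to conservation *)

Let one : M -> R := fun=> 1.
Let zero_fld : M -> 'rV[R]_n := fun=> 0.

(** With d = u - e_j, the evolution minus 1 is (u - 1) - T_t d + int_0^t T_s d ds, because L u = u -
    e_j - h_j. As |d| <= 2c, the three norms are at most c, 2c and 2tc. *)
Lemma evolve_gap (t : R) (j : nat) (U : E1) (c : R) : 0 < t -> Lr one -> 0 <= c ->
 resolves (kn j) U -> graph U.1 (linf (-1) (kn j) U.1) ->
 dist2 linf sr U.1 one <= c ^+ 2 -> dist2 linf sr one (e j) <= c ^+ 2 ->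
 nr (dif linf (evolve t (e j) (h j)) one) <= ((2 * t + 3) * c) ^+ 2.
move=> t0 L1 c0 [NU hU] gU; have [Lu Lv] := graph_L2 gU; case: U NU hU gU Lu Lv => u X NU hU gU Lu Lv /= c1 c2.
have Ld := ph_dif PR Lu (Le j); set d := dif linf u (e j) in Ld.
have nd : nr d <= (2 * c) ^+ 2.
 have := dist2_tri2 PR Lu L1 (Le j); rewrite -/d /dist2 -/d.
 by move: c1 c2; rewrite /dist2; move: (nr _) (nr _) (nr _) => x1 x2 x3 h1 h2 h3; rewrite exprMn; lra.
have cs (a b : M -> R) (x y : R) : Lr a -> Lr b -> 0 <= x -> 0 <= y -> nr a <= x ^+ 2 -> nr b <= y ^+ 2 ->
 Num.sqrt (nr a) * Num.sqrt (nr b) <= x * y.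
 move=> La Lb x0 y0 ax bY; apply: ler_pM; rewrite ?sqrtr_ge0 //.
 by rewrite -(ger0_norm x0) -sqrtr_sqr ler_wsqrtr.
 by rewrite -(ger0_norm y0) -sqrtr_sqr ler_wsqrtr.
have [LS eS] := evolveP t0 (Le j) (Lh j).
have LD := ph_dif PR LS L1; set D := dif linf _ _ in LD *.
(* Time integrals are known only by duality, so the identity is paired with D itself and the
   resulting bound is divided by the norm of D. *)
have D0 := ph_ge0 PR LD; pose y := Num.sqrt (nr D); have y0 : 0 <= y := sqrtr_ge0 _.
have yE : nr D = y ^+ 2 by rewrite sqr_sqrtr.
have yE' : nr D <= y ^+ 2 by rewrite yE.
have b1' := orbit_int_bd t0 Ld LD.
have b2 := orbit_bd t Ld LD.
have Lg := ph_dif PR Lu L1.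
have b3 := orbit_bd 0 Lg LD; rewrite {1}/orb /orb0 ltxx in b3.
have k1 := cs _ _ (2 * c) y Ld LD _ y0 nd yE'.
have k2 := cs _ _ c y Lg LD c0 y0 c1 yE'.
have id := orb_int 0 t Ld LD; have ih := orb_int 0 t (Lh j) LD.
have ftc := orbit_ftc gU LD t0.
have e1 : \int[leb1]_(s in `[0%R, t]) orb (linf (-1) (kn j) u) D s =
 \int[leb1]_(s in `[0%R, t]) orb d D s - \int[leb1]_(s in `[0%R, t]) orb (h j) D s.
 rewrite -RintegralB //; apply: eqRint => s _.
 rewrite /d /dif (orb_lin (-1) s (Lk j) Lu LD) (orb_lin (-1) s (Le j) Lu LD).
 by rewrite (orb_lin 1 s (Le j) (Lh j) LD); move: (orb _ _ _) (orb _ _ _) (orb _ _ _) => x1 x2 x3; ring.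
have e2 : orb d D t = orb u D t - orb (e j) D t.
 by rewrite (orb_lin (-1) t (Le j) Lu LD) mulN1r addrC.
have e3 : sr (dif linf u one) D = sr u D - sr one D.
 by rewrite /dif (ph_linl PR (-1) L1 Lu LD) mulN1r addrC.
have e4 : nr D = sr (evolve t (e j) (h j)) D - sr one D.
 by rewrite {1}/D /dif (ph_linl PR (-1) L1 LS LD) mulN1r addrC.
have e5 : nr D = \int[leb1]_(s in `[0%R, t]) orb d D s - orb d D t + sr (dif linf u one) D.
 rewrite e4 (eS D LD) e2 e3; move: e1; rewrite ftc /=.
 by move: (Rintegral _ _ _) (Rintegral _ _ _) (orb _ _ _) (orb _ _ _) (sr _ _) (sr _ _) => x1 x2 x3 x4 x5 x6; lra.
have k1' : Num.sqrt (nr d) * Num.sqrt (nr D) <= 2 * c * y by apply: k1; rewrite mulr_ge0.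
have k3 : t * (Num.sqrt (nr d) * Num.sqrt (nr D)) <= t * (2 * c * y) by rewrite ler_wpM2l // ltW.
have fin : nr D <= (2 * t + 3) * c * y.
 rewrite e5; move: b1' b2 b3 k1' k2 k3.
 move: (Rintegral _ _ _) (orb _ _ _) (sr (dif linf u one) D) (_ * Num.sqrt _) (Num.sqrt (nr (dif linf u one)) * _) => x1 x2 x3 x4 x5.
 rewrite !ler_norml => /andP[_ p1] /andP[p2 _] /andP[_ p3] p4 p5 p6.
 have -> : (2 * t + 3) * c * y = t * (2 * c * y) + 2 * c * y + c * y by ring.
 have := lerB p1 p2; rewrite opprK => p12. exact: le_trans (lerD p12 p3) (lerD (lerD p6 p4) p5).
have B0 : 0 <= (2 * t + 3) * c by rewrite mulr_ge0 // addr_ge0 // mulr_ge0 // ltW.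
rewrite yE ler_pXn2r ?nnegrE //; rewrite yE in fin.
have [->//|yn] := eqVneq y 0; have yp : 0 < y by rewrite lt_neqAle eq_sym yn.
by rewrite -(ler_pM2r yp) -expr2.
Qed.

Lemma kn_cvg : {ae mu, forall x, kn j x @[j --> \oo] --> 1 + V x / rho x}.
apply: ae2 eP hP => x [_ _ _ c1] [_ _ _ c2].
have -> : (fun j : nat => kn j x) = (fun j : nat => e j x + h j x).
 by apply/funext => j; rewrite /kn /linf_ mul1r.
exact: cvgD.
Qed.

Variables (integrable_sumw : mint w) (N10_one : N10 (one, zero_fld)).
Let L2w_one : L2w one. Proof. by have [] := N10_D1 N10_one. Qed.
Let Lr_one : Lr one. Proof. exact: L2w_Lr. Qed.

Let intble_rho : mint rho.
apply: (@ae_le_intble _ (borel M) R mu _ w) => // x; rewrite ger0_norm; first exact: rho_le.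
exact: ltW.
Qed.

Let gap_cvg : (\int[mu]_x w x - sr (kn j) one) + dist2 linf sr one (e j) @[j --> \oo] --> (0 : R).
have c1 : sr (kn j) one @[j --> \oo] --> \int[mu]_x w x.
 apply: (@Rint_dom_ae _ (borel M) R mu _ _ _ w) => //.
 - by move=> j; exact: msr.
 - apply: ae1 kn_cvg => x cx _. have h1 := cvgM cx (@cvg_cst _ (rho x) _ \oo _).
 have -> : w x = (1 + V x / rho x) * rho x by rewrite mulrDl mul1r divfK // gt_eqF.
 have -> : (fun j : nat => kn j x * one x * rho x) = (fun j : nat => kn j x * rho x).
 by apply/funext => j; rewrite mulr1.
 exact: h1.
 - have h1 := @ae_all_nat _ (borel M) R mu _ kn_ge0; have h2 := @ae_all_nat _ (borel M) R mu _ kn_le.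
 apply: ae2 h1 h2 => x k0 k1 _ j; rewrite mulr1 ger0_norm; last by rewrite mulr_ge0 // ltW.
 have -> : w x = (1 + V x / rho x) * rho x by rewrite mulrDl mul1r divfK // gt_eqF. by rewrite ler_wpM2r // ltW.
have c2 : dist2 linf sr one (e j) @[j --> \oo] --> (0 : R).
 have -> : (fun j : nat => dist2 linf sr one (e j)) = (fun j : nat => \int[mu]_x ((1 - e j x) * (1 - e j x) * rho x)).
 by apply/funext => j; rewrite wdist2; apply: eqRint => x _; rewrite expr2.
 have z0 : \int[mu]_x (0 : R) = 0 by rewrite /Rintegral integral0. rewrite -[X in _ --> X]z0.
 apply: (@Rint_dom_ae _ (borel M) R mu _ _ _ rho) => //.
 - move=> j; have := msr (ph_dif PR Lr_one (Le j)) (ph_dif PR Lr_one (Le j)).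
 by apply: eq_measurable_fun => x _; rewrite /dif /linf_ /one; ring.
 - apply: ae1 eP => x [_ _ _ cx] _. have h0 : 1 - e j x @[j --> \oo] --> (0 : R).
 by have h0 := cvgB (@cvg_cst _ (1 : R) _ \oo _) cx; rewrite subrr in h0; exact: h0.
 have h1 := cvgM (cvgM h0 h0) (@cvg_cst _ (rho x) _ \oo _); rewrite !mul0r in h1; exact: h1.
 - apply: ae1 eP => x [e0 _ e1 _] _ j; have r0 := ltW (rho_gt0 x). have p0 : 0 <= 1 - e j x by rewrite subr_ge0.
 have p1 : 1 - e j x <= 1 by rewrite gerBl.
 rewrite !normrM !ger0_norm // -[leRHS]mul1r ler_wpM2r // -[leRHS]mulr1 ler_pM //.
have c3 := cvgD (cvgB (@cvg_cst _ (\int[mu]_x w x) _ \oo _) c1) c2.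
rewrite subrr addr0 in c3; exact: c3.
Qed.

(** The squared form norm of 1 - u is int w - 2 <k, 1> + <k, u>, and u <= 1 by [res_bd] with C = 1
    and the zero pair, written as U - U. *)
Let gap_bd (j : nat) : exists U : E1, [/\ resolves (kn j) U, graph U.1 (linf (-1) (kn j) U.1) &
 dist2 linf sr U.1 one <= \int[mu]_x w x - sr (kn j) one].
have [U [NU hU gU]] := graph_exists (Lk j); exists U; split=> //.
have D1' := N10_D1 N10_one; have DU := N10_D1 NU; have [Lu _] := graph_L2 gU.
have uC : {ae mu, forall x, U.1 x <= 1}.
 have N0 := N10_lin sm_w wgt0 (-1) NU NU. have D0 := N10_D1 N0.
 have f0 : {ae mu, forall x, (lin1 (-1) U U).1 x <= 1}.
 by apply: aeT => x; rewrite /= /linf_ mulN1r addNr.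
 have := @res_bd 1 (kn j) U (lin1 (-1) U U).1 (lin1 (-1) U U).2 ler01 (Lk j) (kn_le j) (conj NU hU) D0 _ f0.
 have ortho q : N10 q -> b1 ((lin1 (-1) U U).1, (lin1 (-1) U U).2) q = 0.
 by move=> Nq; have := ph_linl P1 (-1) DU DU (N10_D1 Nq); rewrite mulN1r addNr.
 move=> /(_ ortho); apply: (@ae1 _ (borel M)) => x. by rewrite /= /linf_ mul1r mulN1r addNr addr0.
apply: le_trans (sr_b1 (ph_lin P1 (-1) D1' DU)) _.
rewrite (ph_exp P1 (-1) D1' DU) (ph_sym P1 D1' DU) (hU _ N10_one) (hU _ NU) /=.
have e1 : b1 (one, zero_fld) (one, zero_fld) = \int[mu]_x w x.
 have e0 : scal g zero_fld zero_fld = fun=> 0 by apply/funext => x; rewrite /scal !mul0mx mxE.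
 rewrite /pform /= /Fscal e0 /Rintegral integral0 add0r. by apply: eqRint => x _; rewrite /one !mul1r.
have le1 : sr (kn j) U.1 <= sr (kn j) one.
 apply: (@ae_Rint_le _ (borel M)).
 - exact: (wL2i mr rho_gt0 (Lk j) Lu).
 - exact: (wL2i mr rho_gt0 (Lk j) Lr_one).
 - apply: ae2 uC (kn_ge0 j) => x u1 k0. by apply: ler_wpM2r; [exact: ltW|apply: ler_wpM2l].
rewrite e1; move: (sr _ _) (sr _ _) (Rintegral _ _ _) le1 => p1 p2 p3; lra.
Qed.

(** The L^2 gap tends to 0, which gives pointwise convergence along a subsequence; the evolutions
    increase with j, so the whole sequence converges. *)
Lemma conserved_of_N10_one (t : R) : 0 < t -> conserved t.
move=> t0; pose al (j : nat) : R := (\int[mu]_x w x - sr (kn j) one) + dist2 linf sr one (e j).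
pose D (j : nat) : M -> R := dif linf (evolve t (e j) (h j)) one.
have LD j : Lr (D j) by apply: (ph_dif PR) => //; have [] := evolveP t0 (Le j) (Lh j).
have bD (j : nat) : nr (D j) <= (2 * t + 3) ^+ 2 * al j.
 have [U [rU gU d1]] := gap_bd j; have [Lu _] := graph_L2 gU.
 have p1 := dq_ge0 PR Lu Lr_one; have p2 := dq_ge0 PR Lr_one (Le j).
 have a0 : 0 <= al j by rewrite /al addr_ge0 // (le_trans p1).
 have := @evolve_gap t j U (Num.sqrt (al j)) t0 Lr_one (sqrtr_ge0 _) rU gU.
 rewrite exprMn sqr_sqrtr //; apply; first by rewrite /al; apply: le_trans d1 _; rewrite lerDl.
 by rewrite /al lerDr (le_trans p1).
have cD : (2 * t + 3) ^+ 2 * al j @[j --> \oo] --> (0 : R).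
 have h1 := cvgM (@cvg_cst _ ((2 * t + 3) ^+ 2) _ \oo _) gap_cvg; rewrite mulr0 in h1; exact: h1.
suff /choice[phi hphi] : forall i : nat, exists j : nat, (i <= j)%N /\ nr (D j) <= 8^-1 ^+ i.
 (* The square root of rho turns the weighted norm into the plain one of [fast_decay]. *)
 pose F (i : nat) x := D (phi i) x * Num.sqrt (rho x). have LF (i : nat) : wL2 mu rho (D (phi i)) := LD _.
 have [||E [mE E0 hE]] := @fast_decay _ (borel M) R mu F.
 - by move=> i; have [] := (wL2_sqint mu mr rho_gt0 (D (phi i))).1 (LF i).
 - move=> i; have [_ h1] := hphi i. have -> : (\int[mu]_x (F i x ^+ 2)%:E)%E = (nr (D (phi i)))%:E.
 rewrite -(@int_Rint _ (borel M)); last exact: (wL2i mr rho_gt0).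
 by apply: eqint => x _; rewrite /F exprMn sqr_sqrtr ?(ltW (rho_gt0 x)) // expr2.
 by rewrite lee_fin.
 have aeE : {ae mu, forall x, E x} by exists (~` E); split=> //; exact: measurableC.
 apply: ae2 (evolve_mono t0) aeE => x mono /hE[C hC].
 apply: (nondecreasing_subseq_cvg mono (phi := phi)) => [i|]; first by have [] := hphi i.
 apply: (@geomet_decay_cvg _ _ (Num.sqrt (rho x)) C); first by rewrite sqrtr_gt0.
 by move=> i; have := hC i; rewrite /F /D /dif /linf_ /one mulN1r addrC.
move=> i; have e0 : (0 : R) < 8^-1 ^+ i by rewrite exprn_gt0 // invr_gt0.
move/cvgrPdist_lt : cD => /(_ _ e0)[N _ hN]; exists (maxn i N); split; first exact: leq_maxl.
have := hN (maxn i N) (leq_maxr _ _); rewrite /= sub0r normrN => h1.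
exact: le_trans (bD _) (ltW (le_lt_trans (ler_norm _) h1)).
Qed.
End conservation.

(** * Conclusion for the sequences selected in [Lplus_extension] *)

Let e0 : nat -> M -> R := xget (fun _ _ => 0) (approximations mu rho (fun=> 1%:E)).
Let h0 : nat -> M -> R := xget (fun _ _ => 0) (approximations mu rho (fun x => (V x / rho x)%:E)).

(** The selection does not default, since [approx_ne] provides an admissible sequence. *)
Let e0P : approximations mu rho (fun=> 1%:E) e0.
apply: xgetPex; have [|f hf] := @approx_ne (fun=> 1) _ (fun=> ler01); first exact: measurable_cst.
by exists f.
Qed.

Let h0P : approximations mu rho (fun x => (V x / rho x)%:E) h0.
apply: xgetPex; have [||f hf] := @approx_ne (fun x => V x / rho x).
- have mV : bmeas V by apply: ms_smooth => x; exact: (smoothP S V).1. have sr x : sma S (fun y => (rho y)^-1) x.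
 by apply: sma_inv; [exact: rho_gt0|exact: (smoothP S rho).1 rho_smooth x].
 by apply: mfM => //; exact: ms_smooth sr.
- by move=> x; rewrite divr_ge0 // ltW.
by exists f.
Qed.

Lemma conservative_conserved : conservative_generalized mu rho V T <->
 forall t : R, 0 < t -> conserved e0 h0 t.
by split=> hc t t0; have := hc t t0; move=> /(conservedP e0P h0P t0).
Qed.

Lemma conservative_W1 : conservative_generalized mu rho V T -> W1 g Psi mu w = W10 g Psi mu w.
move=> /conservative_conserved cons; apply/seteqP; split=> [f|f [] //] /W1P[X Df].
have [Y NY] := conserved_N10 e0P h0P cons Df.
exact: (W10P sm_w wgt0 (N10_D1 NY)).2 NY.
Qed.

(** Integrability of rho + V puts the constant 1, with gradient 0, into W^1, hence into W^1_0. *)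
Lemma W1_conservative : mint w ->
 W1 g Psi mu w = W10 g Psi mu w -> conservative_generalized mu rho V T.
move=> iw eW; apply/conservative_conserved => t t0; apply: (conserved_of_N10_one e0P h0P iw _ t0).
have D : D1 (fun=> 1, fun=> 0).
 split=> /=.
 - split; first exact: measurable_cst. under eqint do rewrite expr1n mul1r.
 by rewrite (@int_Rint _ (borel M)) // ltry.
 - split=> [c ac k|].
 by under eq_fun do rewrite /in_chart mul0mx mxE; exact: measurable_cst.
 by under eqint do rewrite /scal !mul0mx mxE; rewrite integral0.
 have := smooth_grd (fun x => sma_cst S 1 x).
 by have -> : nab g (fun=> 1) = fun=> 0 by apply/funext => x; exact: nab_cst.
have : W10 g Psi mu w (fun=> 1) by rewrite -eW; apply/W1P; exists (fun=> 0).
exact: (W10P sm_w wgt0 D).1.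
Qed.
End semigroup.
End weighted_manifold.

Unset Implicit Arguments.
Set Strict Implicit.
Set Printing Implicit Defensive.

Theorem theorem6p1 (R : realType) (n : nat) (M : ptopologicalType)
    (S : smooth_manifold R n M) (M_connected : connected [set: M])
    (g : riemannian_metric S)
    (vol : {measure set (borel M) -> \bar R})
    (vol_g : is_riemannian_measure g vol)
    (Psi : M -> R) (Psi_smooth : smooth S Psi) (Psi_gt0 : forall x, 0 < Psi x)
    (mu : {measure set (borel M) -> \bar R})
    (mu_Psi : is_weighted_measure vol Psi mu)
    (V : M -> R) (V_smooth : smooth S V) (V_ge0 : forall x, 0 <= V x)
    (rho : M -> R) (rho_smooth : smooth S rho) (rho_gt0 : forall x, 0 < rho x)
    (T : R -> (M -> R) -> (M -> R))
    (T_semigroup : is_semigroup_of_form g Psi mu rho V T) :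
  (conservative_generalized mu rho V T ->
     W1 g Psi mu (rho \+ V) = W10 g Psi mu (rho \+ V)) /\
  (mu.-integrable [set: borel M] (EFin \o (rho \+ V)) ->
     (conservative_generalized mu rho V T <->
      W1 g Psi mu (rho \+ V) = W10 g Psi mu (rho \+ V))).
Proof.
have h1 := conservative_W1 vol_g Psi_smooth Psi_gt0 mu_Psi V_smooth V_ge0 rho_smooth rho_gt0 T_semigroup.
split=> [|iw]; first exact: h1.
split; first exact: h1.
exact: (W1_conservative vol_g Psi_smooth Psi_gt0 mu_Psi V_smooth V_ge0 rho_smooth rho_gt0 T_semigroup).
Qed.
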